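(* Let $K\ge1$, $\alpha\in[1,2]$, $\lambda>0$ and $m\in\mathbb{N}$. Let $R^{**}_{K,m,\alpha,\lambda}\in(0,1)$ be the unique root in $(0,1)$ of the equation $$f_{\alpha}(r^m)+r\frac{(1+r^m)^{\alpha-1}}{(1-r^m)^{\alpha+1}}+\lambda\left(\frac{2K}{K+1}f_{\alpha}(r)-r\right)-\frac{1}{2\alpha}=0,\qquad f_\alpha(z)=\frac{1}{2\alpha}\left[\left(\frac{1+z}{1-z}\right)^\alpha-1\right].$$ Suppose that $f(z)=h(z)+\overline{g(z)}=\sum_{n=0}^{\infty}a_nz^n+\overline{\sum_{n=1}^{\infty}b_nz^n}$ is a sense-preserving $K$-quasiconformal harmonic mapping in $\mathbb{D}$ and $h\prec\phi$, where $\phi\in\widehat{\mathcal{C}_0}(\alpha)$. Then $$|h(z^m)|+|h'(z^m)|\,r+\lambda\left(\sum_{n=2}^{\infty}|a_n|r^n+\sum_{n=1}^{\infty}|b_n|r^n\right)\le|\phi(0)|+d(\phi(0),\partial\phi(\mathbb{D}))$$ for $|z|=r\le\min\{1/3,R^{**}_{K,m,\alpha,\lambda}\}$. Here $h'(z^m)$ is the value of $h'$ at the point $z^m$. Moreover, if $R^{**}_{K,m,\alpha,\lambda}\le1/3$, the result is sharp, i.e. $R^{**}_{K,m,\alpha,\lambda}$ cannot be replaced by any larger number in this statement (over all admissible $f$ and $\phi$).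
   Context: $\mathbb{D}=\{z\in\mathbb{C}:|z|<1\}$. For $\alpha\in[1,2]$, $\widehat{\mathcal{C}_0}(\alpha)$ (concave univalent functions with opening angle $\pi\alpha$) is the class of analytic functions $\phi$ in $\mathbb{D}$ such that: (1) $\phi$ maps $\mathbb{D}$ conformally onto $\phi(\mathbb{D})$; (2) $\phi(1)=\infty$; (3) the set $(\mathbb{C}\cup\{\infty\})\setminus\phi(\mathbb{D})$ is convex, and the opening angle of $\phi(\mathbb{D})$ at infinity is less than or equal to $\pi\alpha$. $d(\phi(0),\partial\phi(\mathbb{D}))$ is the Euclidean distance from $\phi(0)$ to the boundary of $\phi(\mathbb{D})$. For analytic $h,\phi$ in $\mathbb{D}$, $h\prec\phi$ ($h$ is subordinate to $\phi$) means $h=\phi\circ w$ for some analytic $w:\mathbb{D}\to\mathbb{D}$ with $w(0)=0$. A harmonic mapping $f=h+\overline g$ in $\mathbb{D}$ ($h,g$ analytic) is sense-preserving $K$-quasiconformal if it is locally univalent and sense-preserving (i.e. $h'\ne0$ and $|\omega|<1$ in $\mathbb{D}$, where $\omega=g'/h'$) and $|\omega(z)|\le k<1$ in $\mathbb{D}$, where $K=(1+k)/(1-k)\ge1$, i.e. $k=(K-1)/(K+1)$. *)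

(* Defs.v *)
From Stdlib Require Export Reals.
From Coquelicot Require Export Coquelicot.
Open Scope R_scope.

Definition disc (z : C) : Prop := Cmod z < 1.

Definition analytic_on_disc (f : C -> C) : Prop :=
  forall z : C, disc z -> ex_derive (K := C_AbsRing) (V := C_NormedModule) f z.

Definition image_of_disc (f : C -> C) (w : C) : Prop :=
  exists z : C, disc z /\ f z = w.

Definition univalent_on_disc (f : C -> C) : Prop :=
  forall z1 z2 : C, disc z1 -> disc z2 -> f z1 = f z2 -> z1 = z2.

Definition convex_set (S : C -> Prop) : Prop :=
  forall (x y : C) (t : R), S x -> S y -> 0 <= t <= 1 ->
    S (Cplus (Cmult (RtoC (1 - t)) x) (Cmult (RtoC t) y)).

Definition boundary (S : C -> Prop) (p : C) : Prop :=
  forall e : R, 0 < e ->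
    (exists w : C, Cmod (w - p) < e /\ S w) /\
    (exists w : C, Cmod (w - p) < e /\ ~ S w).

(* The infimum is a real number as soon as [S] is nonempty, which is the case
   below: the boundary of the image of a univalent map of the disc is nonempty. *)
Definition dist_to_set (p : C) (S : C -> Prop) : R :=
  real (Glb_Rbar (fun x : R => exists w : C, S w /\ x = Cmod (p - w))).

(* The domain [S] reaches infinity in the direction [t]: the half-line of
   argument [t] eventually stays in [S]. *)
Definition direction_to_infinity (S : C -> Prop) (t : R) : Prop :=
  Rbar_locally p_infty (fun s : R => S (s * cos t, s * sin t)).

(* Opening of the largest open arc of directions in which [S] reaches infinity.
   A domain with convex unbounded complement contains, up to end points, one
   such maximal arc, complementary to the directions of half-lines contained in
   the complement; the choice of the origin as base point plays no role, since
   it only affects the end points of the arc. The bound [b <= a + 2 * PI]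
   prevents arcs from being counted with multiplicity. *)
Definition opening_angle_at_infinity (S : C -> Prop) : Rbar :=
  Lub_Rbar (fun x : R => exists a b : R,
    a <= b <= a + 2 * PI /\ x = b - a /\
    forall t : R, a < t < b -> direction_to_infinity S t).

(* As the point at infinity lies in the complement of the image in the extended
   plane, convexity of that complement is convexity of its finite part. *)
Record concave_univalent (alpha : R) (phi : C -> C) : Prop := {
  cu_analytic : analytic_on_disc phi;
  cu_univalent : univalent_on_disc phi;
  cu_pole : filterlim (fun z : C => Cmod (phi z))
              (within disc (locally (RtoC 1))) (Rbar_locally p_infty);
  cu_convex : convex_set (fun w : C => ~ image_of_disc phi w);
  cu_angle : Rbar_le (opening_angle_at_infinity (image_of_disc phi))
                     (Finite (PI * alpha))
}.

Definition subordinate (h phi : C -> C) : Prop :=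
  exists w : C -> C,
    analytic_on_disc w /\ (forall z : C, disc z -> disc (w z)) /\
    w (RtoC 0) = RtoC 0 /\ (forall z : C, disc z -> h z = phi (w z)).

(* [C_derive] is the complex derivative wherever the function is complex
   differentiable; here it is only used at points of the disc. *)
Definition dilatation (h g : C -> C) (z : C) : C :=
  Cdiv (C_derive g z) (C_derive h z).

Record harmonic_mapping (f h g : C -> C) : Prop := {
  hm_analytic_h : analytic_on_disc h;
  hm_analytic_g : analytic_on_disc g;
  hm_decomp : forall z : C, disc z -> f z = Cplus (h z) (Cconj (g z))
}.

Record sense_preserving_qc (K : R) (f h g : C -> C) : Prop := {
  sp_harmonic : harmonic_mapping f h g;
  sp_locally_univalent : forall z : C, disc z -> C_derive h z <> RtoC 0;
  sp_sense_preserving : forall z : C, disc z -> Cmod (dilatation h g z) < 1;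
  sp_quasiconformal : forall z : C, disc z ->
    Cmod (dilatation h g z) <= (K - 1) / (K + 1)
}.

Definition has_expansion (a : nat -> C) (h : C -> C) : Prop :=
  forall z : C, disc z ->
    is_pseries (K := C_AbsRing) (V := C_NormedModule) a z (h z).

(* Only needed at real arguments [0 <= x < 1], where the base of the power is
   positive and the principal branch is the real power. *)
Definition f_alpha (alpha x : R) : R :=
  / (2 * alpha) * (Rpower ((1 + x) / (1 - x)) alpha - 1).

Definition radius_equation_lhs (K : R) (m : nat) (alpha lambda r : R) : R :=
  f_alpha alpha (r ^ m)
  + r * (Rpower (1 + r ^ m) (alpha - 1) / Rpower (1 - r ^ m) (alpha + 1))
  + lambda * (2 * K / (K + 1) * f_alpha alpha r - r)
  - / (2 * alpha).

Definition is_radius (K : R) (m : nat) (alpha lambda r : R) : Prop :=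
  0 < r < 1 /\ radius_equation_lhs K m alpha lambda r = 0.

(* The two series converge for [Cmod z < 1] because [a] and [b] are the
   coefficients of power series converging in the whole disc. *)
Definition bohr_sum (m : nat) (lambda : R) (h : C -> C) (a b : nat -> C)
    (z : C) : R :=
  Cmod (h (Cpow z m)) + Cmod (C_derive h (Cpow z m)) * Cmod z
  + lambda * (Series (fun n : nat => Cmod (a (n + 2)%nat) * Cmod z ^ (n + 2))
              + Series (fun n : nat => Cmod (b (n + 1)%nat) * Cmod z ^ (n + 1))).

(* The inequality holds on [Cmod z <= rho] (within the disc) for every
   admissible mapping [f] and every admissible [phi]. *)
Definition bohr_inequality_up_to (K : R) (m : nat) (alpha lambda rho : R) : Prop :=
  forall (f h g phi : C -> C) (a b : nat -> C),
    sense_preserving_qc K f h g ->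
    has_expansion a h ->
    has_expansion b g -> b 0%nat = RtoC 0 ->
    concave_univalent alpha phi ->
    subordinate h phi ->
    forall z : C, disc z -> Cmod z <= rho ->
      bohr_sum m lambda h a b z
      <= Cmod (phi (RtoC 0))
         + dist_to_set (phi (RtoC 0)) (boundary (image_of_disc phi)).

(* Main.v *)
Require Import Defs.
From Stdlib Require Import Lra Lia Classical ClassicalEpsilon FunctionalExtensionality.

(** Fix a point [p] omitted by [phi]. The complement of the image is convex and,
    as [phi] has its pole on the unit circle, unbounded ([omitted_unbounded]); the
    bound on the opening angle forces it to contain a cone of vertex [p] and
    opening [(2 - alpha) PI] ([omitted_cone]). So [F = (h - p) / (phi 0 - p)] has
    [F 0 = 1] and values in a sector of vertex 0 and opening at most [alpha PI],
    possibly tilted ([omitted_rays]). Everything follows from comparing such an [F]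
    with the symmetric sector map [((1 + z) / (1 - z)) ^ alpha]: the value and the
    derivative at [z ^ m], and the sum of the moduli of the coefficients of order at
    least 2, are bounded by those of the symmetric map ([sector_estimates]). The
    coefficients of [g] are reduced to those of [h] because [g' = w h'] with
    [|w| <= k], where Bohr's theorem bounds the majorant series of [w] by [k] up to
    radius [1 / 3] ([bohr_majorant], [dilatation_majorant]). The bounds add up to
    [|phi 0| + |phi 0 - p| (1 + 2 alpha E)], with [E] the left side of the
    equation ([bohr_sum_omitted]). [E] increases with [r], which gives existence and
    uniqueness of the root and [E <= 0] up to it, and [p] can be taken as close to
    the boundary as desired ([near_omitted_point]).

    The delicate estimate is that of the coefficients ([F_tail]). Write
    [F = Q ^ alpha], with [Q] in a half plane whose normal has argument [b], and
    [F' = alpha Q' G] with [G = Q ^ (alpha - 1)]. Caratheodory's inequality gives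
    [|Q n| <= 2 cos b]. Moreover [G] is subordinate to the kernel
    [((1 + e^{ib} v) / (1 - e^{-ib} v)) ^ (alpha - 1)], and up to [1 / 3] majorants
    do not increase under subordination ([majorant_comp]). The linear
    coefficient of [F] is at most [2 alpha cos b], which for [b <> 0] is less than
    [2 alpha]; so the bound on the remaining coefficients must improve by as much.
    It does: the majorant of the kernel times [cos b] is smaller than that of the
    symmetric kernel by at least [(1 - cos b) (1 - r) ^ 2] ([compare_majorant]),
    because the recurrence for its coefficients changes with [b] only to second order
    ([compare_step]).

    For the sharpness take [h = phi = (((1 + z) / (1 - z)) ^ alpha - 1) / (2 alpha)]
    and [g = k phi]. The image of [phi] is a sector with vertex [- 1 / (2 alpha)]
    ([sector_map_concave], [sector_map_dist]), so the right side is at most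
    [1 / (2 alpha)], whereas at a point [x > r] of the positive axis the left side is
    at least [1 / (2 alpha) + E], with [E > 0] ([sector_map_extremal]).

    The function theory this rests on (Taylor expansion in the disc, the open
    mapping property) is obtained from Goursat's theorem through means over circles. *)

(** * Complex derivatives *)

(** [C] carries two normed module structures, [C_NormedModule] with square balls
    and that of its absolute ring with round ones; estimates with [Cmod] alone
    spare translations between them. *)
Definition cderiv (f : C -> C) (z l : C) : Prop :=
  forall eps : R, 0 < eps -> exists delta : R, 0 < delta /\
    forall u : C, Cmod (u - z) < delta ->
      Cmod (f u - f z - l * (u - z)) <= eps * Cmod (u - z).

Definition ccont (f : C -> C) (z : C) : Prop :=
  forall eps : R, 0 < eps -> exists delta : R, 0 < delta /\
    forall u : C, Cmod (u - z) < delta -> Cmod (f u - f z) < eps.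

Lemma Cmod_sub_sym (x y : C) : Cmod (x - y) = Cmod (y - x).
Proof. rewrite <- (Cmod_opp (x - y)). f_equal. ring. Qed.

Lemma locally_Cmod (z : C) (P : C -> Prop) :
  locally (T := C_UniformSpace) z P <->
  exists d : R, 0 < d /\ forall u, Cmod (u - z) < d -> P u.
Proof.
  split.
  - intros [d Hd]. exists d. split; [apply cond_pos|].
    intros u Hu. apply Hd. apply C_NormedModule_mixin_compat1. exact Hu.
  - intros [d [Hd H]].
    assert (h2 : 0 < sqrt 2) by (apply sqrt_lt_R0; lra).
    assert (Hp : 0 < d / sqrt 2) by (apply Rdiv_lt_0_compat; lra).
    exists (mkposreal _ Hp). intros u Hu. apply H.
    apply C_NormedModule_mixin_compat2 in Hu.
    eapply Rlt_le_trans; [exact Hu|]. simpl. right. field. lra.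
Qed.

Lemma cderiv_is_derive (f : C -> C) (z l : C) :
  cderiv f z l <-> is_derive (K := C_AbsRing) (V := C_NormedModule) f z l.
Proof.
  split.
  - intros H. split; [apply is_linear_scal_l|].
    intros x Hx.
    assert (Hxz : z = x).
    { apply (is_filter_lim_locally_unique (K := C_AbsRing) (V := AbsRing_NormedModule C_AbsRing)); exact Hx. }
    subst x. intros eps.
    destruct (H eps (cond_pos eps)) as [d [Hd HH]].
    assert (L : locally (T := C_UniformSpace) z (fun u =>
       Cmod (f u - f z - l * (u - z)) <= eps * Cmod (u - z))).
    { apply locally_Cmod. exists d. auto. }
    apply locally_C in L.
    revert L. apply filter_imp. intros u Hu.
    change (Cmod (f u - f z - (u - z) * l) <= eps * Cmod (u - z)).
    replace ((u - z) * l)%C with (l * (u - z))%C by ring. exact Hu.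
  - intros [_ H] eps Heps.
    specialize (H z (fun P HP => HP) (mkposreal _ Heps)).
    apply locally_C in H. apply locally_Cmod in H.
    destruct H as [d [Hd H]]. exists d. split; [exact Hd|].
    intros u Hu. specialize (H u Hu).
    change (Cmod (f u - f z - (u - z) * l) <= eps * Cmod (u - z)) in H.
    replace (l * (u - z))%C with ((u - z) * l)%C by ring. exact H.
Qed.

(** The product and chain rules refer to the normed module of the absolute ring. *)
Lemma cderiv_is_derive_abs (f : C -> C) (z l : C) :
  cderiv f z l <-> is_derive (K := C_AbsRing) (V := AbsRing_NormedModule C_AbsRing) f z l.
Proof.
  split.
  - intros H. split; [apply is_linear_scal_l|].
    intros x Hx.
    assert (Hxz : z = x).
    { apply (is_filter_lim_locally_unique (K := C_AbsRing) (V := AbsRing_NormedModule C_AbsRing)); exact Hx. }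
    subst x. intros eps.
    destruct (H eps (cond_pos eps)) as [d [Hd HH]].
    assert (L : locally (T := C_UniformSpace) z (fun u =>
       Cmod (f u - f z - l * (u - z)) <= eps * Cmod (u - z))).
    { apply locally_Cmod. exists d. auto. }
    apply locally_C in L.
    revert L. apply filter_imp. intros u Hu.
    change (Cmod (f u - f z - (u - z) * l) <= eps * Cmod (u - z)).
    replace ((u - z) * l)%C with (l * (u - z))%C by ring. exact Hu.
  - intros [_ H] eps Heps.
    specialize (H z (fun P HP => HP) (mkposreal _ Heps)).
    apply locally_C in H. apply locally_Cmod in H.
    destruct H as [d [Hd H]]. exists d. split; [exact Hd|].
    intros u Hu. specialize (H u Hu).
    change (Cmod (f u - f z - (u - z) * l) <= eps * Cmod (u - z)) in H.
    replace (l * (u - z))%C with ((u - z) * l)%C by ring. exact H.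
Qed.

Lemma cderiv_ext_loc (f g : C -> C) (z l : C) (d : R) :
  0 < d -> (forall u, Cmod (u - z) < d -> f u = g u) -> cderiv f z l -> cderiv g z l.
Proof.
  intros Hd E H eps Heps. destruct (H eps Heps) as [e [He HH]].
  exists (Rmin d e). split; [apply Rmin_glb_lt; assumption|].
  intros u Hu. rewrite <- (E u), <- (E z).
  - apply HH. eapply Rlt_le_trans; [exact Hu|apply Rmin_r].
  - replace (z - z)%C with (RtoC 0) by ring. rewrite Cmod_0. exact Hd.
  - eapply Rlt_le_trans; [exact Hu|apply Rmin_l].
Qed.

Lemma cderiv_ext (f g : C -> C) (z l : C) :
  (forall u, f u = g u) -> cderiv f z l -> cderiv g z l.
Proof. intros E. apply (cderiv_ext_loc _ _ _ _ 1); [lra|auto]. Qed.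

Lemma cderiv_eq (f : C -> C) (z l l' : C) : cderiv f z l -> l = l' -> cderiv f z l'.
Proof. intros H E. subst. exact H. Qed.

Lemma cderiv_const (k z : C) : cderiv (fun _ => k) z (RtoC 0).
Proof.
  intros eps Heps. exists 1. split; [lra|]. intros u _.
  replace (k - k - 0 * (u - z))%C with (RtoC 0) by ring. rewrite Cmod_0.
  apply Rmult_le_pos; [lra|apply Cmod_ge_0].
Qed.

Lemma cderiv_id (z : C) : cderiv (fun u => u) z (RtoC 1).
Proof.
  intros eps Heps. exists 1. split; [lra|]. intros u _.
  replace (u - z - 1 * (u - z))%C with (RtoC 0) by ring. rewrite Cmod_0.
  apply Rmult_le_pos; [lra|apply Cmod_ge_0].
Qed.

Lemma cderiv_plus (f g : C -> C) (z l m : C) :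
  cderiv f z l -> cderiv g z m -> cderiv (fun u => f u + g u)%C z (l + m)%C.
Proof.
  intros Hf Hg. apply cderiv_is_derive.
  apply (is_derive_plus (K := C_AbsRing) (V := C_NormedModule)); apply cderiv_is_derive; assumption.
Qed.

Lemma cderiv_mult (f g : C -> C) (z l m : C) :
  cderiv f z l -> cderiv g z m -> cderiv (fun u => f u * g u)%C z (l * g z + f z * m)%C.
Proof.
  intros Hf Hg. apply cderiv_is_derive.
  apply cderiv_is_derive, cderiv_is_derive_abs.
  apply (is_derive_mult (K := C_AbsRing)); try (apply cderiv_is_derive_abs; assumption).
  intros; apply Cmult_comm.
Qed.

Lemma cderiv_comp (f g : C -> C) (z l m : C) :
  cderiv f (g z) l -> cderiv g z m -> cderiv (fun u => f (g u)) z (m * l)%C.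
Proof.
  intros Hf Hg. apply cderiv_is_derive.
  apply (is_derive_comp (K := C_AbsRing) (V := C_NormedModule)).
  - apply cderiv_is_derive; assumption.
  - apply cderiv_is_derive_abs; assumption.
Qed.

Lemma cderiv_cmult (k : C) (f : C -> C) (z l : C) :
  cderiv f z l -> cderiv (fun u => k * f u)%C z (k * l)%C.
Proof.
  intros H. eapply cderiv_eq; [apply cderiv_mult; [apply cderiv_const|exact H]|]. cbv beta; ring.
Qed.

Lemma cderiv_opp (f : C -> C) (z l : C) :
  cderiv f z l -> cderiv (fun u => - f u)%C z (- l)%C.
Proof.
  intros H. apply cderiv_ext with (fun u => - (1) * f u)%C.
  - intros u. ring.
  - eapply cderiv_eq; [apply cderiv_cmult; exact H|]. ring.
Qed.

Lemma cderiv_minus (f g : C -> C) (z l m : C) :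
  cderiv f z l -> cderiv g z m -> cderiv (fun u => f u - g u)%C z (l - m)%C.
Proof. intros Hf Hg. apply cderiv_plus; [exact Hf|apply cderiv_opp; exact Hg]. Qed.

Lemma cderiv_ccont (f : C -> C) (z l : C) : cderiv f z l -> ccont f z.
Proof.
  intros H eps Heps. destruct (H 1 Rlt_0_1) as [d [Hd HH]].
  set (k := 1 + Cmod l). assert (Hk : 0 < k) by (unfold k; pose proof (Cmod_ge_0 l); lra).
  exists (Rmin d (eps / k)). split.
  { apply Rmin_glb_lt; [exact Hd|]. apply Rdiv_lt_0_compat; lra. }
  intros u Hu. assert (H1 : Cmod (u - z) < d) by (eapply Rlt_le_trans; [exact Hu|apply Rmin_l]).
  assert (H2 : Cmod (u - z) < eps / k) by (eapply Rlt_le_trans; [exact Hu|apply Rmin_r]).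
  specialize (HH u H1).
  replace (f u - f z)%C with ((f u - f z - l * (u - z)) + l * (u - z))%C by ring.
  eapply Rle_lt_trans; [apply Cmod_triangle|]. rewrite Cmod_mult.
  apply (Rmult_lt_compat_r k) in H2; [|exact Hk].
  replace (eps / k * k) with eps in H2 by (field; lra). unfold k in H2. nra.
Qed.

Lemma cderiv_unique (f : C -> C) (z l m : C) : cderiv f z l -> cderiv f z m -> l = m.
Proof.
  intros H1 H2. apply cderiv_is_derive in H1, H2.
  apply is_C_derive_unique in H1. apply is_C_derive_unique in H2. congruence.
Qed.

Lemma cderiv_C_derive (f : C -> C) (z l : C) : cderiv f z l -> C_derive f z = l.
Proof. intros H. apply is_C_derive_unique. apply cderiv_is_derive. exact H. Qed.

Lemma ex_derive_cderiv (f : C -> C) (z : C) :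
  ex_derive (K := C_AbsRing) (V := C_NormedModule) f z -> cderiv f z (C_derive f z).
Proof. intros H. apply cderiv_is_derive. apply C_derive_correct; [exact z|exact H]. Qed.

Lemma cderiv_ex_derive (f : C -> C) (z l : C) :
  cderiv f z l -> ex_derive (K := C_AbsRing) (V := C_NormedModule) f z.
Proof. intros H. exists l. apply cderiv_is_derive. exact H. Qed.

Lemma Cmod_lower (x y : C) : Cmod x - Cmod y <= Cmod (x + y).
Proof.
  assert (H := Cmod_triangle (x + y) (- y)).
  replace (x + y + - y)%C with x in H by ring. rewrite Cmod_opp in H. lra.
Qed.

Lemma cderiv_Cinv (z : C) : z <> 0%C -> cderiv Cinv z (- / (z * z))%C.
Proof.
  intros Hz eps Heps. assert (Hm : 0 < Cmod z) by (apply Cmod_gt_0; exact Hz).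
  set (m := Cmod z) in *.
  exists (Rmin (m / 2) (eps * m * m * m / 2)).
  assert (H3 : 0 < eps * m * m * m / 2).
  { apply Rdiv_lt_0_compat; [|lra]. repeat apply Rmult_lt_0_compat; assumption. }
  split; [apply Rmin_glb_lt; lra|].
  intros u Hu. assert (H1 : Cmod (u - z) < m / 2) by (eapply Rlt_le_trans; [exact Hu|apply Rmin_l]).
  assert (H2 : Cmod (u - z) < eps * m * m * m / 2) by (eapply Rlt_le_trans; [exact Hu|apply Rmin_r]).
  assert (Hmu : m / 2 < Cmod u).
  { assert (H := Cmod_lower z (u - z)). replace (z + (u - z))%C with u in H by ring. fold m in H. lra. }
  assert (Hu0 : u <> 0%C) by (apply Cmod_gt_0; lra).
  replace (/ u - / z - - / (z * z) * (u - z))%C with ((u - z) * (u - z) / (u * z * z))%C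
    by (field; split; assumption).
  rewrite Cmod_div, !Cmod_mult by (repeat apply Cmult_neq_0; assumption). fold m.
  assert (Hd : 0 < Cmod u * m * m) by (repeat apply Rmult_lt_0_compat; lra).
  apply (Rmult_le_reg_r (Cmod u * m * m)); [exact Hd|].
  replace (Cmod (u - z) * Cmod (u - z) / (Cmod u * m * m) * (Cmod u * m * m))
    with (Cmod (u - z) * Cmod (u - z)) by (field; lra).
  assert (Hp := Cmod_ge_0 (u - z)).
  rewrite (Rmult_comm eps), Rmult_assoc. apply Rmult_le_compat_l; [exact Hp|].
  apply Rle_trans with (eps * m * m * m / 2); [lra|].
  replace (eps * m * m * m / 2) with (eps * (m / 2 * m * m)) by field.
  apply Rmult_le_compat_l; [lra|]. repeat apply Rmult_le_compat_r; lra.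
Qed.

Lemma cderiv_inv (f : C -> C) (z l : C) :
  f z <> 0%C -> cderiv f z l -> cderiv (fun u => / f u)%C z (- l / (f z * f z))%C.
Proof.
  intros Hz H. eapply cderiv_eq; [apply (cderiv_comp Cinv f); [apply cderiv_Cinv; exact Hz|exact H]|].
  field. exact Hz.
Qed.

Lemma cderiv_div (f g : C -> C) (z l m : C) :
  g z <> 0%C -> cderiv f z l -> cderiv g z m ->
  cderiv (fun u => f u / g u)%C z ((l * g z - f z * m) / (g z * g z))%C.
Proof.
  intros Hz Hf Hg.
  eapply cderiv_eq; [apply cderiv_mult; [exact Hf|apply cderiv_inv; [exact Hz|exact Hg]]|].
  cbv beta; field. exact Hz.
Qed.

Lemma cderiv_pow (n : nat) (z : C) :
  cderiv (fun u => u ^ n)%C z (INR n * z ^ (pred n))%C.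
Proof.
  induction n as [|n IH].
  - eapply cderiv_eq; [apply (cderiv_const (RtoC 1))|]. simpl. ring.
  - apply cderiv_ext with (fun u => u * u ^ n)%C; [intros; reflexivity|].
    eapply cderiv_eq; [apply cderiv_mult; [apply cderiv_id|exact IH]|]. cbv beta.
    destruct n; [simpl; ring|]. rewrite (S_INR (S n)), RtoC_plus.
    change (pred (S n)) with n. change (pred (S (S n))) with (S n).
    rewrite !Cpow_S. ring.
Qed.

(** * The complex exponential *)

Definition cexp (z : C) : C := (exp (Re z) * cos (Im z), exp (Re z) * sin (Im z)).

Lemma cexp_plus (z w : C) : cexp (z + w) = (cexp z * cexp w)%C.
Proof.
  unfold cexp, Cmult, Cplus, Re, Im; simpl. rewrite exp_plus, cos_plus, sin_plus.
  f_equal; ring.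
Qed.

Lemma cexp_0 : cexp 0 = 1%C.
Proof. unfold cexp; simpl. rewrite exp_0, cos_0, sin_0. unfold RtoC. f_equal; ring. Qed.

Lemma Cmod_cexp (z : C) : Cmod (cexp z) = exp (Re z).
Proof.
  unfold cexp, Cmod. simpl fst; simpl snd.
  replace ((exp (Re z) * cos (Im z)) ^ 2 + (exp (Re z) * sin (Im z)) ^ 2)
    with (Rsqr (exp (Re z))).
  - apply sqrt_Rsqr. left; apply exp_pos.
  - unfold Rsqr. assert (H := sin2_cos2 (Im z)). unfold Rsqr in H.
    transitivity (exp (Re z) * exp (Re z) * (sin (Im z) * sin (Im z) + cos (Im z) * cos (Im z))).
    + rewrite H; ring. + ring.
Qed.

Lemma cexp_neq_0 (z : C) : cexp z <> 0%C.
Proof. apply Cmod_gt_0. rewrite Cmod_cexp. apply exp_pos. Qed.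

Lemma cexp_opp (z : C) : cexp (- z) = (/ cexp z)%C.
Proof.
  assert (H : (cexp z * cexp (- z))%C = 1%C).
  { rewrite <- cexp_plus. replace (z + - z)%C with (RtoC 0) by ring. apply cexp_0. }
  assert (Hn := cexp_neq_0 z).
  replace (cexp (- z)) with (/ cexp z * (cexp z * cexp (- z)))%C by (field; exact Hn).
  rewrite H. ring.
Qed.

Lemma Cmod_le_abs (z : C) : Cmod z <= Rabs (Re z) + Rabs (Im z).
Proof.
  replace z with (RtoC (Re z) + Ci * RtoC (Im z))%C at 1.
  - eapply Rle_trans; [apply Cmod_triangle|].
    rewrite Cmod_mult, Cmod_Ci, !Cmod_R. lra.
  - destruct z as [x y]. unfold RtoC, Ci, Cplus, Cmult; simpl. f_equal; ring.
Qed.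

Lemma im_le_Cmod (z : C) : Rabs (Im z) <= Cmod z.
Proof. eapply Rle_trans; [apply Rmax_r|apply (Rmax_Cmod z)]. Qed.

(** The real differential of a function of one variable, in the shape needed
    to estimate [cexp] near the origin. *)
Lemma derive_pt_little_o (f : R -> R) (l : R) (eps : R) :
  derivable_pt_lim f 0 l -> 0 < eps ->
  exists d, 0 < d /\ forall h, Rabs h < d -> Rabs (f h - f 0 - l * h) <= eps * Rabs h.
Proof.
  intros H Heps. destruct (H eps Heps) as [d Hd]. exists d. split; [apply cond_pos|].
  intros h Hh. destruct (Req_dec h 0) as [->|Hn].
  - replace (f 0 - f 0 - l * 0) with 0 by ring. rewrite Rabs_R0. lra.
  - specialize (Hd h Hn Hh). rewrite Rplus_0_l in Hd.
    replace (f h - f 0 - l * h) with (((f h - f 0) / h - l) * h) by (field; exact Hn).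
    rewrite Rabs_mult. apply Rmult_le_compat_r; [apply Rabs_pos|lra].
Qed.

Lemma cderiv_cexp_0 : cderiv cexp 0 1.
Proof.
  intros eps Heps.
  set (e := Rmin (eps / 10) 1).
  assert (He : 0 < e) by (unfold e; apply Rmin_glb_lt; lra).
  assert (He1 : e <= 1) by apply Rmin_r. assert (He2 : e <= eps / 10) by apply Rmin_l.
  clearbody e.
  destruct (derive_pt_little_o exp 1 e) as [d1 [Hd1 H1]]; [|exact He|].
  { pose proof (derivable_pt_lim_exp 0) as P; rewrite exp_0 in P; exact P. }
  destruct (derive_pt_little_o cos 0 e) as [d2 [Hd2 H2]]; [|exact He|].
  { pose proof (derivable_pt_lim_cos 0) as P; rewrite sin_0, Ropp_0 in P; exact P. }
  destruct (derive_pt_little_o sin 1 e) as [d3 [Hd3 H3]]; [|exact He|].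
  { pose proof (derivable_pt_lim_sin 0) as P; rewrite cos_0 in P; exact P. }
  exists (Rmin e (Rmin d1 (Rmin d2 d3))). split.
  { repeat apply Rmin_glb_lt; assumption. }
  intros u Hu.
  assert (Hu0 : Cmod (u - 0) < e) by (eapply Rlt_le_trans; [exact Hu|apply Rmin_l]).
  assert (Hu1 : Cmod (u - 0) < d1).
  { eapply Rlt_le_trans; [exact Hu|]. eapply Rle_trans; [apply Rmin_r|apply Rmin_l]. }
  assert (Hu2 : Cmod (u - 0) < d2).
  { eapply Rlt_le_trans; [exact Hu|]. do 2 (eapply Rle_trans; [apply Rmin_r|]). apply Rmin_l. }
  assert (Hu3 : Cmod (u - 0) < d3).
  { eapply Rlt_le_trans; [exact Hu|]. do 3 (eapply Rle_trans; [apply Rmin_r|]). apply Rle_refl. }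
  replace (u - 0)%C with u in * by ring. rewrite cexp_0.
  assert (Hx := re_le_Cmod u). assert (Hy := im_le_Cmod u).
  destruct u as [x y]. unfold Re, Im in *; simpl in *.
  specialize (H1 x ltac:(lra)). specialize (H2 y ltac:(lra)). specialize (H3 y ltac:(lra)).
  rewrite exp_0 in H1. rewrite cos_0 in H2. rewrite sin_0 in H3.
  set (M := Cmod (x, y)) in *. assert (HM : 0 <= M) by (pose proof (Rabs_pos x); lra).
  eapply Rle_trans; [apply Cmod_le_abs|]. unfold cexp, Cminus, Cplus, Copp, Cmult, RtoC, Re, Im; simpl.
  replace (exp x * cos y + - (1) + - (1 * x - 0 * y))
    with ((exp x - 1 - 1 * x) * cos y + (1 + x) * (cos y - 1 - 0 * y) + x * 0) by ring.
  replace (exp x * sin y + - 0 + - (1 * y + 0 * x))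
    with ((exp x - 1 - 1 * x) * sin y + (1 + x) * (sin y - 0 - 1 * y) + x * y) by ring.
  assert (Hc : Rabs (cos y) <= 1) by (apply Rabs_le; apply COS_bound).
  assert (Hs : Rabs (sin y) <= 1) by (apply Rabs_le; apply SIN_bound).
  assert (Hx1 : Rabs (1 + x) <= 2).
  { eapply Rle_trans; [apply Rabs_triang|]. rewrite (Rabs_right 1); lra. }
  assert (A : forall a b k : R, Rabs a <= k -> Rabs b <= e * M -> 0 <= k -> Rabs (a * b) <= k * (e * M)).
  { intros a b k Ha Hb Hk. rewrite Rabs_mult.
    apply Rmult_le_compat; try apply Rabs_pos; assumption. }
  assert (HeM : 0 <= e * M) by (apply Rmult_le_pos; lra).
  assert (B1 : Rabs (exp x - 1 - 1 * x) <= e * M) by (eapply Rle_trans; [exact H1|]; apply Rmult_le_compat_l; lra).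
  assert (B2 : Rabs (cos y - 1 - 0 * y) <= e * M) by (eapply Rle_trans; [exact H2|]; apply Rmult_le_compat_l; lra).
  assert (B3 : Rabs (sin y - 0 - 1 * y) <= e * M) by (eapply Rle_trans; [exact H3|]; apply Rmult_le_compat_l; lra).
  assert (C1 := A _ _ 1 Hc B1 ltac:(lra)). assert (C2 := A _ _ 2 Hx1 B2 ltac:(lra)).
  assert (C3 := A _ _ 1 Hs B1 ltac:(lra)). assert (C4 := A _ _ 2 Hx1 B3 ltac:(lra)).
  rewrite (Rmult_comm (cos y)) in C1. rewrite (Rmult_comm (sin y)) in C3.
  assert (C5 : Rabs (x * y) <= e * M).
  { rewrite Rabs_mult. apply Rmult_le_compat; try apply Rabs_pos; lra. }
  assert (T1 := Rabs_triang ((exp x - 1 - 1 * x) * cos y) ((1 + x) * (cos y - 1 - 0 * y))).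
  assert (T2 := Rabs_triang ((exp x - 1 - 1 * x) * sin y + (1 + x) * (sin y - 0 - 1 * y)) (x * y)).
  assert (T3 := Rabs_triang ((exp x - 1 - 1 * x) * sin y) ((1 + x) * (sin y - 0 - 1 * y))).
  rewrite Rmult_0_r, Rplus_0_r.
  apply Rle_trans with (10 * (e * M)); [lra|].
  replace (eps * M) with (10 * (eps / 10 * M)) by field.
  apply Rmult_le_compat_l; [lra|]. apply Rmult_le_compat_r; lra.
Qed.

Lemma cderiv_cexp (z : C) : cderiv cexp z (cexp z).
Proof.
  apply cderiv_ext with (fun u => cexp z * cexp (u - z))%C.
  - intros u. rewrite <- cexp_plus. f_equal. ring.
  - eapply cderiv_eq.
    + apply cderiv_cmult. apply (cderiv_comp cexp (fun u => u - z)%C).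
      * replace (z - z)%C with (RtoC 0) by ring. apply cderiv_cexp_0.
      * apply cderiv_minus; [apply cderiv_id|apply cderiv_const].
    + ring.
Qed.

Lemma cderiv_cexp_comp (f : C -> C) (z l : C) :
  cderiv f z l -> cderiv (fun u => cexp (f u)) z (l * cexp (f z))%C.
Proof. intros H. apply (cderiv_comp cexp f); [apply cderiv_cexp|exact H]. Qed.

(** * Integrals of complex functions of a real variable *)

Definition CInt (f : R -> C) (a b : R) : C :=
  (RInt (fun t => Re (f t)) a b, RInt (fun t => Im (f t)) a b).

Definition cintegrable (f : R -> C) (a b : R) : Prop :=
  ex_RInt (fun t => Re (f t)) a b /\ ex_RInt (fun t => Im (f t)) a b.

Definition pcont (f : R -> C) (t : R) : Prop :=
  forall eps : R, 0 < eps -> exists d : R, 0 < d /\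
    forall u : R, Rabs (u - t) < d -> Cmod (f u - f t) < eps.

Definition rderiv (f : R -> C) (t : R) (l : C) : Prop :=
  forall eps : R, 0 < eps -> exists d : R, 0 < d /\
    forall u : R, Rabs (u - t) < d ->
      Cmod (f u - f t - l * RtoC (u - t)) <= eps * Rabs (u - t).

Lemma pcont_Re (f : R -> C) (t : R) : pcont f t -> continuous (fun x => Re (f x)) t.
Proof.
  intros H. apply continuity_pt_filterlim. intros eps Heps.
  destruct (H eps Heps) as [d [Hd HH]]. exists d. split; [exact Hd|].
  intros x [_ Hx]. simpl in *. unfold R_dist in *.
  eapply Rle_lt_trans; [|apply (HH x Hx)].
  apply (re_le_Cmod (f x - f t)).
Qed.

Lemma pcont_Im (f : R -> C) (t : R) : pcont f t -> continuous (fun x => Im (f x)) t.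
Proof.
  intros H. apply continuity_pt_filterlim. intros eps Heps.
  destruct (H eps Heps) as [d [Hd HH]]. exists d. split; [exact Hd|].
  intros x [_ Hx]. simpl in *. unfold R_dist in *.
  eapply Rle_lt_trans; [|apply (HH x Hx)].
  apply (im_le_Cmod (f x - f t)).
Qed.

Lemma pcont_integrable (f : R -> C) (a b : R) :
  a <= b -> (forall t, a <= t <= b -> pcont f t) -> cintegrable f a b.
Proof.
  intros Hab H. split; apply (ex_RInt_continuous (V := R_CompleteNormedModule)); intros t Ht;
    rewrite Rmin_left, Rmax_right in Ht by exact Hab.
  - apply pcont_Re, H, Ht. - apply pcont_Im, H, Ht.
Qed.

Lemma CInt_Chasles (f : R -> C) (a m b : R) :
  cintegrable f a m -> cintegrable f m b ->
  CInt f a b = (CInt f a m + CInt f m b)%C.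
Proof.
  intros [H1 H2] [H3 H4]. unfold CInt, Cplus; simpl. f_equal; symmetry.
  - apply (RInt_Chasles (V := R_CompleteNormedModule)); assumption.
  - apply (RInt_Chasles (V := R_CompleteNormedModule)); assumption.
Qed.

Lemma CInt_ext (f g : R -> C) (a b : R) :
  a <= b -> (forall t, a < t < b -> f t = g t) -> CInt f a b = CInt g a b.
Proof.
  intros Hab H. unfold CInt. f_equal; apply RInt_ext; intros t Ht;
    rewrite Rmin_left, Rmax_right in Ht by exact Hab; rewrite H; auto.
Qed.

Lemma CInt_plus (f g : R -> C) (a b : R) :
  cintegrable f a b -> cintegrable g a b ->
  CInt (fun t => f t + g t)%C a b = (CInt f a b + CInt g a b)%C.
Proof.
  intros [H1 H2] [H3 H4]. unfold CInt, Cplus; simpl. f_equal.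
  - apply (RInt_plus (V := R_CompleteNormedModule)); assumption.
  - apply (RInt_plus (V := R_CompleteNormedModule)); assumption.
Qed.

Lemma is_RInt_cmult (k : C) (f : R -> C) (a b : R) : cintegrable f a b ->
  is_RInt (fun t => Re (k * f t)) a b (Re (k * CInt f a b)) /\
  is_RInt (fun t => Im (k * f t)) a b (Im (k * CInt f a b)).
Proof.
  intros [H1 H2].
  apply (RInt_correct (V := R_CompleteNormedModule)) in H1.
  apply (RInt_correct (V := R_CompleteNormedModule)) in H2.
  destruct k as [x y]. unfold CInt. split.
  - assert (A := is_RInt_minus _ _ _ _ _ _
      (is_RInt_scal _ _ _ x _ H1) (is_RInt_scal _ _ _ y _ H2)).
    exact A.
  - assert (A := is_RInt_plus _ _ _ _ _ _
      (is_RInt_scal _ _ _ x _ H2) (is_RInt_scal _ _ _ y _ H1)).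
    exact A.
Qed.

Lemma CInt_cmult (k : C) (f : R -> C) (a b : R) : cintegrable f a b ->
  CInt (fun t => k * f t)%C a b = (k * CInt f a b)%C.
Proof.
  intros H. destruct (is_RInt_cmult k f a b H) as [A B].
  unfold CInt at 1.
  rewrite (is_RInt_unique (V := R_CompleteNormedModule) _ _ _ _ A).
  rewrite (is_RInt_unique (V := R_CompleteNormedModule) _ _ _ _ B).
  destruct (k * CInt f a b)%C; reflexivity.
Qed.

Lemma cintegrable_cmult (k : C) (f : R -> C) (a b : R) :
  cintegrable f a b -> cintegrable (fun t => k * f t)%C a b.
Proof.
  intros H. destruct (is_RInt_cmult k f a b H) as [A B].
  split; eexists; [exact A|exact B].
Qed.

Lemma CInt_minus (f g : R -> C) (a b : R) :
  cintegrable f a b -> cintegrable g a b ->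
  CInt (fun t => f t - g t)%C a b = (CInt f a b - CInt g a b)%C.
Proof.
  intros Hf Hg.
  replace (fun t => f t - g t)%C with (fun t => f t + - (1) * g t)%C
    by (apply functional_extensionality; intros; ring).
  rewrite CInt_plus, CInt_cmult; [ring|assumption|assumption|].
  apply cintegrable_cmult; assumption.
Qed.

(** The factor 2 comes from bounding real and imaginary parts separately. *)
Lemma CInt_bound (f : R -> C) (a b M : R) :
  a <= b -> cintegrable f a b -> (forall t, a <= t <= b -> Cmod (f t) <= M) ->
  Cmod (CInt f a b) <= 2 * M * (b - a).
Proof.
  intros Hab [H1 H2] HM.
  assert (A : forall g : R -> R, ex_RInt g a b ->
    (forall t, a <= t <= b -> Rabs (g t) <= M) -> Rabs (RInt g a b) <= (b - a) * M).
  { intros g Hg HgM. apply (norm_RInt_le_const (V := R_NormedModule) g a b).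
    - exact Hab.
    - exact HgM.
    - apply (RInt_correct (V := R_CompleteNormedModule)). exact Hg. }
  eapply Rle_trans; [apply Cmod_le_abs|]. unfold CInt at 1 2; simpl.
  assert (B1 := A _ H1). assert (B2 := A _ H2).
  assert (C1 : Rabs (RInt (fun t => Re (f t)) a b) <= (b - a) * M).
  { apply B1. intros t Ht. eapply Rle_trans; [apply re_le_Cmod|auto]. }
  assert (C2 : Rabs (RInt (fun t => Im (f t)) a b) <= (b - a) * M).
  { apply B2. intros t Ht. eapply Rle_trans; [apply im_le_Cmod|auto]. }
  lra.
Qed.

Lemma rderiv_pcont (f : R -> C) (t : R) (l : C) : rderiv f t l -> pcont f t.
Proof.
  intros H eps Heps. destruct (H 1 Rlt_0_1) as [d [Hd HH]].
  set (k := 1 + Cmod l). assert (Hk : 0 < k) by (unfold k; pose proof (Cmod_ge_0 l); lra).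
  exists (Rmin d (eps / k)). split.
  { apply Rmin_glb_lt; [exact Hd|]. apply Rdiv_lt_0_compat; lra. }
  intros u Hu. assert (H1 : Rabs (u - t) < d) by (eapply Rlt_le_trans; [exact Hu|apply Rmin_l]).
  assert (H2 : Rabs (u - t) < eps / k) by (eapply Rlt_le_trans; [exact Hu|apply Rmin_r]).
  specialize (HH u H1).
  replace (f u - f t)%C with ((f u - f t - l * RtoC (u - t)) + l * RtoC (u - t))%C by ring.
  eapply Rle_lt_trans; [apply Cmod_triangle|]. rewrite Cmod_mult, Cmod_R.
  apply (Rmult_lt_compat_r k) in H2; [|exact Hk].
  replace (eps / k * k) with eps in H2 by (field; lra). unfold k in H2. nra.
Qed.

Lemma rderiv_Re (f : R -> C) (t : R) (l : C) :
  rderiv f t l -> is_derive (fun x => Re (f x)) t (Re l).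
Proof.
  intros H. apply is_derive_Reals. intros eps Heps.
  destruct (H (eps / 2) ltac:(lra)) as [d [Hd HH]]. exists (mkposreal d Hd).
  intros h Hh0 Hh. simpl in Hh. specialize (HH (t + h)).
  replace (t + h - t) with h in HH by ring. specialize (HH Hh).
  replace ((Re (f (t + h)) - Re (f t)) / h - Re l)
    with (Re (f (t + h) - f t - l * RtoC h) / h)
    by (unfold Cminus, Cplus, Copp, Cmult, RtoC, Re; simpl; field; exact Hh0).
  assert (Hp : 0 < Rabs h) by (apply Rabs_pos_lt; exact Hh0).
  unfold Rdiv. rewrite Rabs_mult, Rabs_inv.
  apply (Rmult_lt_reg_r (Rabs h)); [exact Hp|].
  rewrite Rmult_assoc, Rinv_l, Rmult_1_r by lra.
  eapply Rle_lt_trans; [apply re_le_Cmod|]. eapply Rle_lt_trans; [exact HH|]. nra.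
Qed.

Lemma rderiv_Im (f : R -> C) (t : R) (l : C) :
  rderiv f t l -> is_derive (fun x => Im (f x)) t (Im l).
Proof.
  intros H. apply is_derive_Reals. intros eps Heps.
  destruct (H (eps / 2) ltac:(lra)) as [d [Hd HH]]. exists (mkposreal d Hd).
  intros h Hh0 Hh. simpl in Hh. specialize (HH (t + h)).
  replace (t + h - t) with h in HH by ring. specialize (HH Hh).
  replace ((Im (f (t + h)) - Im (f t)) / h - Im l)
    with (Im (f (t + h) - f t - l * RtoC h) / h)
    by (unfold Cminus, Cplus, Copp, Cmult, RtoC, Im; simpl; field; exact Hh0).
  assert (Hp : 0 < Rabs h) by (apply Rabs_pos_lt; exact Hh0).
  unfold Rdiv. rewrite Rabs_mult, Rabs_inv.
  apply (Rmult_lt_reg_r (Rabs h)); [exact Hp|].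
  rewrite Rmult_assoc, Rinv_l, Rmult_1_r by lra.
  eapply Rle_lt_trans; [apply im_le_Cmod|]. eapply Rle_lt_trans; [exact HH|]. nra.
Qed.

Lemma CInt_FTC (F f : R -> C) (a b : R) : a <= b ->
  (forall t, a <= t <= b -> rderiv F t (f t)) ->
  (forall t, a <= t <= b -> pcont f t) -> CInt f a b = (F b - F a)%C.
Proof.
  intros Hab HF Hf. unfold CInt.
  assert (A : is_RInt (fun t => Re (f t)) a b (Re (F b) - Re (F a))).
  { apply (is_RInt_derive (V := R_CompleteNormedModule) (fun t => Re (F t)));
      intros t Ht; rewrite Rmin_left, Rmax_right in Ht by exact Hab.
    - apply rderiv_Re, HF, Ht. - apply pcont_Re, Hf, Ht. }
  assert (B : is_RInt (fun t => Im (f t)) a b (Im (F b) - Im (F a))).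
  { apply (is_RInt_derive (V := R_CompleteNormedModule) (fun t => Im (F t)));
      intros t Ht; rewrite Rmin_left, Rmax_right in Ht by exact Hab.
    - apply rderiv_Im, HF, Ht. - apply pcont_Im, Hf, Ht. }
  rewrite (is_RInt_unique (V := R_CompleteNormedModule) _ _ _ _ A).
  rewrite (is_RInt_unique (V := R_CompleteNormedModule) _ _ _ _ B). reflexivity.
Qed.

Lemma rderiv_comp (f : C -> C) (g : R -> C) (t : R) (l m : C) :
  cderiv f (g t) l -> rderiv g t m -> rderiv (fun x => f (g x)) t (l * m)%C.
Proof.
  intros Hf Hg eps Heps.
  set (k := Cmod m + 1). assert (Hk : 0 < k) by (unfold k; pose proof (Cmod_ge_0 m); lra).
  set (kl := Cmod l + 1). assert (Hkl : 0 < kl) by (unfold kl; pose proof (Cmod_ge_0 l); lra).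
  destruct (Hf (eps / (2 * k))) as [d1 [Hd1 H1]]; [apply Rdiv_lt_0_compat; lra|].
  assert (He2 : 0 < Rmin 1 (eps / (2 * kl))).
  { apply Rmin_glb_lt; [lra|apply Rdiv_lt_0_compat; lra]. }
  destruct (Hg _ He2) as [d2 [Hd2 H2]].
  destruct (rderiv_pcont g t m Hg d1 Hd1) as [d3 [Hd3 H3]].
  exists (Rmin d2 d3). split; [apply Rmin_glb_lt; assumption|].
  intros u Hu.
  assert (Hu2 : Rabs (u - t) < d2) by (eapply Rlt_le_trans; [exact Hu|apply Rmin_l]).
  assert (Hu3 : Rabs (u - t) < d3) by (eapply Rlt_le_trans; [exact Hu|apply Rmin_r]).
  specialize (H2 u Hu2). specialize (H3 u Hu3). specialize (H1 (g u) H3).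
  set (D := Rabs (u - t)) in *. assert (HD : 0 <= D) by apply Rabs_pos.
  assert (HgD : Cmod (g u - g t) <= k * D).
  { replace (g u - g t)%C with ((g u - g t - m * RtoC (u - t)) + m * RtoC (u - t))%C by ring.
    eapply Rle_trans; [apply Cmod_triangle|]. rewrite Cmod_mult, Cmod_R. fold D.
    assert (Rmin 1 (eps / (2 * kl)) * D <= 1 * D) by (apply Rmult_le_compat_r; [exact HD|apply Rmin_l]).
    unfold k. lra. }
  replace (f (g u) - f (g t) - l * m * RtoC (u - t))%C
    with ((f (g u) - f (g t) - l * (g u - g t)) + l * (g u - g t - m * RtoC (u - t)))%C by ring.
  eapply Rle_trans; [apply Cmod_triangle|]. rewrite Cmod_mult.
  assert (A1 : eps / (2 * k) * Cmod (g u - g t) <= eps / 2 * D).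
  { apply Rle_trans with (eps / (2 * k) * (k * D)).
    - apply Rmult_le_compat_l; [left; apply Rdiv_lt_0_compat; lra|exact HgD].
    - right. field. lra. }
  assert (A2 : Cmod l * Cmod (g u - g t - m * RtoC (u - t)) <= eps / 2 * D).
  { apply Rle_trans with (kl * (eps / (2 * kl) * D)).
    - apply Rmult_le_compat; [apply Cmod_ge_0|apply Cmod_ge_0|unfold kl; lra|].
      eapply Rle_trans; [exact H2|]. apply Rmult_le_compat_r; [exact HD|apply Rmin_r].
    - right. field. lra. }
  lra.
Qed.

Lemma rderiv_affine (z k : C) (t : R) : rderiv (fun x => z + RtoC x * k)%C t k.
Proof.
  intros eps Heps. exists 1. split; [lra|]. intros u _.
  replace (z + RtoC u * k - (z + RtoC t * k) - k * RtoC (u - t))%C with (RtoC 0).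
  - rewrite Cmod_0. apply Rmult_le_pos; [lra|apply Rabs_pos].
  - rewrite RtoC_minus. ring.
Qed.

Lemma pcont_comp (f : C -> C) (g : R -> C) (t : R) :
  ccont f (g t) -> pcont g t -> pcont (fun x => f (g x)) t.
Proof.
  intros Hf Hg eps Heps. destruct (Hf eps Heps) as [d [Hd H]].
  destruct (Hg d Hd) as [e [He HH]]. exists e. split; [exact He|]. intros u Hu. auto.
Qed.

Lemma pcont_affine (z k : C) (t : R) : pcont (fun x => z + RtoC x * k)%C t.
Proof. eapply rderiv_pcont. apply rderiv_affine. Qed.

(** * The integral theorem of Cauchy and Goursat on rectangles *)

(** The integral of [H] along the positively oriented boundary of [[a, b] x [c, d]]. *)
Definition rect_int (H : C -> C) (a b c d : R) : C :=
  (CInt (fun x => H (x, c)) a b + Ci * CInt (fun y => H (b, y)) c d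
   - CInt (fun x => H (x, d)) a b - Ci * CInt (fun y => H (a, y)) c d)%C.

Definition cont_on_rect (H : C -> C) (a b c d : R) : Prop :=
  forall x y, a <= x <= b -> c <= y <= d -> ccont H (x, y).

Lemma pcont_horizontal (H : C -> C) (x y : R) : ccont H (x, y) -> pcont (fun u => H (u, y)) x.
Proof.
  intros HH. apply (pcont_comp H (fun u => (u, y))); [exact HH|].
  replace (fun u : R => (u, y)) with (fun u : R => (0, y) + RtoC u * 1)%C.
  - apply pcont_affine.
  - apply functional_extensionality. intros u. unfold Cplus, Cmult, RtoC; simpl. f_equal; ring.
Qed.

Lemma pcont_vertical (H : C -> C) (x y : R) : ccont H (x, y) -> pcont (fun u => H (x, u)) y.
Proof.
  intros HH. apply (pcont_comp H (fun u => (x, u))); [exact HH|].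
  replace (fun u : R => (x, u)) with (fun u : R => (x, 0) + RtoC u * Ci)%C.
  - apply pcont_affine.
  - apply functional_extensionality. intros u. unfold Cplus, Cmult, RtoC, Ci; simpl. f_equal; ring.
Qed.

Lemma cont_rect_sub (H : C -> C) (a b c d a' b' c' d' : R) :
  cont_on_rect H a b c d -> a <= a' -> b' <= b -> c <= c' -> d' <= d ->
  cont_on_rect H a' b' c' d'.
Proof. intros HH ? ? ? ? x y Hx Hy. apply HH; lra. Qed.

Lemma integrable_horizontal (H : C -> C) (a b c d y : R) :
  a <= b -> cont_on_rect H a b c d -> c <= y <= d -> cintegrable (fun x => H (x, y)) a b.
Proof.
  intros Hab HH Hy. apply pcont_integrable; [exact Hab|].
  intros t Ht. apply pcont_horizontal, HH; assumption.
Qed.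

Lemma integrable_vertical (H : C -> C) (a b c d x : R) :
  c <= d -> cont_on_rect H a b c d -> a <= x <= b -> cintegrable (fun y => H (x, y)) c d.
Proof.
  intros Hcd HH Hx. apply pcont_integrable; [exact Hcd|].
  intros t Ht. apply pcont_vertical, HH; assumption.
Qed.

Lemma rect_int_split_x (H : C -> C) (a m b c d : R) :
  a <= m <= b -> c <= d -> cont_on_rect H a b c d ->
  rect_int H a b c d = (rect_int H a m c d + rect_int H m b c d)%C.
Proof.
  intros Hm Hcd HH. unfold rect_int.
  rewrite (CInt_Chasles (fun x => H (x, c)) a m b), (CInt_Chasles (fun x => H (x, d)) a m b).
  - ring.
  - apply (integrable_horizontal H a m c d); [lra| |lra]. apply (cont_rect_sub H a b c d); auto; lra.
  - apply (integrable_horizontal H m b c d); [lra| |lra]. apply (cont_rect_sub H a b c d); auto; lra.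
  - apply (integrable_horizontal H a m c d); [lra| |lra]. apply (cont_rect_sub H a b c d); auto; lra.
  - apply (integrable_horizontal H m b c d); [lra| |lra]. apply (cont_rect_sub H a b c d); auto; lra.
Qed.

Lemma rect_int_split_y (H : C -> C) (a b c m d : R) :
  a <= b -> c <= m <= d -> cont_on_rect H a b c d ->
  rect_int H a b c d = (rect_int H a b c m + rect_int H a b m d)%C.
Proof.
  intros Hab Hm HH. unfold rect_int.
  rewrite (CInt_Chasles (fun y => H (a, y)) c m d), (CInt_Chasles (fun y => H (b, y)) c m d).
  - ring.
  - apply (integrable_vertical H a b c m); [lra| |lra]. apply (cont_rect_sub H a b c d); auto; lra.
  - apply (integrable_vertical H a b m d); [lra| |lra]. apply (cont_rect_sub H a b c d); auto; lra.
  - apply (integrable_vertical H a b c m); [lra| |lra]. apply (cont_rect_sub H a b c d); auto; lra.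
  - apply (integrable_vertical H a b m d); [lra| |lra]. apply (cont_rect_sub H a b c d); auto; lra.
Qed.

Lemma rect_int_bound (H : C -> C) (a b c d M : R) :
  a <= b -> c <= d -> cont_on_rect H a b c d ->
  (forall x y, a <= x <= b -> c <= y <= d -> Cmod (H (x, y)) <= M) ->
  Cmod (rect_int H a b c d) <= 4 * M * ((b - a) + (d - c)).
Proof.
  intros Hab Hcd HH HM. unfold rect_int.
  assert (B1 := CInt_bound (fun x => H (x, c)) a b M Hab
    (integrable_horizontal H a b c d c Hab HH ltac:(lra)) ltac:(intros; apply HM; lra)).
  assert (B2 := CInt_bound (fun y => H (b, y)) c d M Hcd
    (integrable_vertical H a b c d b Hcd HH ltac:(lra)) ltac:(intros; apply HM; lra)).
  assert (B3 := CInt_bound (fun x => H (x, d)) a b M Hab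
    (integrable_horizontal H a b c d d Hab HH ltac:(lra)) ltac:(intros; apply HM; lra)).
  assert (B4 := CInt_bound (fun y => H (a, y)) c d M Hcd
    (integrable_vertical H a b c d a Hcd HH ltac:(lra)) ltac:(intros; apply HM; lra)).
  set (u1 := CInt _ _ _) in B1. set (u2 := CInt _ _ _) in B2.
  set (u3 := CInt _ _ _) in B3. set (u4 := CInt _ _ _) in B4.
  change (Cmod (u1 + Ci * u2 - u3 - Ci * u4) <= 4 * M * (b - a + (d - c))).
  unfold Cminus.
  eapply Rle_trans; [apply Cmod_triangle|]. rewrite Cmod_opp, Cmod_mult, Cmod_Ci.
  assert (T1 := Cmod_triangle (u1 + Ci * u2) (- u3)). rewrite Cmod_opp in T1.
  assert (T2 := Cmod_triangle u1 (Ci * u2)). rewrite Cmod_mult, Cmod_Ci in T2. lra.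
Qed.

Lemma rect_int_minus (H1 H2 : C -> C) (a b c d : R) :
  a <= b -> c <= d -> cont_on_rect H1 a b c d -> cont_on_rect H2 a b c d ->
  rect_int (fun z => H1 z - H2 z)%C a b c d = (rect_int H1 a b c d - rect_int H2 a b c d)%C.
Proof.
  intros Hab Hcd C1 C2. unfold rect_int.
  assert (Ih : forall H y, cont_on_rect H a b c d -> c <= y <= d -> cintegrable (fun x => H (x, y)) a b).
  { intros H y HH Hy. exact (integrable_horizontal H a b c d y Hab HH Hy). }
  assert (Iv : forall H x, cont_on_rect H a b c d -> a <= x <= b -> cintegrable (fun y => H (x, y)) c d).
  { intros H x HH Hx. exact (integrable_vertical H a b c d x Hcd HH Hx). }
  rewrite (CInt_minus (fun x => H1 (x, c)) (fun x => H2 (x, c)))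
    by (apply Ih; [assumption|lra]).
  rewrite (CInt_minus (fun x => H1 (x, d)) (fun x => H2 (x, d)))
    by (apply Ih; [assumption|lra]).
  rewrite (CInt_minus (fun y => H1 (a, y)) (fun y => H2 (a, y)))
    by (apply Iv; [assumption|lra]).
  rewrite (CInt_minus (fun y => H1 (b, y)) (fun y => H2 (b, y)))
    by (apply Iv; [assumption|lra]).
  ring.
Qed.

Lemma rect_int_primitive (P H : C -> C) (a b c d : R) :
  a <= b -> c <= d -> cont_on_rect H a b c d ->
  (forall x y, a <= x <= b -> c <= y <= d -> cderiv P (x, y) (H (x, y))) ->
  rect_int H a b c d = 0%C.
Proof.
  intros Hab Hcd HH HP.
  assert (Ehor : forall y, c <= y <= d -> CInt (fun x => H (x, y)) a b = (P (b, y) - P (a, y))%C).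
  { intros y Hy. apply (CInt_FTC (fun x => P (x, y))); [exact Hab| |].
    - intros t Ht. replace (H (t, y)) with (H (t, y) * 1)%C by ring.
      apply (rderiv_comp P (fun x => (x, y))); [apply HP; assumption|].
      replace (fun u : R => (u, y)) with (fun u : R => (0, y) + RtoC u * 1)%C.
      + apply rderiv_affine.
      + apply functional_extensionality. intros u. unfold Cplus, Cmult, RtoC; simpl. f_equal; ring.
    - intros t Ht. apply pcont_horizontal, HH; assumption. }
  assert (Ever : forall x, a <= x <= b -> (Ci * CInt (fun y => H (x, y)) c d)%C = (P (x, d) - P (x, c))%C).
  { intros x Hx. rewrite <- CInt_cmult by (exact (integrable_vertical H a b c d x Hcd HH Hx)).
    apply (CInt_FTC (fun y => P (x, y))); [exact Hcd| |].
    - intros t Ht. rewrite Cmult_comm.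
      apply (rderiv_comp P (fun y => (x, y))); [apply HP; assumption|].
      replace (fun u : R => (x, u)) with (fun u : R => (x, 0) + RtoC u * Ci)%C.
      + apply rderiv_affine.
      + apply functional_extensionality. intros u. unfold Cplus, Cmult, RtoC, Ci; simpl. f_equal; ring.
    - intros t Ht. apply (pcont_comp (fun w => Ci * w)%C).
      + eapply cderiv_ccont. apply cderiv_cmult. apply cderiv_id.
      + apply pcont_vertical, HH; assumption. }
  unfold rect_int. rewrite !Ehor, !Ever by lra. ring.
Qed.

Lemma rect_int_affine (A B z0 : C) (a b c d : R) : a <= b -> c <= d ->
  rect_int (fun z => A + B * (z - z0))%C a b c d = 0%C.
Proof.
  intros Hab Hcd.
  apply (rect_int_primitive (fun z => A * z + B / 2 * ((z - z0) * (z - z0)))%C); auto.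
  - intros x y _ _. eapply cderiv_ccont. apply cderiv_plus; [apply cderiv_const|].
    apply cderiv_cmult. apply cderiv_minus; [apply cderiv_id|apply cderiv_const].
  - intros x y _ _. eapply cderiv_eq.
    + apply cderiv_plus; [apply cderiv_cmult, cderiv_id|]. apply cderiv_cmult.
      apply (cderiv_mult (fun z => z - z0)%C (fun z => z - z0)%C);
        (apply cderiv_minus; [apply cderiv_id|apply cderiv_const]).
    + cbv beta. field.
Qed.

(** Inner sides are shared by two quarters with opposite orientations, so the
    boundary integrals of the quarters add up to that of the rectangle. *)
Lemma rect_bisect (H : C -> C) (a b c d eta : R) :
  a <= b -> c <= d -> cont_on_rect H a b c d -> eta <= Cmod (rect_int H a b c d) ->
  exists a' b' c' d', a <= a' /\ b' <= b /\ c <= c' /\ d' <= d /\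
    b' - a' = (b - a) / 2 /\ d' - c' = (d - c) / 2 /\
    eta / 4 <= Cmod (rect_int H a' b' c' d').
Proof.
  intros Hab Hcd HH He.
  set (m := (a + b) / 2). set (n := (c + d) / 2).
  assert (E : rect_int H a b c d = ((rect_int H a m c n + rect_int H a m n d)
     + (rect_int H m b c n + rect_int H m b n d))%C).
  { rewrite (rect_int_split_x H a m b c d); [|unfold m; lra|lra|exact HH].
    rewrite (rect_int_split_y H a m c n d); [|unfold m; lra|unfold n; lra|
      apply (cont_rect_sub H a b c d); auto; unfold m; lra].
    rewrite (rect_int_split_y H m b c n d); [|unfold m; lra|unfold n; lra|
      apply (cont_rect_sub H a b c d); auto; unfold m; lra].
    reflexivity. }
  rewrite E in He.
  assert (T := Cmod_triangle (rect_int H a m c n + rect_int H a m n d)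
     (rect_int H m b c n + rect_int H m b n d)).
  assert (T1 := Cmod_triangle (rect_int H a m c n) (rect_int H a m n d)).
  assert (T2 := Cmod_triangle (rect_int H m b c n) (rect_int H m b n d)).
  destruct (Rle_dec (eta / 4) (Cmod (rect_int H a m c n))).
  { exists a, m, c, n. unfold m, n in *. repeat split; auto; lra. }
  destruct (Rle_dec (eta / 4) (Cmod (rect_int H a m n d))).
  { exists a, m, n, d. unfold m, n in *. repeat split; auto; lra. }
  destruct (Rle_dec (eta / 4) (Cmod (rect_int H m b c n))).
  { exists m, b, c, n. unfold m, n in *. repeat split; auto; lra. }
  exists m, b, n, d. unfold m, n in *. repeat split; auto; lra.
Qed.

Lemma nested_intervals (a b : nat -> R) (w : R) :
  (forall n, a n <= a (S n)) -> (forall n, b (S n) <= b n) -> (forall n, a n <= b n) ->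
  exists x, forall n, a n <= x <= b n.
Proof.
  intros Ha Hb Hab.
  assert (Ha' : forall n k, a n <= a (n + k)%nat).
  { intros n k. induction k; [rewrite Nat.add_0_r; lra|]. rewrite Nat.add_succ_r. specialize (Ha (n + k)%nat). lra. }
  assert (Hb' : forall n k, b (n + k)%nat <= b n).
  { intros n k. induction k; [rewrite Nat.add_0_r; lra|]. rewrite Nat.add_succ_r. specialize (Hb (n + k)%nat). lra. }
  assert (Hx : forall n m, a n <= b m).
  { intros n m. specialize (Ha' n m). specialize (Hb' m n). specialize (Hab (n + m)%nat).
    rewrite (Nat.add_comm m n) in Hb'. lra. }
  destruct (completeness (fun x => exists n, x = a n)) as [x [H1 H2]].
  - exists (b 0%nat). intros y [n ->]. apply Hx.
  - exists (a 0%nat), 0%nat. reflexivity.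
  - exists x. intros n. split; [apply H1; exists n; reflexivity|].
    apply H2. intros y [m ->]. apply Hx.
Qed.

(** Goursat's theorem: bisection keeps [eta / 4 ^ n] of the integral, whereas on
    rectangles shrinking to a point [H] is affine up to a small multiple of the
    diameter, and affine functions have integral 0. *)
Lemma goursat (H : C -> C) (a b c d : R) :
  a <= b -> c <= d ->
  (forall x y, a <= x <= b -> c <= y <= d -> exists l, cderiv H (x, y) l) ->
  rect_int H a b c d = 0%C.
Proof.
  intros Hab Hcd HD.
  assert (HC : cont_on_rect H a b c d).
  { intros x y Hx Hy. destruct (HD x y Hx Hy) as [l Hl]. eapply cderiv_ccont; exact Hl. }
  apply NNPP. intros Hne.
  set (eta := Cmod (rect_int H a b c d)).
  assert (Heta : 0 < eta) by (apply Cmod_gt_0; exact Hne).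
  set (good := fun (n : nat) (q : R * R * (R * R)) =>
     let '((a', b'), (c', d')) := q in
     a <= a' /\ b' <= b /\ c <= c' /\ d' <= d /\
     b' - a' = (b - a) / 2 ^ n /\ d' - c' = (d - c) / 2 ^ n /\
     eta / 4 ^ n <= Cmod (rect_int H a' b' c' d')).
  set (sub := fun q q' : R * R * (R * R) =>
     let '((a0, b0), (c0, d0)) := q in let '((a', b'), (c', d')) := q' in
     a0 <= a' /\ b' <= b0 /\ c0 <= c' /\ d' <= d0).
  assert (Hp2 : forall n, 0 < 2 ^ n) by (intros; apply pow_lt; lra).
  assert (Hp4 : forall n, 0 < 4 ^ n) by (intros; apply pow_lt; lra).
  assert (Hlen : forall n l, 0 <= l -> 0 <= l / 2 ^ n).
  { intros n l Hl. apply Rmult_le_pos; [exact Hl|]. left. apply Rinv_0_lt_compat, Hp2. }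
  assert (step : forall n q, good n q -> exists q', good (S n) q' /\ sub q q').
  { intros n [[a0 b0] [c0 d0]] (G1 & G2 & G3 & G4 & G5 & G6 & G7).
    assert (L1 := Hlen n (b - a) ltac:(lra)). assert (L2 := Hlen n (d - c) ltac:(lra)).
    destruct (rect_bisect H a0 b0 c0 d0 (eta / 4 ^ n)) as (a' & b' & c' & d' & S1 & S2 & S3 & S4 & S5 & S6 & S7);
      [lra|lra|apply (cont_rect_sub H a b c d); auto|exact G7|].
    exists ((a', b'), (c', d')). split; [|repeat split; assumption].
    specialize (Hp2 n). specialize (Hp4 n).
    repeat split; try lra.
    - rewrite S5, G5. simpl. field. lra.
    - rewrite S6, G6. simpl. field. lra.
    - eapply Rle_trans; [|exact S7]. right. simpl. field. lra. }
  set (nxt := fun n q => match excluded_middle_informative (good n q) with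
     | left Hg => proj1_sig (constructive_indefinite_description _ (step n q Hg))
     | right _ => q end).
  set (sq := fix sq n := match n with O => ((a, b), (c, d)) | S k => nxt k (sq k) end).
  assert (Hgood : forall n, good n (sq n)).
  { induction n as [|n IH].
    - simpl. repeat split; try lra. fold eta. lra.
    - change (sq (S n)) with (nxt n (sq n)). unfold nxt.
      destruct (excluded_middle_informative (good n (sq n))) as [Hg|Hg]; [|contradiction].
      destruct (constructive_indefinite_description _ (step n (sq n) Hg)) as [q' [Q1 Q2]]. exact Q1. }
  assert (Hsub : forall n, sub (sq n) (sq (S n))).
  { intros n. change (sq (S n)) with (nxt n (sq n)). unfold nxt.
    destruct (excluded_middle_informative (good n (sq n))) as [Hg|Hg]; [|exfalso; apply Hg, Hgood].
    destruct (constructive_indefinite_description _ (step n (sq n) Hg)) as [q' [Q1 Q2]]. exact Q2. }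
  clearbody sq. clear nxt step.
  set (A := fun n => fst (fst (sq n))). set (B := fun n => snd (fst (sq n))).
  set (Cc := fun n => fst (snd (sq n))). set (Dd := fun n => snd (snd (sq n))).
  assert (G : forall n, a <= A n /\ B n <= b /\ c <= Cc n /\ Dd n <= d /\
     B n - A n = (b - a) / 2 ^ n /\ Dd n - Cc n = (d - c) / 2 ^ n /\
     eta / 4 ^ n <= Cmod (rect_int H (A n) (B n) (Cc n) (Dd n))).
  { intros n. specialize (Hgood n). unfold A, B, Cc, Dd. destruct (sq n) as [[a0 b0] [c0 d0]]. exact Hgood. }
  assert (Sb : forall n, A n <= A (S n) /\ B (S n) <= B n /\ Cc n <= Cc (S n) /\ Dd (S n) <= Dd n).
  { intros n. specialize (Hsub n). unfold A, B, Cc, Dd.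
    destruct (sq n) as [[a0 b0] [c0 d0]]. destruct (sq (S n)) as [[a1 b1] [c1 d1]]. exact Hsub. }
  destruct (nested_intervals A B 0) as [x0 Hx0].
  { intros; apply Sb. } { intros; apply Sb. }
  { intros n. destruct (G n) as (_ & _ & _ & _ & G5 & _). specialize (Hlen n (b - a)). lra. }
  destruct (nested_intervals Cc Dd 0) as [y0 Hy0].
  { intros; apply Sb. } { intros; apply Sb. }
  { intros n. destruct (G n) as (_ & _ & _ & _ & _ & G6 & _). specialize (Hlen n (d - c)). lra. }
  assert (Hx0b : a <= x0 <= b).
  { destruct (G 0%nat) as (G1 & G2 & _). specialize (Hx0 0%nat). lra. }
  assert (Hy0b : c <= y0 <= d).
  { destruct (G 0%nat) as (_ & _ & G3 & G4 & _). specialize (Hy0 0%nat). lra. }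
  destruct (HD x0 y0 Hx0b Hy0b) as [l Hl].
  set (w := (b - a) + (d - c)). assert (Hw : 0 <= w) by (unfold w; lra).
  set (eps := eta / (8 * (w * w + 1))).
  assert (Hww : 0 < w * w + 1) by nra.
  assert (Heps : 0 < eps) by (apply Rdiv_lt_0_compat; lra).
  destruct (Hl eps Heps) as [del [Hdel HL]].
  assert (Hn : exists n, w / 2 ^ n < del).
  { destruct (pow_lt_1_zero (/ 2)) with (y := del / (w + 1)) as [N HN].
    - rewrite Rabs_right; lra.
    - apply Rdiv_lt_0_compat; lra.
    - exists N. specialize (HN N (le_n N)). rewrite Rabs_right in HN by (apply Rle_ge, pow_le; lra).
      rewrite pow_inv in HN.
      apply Rle_lt_trans with ((w + 1) * / 2 ^ N).
      + unfold Rdiv. apply Rmult_le_compat_r; [left; apply Rinv_0_lt_compat, Hp2|lra].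
      + apply (Rmult_lt_compat_l (w + 1)) in HN; [|lra].
        replace ((w + 1) * (del / (w + 1))) with del in HN by (field; lra). exact HN. }
  destruct Hn as [n Hn]. destruct (G n) as (G1 & G2 & G3 & G4 & G5 & G6 & G7).
  specialize (Hx0 n). specialize (Hy0 n). specialize (Hp2 n). specialize (Hp4 n).
  set (wn := w / 2 ^ n) in *.
  assert (Hwn : B n - A n + (Dd n - Cc n) = wn) by (rewrite G5, G6; unfold wn, w; field; lra).
  assert (Hcn : cont_on_rect H (A n) (B n) (Cc n) (Dd n)) by (apply (cont_rect_sub H a b c d); auto).
  set (aff := fun z => (H (x0, y0) + l * (z - (x0, y0)))%C).
  assert (Haff : cont_on_rect aff (A n) (B n) (Cc n) (Dd n)).
  { intros x y _ _. eapply cderiv_ccont. apply cderiv_plus; [apply cderiv_const|].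
    apply cderiv_cmult. apply cderiv_minus; [apply cderiv_id|apply cderiv_const]. }
  assert (E : rect_int H (A n) (B n) (Cc n) (Dd n) = rect_int (fun z => H z - aff z)%C (A n) (B n) (Cc n) (Dd n)).
  { rewrite rect_int_minus; [|lra|lra|exact Hcn|exact Haff].
    unfold aff. rewrite rect_int_affine by lra. ring. }
  rewrite E in G7.
  assert (HB : Cmod (rect_int (fun z => H z - aff z)%C (A n) (B n) (Cc n) (Dd n)) <=
     4 * (eps * wn) * (B n - A n + (Dd n - Cc n))).
  { apply rect_int_bound; [lra|lra| |].
    - intros x y Hx Hy e He. destruct (Hcn x y Hx Hy (e / 2) ltac:(lra)) as [d1 [Hd1 E1]].
      destruct (Haff x y Hx Hy (e / 2) ltac:(lra)) as [d2 [Hd2 E2]].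
      exists (Rmin d1 d2). split; [apply Rmin_glb_lt; assumption|]. intros u Hu.
      specialize (E1 u ltac:(eapply Rlt_le_trans; [exact Hu|apply Rmin_l])).
      specialize (E2 u ltac:(eapply Rlt_le_trans; [exact Hu|apply Rmin_r])).
      replace (H u - aff u - (H (x, y) - aff (x, y)))%C
        with ((H u - H (x, y)) + - (aff u - aff (x, y)))%C by ring.
      eapply Rle_lt_trans; [apply Cmod_triangle|]. rewrite Cmod_opp. lra.
    - intros x y Hx Hy.
      assert (Hdist : Cmod ((x, y) - (x0, y0)) <= wn).
      { eapply Rle_trans; [apply Cmod_le_abs|]. unfold Re, Im, Cminus, Cplus, Copp; simpl.
        rewrite <- Hwn. apply Rplus_le_compat; apply Rabs_le; lra. }
      specialize (HL (x, y) ltac:(lra)).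
      unfold aff. replace (H (x, y) - (H (x0, y0) + l * ((x, y) - (x0, y0))))%C
        with (H (x, y) - H (x0, y0) - l * ((x, y) - (x0, y0)))%C by ring.
      eapply Rle_trans; [exact HL|]. apply Rmult_le_compat_l; lra. }
  rewrite Hwn in HB.
  assert (F : eta / 4 ^ n <= 4 * eps * wn * wn) by lra.
  apply (Rmult_le_compat_r (4 ^ n)) in F; [|lra].
  replace (eta / 4 ^ n * 4 ^ n) with eta in F by (field; lra).
  replace (4 * eps * wn * wn * 4 ^ n) with (4 * eps * (w * w)) in F.
  - assert (F2 : eps * (w * w + 1) = eta / 8) by (unfold eps; field; lra). nra.
  - unfold wn. replace (4 ^ n) with (2 ^ n * 2 ^ n).
    + field. lra.
    + rewrite <- Rpow_mult_distr. replace (2 * 2) with 4 by ring. reflexivity.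
Qed.

Lemma eq_0_of_small (z : C) (k : R) :
  0 < k -> (forall d, 0 < d < k -> Cmod z <= d) -> z = 0%C.
Proof.
  intros Hk H. apply NNPP. intros Hn. apply Cmod_gt_0 in Hn.
  assert (A := Rmin_l (k / 2) (Cmod z / 2)). assert (B := Rmin_r (k / 2) (Cmod z / 2)).
  assert (D : 0 < Rmin (k / 2) (Cmod z / 2)) by (apply Rmin_glb_lt; lra).
  specialize (H (Rmin (k / 2) (Cmod z / 2)) ltac:(lra)). lra.
Qed.

(** A single point where [H] is merely continuous does not disturb Goursat's
    theorem: isolate it in a small square, whose boundary integral tends to 0. *)
Lemma goursat_except (H : C -> C) (a b c d x0 y0 : R) :
  a < x0 < b -> c < y0 < d -> ccont H (x0, y0) ->
  (forall x y, a <= x <= b -> c <= y <= d -> (x, y) <> (x0, y0) -> exists l, cderiv H (x, y) l) ->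
  rect_int H a b c d = 0%C.
Proof.
  intros Hx0 Hy0 Hc HD.
  assert (HC : cont_on_rect H a b c d).
  { intros x y Hx Hy. destruct (classic ((x, y) = (x0, y0))) as [E|E].
    - rewrite E. exact Hc.
    - destruct (HD x y Hx Hy E) as [l Hl]. eapply cderiv_ccont; exact Hl. }
  destruct (Hc 1 Rlt_0_1) as [d1 [Hd1 Hb]].
  set (M := Cmod (H (x0, y0)) + 1).
  assert (HM : 0 < M) by (unfold M; pose proof (Cmod_ge_0 (H (x0, y0))); lra).
  set (k := Rmin (d1 / 4) (Rmin (Rmin (x0 - a) (b - x0)) (Rmin (y0 - c) (d - y0)))).
  assert (Hk : 0 < k) by (unfold k; repeat apply Rmin_glb_lt; lra).
  assert (K1 : k <= d1 / 4) by apply Rmin_l.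
  assert (K2 : k <= Rmin (Rmin (x0 - a) (b - x0)) (Rmin (y0 - c) (d - y0))) by apply Rmin_r.
  assert (K3 : k <= Rmin (x0 - a) (b - x0)) by (eapply Rle_trans; [exact K2|apply Rmin_l]).
  assert (K4 : k <= Rmin (y0 - c) (d - y0)) by (eapply Rle_trans; [exact K2|apply Rmin_r]).
  assert (K5 : k <= x0 - a) by (eapply Rle_trans; [exact K3|apply Rmin_l]).
  assert (K6 : k <= b - x0) by (eapply Rle_trans; [exact K3|apply Rmin_r]).
  assert (K7 : k <= y0 - c) by (eapply Rle_trans; [exact K4|apply Rmin_l]).
  assert (K8 : k <= d - y0) by (eapply Rle_trans; [exact K4|apply Rmin_r]).
  clearbody k. clear K2 K3 K4.
  apply (eq_0_of_small _ (16 * M * k)). { repeat apply Rmult_lt_0_compat; lra. }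
  intros e He. set (h := e / (16 * M)).
  assert (Hh : 0 < h) by (apply Rdiv_lt_0_compat; lra).
  assert (Hhk : h < k).
  { apply (Rmult_lt_reg_l (16 * M)); [lra|]. unfold h. replace (16 * M * (e / (16 * M))) with e by (field; lra). lra. }
  assert (Z : forall a' b' c' d', a <= a' <= b' -> b' <= b -> c <= c' <= d' -> d' <= d ->
     (b' < x0 \/ x0 < a' \/ d' < y0 \/ y0 < c') -> rect_int H a' b' c' d' = 0%C).
  { intros a' b' c' d' ? ? ? ? Hout. apply goursat; [lra|lra|].
    intros x y Hx Hy. apply HD; [lra|lra|]. intros E. injection E as E1 E2. lra. }
  assert (S : forall a' b' c' d', a <= a' -> b' <= b -> c <= c' -> d' <= d -> cont_on_rect H a' b' c' d').
  { intros. apply (cont_rect_sub H a b c d); auto. }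
  rewrite (rect_int_split_x H a (x0 - h) b c d) by (auto; lra).
  rewrite (Z a (x0 - h) c d) by lra.
  rewrite (rect_int_split_x H (x0 - h) (x0 + h) b c d); [|lra|lra|apply S; lra].
  rewrite (Z (x0 + h) b c d) by lra.
  rewrite (rect_int_split_y H (x0 - h) (x0 + h) c (y0 - h) d); [|lra|lra|apply S; lra].
  rewrite (Z (x0 - h) (x0 + h) c (y0 - h)) by lra.
  rewrite (rect_int_split_y H (x0 - h) (x0 + h) (y0 - h) (y0 + h) d); [|lra|lra|apply S; lra].
  rewrite (Z (x0 - h) (x0 + h) (y0 + h) d) by lra.
  match goal with |- Cmod ?X <= _ => replace X with (rect_int H (x0 - h) (x0 + h) (y0 - h) (y0 + h)) by ring end.
  eapply Rle_trans; [apply (rect_int_bound H _ _ _ _ M); [lra|lra|apply S; lra|]|].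
  - intros x y Hx Hy. specialize (Hb (x, y)).
    assert (Hd : Cmod ((x, y) - (x0, y0)) < d1).
    { eapply Rle_lt_trans; [apply Cmod_le_abs|]. unfold Re, Im, Cminus, Cplus, Copp; simpl.
      assert (Rabs (x + - x0) <= h) by (apply Rabs_le; lra).
      assert (Rabs (y + - y0) <= h) by (apply Rabs_le; lra). lra. }
    specialize (Hb Hd). assert (L := Cmod_triangle (H (x, y) - H (x0, y0)) (H (x0, y0))).
    replace (H (x, y) - H (x0, y0) + H (x0, y0))%C with (H (x, y)) in L by ring. unfold M. lra.
  - right. unfold h. field. lra.
Qed.

(** * Means over circles *)

Definition polar (r t : R) : C := (r * cos t, r * sin t).

Lemma cexp_polar (x t : R) : cexp (x, t) = polar (exp x) t.
Proof. reflexivity. Qed.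

Lemma polar_mult (r t : R) : polar r t = (RtoC r * polar 1 t)%C.
Proof. unfold polar, Cmult, RtoC; simpl. f_equal; ring. Qed.

Lemma Cmod_polar (r t : R) : 0 <= r -> Cmod (polar r t) = r.
Proof.
  intros Hr. unfold polar, Cmod. simpl fst; simpl snd.
  replace ((r * cos t) ^ 2 + (r * sin t) ^ 2) with (Rsqr r).
  - apply sqrt_Rsqr. exact Hr.
  - unfold Rsqr. assert (H := sin2_cos2 t). unfold Rsqr in H.
    transitivity (r * r * (sin t * sin t + cos t * cos t)); [rewrite H; ring|ring].
Qed.

Lemma polar_periodic (r t : R) : polar r (t + 2 * PI) = polar r t.
Proof. unfold polar. rewrite cos_plus, sin_plus, cos_2PI, sin_2PI. f_equal; ring. Qed.

Lemma polar_1_add (s t : R) : polar 1 (s + t) = (polar 1 s * polar 1 t)%C.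
Proof. unfold polar, Cmult; simpl. rewrite cos_plus, sin_plus. f_equal; ring. Qed.

Lemma polar_1_cexp (t : R) : polar 1 t = cexp (RtoC t * Ci).
Proof.
  unfold cexp, polar, RtoC, Ci, Cmult, Re, Im; simpl.
  replace (t * 0 - 0 * 1) with 0 by ring. replace (t * 1 + 0 * 0) with t by ring.
  rewrite exp_0. reflexivity.
Qed.

Lemma polar_form (z : C) : exists t, - PI < t <= PI /\ z = polar (Cmod z) t.
Proof.
  destruct (classic (z = 0%C)) as [->|Hz].
  { exists 0. pose proof PI_RGT_0. split; [lra|]. rewrite Cmod_0. unfold polar, RtoC. f_equal; ring. }
  apply Cmod_gt_0 in Hz. set (r := Cmod z) in *.
  assert (Hsq : Re z ^ 2 + Im z ^ 2 = r ^ 2) by (unfold r; rewrite Cmod2_alt; reflexivity).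
  destruct z as [x y]. unfold Re, Im in Hsq; simpl fst in Hsq; simpl snd in Hsq.
  set (u := x / r).
  assert (Hxu : x = r * u) by (unfold u; field; lra).
  assert (Hxr : x ^ 2 <= r ^ 2) by nra.
  assert (Hu : -1 <= u <= 1).
  { assert (H : u ^ 2 <= 1).
    { replace (u ^ 2) with (x ^ 2 / r ^ 2) by (unfold u; field; lra).
      apply (Rmult_le_reg_r (r ^ 2)); [nra|]. unfold Rdiv. rewrite Rmult_assoc, Rinv_l by nra. lra. }
    split; nra. }
  assert (B := acos_bound u).
  assert (Hcos : cos (acos u) = u) by (apply cos_acos; exact Hu).
  assert (Hsin : sin (acos u) = sqrt (1 - u²)) by (apply sin_acos; exact Hu).
  assert (Hy : Rabs y = r * sqrt (1 - u²)).
  { rewrite <- (sqrt_Rsqr r) at 1 by lra. rewrite <- sqrt_mult_alt by apply Rle_0_sqr.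
    replace (r² * (1 - u²)) with (y²).
    - symmetry. apply sqrt_Rsqr_abs.
    - unfold Rsqr, u. unfold Rsqr. assert (y * y = r * r - x * x) by lra. rewrite H. field. lra. }
  destruct (Rle_dec 0 y) as [H0|H0].
  - exists (acos u). pose proof PI_RGT_0. split; [lra|]. unfold polar. rewrite Hcos, Hsin.
    rewrite Rabs_right in Hy by lra. f_equal; lra.
  - exists (- acos u). pose proof PI_RGT_0. split.
    + split; [|lra]. assert (acos u <> PI); [|lra]. intros E.
      rewrite E, cos_PI in Hcos. rewrite <- Hcos in Hy.
      replace (1 - (-1)²) with 0 in Hy by (unfold Rsqr; ring). rewrite sqrt_0 in Hy.
      rewrite Rabs_left in Hy by lra. lra.
    + unfold polar. rewrite cos_neg, sin_neg, Hcos, Hsin. rewrite Rabs_left in Hy by lra. f_equal; lra.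
Qed.

Lemma rderiv_polar (r t : R) : rderiv (polar r) t (Ci * polar r t)%C.
Proof.
  assert (E : polar r = fun x => (RtoC r * cexp (0 + RtoC x * Ci))%C).
  { apply functional_extensionality. intros x. rewrite polar_mult, polar_1_cexp. do 2 f_equal. ring. }
  replace (Ci * polar r t)%C with (RtoC r * cexp (0 + RtoC t * Ci) * Ci)%C.
  - rewrite E. apply (rderiv_comp (fun w => RtoC r * cexp w)%C (fun x => 0 + RtoC x * Ci)%C).
    + apply cderiv_cmult, cderiv_cexp.
    + apply rderiv_affine.
  - rewrite E. ring.
Qed.

Lemma pcont_polar (r t : R) : pcont (polar r) t.
Proof. eapply rderiv_pcont. apply rderiv_polar. Qed.

Lemma CInt_shift (f : R -> C) (a b v : R) : a <= b ->
  (forall t, pcont f t) -> CInt (fun t => f (t + v)) a b = CInt f (a + v) (b + v).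
Proof.
  intros Hab Hf. unfold CInt.
  destruct (pcont_integrable f (a + v) (b + v) ltac:(lra) ltac:(auto)) as [H1 H2].
  f_equal.
  - rewrite <- (Rmult_1_l a), <- (Rmult_1_l b) in H1.
    assert (E := RInt_comp_lin (V := R_CompleteNormedModule) (fun t => Re (f t)) 1 v a b H1).
    rewrite !Rmult_1_l in E. rewrite <- E. apply RInt_ext. intros x _.
    change (Re (f (x + v)) = 1 * Re (f (1 * x + v))). rewrite !Rmult_1_l. reflexivity.
  - rewrite <- (Rmult_1_l a), <- (Rmult_1_l b) in H2.
    assert (E := RInt_comp_lin (V := R_CompleteNormedModule) (fun t => Im (f t)) 1 v a b H2).
    rewrite !Rmult_1_l in E. rewrite <- E. apply RInt_ext. intros x _.
    change (Im (f (x + v)) = 1 * Im (f (1 * x + v))). rewrite !Rmult_1_l. reflexivity.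
Qed.

Lemma CInt_period (f : R -> C) (th : R) : (forall t, pcont f t) ->
  (forall t, f (t + 2 * PI) = f t) -> CInt f th (th + 2 * PI) = CInt f 0 (2 * PI).
Proof.
  intros Hf Hp. pose proof PI_RGT_0 as Hpi.
  assert (I : forall a b, a <= b -> cintegrable f a b) by (intros; apply pcont_integrable; auto).
  assert (G : forall th, 0 <= th -> CInt f th (th + 2 * PI) = CInt f 0 (2 * PI)).
  { intros t Ht.
    assert (E1 := CInt_Chasles f 0 t (t + 2 * PI) (I _ _ Ht) (I t (t + 2 * PI) ltac:(lra))).
    assert (E2 := CInt_Chasles f 0 (2 * PI) (t + 2 * PI) (I 0 (2 * PI) ltac:(lra)) (I (2 * PI) (t + 2 * PI) ltac:(lra))).
    assert (E3 := CInt_shift f 0 t (2 * PI) Ht Hf). rewrite Rplus_0_l in E3.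
    rewrite <- E3 in E2. rewrite (CInt_ext (fun x => f (x + 2 * PI)) f) in E2 by auto.
    rewrite E1 in E2.
    replace (CInt f t (t + 2 * PI)) with ((CInt f 0 t + CInt f t (t + 2 * PI)) - CInt f 0 t)%C by ring.
    rewrite E2. ring. }
  destruct (Rle_dec 0 th) as [H|H]; [apply G; exact H|].
  (* shift by a multiple of the period to reach a nonnegative base point *)
  assert (S : forall n, CInt f th (th + 2 * PI) = CInt f (th + INR n * (2 * PI)) (th + INR n * (2 * PI) + 2 * PI)).
  { induction n as [|n IH].
    - simpl. f_equal; ring.
    - rewrite IH. rewrite S_INR.
      replace (th + (INR n + 1) * (2 * PI)) with (th + INR n * (2 * PI) + 2 * PI) by ring.
      rewrite <- CInt_shift by (auto; lra). apply CInt_ext; [lra|]. auto. }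
  destruct (INR_unbounded (- th / (2 * PI))) as [n Hn].
  rewrite (S n). apply G.
  apply (Rmult_lt_compat_r (2 * PI)) in Hn; [|lra].
  replace (- th / (2 * PI) * (2 * PI)) with (- th) in Hn by (field; lra). lra.
Qed.

Definition cmean (F : C -> C) (r : R) : C :=
  (/ RtoC (2 * PI) * CInt (fun t => F (polar r t)) 0 (2 * PI))%C.

Definition cont_on_circle (F : C -> C) (r : R) : Prop := forall t, ccont F (polar r t).

Lemma circle_pcont (F : C -> C) (r t : R) : cont_on_circle F r -> pcont (fun x => F (polar r x)) t.
Proof. intros H. apply (pcont_comp F (polar r)); [apply H|apply pcont_polar]. Qed.

Lemma circle_integrable (F : C -> C) (r : R) :
  cont_on_circle F r -> cintegrable (fun t => F (polar r t)) 0 (2 * PI).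
Proof.
  intros H. pose proof PI_RGT_0. apply pcont_integrable; [lra|].
  intros; apply circle_pcont; exact H.
Qed.

Lemma RtoC_2PI_neq_0 : RtoC (2 * PI) <> 0%C.
Proof. pose proof PI_RGT_0. intros E. injection E. lra. Qed.

Lemma cmean_plus (F G : C -> C) (r : R) : cont_on_circle F r -> cont_on_circle G r ->
  cmean (fun u => F u + G u)%C r = (cmean F r + cmean G r)%C.
Proof.
  intros HF HG. unfold cmean. rewrite CInt_plus by (apply circle_integrable; assumption). ring.
Qed.

Lemma cmean_minus (F G : C -> C) (r : R) : cont_on_circle F r -> cont_on_circle G r ->
  cmean (fun u => F u - G u)%C r = (cmean F r - cmean G r)%C.
Proof.
  intros HF HG. unfold cmean. rewrite CInt_minus by (apply circle_integrable; assumption). ring.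
Qed.

Lemma cmean_cmult (k : C) (F : C -> C) (r : R) : cont_on_circle F r ->
  cmean (fun u => k * F u)%C r = (k * cmean F r)%C.
Proof.
  intros HF. unfold cmean. rewrite CInt_cmult by (apply circle_integrable; assumption). ring.
Qed.

Lemma cmean_ext (F G : C -> C) (r : R) : (forall t, F (polar r t) = G (polar r t)) ->
  cmean F r = cmean G r.
Proof.
  intros H. unfold cmean. f_equal. pose proof PI_RGT_0. apply CInt_ext; [lra|]. auto.
Qed.

Lemma cmean_const (k : C) (r : R) : cmean (fun _ => k) r = k.
Proof.
  unfold cmean. pose proof PI_RGT_0.
  rewrite (CInt_FTC (fun t => 0 + RtoC t * k)%C); [|lra| |].
  - replace (0 + RtoC (2 * PI) * k - (0 + 0 * k))%C with (RtoC (2 * PI) * k)%C by ring.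
    field. apply RtoC_2PI_neq_0.
  - intros; apply rderiv_affine.
  - intros t _ eps Heps. exists 1. split; [lra|]. intros. replace (k - k)%C with (RtoC 0) by ring. rewrite Cmod_0. exact Heps.
Qed.

Lemma cmean_bound (F : C -> C) (r M : R) : cont_on_circle F r ->
  (forall t, Cmod (F (polar r t)) <= M) -> Cmod (cmean F r) <= 2 * M.
Proof.
  intros HF HM. unfold cmean. pose proof PI_RGT_0.
  rewrite Cmod_mult, Cmod_inv by apply RtoC_2PI_neq_0. rewrite Cmod_R, Rabs_right by lra.
  assert (B := CInt_bound (fun t => F (polar r t)) 0 (2 * PI) M ltac:(lra) (circle_integrable F r HF) (fun t _ => HM t)).
  apply (Rmult_le_reg_l (2 * PI)); [lra|]. rewrite <- Rmult_assoc, Rinv_r by lra. lra.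
Qed.

(** Means over concentric circles agree: Goursat for [F o cexp] on a rectangle
    of height [2 * PI], whose horizontal sides cancel by periodicity. *)
Lemma circle_mean_eq_aux (F : C -> C) (r1 r2 th : R) : 0 < r1 < r2 ->
  cont_on_circle F r1 -> cont_on_circle F r2 ->
  rect_int (fun z => F (cexp z)) (ln r1) (ln r2) th (th + 2 * PI) = 0%C ->
  cmean F r1 = cmean F r2.
Proof.
  intros Hr H1 H2 HJ. unfold cmean. f_equal.
  rewrite <- (CInt_period (fun t => F (polar r1 t)) th).
  rewrite <- (CInt_period (fun t => F (polar r2 t)) th).
  - unfold rect_int in HJ.
    rewrite (CInt_ext (fun x => F (cexp (x, th + 2 * PI))) (fun x => F (cexp (x, th)))) in HJ.
    + assert (E1 : (fun y => F (cexp (ln r1, y))) = (fun y => F (polar r1 y))).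
      { apply functional_extensionality. intros y. rewrite cexp_polar, exp_ln by lra. reflexivity. }
      assert (E2 : (fun y => F (cexp (ln r2, y))) = (fun y => F (polar r2 y))).
      { apply functional_extensionality. intros y. rewrite cexp_polar, exp_ln by lra. reflexivity. }
      rewrite E1, E2 in HJ.
      set (A := CInt _ (ln r1) (ln r2)) in HJ.
      set (B := CInt (fun t => F (polar r1 t)) th _) in *.
      set (D := CInt (fun t => F (polar r2 t)) th _) in *.
      replace (A + Ci * D - A - Ci * B)%C with (Ci * (D - B))%C in HJ by ring.
      assert (HDB : (D - B)%C = 0%C).
      { replace (D - B)%C with (- Ci * (Ci * (D - B)))%C.
        - rewrite HJ. ring.
        - destruct (D - B)%C. unfold Ci, Copp, Cmult; simpl. f_equal; ring. }
      replace D with (D - B + B)%C by ring. rewrite HDB. ring.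
    + left. apply ln_increasing; lra.
    + intros t _. rewrite !cexp_polar, polar_periodic. reflexivity.
  - intros t. apply circle_pcont; exact H2.
  - intros t. rewrite polar_periodic. reflexivity.
  - intros t. apply circle_pcont; exact H1.
  - intros t. rewrite polar_periodic. reflexivity.
Qed.

Lemma cmean_annulus (F : C -> C) (r1 r2 : R) : 0 < r1 < r2 ->
  (forall u, r1 <= Cmod u <= r2 -> exists l, cderiv F u l) ->
  cmean F r1 = cmean F r2.
Proof.
  intros Hr HF.
  assert (HC : forall r, r1 <= r <= r2 -> cont_on_circle F r).
  { intros r Hr' t. destruct (HF (polar r t)) as [l Hl]; [rewrite Cmod_polar; lra|].
    eapply cderiv_ccont; exact Hl. }
  pose proof PI_RGT_0.
  apply (circle_mean_eq_aux F r1 r2 0 Hr); [apply HC; lra|apply HC; lra|].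
  apply goursat; [left; apply ln_increasing; lra|lra|].
  intros x y Hx _. destruct (HF (cexp (x, y))) as [l Hl].
  - rewrite Cmod_cexp. unfold Re; simpl fst.
    assert (E1 : exp (ln r1) = r1) by (apply exp_ln; lra).
    assert (E2 : exp (ln r2) = r2) by (apply exp_ln; lra).
    rewrite <- E1, <- E2. split.
    + destruct (proj1 Hx) as [K|K]; [left; apply exp_increasing; exact K|right; rewrite K; reflexivity].
    + destruct (proj2 Hx) as [K|K]; [left; apply exp_increasing; exact K|right; rewrite K; reflexivity].
  - exists (cexp (x, y) * l)%C. apply (cderiv_comp F cexp); [exact Hl|apply cderiv_cexp].
Qed.

(** The exceptional point is put in the interior of the rectangle of logarithms
    by starting the angles at [arg z - PI]. *)
Lemma cmean_annulus_except (F : C -> C) (r1 r2 : R) (z : C) :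
  0 < r1 < Cmod z -> Cmod z < r2 -> ccont F z ->
  (forall u, r1 <= Cmod u <= r2 -> u <> z -> exists l, cderiv F u l) ->
  cmean F r1 = cmean F r2.
Proof.
  intros Hr1 Hr2 Hz HF.
  assert (HC : forall r, r1 <= r <= r2 -> r <> Cmod z -> cont_on_circle F r).
  { intros r Hr' Hne t. destruct (HF (polar r t)) as [l Hl].
    - rewrite Cmod_polar; lra.
    - intros E. apply Hne. rewrite <- E, Cmod_polar; lra.
    - eapply cderiv_ccont; exact Hl. }
  pose proof PI_RGT_0.
  destruct (polar_form z) as [th [Hth Ez]].
  assert (Eln : forall r, 0 < r -> exp (ln r) = r) by (intros; apply exp_ln; assumption).
  apply (circle_mean_eq_aux F r1 r2 (th - PI)); [lra|apply HC; lra|apply HC; lra|].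
  apply (goursat_except _ _ _ _ _ (ln (Cmod z)) th).
  - split; apply ln_increasing; lra.
  - lra.
  - intros eps Heps. destruct (Hz eps Heps) as [d [Hd HH]].
    destruct (cderiv_ccont _ _ _ (cderiv_cexp (ln (Cmod z), th)) d Hd) as [e [He HHe]].
    assert (Ez' : cexp (ln (Cmod z), th) = z) by (rewrite cexp_polar, Eln, <- Ez by lra; reflexivity).
    rewrite Ez' in *.
    exists e. split; [exact He|]. intros u Hu. apply HH, HHe, Hu.
  - intros x y Hx Hy Hne. destruct (HF (cexp (x, y))) as [l Hl].
    + rewrite Cmod_cexp. unfold Re; simpl fst.
      rewrite <- (Eln r1), <- (Eln r2) by lra. split.
      * destruct (proj1 Hx) as [K|K]; [left; apply exp_increasing; exact K|right; rewrite K; reflexivity].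
      * destruct (proj2 Hx) as [K|K]; [left; apply exp_increasing; exact K|right; rewrite K; reflexivity].
    + intros E. apply Hne.
      assert (Ex : exp x = Cmod z) by (rewrite <- E, Cmod_cexp; reflexivity).
      assert (Ex' : x = ln (Cmod z)) by (rewrite <- Ex, ln_exp; reflexivity).
      rewrite Ez, cexp_polar, Ex in E. unfold polar in E. injection E as E1 E2.
      apply Rmult_eq_reg_l in E1; [|lra]. apply Rmult_eq_reg_l in E2; [|lra].
      assert (Hyt : cos (y - th) = 1).
      { rewrite cos_minus, E1, E2. assert (S := sin2_cos2 th). unfold Rsqr in S. lra. }
      assert (Hy' : y - th = 0).
      { destruct (Rtotal_order (y - th) 0) as [K|[K|K]]; [|exact K|]; exfalso.
        - assert (L := COS_bound (y - th)).
          assert (A := cos_decreasing_1 0 (- (y - th))). rewrite cos_neg, cos_0 in A. lra.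
        - assert (A := cos_decreasing_1 0 (y - th)). rewrite cos_0 in A. lra. }
      subst x. f_equal. lra.
    + exists (cexp (x, y) * l)%C. apply (cderiv_comp F cexp); [exact Hl|apply cderiv_cexp].
Qed.

(** * Holomorphic functions on the disc are power series *)

Fixpoint csum (u : nat -> C) (n : nat) : C :=
  match n with O => 0%C | S k => (csum u k + u k)%C end.

Definition cseries (u : nat -> C) (l : C) : Prop :=
  forall eps : R, 0 < eps -> exists N : nat, forall n, (N <= n)%nat -> Cmod (csum u n - l) < eps.

Lemma csum_sum_n (u : nat -> C) (n : nat) :
  sum_n (G := AbelianGroup.AbelianMonoid C_AbelianGroup) u n = csum u (S n).
Proof.
  induction n as [|n IH].
  - rewrite sum_O. simpl. ring.
  - rewrite sum_Sn, IH. reflexivity.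
Qed.

Lemma pow_n_Cpow (z : C) (n : nat) : pow_n (K := C_Ring) z n = (z ^ n)%C.
Proof. induction n as [|n IH]; [reflexivity|]. simpl. rewrite IH. reflexivity. Qed.

Lemma is_pseries_cseries (a : nat -> C) (z l : C) :
  is_pseries (K := C_AbsRing) (V := C_NormedModule) a z l <-> cseries (fun k => a k * z ^ k)%C l.
Proof.
  assert (E : forall n, sum_n (G := NormedModule.AbelianMonoid C_AbsRing C_NormedModule) (fun k => scal (pow_n (K := C_AbsRing) z k) (a k)) n
     = csum (fun k => a k * z ^ k)%C (S n)).
  { intros n. rewrite <- csum_sum_n. apply sum_n_ext. intros k.
    change (pow_n (K := C_Ring) z k * a k = a k * z ^ k)%C. rewrite pow_n_Cpow. ring. }
  split.
  - intros H eps Heps.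
    specialize (H (fun y => Cmod (y - l) < eps)).
    destruct H as [N HN].
    + apply locally_Cmod. exists eps. auto.
    + exists (S N). intros n Hn. destruct n as [|n]; [lia|].
      specialize (HN n ltac:(lia)). rewrite E in HN. exact HN.
  - intros H P HP. apply locally_Cmod in HP. destruct HP as [d [Hd HP]].
    destruct (H d Hd) as [N HN]. exists N. intros n Hn. apply HP. rewrite E. apply HN. lia.
Qed.

Lemma analytic_cderiv (f : C -> C) (z : C) :
  analytic_on_disc f -> disc z -> cderiv f z (C_derive f z).
Proof. intros H Hz. apply ex_derive_cderiv. apply H, Hz. Qed.

Lemma analytic_intro (f : C -> C) :
  (forall z, disc z -> exists l, cderiv f z l) -> analytic_on_disc f.
Proof. intros H z Hz. destruct (H z Hz) as [l Hl]. eapply cderiv_ex_derive. exact Hl. Qed.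

Lemma ccont_bounded_near (f : C -> C) (z : C) : ccont f z ->
  exists d M, 0 < d /\ 0 < M /\ forall u, Cmod (u - z) < d -> Cmod (f u) <= M.
Proof.
  intros H. destruct (H 1 Rlt_0_1) as [d [Hd HH]]. exists d, (Cmod (f z) + 1).
  pose proof (Cmod_ge_0 (f z)). split; [exact Hd|]. split; [lra|].
  intros u Hu. specialize (HH u Hu). assert (T := Cmod_triangle (f u - f z) (f z)).
  replace (f u - f z + f z)%C with (f u) in T by ring. lra.
Qed.

(** Means over small circles are small, yet all equal to the one over radius [r]. *)
Lemma cmean_0_of_limit (F : C -> C) (r : R) : 0 < r ->
  (forall s, 0 < s < r -> cmean F s = cmean F r) ->
  (forall s, 0 < s < r -> cont_on_circle F s) ->
  (forall eps, 0 < eps -> exists d, 0 < d /\ forall u, 0 < Cmod u < d -> Cmod (F u) <= eps) ->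
  cmean F r = 0%C.
Proof.
  intros Hr Hc HC HL. apply (eq_0_of_small _ 1); [lra|]. intros e He.
  destruct (HL (e / 2) ltac:(lra)) as [d [Hd HF]].
  assert (Hm1 := Rmin_l d r). assert (Hm2 := Rmin_r d r).
  assert (Hm : 0 < Rmin d r) by (apply Rmin_glb_lt; lra).
  set (s := Rmin d r / 2). rewrite <- (Hc s) by (unfold s; lra).
  eapply Rle_trans; [apply (cmean_bound F s (e / 2))|lra].
  - apply HC. unfold s; lra.
  - intros t. apply HF. rewrite Cmod_polar; unfold s; lra.
Qed.

Lemma disc_cont_on_circle (F : C -> C) (r : R) : 0 < r < 1 ->
  (forall u, 0 < Cmod u < 1 -> exists l, cderiv F u l) -> cont_on_circle F r.
Proof.
  intros Hr HF t. destruct (HF (polar r t)) as [l Hl]; [rewrite Cmod_polar; lra|].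
  eapply cderiv_ccont; exact Hl.
Qed.

Lemma cmean_punctured (F : C -> C) (r1 r2 : R) : 0 < r1 < 1 -> 0 < r2 < 1 ->
  (forall u, 0 < Cmod u < 1 -> exists l, cderiv F u l) -> cmean F r1 = cmean F r2.
Proof.
  intros H1 H2 HF. destruct (Rtotal_order r1 r2) as [H|[H|H]].
  - apply cmean_annulus; [lra|]. intros u Hu. apply HF. lra.
  - subst; reflexivity.
  - symmetry. apply cmean_annulus; [lra|]. intros u Hu. apply HF. lra.
Qed.

(** Mean value property: [f - f 0] tends to 0 at the origin. *)
Lemma cmean_center (f : C -> C) (r : R) : analytic_on_disc f -> 0 < r < 1 -> cmean f r = f 0%C.
Proof.
  intros Hf Hr.
  assert (HD : forall u, 0 < Cmod u < 1 -> exists l, cderiv f u l).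
  { intros u Hu. eexists. apply analytic_cderiv; [exact Hf|apply Hu]. }
  assert (HC : forall s, 0 < s < 1 -> cont_on_circle f s) by (intros; apply disc_cont_on_circle; assumption).
  assert (Hk : forall s, cont_on_circle (fun _ => f 0%C) s).
  { intros s t. eapply cderiv_ccont. apply cderiv_const. }
  assert (E : cmean (fun u => f u - f 0%C)%C r = 0%C).
  { apply cmean_0_of_limit; [lra| | |].
    - intros s Hs. apply cmean_punctured; [lra|lra|]. intros u Hu. destruct (HD u Hu) as [l Hl].
      eexists. apply cderiv_minus; [exact Hl|apply cderiv_const].
    - intros s Hs. apply disc_cont_on_circle; [lra|]. intros u Hu. destruct (HD u Hu) as [l Hl].
      eexists. apply cderiv_minus; [exact Hl|apply cderiv_const].
    - intros eps Heps. assert (H0 : disc 0) by (unfold disc; rewrite Cmod_0; lra).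
      destruct (cderiv_ccont _ _ _ (analytic_cderiv f _ Hf H0) eps Heps) as [d [Hd HH]].
      exists d. split; [exact Hd|]. intros u Hu. left. apply HH.
      replace (u - 0)%C with u by ring. apply Hu. }
  rewrite cmean_minus, cmean_const in E by (auto; apply HC; lra).
  replace (cmean f r) with (cmean f r - f 0%C + f 0%C)%C by ring. rewrite E. ring.
Qed.

Lemma cmean_inv_pow (n : nat) (r : R) : (1 <= n)%nat -> 0 < r -> cmean (fun u => / u ^ n)%C r = 0%C.
Proof.
  intros Hn Hr.
  assert (HD : forall u : C, u <> 0%C -> exists l, cderiv (fun u => / u ^ n)%C u l).
  { intros u Hu. eexists. apply (cderiv_inv (fun u => u ^ n)%C); [apply Cpow_nz, Hu|apply cderiv_pow]. }
  apply (eq_0_of_small _ (/ (r ^ n))); [apply Rinv_0_lt_compat, pow_lt, Hr|]. intros e He.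
  set (s := 2 / e + r + 1).
  assert (Hs : 0 < 2 / e) by (apply Rdiv_lt_0_compat; lra).
  assert (Hsn : s <= s ^ n).
  { destruct n as [|n]; [lia|]. simpl. rewrite <- (Rmult_1_r s) at 1.
    apply Rmult_le_compat_l; [unfold s; lra|]. apply pow_R1_Rle. unfold s; lra. }
  rewrite (cmean_annulus _ r s); [|unfold s; lra|].
  - eapply Rle_trans; [apply (cmean_bound _ _ (e / 2))|lra].
    + intros t. destruct (HD (polar s t)) as [l Hl].
      * apply Cmod_gt_0. rewrite Cmod_polar; unfold s; lra.
      * eapply cderiv_ccont; exact Hl.
    + intros t. rewrite Cmod_inv, Cmod_pow, Cmod_polar; [|unfold s; lra|].
      * apply Rle_trans with (/ s); [apply Rinv_le_contravar; [unfold s; lra|exact Hsn]|].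
        replace (e / 2) with (/ (2 / e)) by (field; lra).
        apply Rinv_le_contravar; unfold s; lra.
      * apply Cpow_nz. apply Cmod_gt_0. rewrite Cmod_polar; unfold s; lra.
  - intros u Hu. apply HD. apply Cmod_gt_0. lra.
Qed.

Lemma continuous_periodic_bounded (f : R -> R) (a b : R) : a <= b ->
  (forall t, a <= t <= b -> continuity_pt f t) -> exists M, forall t, a <= t <= b -> f t <= M.
Proof.
  intros Hab Hf. destruct (continuity_ab_maj f a b Hab Hf) as [x [Hx _]]. exists (f x). exact Hx.
Qed.

Lemma pcont_Cmod (f : R -> C) (t : R) : pcont f t -> continuity_pt (fun x => Cmod (f x)) t.
Proof.
  intros H eps Heps. destruct (H eps Heps) as [d [Hd HH]]. exists d. split; [exact Hd|].
  intros x [_ Hx]. simpl in *. unfold R_dist in *.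
  eapply Rle_lt_trans; [|apply (HH x Hx)].
  assert (A := Cmod_lower (f x) (f t - f x)). assert (B := Cmod_lower (f t) (f x - f t)).
  replace (f x + (f t - f x))%C with (f t) in A by ring.
  replace (f t + (f x - f t))%C with (f x) in B by ring.
  rewrite (Cmod_sub_sym (f t)) in A. apply Rabs_le. lra.
Qed.

Lemma circle_bounded (F : C -> C) (r : R) : cont_on_circle F r ->
  exists M, 0 < M /\ forall t, 0 <= t <= 2 * PI -> Cmod (F (polar r t)) <= M.
Proof.
  intros H. pose proof PI_RGT_0.
  destruct (continuous_periodic_bounded (fun t => Cmod (F (polar r t))) 0 (2 * PI)) as [M HM]; [lra| |].
  - intros t _. apply pcont_Cmod, circle_pcont, H.
  - exists (Rmax M 1). split; [apply Rlt_le_trans with 1; [lra|apply Rmax_r]|].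
    intros t Ht. eapply Rle_trans; [apply HM, Ht|apply Rmax_l].
Qed.

Lemma cmean_bound_weak (F : C -> C) (r M : R) : cont_on_circle F r ->
  (forall t, 0 <= t <= 2 * PI -> Cmod (F (polar r t)) <= M) -> Cmod (cmean F r) <= 2 * M.
Proof.
  intros HF HM. unfold cmean. pose proof PI_RGT_0.
  rewrite Cmod_mult, Cmod_inv by apply RtoC_2PI_neq_0. rewrite Cmod_R, Rabs_right by lra.
  assert (B := CInt_bound (fun t => F (polar r t)) 0 (2 * PI) M ltac:(lra) (circle_integrable F r HF) HM).
  apply (Rmult_le_reg_l (2 * PI)); [lra|]. rewrite <- Rmult_assoc, Rinv_r by lra. lra.
Qed.

(** Cauchy's formula: [(f u - f z) * u / (u - z)] is holomorphic off [0] and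
    [z], continuous at [z] and vanishes at [0], so its circle means are 0. *)
Lemma cauchy_formula_quotient (f : C -> C) (z : C) (r : R) :
  analytic_on_disc f -> 0 < Cmod z < r -> r < 1 ->
  cmean (fun u => (f u - f z) * (u / (u - z)))%C r = 0%C.
Proof.
  intros Hf Hz Hr.
  set (F := fun u => if excluded_middle_informative (u = z) then (C_derive f z * z)%C
                     else ((f u - f z) * (u / (u - z)))%C).
  assert (Hzd : disc z) by (unfold disc; lra).
  assert (Efar : forall u, u <> z -> F u = ((f u - f z) * (u / (u - z)))%C).
  { intros u Hu. unfold F. destruct (excluded_middle_informative (u = z)); [contradiction|reflexivity]. }
  assert (Ez : F z = (C_derive f z * z)%C).
  { unfold F. destruct (excluded_middle_informative (z = z)) as [_|n]; [reflexivity|exfalso; apply n; reflexivity]. }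
  assert (HD : forall u, Cmod u < 1 -> u <> z -> exists l, cderiv F u l).
  { intros u Hu Hne.
    assert (Hne' : (u - z)%C <> 0%C) by (intros E; apply Hne; replace u with (u - z + z)%C by ring; rewrite E; ring).
    assert (Hd : 0 < Cmod (u - z)) by (apply Cmod_gt_0, Hne').
    eexists. apply (cderiv_ext_loc (fun u => (f u - f z) * (u / (u - z)))%C F u _ (Cmod (u - z)) Hd).
    - intros v Hv. symmetry. apply Efar. intros E. subst v.
      rewrite Cmod_sub_sym in Hv. lra.
    - apply cderiv_mult.
      + apply cderiv_minus; [apply analytic_cderiv; [exact Hf|exact Hu]|apply cderiv_const].
      + apply (cderiv_div (fun u => u) (fun u => u - z)%C); [exact Hne'|apply cderiv_id|].
        apply cderiv_minus; [apply cderiv_id|apply cderiv_const]. }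
  assert (Hcz : ccont F z).
  { intros eps Heps.
    destruct (analytic_cderiv f z Hf Hzd (eps / 4) ltac:(lra)) as [d [Hd HH]].
    set (m := Cmod (C_derive f z)). assert (Hm : 0 <= m) by apply Cmod_ge_0.
    exists (Rmin d (Rmin 1 (eps / (4 * (m + 1))))). split.
    { repeat apply Rmin_glb_lt; try lra. apply Rdiv_lt_0_compat; lra. }
    intros u Hu.
    assert (Hu1 : Cmod (u - z) < d) by (eapply Rlt_le_trans; [exact Hu|apply Rmin_l]).
    assert (Hu2 : Cmod (u - z) < 1).
    { eapply Rlt_le_trans; [exact Hu|]. eapply Rle_trans; [apply Rmin_r|apply Rmin_l]. }
    assert (Hu3 : Cmod (u - z) < eps / (4 * (m + 1))).
    { eapply Rlt_le_trans; [exact Hu|]. eapply Rle_trans; [apply Rmin_r|apply Rmin_r]. }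
    destruct (classic (u = z)) as [->|Hne].
    { replace (F z - F z)%C with (RtoC 0) by ring. rewrite Cmod_0. exact Heps. }
    assert (Hne' : (u - z)%C <> 0%C) by (intros E; apply Hne; replace u with (u - z + z)%C by ring; rewrite E; ring).
    assert (Hd0 : 0 < Cmod (u - z)) by (apply Cmod_gt_0, Hne').
    rewrite Efar, Ez by exact Hne.
    replace ((f u - f z) * (u / (u - z)) - C_derive f z * z)%C
      with ((f u - f z - C_derive f z * (u - z)) / (u - z) * u + C_derive f z * (u - z))%C
      by (field; exact Hne').
    eapply Rle_lt_trans; [apply Cmod_triangle|]. rewrite !Cmod_mult, Cmod_div by exact Hne'. fold m.
    specialize (HH u Hu1).
    assert (Hu2' : Cmod u <= 2).
    { assert (T := Cmod_triangle (u - z) z). replace (u - z + z)%C with u in T by ring. lra. }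
    assert (A : Cmod (f u - f z - C_derive f z * (u - z)) / Cmod (u - z) <= eps / 4).
    { apply (Rmult_le_reg_r (Cmod (u - z))); [exact Hd0|]. unfold Rdiv at 1.
      rewrite Rmult_assoc, Rinv_l, Rmult_1_r by lra. exact HH. }
    assert (B : m * Cmod (u - z) <= eps / 4).
    { apply Rle_trans with ((m + 1) * (eps / (4 * (m + 1)))).
      - apply Rmult_le_compat; lra.
      - right; field; lra. }
    assert (A0 : 0 <= Cmod (f u - f z - C_derive f z * (u - z)) / Cmod (u - z)).
    { apply Rmult_le_pos; [apply Cmod_ge_0|]. left. apply Rinv_0_lt_compat, Hd0. }
    assert (D : Cmod (f u - f z - C_derive f z * (u - z)) / Cmod (u - z) * Cmod u <= eps / 4 * 2).
    { apply Rmult_le_compat; [exact A0|apply Cmod_ge_0|exact A|exact Hu2']. }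
    lra. }
  transitivity (cmean F r).
  { apply cmean_ext. intros t. symmetry. apply Efar. intros E. assert (Cmod (polar r t) = Cmod z) by (f_equal; exact E).
    rewrite Cmod_polar in H; lra. }
  set (s0 := Cmod z / 2).
  rewrite <- (cmean_annulus_except F s0 r z); [|unfold s0; lra|lra|exact Hcz|].
  2:{ intros u Hu Hne. apply HD; [lra|exact Hne]. }
  apply cmean_0_of_limit; [unfold s0; lra| | |].
  - intros s Hs. apply cmean_annulus; [lra|]. intros u Hu. apply HD; [unfold s0 in *; lra|].
    intros E. subst u. unfold s0 in *. lra.
  - intros s Hs t. destruct (HD (polar s t)) as [l Hl].
    + rewrite Cmod_polar; unfold s0 in *; lra.
    + intros E. assert (Cmod (polar s t) = Cmod z) by (f_equal; exact E). rewrite Cmod_polar in H; unfold s0 in *; lra.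
    + eapply cderiv_ccont; exact Hl.
  - intros eps Heps.
    assert (H0 : disc 0) by (unfold disc; rewrite Cmod_0; lra).
    destruct (ccont_bounded_near f 0 (cderiv_ccont _ _ _ (analytic_cderiv f 0 Hf H0))) as (d & M & Hd & HM & HB).
    set (B := M + Cmod (f z)). assert (HBp : 0 < B) by (unfold B; pose proof (Cmod_ge_0 (f z)); lra).
    exists (Rmin d (Rmin s0 (eps * s0 / B))). split.
    { repeat apply Rmin_glb_lt; [exact Hd|unfold s0; lra|]. apply Rdiv_lt_0_compat; [|exact HBp].
      apply Rmult_lt_0_compat; unfold s0; lra. }
    intros u [Hu0 Hu].
    assert (Hu1 : Cmod u < d) by (eapply Rlt_le_trans; [exact Hu|apply Rmin_l]).
    assert (Hu2 : Cmod u < s0).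
    { eapply Rlt_le_trans; [exact Hu|]. eapply Rle_trans; [apply Rmin_r|apply Rmin_l]. }
    assert (Hu3 : Cmod u < eps * s0 / B).
    { eapply Rlt_le_trans; [exact Hu|]. eapply Rle_trans; [apply Rmin_r|apply Rmin_r]. }
    assert (Hne : u <> z) by (intros E; subst u; unfold s0 in *; lra).
    assert (Hne' : (u - z)%C <> 0%C) by (intros E; apply Hne; replace u with (u - z + z)%C by ring; rewrite E; ring).
    rewrite Efar by exact Hne. rewrite Cmod_mult, Cmod_div by exact Hne'.
    assert (L : s0 <= Cmod (u - z)).
    { assert (T := Cmod_lower z (- u)). rewrite Cmod_opp in T.
      rewrite Cmod_sub_sym. unfold Cminus. unfold s0 in *. lra. }
    assert (Hs0 : 0 < s0) by (unfold s0; lra).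
    assert (A : Cmod (f u - f z) <= B).
    { unfold Cminus. eapply Rle_trans; [apply Cmod_triangle|]. rewrite Cmod_opp. unfold B.
      apply Rplus_le_compat_r. apply HB. replace (u - 0)%C with u by ring. exact Hu1. }
    apply Rle_trans with (B * (Cmod u / s0)).
    + apply Rmult_le_compat; [apply Cmod_ge_0| |exact A|].
      * apply Rmult_le_pos; [apply Cmod_ge_0|]. left. apply Rinv_0_lt_compat; lra.
      * unfold Rdiv. apply Rmult_le_compat_l; [apply Cmod_ge_0|]. apply Rinv_le_contravar; lra.
    + apply Rle_trans with (B * ((eps * s0 / B) / s0)).
      * apply Rmult_le_compat_l; [lra|]. unfold Rdiv. apply Rmult_le_compat_r; [left; apply Rinv_0_lt_compat; exact Hs0|].
        left. exact Hu3.
      * right. field. lra.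
Qed.

Lemma pow_half_small (q eps B : R) : 0 <= q < 1 -> 0 < eps -> 0 < B ->
  exists N, forall n, (N <= n)%nat -> B * q ^ n < eps.
Proof.
  intros Hq He HB. destruct (pow_lt_1_zero q) with (y := eps / B) as [N HN].
  - rewrite Rabs_right; lra.
  - apply Rdiv_lt_0_compat; assumption.
  - exists N. intros n Hn. specialize (HN n Hn). rewrite Rabs_right in HN by (apply Rle_ge, pow_le; lra).
    apply (Rmult_lt_compat_l B) in HN; [|exact HB].
    replace (B * (eps / B)) with eps in HN by (field; lra). exact HN.
Qed.

(** A circle mean is defined for every [f]; by [taylor_mean] the radius [1 / 2] is
    as good as any other. *)
Definition taylor (f : C -> C) (n : nat) : C := cmean (fun u => f u / u ^ n)%C (1 / 2).

Lemma taylor_mean (f : C -> C) (n : nat) (r : R) : analytic_on_disc f -> 0 < r < 1 ->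
  cmean (fun u => f u / u ^ n)%C r = taylor f n.
Proof.
  intros Hf Hr. apply cmean_punctured; [exact Hr|lra|]. intros u Hu.
  eexists. apply cderiv_div; [|apply analytic_cderiv; [exact Hf|apply Hu]|apply cderiv_pow].
  apply Cpow_nz, Cmod_gt_0; lra.
Qed.

Theorem taylor_expansion (f : C -> C) : analytic_on_disc f -> has_expansion (taylor f) f.
Proof.
  intros Hf z Hz. apply is_pseries_cseries.
  destruct (classic (z = 0%C)) as [->|Hz0].
  { assert (E : forall n, csum (fun k => taylor f k * 0 ^ k)%C (S n) = f 0%C).
    { induction n as [|n IH].
      - simpl. rewrite <- (cmean_center f (1 / 2) Hf) by lra. unfold taylor.
        rewrite (cmean_ext _ f); [ring|]. intros t. simpl. field.
      - change (csum (fun k => taylor f k * 0 ^ k)%C (S n) + taylor f (S n) * 0 ^ (S n) = f 0)%C.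
        rewrite IH, Cpow_S. ring. }
    intros eps Heps. exists 1%nat. intros n Hn. destruct n as [|n]; [lia|]. rewrite E.
    replace (f 0 - f 0)%C with (RtoC 0) by ring. rewrite Cmod_0. exact Heps. }
  assert (Hz1 : 0 < Cmod z) by (apply Cmod_gt_0, Hz0). unfold disc in Hz.
  set (r := (Cmod z + 1) / 2). assert (Hr : Cmod z < r < 1) by (unfold r; lra).
  assert (Hpol : forall t, polar r t <> 0%C) by (intros t; apply Cmod_gt_0; rewrite Cmod_polar; lra).
  assert (Hpz : forall t, (polar r t - z)%C <> 0%C).
  { intros t E. assert (E' : polar r t = z) by (replace (polar r t) with (polar r t - z + z)%C by ring; rewrite E; ring).
    assert (Cmod (polar r t) = Cmod z) by (f_equal; exact E'). rewrite Cmod_polar in H; lra. }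
  set (G := fun N u => ((f u - f z) * ((z / u) ^ N * (u / (u - z))))%C).
  set (T := fun N u => (f u / u ^ N - f z * / u ^ N)%C).
  assert (Cf : forall t, ccont f (polar r t)).
  { intros t. eapply cderiv_ccont. apply analytic_cderiv; [exact Hf|]. unfold disc. rewrite Cmod_polar; lra. }
  assert (Dq : forall t, exists l, cderiv f (polar r t) l).
  { intros t. eexists. apply analytic_cderiv; [exact Hf|]. unfold disc. rewrite Cmod_polar; lra. }
  assert (C1 : forall N, cont_on_circle (fun u => f u / u ^ N)%C r).
  { intros N t. destruct (Dq t) as [l Hl]. eapply cderiv_ccont.
    apply cderiv_div; [apply Cpow_nz, Hpol|exact Hl|apply cderiv_pow]. }
  assert (C2 : forall N, cont_on_circle (fun u => / u ^ N)%C r).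
  { intros N t. eapply cderiv_ccont. apply (cderiv_inv (fun u => u ^ N)%C); [apply Cpow_nz, Hpol|apply cderiv_pow]. }
  assert (C2' : forall N, cont_on_circle (fun u => f z * / u ^ N)%C r).
  { intros N t. eapply cderiv_ccont. apply cderiv_cmult.
    apply (cderiv_inv (fun u => u ^ N)%C); [apply Cpow_nz, Hpol|apply cderiv_pow]. }
  assert (CT : forall N, cont_on_circle (T N) r).
  { intros N t. destruct (Dq t) as [l Hl]. eapply cderiv_ccont. apply cderiv_minus.
    - apply cderiv_div; [apply Cpow_nz, Hpol|exact Hl|apply cderiv_pow].
    - apply cderiv_cmult. apply (cderiv_inv (fun u => u ^ N)%C); [apply Cpow_nz, Hpol|apply cderiv_pow]. }
  assert (CT' : forall N, cont_on_circle (fun u => z ^ N * T N u)%C r).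
  { intros N t. destruct (Dq t) as [l Hl]. eapply cderiv_ccont. apply cderiv_cmult. apply cderiv_minus.
    - apply cderiv_div; [apply Cpow_nz, Hpol|exact Hl|apply cderiv_pow].
    - apply cderiv_cmult. apply (cderiv_inv (fun u => u ^ N)%C); [apply Cpow_nz, Hpol|apply cderiv_pow]. }
  assert (CG : forall N, cont_on_circle (G N) r).
  { intros N t. destruct (Dq t) as [l Hl]. eapply cderiv_ccont. unfold G. apply cderiv_mult.
    - apply cderiv_minus; [exact Hl|apply cderiv_const].
    - apply cderiv_mult.
      + apply (cderiv_comp (fun w => w ^ N)%C (fun u => z / u)%C); [apply cderiv_pow|].
        apply cderiv_div; [apply Hpol|apply cderiv_const|apply cderiv_id].
      + apply (cderiv_div (fun u => u) (fun u => u - z)%C); [apply Hpz|apply cderiv_id|].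
        apply cderiv_minus; [apply cderiv_id|apply cderiv_const]. }
  assert (HT : forall N, cmean (T N) r = (taylor f N - f z * (if Nat.eq_dec N 0 then 1 else 0))%C).
  { intros N. unfold T. rewrite (cmean_minus (fun u => f u / u ^ N)%C) by auto.
    rewrite cmean_cmult by auto. rewrite (taylor_mean f N r Hf) by lra. do 2 f_equal.
    destruct (Nat.eq_dec N 0) as [->|HN].
    - rewrite (cmean_ext _ (fun _ => 1%C)); [apply cmean_const|]. intros t. simpl. field.
    - apply cmean_inv_pow; [lia|lra]. }
  assert (HG : forall N, cmean (G N) r = (z ^ N * cmean (T N) r + cmean (G (S N)) r)%C).
  { intros N. rewrite <- cmean_cmult by auto. rewrite <- cmean_plus by auto. apply cmean_ext. intros t.
    unfold G, T. rewrite Cpow_S. unfold Cdiv. rewrite !Cpow_mult_l, Cpow_inv by apply Hpol.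
    field. repeat split; first [apply Hpz | apply Hpol | apply Cpow_nz, Hpol]. }
  assert (HG0 : cmean (G 0%nat) r = 0%C).
  { rewrite <- (cauchy_formula_quotient f z r Hf) by lra. apply cmean_ext. intros t. unfold G. simpl. ring. }
  assert (Hsum : forall N, (csum (fun k => taylor f k * z ^ k)%C (S N) - f z + cmean (G (S N)) r)%C = 0%C).
  { induction N as [|N IH].
    - transitivity (cmean (G 0%nat) r); [|exact HG0]. rewrite (HG 0%nat), HT. simpl. ring.
    - rewrite (HG (S N)), HT in IH. destruct (Nat.eq_dec (S N) 0); [lia|].
      etransitivity; [|exact IH]. simpl csum. rewrite Cpow_S. ring. }
  destruct (circle_bounded (G 0%nat) r (CG 0%nat)) as [M [HM HMb]].
  set (q := Cmod z / r). assert (Hq : 0 <= q < 1).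
  { unfold q. split; [apply Rmult_le_pos; [lra|left; apply Rinv_0_lt_compat; lra]|].
    apply (Rmult_lt_reg_r r); [lra|]. unfold Rdiv. rewrite Rmult_assoc, Rinv_l; lra. }
  intros eps Heps. destruct (pow_half_small q eps (2 * M) Hq Heps ltac:(lra)) as [N HN].
  exists (S N). intros n Hn. destruct n as [|n]; [lia|].
  replace (csum (fun k => taylor f k * z ^ k)%C (S n) - f z)%C with (- cmean (G (S n)) r)%C.
  - rewrite Cmod_opp. eapply Rle_lt_trans; [apply (cmean_bound_weak _ _ (M * q ^ (S n)) (CG (S n)))|].
    + intros t Ht. specialize (HMb t Ht). unfold G in *.
      replace ((f (polar r t) - f z) * ((z / polar r t) ^ S n * (polar r t / (polar r t - z))))%C
        with ((f (polar r t) - f z) * ((z / polar r t) ^ 0 * (polar r t / (polar r t - z))) * (z / polar r t) ^ S n)%C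
        by (simpl; ring).
      rewrite Cmod_mult, (Cmod_pow _ (S n)), Cmod_div, Cmod_polar by (lra || apply Hpol). fold q.
      apply Rmult_le_compat_r; [apply pow_le; lra|exact HMb].
    + rewrite <- Rmult_assoc. apply HN. lia.
  - specialize (Hsum n).
    replace (- cmean (G (S n)) r)%C with (csum (fun k => taylor f k * z ^ k)%C (S n) - f z
      - (csum (fun k => taylor f k * z ^ k)%C (S n) - f z + cmean (G (S n)) r))%C by ring.
    rewrite Hsum. ring.
Qed.

(** * Complex power series: derivatives, uniqueness, products *)

Lemma csum_ext (u v : nat -> C) (n : nat) :
  (forall k, (k < n)%nat -> u k = v k) -> csum u n = csum v n.
Proof.
  induction n as [|n IH]; intros H; [reflexivity|]. simpl. rewrite IH, H by (intros; try apply H; lia). reflexivity.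
Qed.

Lemma csum_plus (u v : nat -> C) (n : nat) : csum (fun k => u k + v k)%C n = (csum u n + csum v n)%C.
Proof. induction n as [|n IH]; simpl; [ring|]. rewrite IH. ring. Qed.

Lemma csum_cmult (c : C) (u : nat -> C) (n : nat) : csum (fun k => c * u k)%C n = (c * csum u n)%C.
Proof. induction n as [|n IH]; simpl; [ring|]. rewrite IH. ring. Qed.

Lemma csum_shift (u : nat -> C) (n : nat) : csum u (S n) = (u 0%nat + csum (fun k => u (S k)) n)%C.
Proof. induction n as [|n IH]; [simpl; ring|]. change (csum u (S (S n))) with (csum u (S n) + u (S n))%C. rewrite IH. simpl. ring. Qed.


Fixpoint rsum (u : nat -> R) (n : nat) : R :=
  match n with O => 0 | S k => rsum u k + u k end.

Lemma rsum_le (u v : nat -> R) (n : nat) :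
  (forall k, (k < n)%nat -> u k <= v k) -> rsum u n <= rsum v n.
Proof.
  induction n as [|n IH]; intros H; simpl; [lra|]. apply Rplus_le_compat; [apply IH; intros; apply H; lia|apply H; lia].
Qed.

Lemma rsum_ext (u v : nat -> R) (n : nat) :
  (forall k, (k < n)%nat -> u k = v k) -> rsum u n = rsum v n.
Proof.
  induction n as [|n IH]; intros H; simpl; [lra|]. rewrite H by lia. f_equal. apply IH; intros; apply H; lia.
Qed.

Lemma rsum_mult (c : R) (u : nat -> R) (n : nat) : rsum (fun k => c * u k) n = c * rsum u n.
Proof. induction n as [|n IH]; simpl; [ring|]. rewrite IH. ring. Qed.

Lemma rsum_plus (u v : nat -> R) (n : nat) : rsum (fun k => u k + v k) n = rsum u n + rsum v n.
Proof. induction n as [|n IH]; simpl; [ring|]. rewrite IH. ring. Qed.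

Lemma rsum_nonneg (u : nat -> R) (n : nat) : (forall k, 0 <= u k) -> 0 <= rsum u n.
Proof. intros H. induction n as [|n IH]; simpl; [lra|]. specialize (H n). lra. Qed.

Lemma rsum_incr (u : nat -> R) (n m : nat) : (forall k, 0 <= u k) -> (n <= m)%nat -> rsum u n <= rsum u m.
Proof. intros H Hnm. induction Hnm as [|m Hm IH]; [lra|]. simpl. specialize (H m). lra. Qed.

Lemma rsum_shift (u : nat -> R) (n : nat) : rsum u (S n) = u 0%nat + rsum (fun k => u (S k)) n.
Proof. induction n as [|n IH]; [simpl; ring|]. change (rsum u (S (S n))) with (rsum u (S n) + u (S n)). rewrite IH. simpl. ring. Qed.

Lemma Cmod_csum (u : nat -> C) (n : nat) : Cmod (csum u n) <= rsum (fun k => Cmod (u k)) n.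
Proof.
  induction n as [|n IH]; simpl; [rewrite Cmod_0; lra|].
  eapply Rle_trans; [apply Cmod_triangle|]. lra.
Qed.

Lemma sum_n_rsum (u : nat -> R) (n : nat) : sum_n u n = rsum u (S n).
Proof.
  induction n as [|n IH].
  - rewrite sum_O. simpl. ring.
  - rewrite sum_Sn, IH. reflexivity.
Qed.

Lemma rsum_le_Series (u : nat -> R) (n : nat) :
  (forall k, 0 <= u k) -> ex_series u -> rsum u n <= Series u.
Proof.
  intros Hu He. apply Series_correct in He.
  assert (L : is_lim_seq (fun _ => rsum u n) (rsum u n)) by apply is_lim_seq_const.
  assert (K : Rbar_le (rsum u n) (Series u)); [|exact K].
  apply (is_lim_seq_le_loc (fun _ => rsum u n) (sum_n u)); [|exact L|exact He].
  exists n. intros m Hm. rewrite sum_n_rsum. apply rsum_incr; [exact Hu|lia].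
Qed.

Lemma series_of_bounded (u : nat -> R) (M : R) :
  (forall k, 0 <= u k) -> (forall n, rsum u n <= M) -> ex_series u /\ Series u <= M.
Proof.
  intros Hu HM.
  assert (Hex : ex_finite_lim_seq (sum_n u)).
  { apply (ex_finite_lim_seq_incr _ M).
    - intros n. rewrite sum_Sn. change (sum_n u n <= sum_n u n + u (S n)). specialize (Hu (S n)). lra.
    - intros n. rewrite sum_n_rsum. apply HM. }
  destruct Hex as [l Hl]. assert (Hs : is_series u l) by exact Hl.
  split; [exists l; exact Hs|]. rewrite (is_series_unique _ _ Hs).
  assert (L : Rbar_le l M); [|exact L].
  apply (is_lim_seq_le (sum_n u) (fun _ => M)); [|exact Hl|apply is_lim_seq_const].
  intros n. rewrite sum_n_rsum. apply HM.
Qed.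

Definition abs_conv (a : nat -> C) : Prop :=
  forall r, 0 <= r < 1 -> ex_series (fun n => Cmod (a n) * r ^ n).

Definition majorant (a : nat -> C) (r : R) : R := Series (fun n => Cmod (a n) * r ^ n).

Lemma majorant_terms_nonneg (a : nat -> C) (r : R) (n : nat) : 0 <= r -> 0 <= Cmod (a n) * r ^ n.
Proof. intros Hr. apply Rmult_le_pos; [apply Cmod_ge_0|apply pow_le; exact Hr]. Qed.

Lemma cseries_terms_bounded (u : nat -> C) (l : C) : cseries u l ->
  exists M, 0 < M /\ forall n, Cmod (u n) <= M.
Proof.
  intros H. destruct (H 1 Rlt_0_1) as [N HN].
  set (M0 := rsum (fun k => Cmod (u k)) N).
  assert (HM0 : 0 <= M0) by (apply rsum_nonneg; intros; apply Cmod_ge_0).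
  exists (M0 + 2). split; [lra|]. intros n. destruct (Nat.le_gt_cases N n) as [Hn|Hn].
  - assert (A := HN n Hn). assert (B := HN (S n) ltac:(lia)). simpl in B.
    assert (T := Cmod_triangle (csum u n + u n - l) (- (csum u n - l))). rewrite Cmod_opp in T.
    replace (csum u n + u n - l + - (csum u n - l))%C with (u n) in T by ring. lra.
  - assert (A : rsum (fun k => Cmod (u k)) (S n) <= M0) by (apply rsum_incr; [intros; apply Cmod_ge_0|lia]).
    simpl in A. assert (B : 0 <= rsum (fun k => Cmod (u k)) n) by (apply rsum_nonneg; intros; apply Cmod_ge_0). lra.
Qed.

Lemma ex_series_geom_bound (u : nat -> R) (M q : R) : 0 <= q < 1 ->
  (forall n, 0 <= u n <= M * q ^ n) -> ex_series u.
Proof.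
  intros Hq Hu. apply (ex_series_le (V := R_CompleteNormedModule) u (fun n => M * q ^ n)).
  - intros n. change (Rabs (u n) <= M * q ^ n). rewrite Rabs_right; [apply Hu|apply Rle_ge, Hu].
  - apply (ex_series_scal (V := R_NormedModule) M (fun n => q ^ n)).
    apply ex_series_geom. rewrite Rabs_right; lra.
Qed.

Lemma expansion_abs_conv (a : nat -> C) (f : C -> C) : has_expansion a f -> abs_conv a.
Proof.
  intros H r Hr. set (s := (r + 1) / 2). assert (Hs : r < s < 1) by (unfold s; lra).
  assert (Hd : disc (RtoC s)) by (unfold disc; rewrite Cmod_R, Rabs_right; lra).
  apply H, is_pseries_cseries in Hd. destruct (cseries_terms_bounded _ _ Hd) as [M [HM HMb]].
  apply (ex_series_geom_bound _ M (r / s)).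
  - split; [apply Rmult_le_pos; [lra|left; apply Rinv_0_lt_compat; lra]|].
    apply (Rmult_lt_reg_r s); [lra|]. unfold Rdiv. rewrite Rmult_assoc, Rinv_l; lra.
  - intros n. split; [apply majorant_terms_nonneg; lra|].
    specialize (HMb n). rewrite Cmod_mult, Cmod_pow, Cmod_R, Rabs_right in HMb by lra.
    assert (Hp : 0 < s ^ n) by (apply pow_lt; lra).
    replace (r ^ n) with (s ^ n * (r / s) ^ n).
    + rewrite <- Rmult_assoc. apply Rmult_le_compat_r; [|exact HMb].
      apply pow_le. apply Rmult_le_pos; [lra|left; apply Rinv_0_lt_compat; lra].
    + rewrite <- Rpow_mult_distr. f_equal. field. lra.
Qed.

Lemma abs_conv_expansion (a : nat -> C) : abs_conv a -> exists f, has_expansion a f.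
Proof.
  intros H.
  assert (A : forall z, disc z -> exists l : C, is_pseries (K := C_AbsRing) (V := C_NormedModule) a z l).
  { intros z Hz. apply (ex_series_le (V := C_CompleteNormedModule) _ (fun n => Cmod (a n) * Cmod z ^ n)).
    - intros n. change (Cmod (pow_n (K := C_Ring) z n * a n) <= Cmod (a n) * Cmod z ^ n).
      rewrite pow_n_Cpow, Cmod_mult, Cmod_pow. lra.
    - apply H. split; [apply Cmod_ge_0|exact Hz]. }
  exists (fun z : C => match excluded_middle_informative (disc z) with
     | left Hz => proj1_sig (constructive_indefinite_description _ (A z Hz))
     | right _ => (RtoC 0) end).
  intros z Hz. destruct (excluded_middle_informative (disc z)) as [Hz'|n]; [|contradiction].
  destruct (constructive_indefinite_description _ (A z Hz')) as [l Hl]. exact Hl.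
Qed.

Lemma RtoC_INR_S_neq_0 (n : nat) : RtoC (INR (S n)) <> 0%C.
Proof. intros K. apply (f_equal Re) in K. change (INR (S n) = 0) in K. rewrite S_INR in K. pose proof (pos_INR n). lra. Qed.

Definition dcoef (a : nat -> C) (n : nat) : C := (RtoC (INR (S n)) * a (S n))%C.

Lemma CV_radius_abs (a : nat -> C) : abs_conv a -> Rbar_le 1 (CV_radius (fun n => Cmod (a n))).
Proof.
  intros H. destruct (CV_radius (fun n => Cmod (a n))) as [x| |] eqn:E; simpl.
  - destruct (Rle_dec 1 x) as [Hx|Hx]; [exact Hx|]. exfalso.
    assert (H0 := CV_radius_ge_0 (fun n => Cmod (a n))). rewrite E in H0. simpl in H0.
    set (r := (x + 1) / 2). assert (Hr : x < r < 1) by (unfold r; lra).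
    apply (CV_disk_outside (fun n => Cmod (a n)) r).
    + rewrite E. simpl. rewrite Rabs_right; lra.
    + apply ex_series_lim_0. apply H. lra.
  - exact I.
  - assert (H0 := CV_radius_ge_0 (fun n => Cmod (a n))). rewrite E in H0. exact H0.
Qed.

Lemma ex_series_of_CV_radius (b : nat -> R) (r : R) :
  Rbar_le 1 (CV_radius b) -> 0 <= r < 1 -> ex_series (fun n => Rabs (b n * r ^ n)).
Proof.
  intros H Hr. apply CV_disk_inside. rewrite Rabs_right by lra.
  destruct (CV_radius b); simpl in *; lra || exact I || contradiction.
Qed.

Lemma abs_conv_dcoef (a : nat -> C) : abs_conv a -> abs_conv (dcoef a).
Proof.
  intros H r Hr. assert (R1 := CV_radius_abs a H). rewrite <- CV_radius_derive in R1.
  assert (E := ex_series_of_CV_radius _ r R1 Hr).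
  revert E. apply ex_series_ext. intros n. unfold PS_derive, dcoef.
  rewrite Cmod_mult, Cmod_R. rewrite (Rabs_right (INR (S n))) by (apply Rle_ge, pos_INR).
  apply Rabs_right, Rle_ge. apply Rmult_le_pos; [|apply pow_le; lra].
  apply Rmult_le_pos; [apply pos_INR|apply Cmod_ge_0].
Qed.

(** Second order Taylor remainder of a power; the factor [rho] on the left avoids
    the exponent [n - 2] on the right. *)
Lemma pow_remainder (u z : C) (rho : R) (n : nat) : 0 < rho -> Cmod u <= rho -> Cmod z <= rho ->
  rho * Cmod (u ^ n - z ^ n - RtoC (INR n) * z ^ pred n * (u - z))
  <= INR n * INR n * rho ^ pred n * Cmod (u - z) ^ 2.
Proof.
  intros Hrho Hu Hz. induction n as [|n IH].
  - simpl. replace (1 - 1 - 0 * 1 * (u - z))%C with (RtoC 0) by ring. rewrite Cmod_0. lra.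
  - set (d := Cmod (u - z)) in *.
    assert (Hd : 0 <= d) by apply Cmod_ge_0.
    assert (E : (u ^ S n - z ^ S n - RtoC (INR (S n)) * z ^ pred (S n) * (u - z))%C
      = (u * (u ^ n - z ^ n - RtoC (INR n) * z ^ pred n * (u - z)) + RtoC (INR n) * z ^ pred n * ((u - z) * (u - z)))%C).
    { rewrite S_INR, RtoC_plus. simpl pred. rewrite !Cpow_S. destruct n as [|n].
      - simpl. ring.
      - simpl pred. rewrite !Cpow_S. ring. }
    rewrite E. clear E.
    set (e := (u ^ n - z ^ n - RtoC (INR n) * z ^ pred n * (u - z))%C) in *.
    assert (T := Cmod_triangle (u * e) (RtoC (INR n) * z ^ pred n * ((u - z) * (u - z)))).
    rewrite !Cmod_mult, Cmod_R, Cmod_pow, Rabs_right in T by (apply Rle_ge, pos_INR). fold d in T.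
    assert (Hn : 0 <= INR n) by apply pos_INR.
    assert (A1 : Cmod u * Cmod e <= rho * Cmod e) by (apply Rmult_le_compat_r; [apply Cmod_ge_0|exact Hu]).
    assert (A2 : INR n * Cmod z ^ pred n * (d * d) <= INR n * rho ^ pred n * (d * d)).
    { apply Rmult_le_compat_r; [nra|]. apply Rmult_le_compat_l; [exact Hn|].
      apply pow_incr. split; [apply Cmod_ge_0|exact Hz]. }
    apply Rle_trans with (rho * (INR n * INR n * rho ^ pred n * d ^ 2 + INR n * rho ^ pred n * (d * d))).
    + apply Rmult_le_compat_l; [lra|]. eapply Rle_trans; [exact T|]. lra.
    + rewrite S_INR. simpl pred. destruct n as [|n].
      * simpl. nra.
      * simpl pred. assert (Hp : 0 <= rho ^ S n * d ^ 2) by (apply Rmult_le_pos; [apply pow_le; lra|nra]).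
        replace (rho * (INR (S n) * INR (S n) * rho ^ n * d ^ 2 + INR (S n) * rho ^ n * (d * d)))
          with ((INR (S n) * INR (S n) + INR (S n)) * (rho ^ S n * d ^ 2)) by (simpl; ring).
        replace ((INR (S n) + 1) * (INR (S n) + 1) * rho ^ S n * d ^ 2)
          with ((INR (S n) * INR (S n) + INR (S n) + (INR (S n) + 1)) * (rho ^ S n * d ^ 2)) by ring.
        apply Rmult_le_compat_r; [exact Hp|]. lra.
Qed.

Lemma cseries_plus (u v : nat -> C) (l m : C) :
  cseries u l -> cseries v m -> cseries (fun n => u n + v n)%C (l + m)%C.
Proof.
  intros H1 H2 eps Heps. destruct (H1 (eps / 2) ltac:(lra)) as [N1 A1]. destruct (H2 (eps / 2) ltac:(lra)) as [N2 A2].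
  exists (max N1 N2). intros n Hn. specialize (A1 n ltac:(lia)). specialize (A2 n ltac:(lia)).
  rewrite csum_plus. replace (csum u n + csum v n - (l + m))%C with ((csum u n - l) + (csum v n - m))%C by ring.
  eapply Rle_lt_trans; [apply Cmod_triangle|]. lra.
Qed.

Lemma cseries_cmult (c : C) (u : nat -> C) (l : C) :
  cseries u l -> cseries (fun n => c * u n)%C (c * l)%C.
Proof.
  intros H eps Heps. set (k := Cmod c + 1). assert (Hk : 0 < k) by (unfold k; pose proof (Cmod_ge_0 c); lra).
  destruct (H (eps / k)) as [N A]; [apply Rdiv_lt_0_compat; lra|].
  exists N. intros n Hn. specialize (A n Hn). rewrite csum_cmult.
  replace (c * csum u n - c * l)%C with (c * (csum u n - l))%C by ring. rewrite Cmod_mult.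
  apply (Rmult_lt_compat_l k) in A; [|exact Hk]. replace (k * (eps / k)) with eps in A by (field; lra).
  pose proof (Cmod_ge_0 (csum u n - l)). unfold k in A. nra.
Qed.

Lemma cseries_ext (u v : nat -> C) (l : C) : (forall n, u n = v n) -> cseries u l -> cseries v l.
Proof.
  intros E H. replace v with u; [exact H|]. apply functional_extensionality. exact E.
Qed.

Lemma cseries_unique (u : nat -> C) (l m : C) : cseries u l -> cseries u m -> l = m.
Proof.
  intros H1 H2. assert (E : (l - m)%C = 0%C).
  { apply (eq_0_of_small _ 1); [lra|]. intros e He.
    destruct (H1 (e / 2) ltac:(lra)) as [N1 A1]. destruct (H2 (e / 2) ltac:(lra)) as [N2 A2].
    set (n := max N1 N2). specialize (A1 n ltac:(lia)). specialize (A2 n ltac:(lia)).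
    replace (l - m)%C with ((csum u n - m) + - (csum u n - l))%C by ring.
    eapply Rle_trans; [apply Cmod_triangle|]. rewrite Cmod_opp. lra. }
  replace l with (l - m + m)%C by ring. rewrite E. ring.
Qed.

Lemma cseries_bound (u : nat -> C) (v : nat -> R) (l : C) :
  cseries u l -> (forall n, Cmod (u n) <= v n) -> ex_series v -> Cmod l <= Series v.
Proof.
  intros H Huv Hv.
  assert (Hv0 : forall k, 0 <= v k) by (intros k; eapply Rle_trans; [apply Cmod_ge_0|apply Huv]).
  apply Rnot_lt_le. intros Hlt.
  destruct (H ((Cmod l - Series v) / 2) ltac:(lra)) as [N A]. specialize (A N (le_n N)).
  assert (B : Cmod (csum u N) <= Series v).
  { eapply Rle_trans; [apply Cmod_csum|]. eapply Rle_trans; [apply rsum_le; intros; apply Huv|].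
    apply rsum_le_Series; assumption. }
  assert (T := Cmod_triangle (l - csum u N) (csum u N)).
  replace (l - csum u N + csum u N)%C with l in T by ring. rewrite Cmod_sub_sym in T. lra.
Qed.

Lemma cseries_shift (u : nat -> C) (l : C) :
  cseries u l -> cseries (fun n => u (S n)) (l - u 0%nat)%C.
Proof.
  intros H eps Heps. destruct (H eps Heps) as [N A]. exists N. intros n Hn.
  specialize (A (S n) ltac:(lia)). rewrite csum_shift in A.
  replace (csum (fun k => u (S k)) n - (l - u 0%nat))%C with (u 0%nat + csum (fun k => u (S k)) n - l)%C by ring.
  exact A.
Qed.

Lemma cseries_unshift (u : nat -> C) (l : C) :
  cseries (fun n => u (S n)) l -> cseries u (u 0%nat + l)%C.
Proof.
  intros H eps Heps. destruct (H eps Heps) as [N A]. exists (S N). intros n Hn. destruct n as [|n]; [lia|].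
  specialize (A n ltac:(lia)). rewrite csum_shift.
  replace (u 0%nat + csum (fun k => u (S k)) n - (u 0%nat + l))%C with (csum (fun k => u (S k)) n - l)%C by ring.
  exact A.
Qed.

Lemma expansion_cseries (a : nat -> C) (f : C -> C) (z : C) :
  has_expansion a f -> disc z -> cseries (fun n => a n * z ^ n)%C (f z).
Proof. intros H Hz. apply is_pseries_cseries. apply H, Hz. Qed.

Lemma expansion_cderiv (a : nat -> C) (f f' : C -> C) (z : C) :
  has_expansion a f -> has_expansion (dcoef a) f' -> disc z -> cderiv f z (f' z).
Proof.
  intros Hf Hf' Hz. unfold disc in Hz.
  assert (Ha := expansion_abs_conv a f Hf).
  set (rho := (Cmod z + 1) / 2). assert (Hz0 := Cmod_ge_0 z).
  assert (Hrho : Cmod z < rho < 1) by (unfold rho; lra).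
  (* the series of the bounds given by [pow_remainder] *)
  set (S2 := fun n => Cmod (a n) * (INR n * INR n * rho ^ pred n / rho)).
  assert (HS2 : ex_series S2).
  { apply ex_series_incr_1.
    assert (B := abs_conv_dcoef _ (abs_conv_dcoef a Ha) rho ltac:(lra)).
    assert (B0 := abs_conv_dcoef a Ha rho ltac:(lra)).
    apply ex_series_incr_1 in B0.
    assert (B1 := ex_series_plus (V := R_NormedModule) _ _ B B0).
    apply (ex_series_scal (V := R_NormedModule) (/ rho)) in B0.
    apply ex_series_incr_1.
    assert (B2 := ex_series_plus (V := R_NormedModule) _ _ B B0).
    revert B2. apply ex_series_ext. intros n. unfold S2, dcoef.
    change (Cmod (RtoC (INR (S n)) * (RtoC (INR (S (S n))) * a (S (S n)))) * rho ^ n +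
      / rho * (Cmod (RtoC (INR (S (S n))) * a (S (S n))) * rho ^ S n) =
      Cmod (a (S (S n))) * (INR (S (S n)) * INR (S (S n)) * rho ^ pred (S (S n)) / rho)).
    rewrite !Cmod_mult, !Cmod_R, !Rabs_right by (apply Rle_ge, pos_INR).
    simpl pred. rewrite (S_INR (S n)). simpl pow. field. lra. }
  intros eps Heps. set (B := Series S2 + 1).
  assert (HS0 : forall n, 0 <= S2 n).
  { intros n. unfold S2. apply Rmult_le_pos; [apply Cmod_ge_0|]. apply Rmult_le_pos; [|left; apply Rinv_0_lt_compat; lra].
    apply Rmult_le_pos; [|apply pow_le; lra]. apply Rmult_le_pos; apply pos_INR. }
  assert (HB : 0 < B).
  { unfold B. assert (H := rsum_le_Series S2 0 HS0 HS2). simpl in H. lra. }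
  exists (Rmin (rho - Cmod z) (eps / B)). split.
  { apply Rmin_glb_lt; [lra|]. apply Rdiv_lt_0_compat; lra. }
  intros u Hu.
  assert (Hu1 : Cmod (u - z) < rho - Cmod z) by (eapply Rlt_le_trans; [exact Hu|apply Rmin_l]).
  assert (Hu2 : Cmod (u - z) < eps / B) by (eapply Rlt_le_trans; [exact Hu|apply Rmin_r]).
  assert (Hur : Cmod u <= rho).
  { assert (T := Cmod_triangle (u - z) z). replace (u - z + z)%C with u in T by ring. lra. }
  set (d := Cmod (u - z)) in *. assert (Hd : 0 <= d) by apply Cmod_ge_0.
  assert (C1 := expansion_cseries a f u Hf ltac:(unfold disc; lra)).
  assert (C2 := expansion_cseries a f z Hf ltac:(unfold disc; lra)).
  assert (C3 := expansion_cseries (dcoef a) f' z Hf' ltac:(unfold disc; lra)).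
  assert (C3' : cseries (fun n => a n * (RtoC (INR n) * z ^ pred n))%C (f' z)).
  { replace (f' z) with (a 0%nat * (RtoC (INR 0) * z ^ pred 0) + f' z)%C by (simpl; ring).
    apply (cseries_unshift (fun n => a n * (RtoC (INR n) * z ^ pred n))%C).
    revert C3. apply cseries_ext. intros n. unfold dcoef. simpl pred. ring. }
  assert (C4 : cseries (fun n => a n * (u ^ n - z ^ n - RtoC (INR n) * z ^ pred n * (u - z)))%C
      (f u - f z - f' z * (u - z))%C).
  { assert (D := cseries_plus _ _ _ _ (cseries_plus _ _ _ _ C1 (cseries_cmult (- (1)) _ _ C2))
       (cseries_cmult (- (u - z)) _ _ C3')).
    replace (f u - f z - f' z * (u - z))%C with (f u + - (1) * f z + - (u - z) * f' z)%C by ring.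
    revert D. apply cseries_ext. intros n. ring. }
  assert (Bd := cseries_bound _ (fun n => d ^ 2 * S2 n) _ C4).
  assert (Bd' : Cmod (f u - f z - f' z * (u - z)) <= d ^ 2 * Series S2).
  { rewrite <- Series_scal_l. apply Bd.
    - intros n. rewrite Cmod_mult. unfold S2. rewrite (Rmult_comm (d ^ 2)), Rmult_assoc.
      apply Rmult_le_compat_l; [apply Cmod_ge_0|].
      assert (P := pow_remainder u z rho n ltac:(lra) Hur ltac:(lra)). fold d in P.
      apply (Rmult_le_reg_l rho); [lra|].
      replace (rho * (INR n * INR n * rho ^ pred n / rho * d ^ 2)) with (INR n * INR n * rho ^ pred n * d ^ 2) by (field; lra).
      exact P.
    - apply (ex_series_scal (V := R_NormedModule) (d ^ 2)). exact HS2. }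
  eapply Rle_trans; [exact Bd'|].
  assert (X : d * B <= eps).
  { apply (Rmult_lt_compat_r B) in Hu2; [|exact HB]. replace (eps / B * B) with eps in Hu2 by (field; lra). lra. }
  assert (Y : d * Series S2 <= eps) by (unfold B in X; nra).
  simpl. nra.
Qed.

Lemma expansion_deriv (a : nat -> C) (f : C -> C) : has_expansion a f ->
  (forall z, disc z -> cderiv f z (C_derive f z)) /\ has_expansion (dcoef a) (C_derive f).
Proof.
  intros Hf. destruct (abs_conv_expansion (dcoef a) (abs_conv_dcoef a (expansion_abs_conv a f Hf))) as [f' Hf'].
  assert (D : forall z, disc z -> cderiv f z (f' z)) by (intros z Hz; eapply expansion_cderiv; eassumption).
  assert (E : forall z, disc z -> C_derive f z = f' z) by (intros z Hz; apply cderiv_C_derive, D, Hz).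
  split.
  - intros z Hz. rewrite E by exact Hz. apply D, Hz.
  - intros z Hz. rewrite E by exact Hz. apply Hf', Hz.
Qed.

Lemma expansion_analytic (a : nat -> C) (f : C -> C) : has_expansion a f -> analytic_on_disc f.
Proof. intros H. apply analytic_intro. intros z Hz. eexists. apply (expansion_deriv a f H), Hz. Qed.

Lemma analytic_C_derive (f : C -> C) : analytic_on_disc f -> analytic_on_disc (C_derive f).
Proof.
  intros H. eapply expansion_analytic. eapply expansion_deriv. apply taylor_expansion, H.
Qed.

Lemma disc_0 : disc 0.
Proof. unfold disc. rewrite Cmod_0. lra. Qed.

Lemma expansion_at_0 (a : nat -> C) (f : C -> C) : has_expansion a f -> f 0%C = a 0%nat.
Proof.
  intros H. apply (cseries_unique (fun n => a n * 0 ^ n)%C).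
  - apply (expansion_cseries a f 0 H disc_0).
  - intros eps Heps. exists 1%nat. intros n Hn. destruct n as [|n]; [lia|].
    assert (E : csum (fun k => a k * 0 ^ k)%C (S n) = a 0%nat).
    { rewrite csum_shift. rewrite (csum_ext _ (fun _ => 0 * 0)%C) by (intros; rewrite Cpow_S; ring).
      rewrite csum_cmult. simpl. ring. }
    rewrite E. replace (a 0%nat - a 0%nat)%C with (RtoC 0) by ring. rewrite Cmod_0. exact Heps.
Qed.

(** Coefficients are determined by the function: differentiate [n] times at 0. *)
Lemma expansion_unique (a b : nat -> C) (f : C -> C) (n : nat) :
  has_expansion a f -> has_expansion b f -> a n = b n.
Proof.
  revert a b f. induction n as [|n IH]; intros a b f Ha Hb.
  - rewrite <- (expansion_at_0 a f Ha). apply (expansion_at_0 b f Hb).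
  - assert (E := IH _ _ _ (proj2 (expansion_deriv a f Ha)) (proj2 (expansion_deriv b f Hb))).
    unfold dcoef in E. assert (HS : RtoC (INR (S n)) <> 0%C).
    { apply RtoC_INR_S_neq_0. }
    replace (a (S n)) with (/ RtoC (INR (S n)) * (RtoC (INR (S n)) * a (S n)))%C by (field; exact HS).
    rewrite E. field. exact HS.
Qed.

Lemma expansion_taylor (a : nat -> C) (f : C -> C) (n : nat) : has_expansion a f -> a n = taylor f n.
Proof.
  intros H. apply (expansion_unique _ _ f n H). apply taylor_expansion. eapply expansion_analytic; exact H.
Qed.

Lemma expansion_plus (a b : nat -> C) (f g : C -> C) : has_expansion a f -> has_expansion b g ->
  has_expansion (fun n => a n + b n)%C (fun z => f z + g z)%C.
Proof.
  intros Ha Hb z Hz. apply is_pseries_cseries.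
  assert (D := cseries_plus _ _ _ _ (expansion_cseries _ _ z Ha Hz) (expansion_cseries _ _ z Hb Hz)).
  revert D. apply cseries_ext. intros n; ring.
Qed.

Lemma expansion_cmult (c : C) (a : nat -> C) (f : C -> C) : has_expansion a f ->
  has_expansion (fun n => c * a n)%C (fun z => c * f z)%C.
Proof.
  intros Ha z Hz. apply is_pseries_cseries.
  assert (D := cseries_cmult c _ _ (expansion_cseries _ _ z Ha Hz)).
  revert D. apply cseries_ext. intros n; ring.
Qed.

(** Integrate the Taylor series term by term. *)
Lemma analytic_primitive (g : C -> C) : analytic_on_disc g ->
  exists G : C -> C, G 0%C = 0%C /\ forall z, disc z -> cderiv G z (g z).
Proof.
  intros Hg. assert (He := taylor_expansion g Hg). set (a := taylor g) in *.
  set (b := fun n => match n return C with O => RtoC 0 | S k => (a k / RtoC (INR (S k)))%C end).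
  assert (HS : forall n, RtoC (INR (S n)) <> 0%C).
  { intros n. apply RtoC_INR_S_neq_0. }
  assert (Eb : dcoef b = a).
  { apply functional_extensionality. intros n. unfold dcoef, b. field. apply HS. }
  assert (Hb : abs_conv b).
  { intros r Hr. apply ex_series_incr_1.
    assert (Ha := expansion_abs_conv a g He r Hr).
    apply (ex_series_le (V := R_CompleteNormedModule) _ (fun n => Cmod (a n) * r ^ n)); [|exact Ha].
    intros n. change (Rabs (Cmod (b (S n)) * r ^ S n) <= Cmod (a n) * r ^ n).
    rewrite Rabs_right by (apply Rle_ge, majorant_terms_nonneg; lra).
    unfold b. rewrite Cmod_div, Cmod_R, Rabs_right by (apply HS || apply Rle_ge, pos_INR).
    assert (1 <= INR (S n)) by (rewrite S_INR; pose proof (pos_INR n); lra).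
    apply Rmult_le_compat; [| apply pow_le; lra| |].
    - apply Rmult_le_pos; [apply Cmod_ge_0|left; apply Rinv_0_lt_compat; lra].
    - rewrite <- (Rmult_1_r (Cmod (a n))) at 2. apply Rmult_le_compat_l; [apply Cmod_ge_0|].
      rewrite <- Rinv_1. apply Rinv_le_contravar; lra.
    - simpl. assert (0 <= r ^ n) by (apply pow_le; lra). nra. }
  destruct (abs_conv_expansion b Hb) as [G HG]. exists G. split.
  - rewrite (expansion_at_0 b G HG). reflexivity.
  - intros z Hz. apply (expansion_cderiv b G g z HG); [rewrite Eb; exact He|exact Hz].
Qed.

(** The derivative determines all Taylor coefficients but the first. *)
Lemma analytic_constant (f : C -> C) : (forall z, disc z -> cderiv f z 0%C) ->
  forall z, disc z -> f z = f 0%C.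
Proof.
  intros H z Hz.
  assert (Hf : analytic_on_disc f) by (apply analytic_intro; intros u Hu; eexists; apply H, Hu).
  assert (Ha := taylor_expansion f Hf).
  destruct (expansion_deriv _ _ Ha) as [_ Hd].
  assert (H0 : has_expansion (fun _ => 0%C) (C_derive f)).
  { intros u Hu. apply is_pseries_cseries. rewrite (cderiv_C_derive f u 0 (H u Hu)).
    intros eps Heps. exists 0%nat. intros n _.
    replace (csum (fun k => 0 * u ^ k)%C n - 0)%C with (RtoC 0).
    - rewrite Cmod_0. exact Heps.
    - rewrite csum_cmult. ring. }
  assert (Z : forall n, taylor f (S n) = 0%C).
  { intros n. assert (E := expansion_unique _ _ _ n Hd H0). unfold dcoef in E.
    assert (HS : RtoC (INR (S n)) <> 0%C) by apply RtoC_INR_S_neq_0.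
    replace (taylor f (S n)) with (/ RtoC (INR (S n)) * (RtoC (INR (S n)) * taylor f (S n)))%C by (field; exact HS).
    rewrite E. ring. }
  rewrite (expansion_at_0 _ _ Ha).
  apply (cseries_unique (fun n => taylor f n * z ^ n)%C); [apply expansion_cseries; assumption|].
  replace (taylor f 0) with (taylor f 0 * z ^ 0 + 0)%C by (simpl; ring).
  apply (cseries_unshift (fun n => taylor f n * z ^ n)%C).
  intros eps Heps. exists 0%nat. intros n _.
  rewrite (csum_ext _ (fun k => 0 * 0)%C) by (intros; rewrite Z; ring).
  rewrite csum_cmult. replace (0 * csum (fun _ => 0) n - 0)%C with (RtoC 0) by ring. rewrite Cmod_0. exact Heps.
Qed.

Definition conv (a b : nat -> C) (n : nat) : C := csum (fun k => a k * b (n - k)%nat)%C (S n).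

Lemma dcoef_conv (a b : nat -> C) (n : nat) :
  dcoef (conv a b) n = (conv (dcoef a) b n + conv a (dcoef b) n)%C.
Proof.
  unfold conv. unfold dcoef at 1. rewrite <- csum_cmult.
  rewrite (csum_ext _ (fun k => RtoC (INR k) * a k * b (S n - k)%nat + RtoC (INR (S n - k)) * a k * b (S n - k)%nat)%C).
  - rewrite csum_plus. f_equal.
    + rewrite csum_shift. simpl INR at 1. rewrite !Cmult_0_l, Cplus_0_l. apply csum_ext.
      intros k Hk. unfold dcoef. replace (S n - S k)%nat with (n - k)%nat by lia. ring.
    + change (csum (fun k => RtoC (INR (S n - k)) * a k * b (S n - k)%nat)%C (S n)
        + RtoC (INR (S n - S n)) * a (S n) * b (S n - S n)%nat
        = csum (fun k => a k * dcoef b (n - k)) (S n))%C.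
      replace (S n - S n)%nat with 0%nat by lia. simpl INR at 2. rewrite !Cmult_0_l, Cplus_0_r.
      apply csum_ext. intros k Hk. unfold dcoef. replace (S n - k)%nat with (S (n - k)) by lia. ring.
  - intros k Hk. rewrite <- Cmult_plus_distr_r, <- Cmult_plus_distr_r, <- RtoC_plus, <- plus_INR.
    replace (k + (S n - k))%nat with (S n) by lia. ring.
Qed.

Lemma analytic_mult (f g : C -> C) : analytic_on_disc f -> analytic_on_disc g ->
  analytic_on_disc (fun z => f z * g z)%C.
Proof.
  intros Hf Hg. apply analytic_intro. intros z Hz. eexists.
  apply cderiv_mult; apply analytic_cderiv; assumption.
Qed.

Lemma analytic_plus (f g : C -> C) : analytic_on_disc f -> analytic_on_disc g ->
  analytic_on_disc (fun z => f z + g z)%C.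
Proof.
  intros Hf Hg. apply analytic_intro. intros z Hz. eexists.
  apply cderiv_plus; apply analytic_cderiv; assumption.
Qed.

Lemma taylor_ext (f g : C -> C) (n : nat) :
  (forall z, disc z -> f z = g z) -> taylor f n = taylor g n.
Proof.
  intros E. unfold taylor. apply cmean_ext. intros t. rewrite E; [reflexivity|].
  unfold disc. rewrite Cmod_polar; lra.
Qed.

Global Opaque taylor.

Lemma taylor_0 (f : C -> C) : analytic_on_disc f -> taylor f 0 = f 0%C.
Proof. intros H. symmetry. apply expansion_at_0, taylor_expansion, H. Qed.

Lemma taylor_S (f : C -> C) (n : nat) : analytic_on_disc f ->
  (RtoC (INR (S n)) * taylor f (S n))%C = taylor (C_derive f) n.
Proof.
  intros H. rewrite <- (expansion_taylor (dcoef (taylor f)) (C_derive f) n); [reflexivity|].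
  apply expansion_deriv, taylor_expansion, H.
Qed.

Lemma taylor_plus (f g : C -> C) (n : nat) : analytic_on_disc f -> analytic_on_disc g ->
  taylor (fun z => f z + g z)%C n = (taylor f n + taylor g n)%C.
Proof.
  intros Hf Hg. symmetry.
  apply (expansion_taylor (fun n => taylor f n + taylor g n)%C (fun z => f z + g z)%C n).
  apply expansion_plus; apply taylor_expansion; assumption.
Qed.

Lemma taylor_cmult (c : C) (f : C -> C) (n : nat) : analytic_on_disc f ->
  taylor (fun z => c * f z)%C n = (c * taylor f n)%C.
Proof.
  intros Hf. symmetry.
  apply (expansion_taylor (fun n => c * taylor f n)%C (fun z => c * f z)%C n).
  apply expansion_cmult; apply taylor_expansion; assumption.
Qed.

(** Leibniz' rule turns into the Cauchy product. *)
Lemma taylor_mult (f g : C -> C) (n : nat) : analytic_on_disc f -> analytic_on_disc g ->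
  taylor (fun z => f z * g z)%C n = conv (taylor f) (taylor g) n.
Proof.
  revert f g. induction n as [|n IH]; intros f g Hf Hg.
  - rewrite taylor_0 by (apply analytic_mult; assumption). unfold conv. simpl.
    rewrite !taylor_0 by assumption. ring.
  - assert (HS : RtoC (INR (S n)) <> 0%C) by apply RtoC_INR_S_neq_0.
    assert (Hf' := analytic_C_derive f Hf). assert (Hg' := analytic_C_derive g Hg).
    assert (E : (RtoC (INR (S n)) * taylor (fun z => f z * g z)%C (S n))%C
       = (RtoC (INR (S n)) * conv (taylor f) (taylor g) (S n))%C).
    { rewrite taylor_S by (apply analytic_mult; assumption).
      change (RtoC (INR (S n)) * conv (taylor f) (taylor g) (S n))%C with (dcoef (conv (taylor f) (taylor g)) n).
      rewrite dcoef_conv.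
      rewrite (taylor_ext _ (fun z => C_derive f z * g z + f z * C_derive g z)%C).
      - rewrite taylor_plus by (apply analytic_mult; assumption).
        rewrite !IH by assumption.
        f_equal; unfold conv; apply csum_ext; intros k Hk; f_equal; unfold dcoef; symmetry; apply taylor_S; assumption.
      - intros z Hz. apply cderiv_C_derive. apply cderiv_mult; apply analytic_cderiv; assumption. }
    replace (taylor (fun z => f z * g z)%C (S n)) with
      (/ RtoC (INR (S n)) * (RtoC (INR (S n)) * taylor (fun z => f z * g z)%C (S n)))%C by (field; exact HS).
    rewrite E. field. exact HS.
Qed.

Lemma taylor_abs_conv (f : C -> C) : analytic_on_disc f -> abs_conv (taylor f).
Proof. intros H. eapply expansion_abs_conv. apply taylor_expansion, H. Qed.

(** The Cauchy product of nonnegative series, for sequences [c] dominated by it. *)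
Lemma product_bound (x y c : nat -> R) (r : R) : 0 <= r ->
  (forall n, 0 <= x n) -> (forall n, 0 <= y n) ->
  ex_series (fun n => x n * r ^ n) -> ex_series (fun n => y n * r ^ n) ->
  (forall n, 0 <= c n <= rsum (fun k => x k * y (n - k)%nat) (S n)) ->
  ex_series (fun n => c n * r ^ n) /\
  Series (fun n => c n * r ^ n) <= Series (fun n => x n * r ^ n) * Series (fun n => y n * r ^ n).
Proof.
  intros Hr Hx Hy Ex Ey Hc.
  assert (Hp : forall n, 0 <= r ^ n) by (intros; apply pow_le; exact Hr).
  assert (Habs : forall z : nat -> R, (forall n, 0 <= z n) -> ex_series (fun n => z n * r ^ n) ->
     ex_series (fun n => Rabs (z n * r ^ n))).
  { intros z Hz Ez. revert Ez. apply ex_series_ext. intros n. symmetry. apply Rabs_right, Rle_ge, Rmult_le_pos; auto. }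
  assert (P := is_series_mult _ _ _ _ (Series_correct _ Ex) (Series_correct _ Ey) (Habs _ Hx Ex) (Habs _ Hy Ey)).
  assert (L : forall n, 0 <= c n * r ^ n <=
     sum_f_R0 (fun k => x k * r ^ k * (y (n - k)%nat * r ^ (n - k))) n).
  { intros n. split; [apply Rmult_le_pos; [apply Hc|auto]|].
    rewrite <- sum_n_Reals, sum_n_rsum.
    eapply Rle_trans; [apply Rmult_le_compat_r; [auto|apply Hc]|].
    rewrite Rmult_comm, <- rsum_mult. apply rsum_le. intros k Hk.
    replace (r ^ n) with (r ^ k * r ^ (n - k)) by (rewrite <- pow_add; f_equal; lia). lra. }
  split.
  - apply (ex_series_le (V := R_CompleteNormedModule) _ (fun n => sum_f_R0 (fun k => x k * r ^ k * (y (n - k)%nat * r ^ (n - k))) n)).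
    + intros n. change (Rabs (c n * r ^ n) <= sum_f_R0 (fun k => x k * r ^ k * (y (n - k)%nat * r ^ (n - k))) n).
      rewrite Rabs_right; [apply L|apply Rle_ge, L].
    + eexists; exact P.
  - rewrite <- (is_series_unique _ _ P). apply Series_le; [exact L|]. eexists; exact P.
Qed.

Lemma majorant_conv (a b : nat -> C) (r : R) : abs_conv a -> abs_conv b -> 0 <= r < 1 ->
  majorant (conv a b) r <= majorant a r * majorant b r.
Proof.
  intros Ha Hb Hr. apply (product_bound (fun n => Cmod (a n)) (fun n => Cmod (b n)));
    try (intros; apply Cmod_ge_0); [lra|apply Ha, Hr|apply Hb, Hr|].
  intros n. split; [apply Cmod_ge_0|]. unfold conv. eapply Rle_trans; [apply Cmod_csum|].
  right. apply rsum_ext. intros k _. apply Cmod_mult.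
Qed.

(** * Coefficient bounds and majorants *)

Lemma cmean_Re_nonneg (F : C -> C) (r : R) : cont_on_circle F r ->
  (forall t, 0 <= Re (F (polar r t))) -> 0 <= Re (cmean F r).
Proof.
  intros HF HR. pose proof PI_RGT_0.
  assert (I := circle_integrable F r HF). destruct I as [I1 _].
  assert (A : 0 <= RInt (fun t => Re (F (polar r t))) 0 (2 * PI)).
  { apply RInt_ge_0; [lra|exact I1|]. intros; apply HR. }
  unfold cmean. rewrite <- RtoC_inv by lra.
  unfold CInt, Cmult, RtoC, Re at 1; simpl fst; simpl snd.
  assert (0 < / (2 * PI)) by (apply Rinv_0_lt_compat; lra). nra.
Qed.

Lemma Cconj_polar_1 (t : R) : Cconj (polar 1 t) = (/ polar 1 t)%C.
Proof.
  assert (E : (Cconj (polar 1 t) * polar 1 t)%C = 1%C).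
  { unfold Cconj, polar, Cmult, RtoC; simpl. assert (S := sin2_cos2 t). unfold Rsqr in S. f_equal; lra. }
  assert (Hn : polar 1 t <> 0%C) by (apply Cmod_gt_0; rewrite Cmod_polar; lra).
  replace (Cconj (polar 1 t)) with (Cconj (polar 1 t) * polar 1 t * / polar 1 t)%C by (field; exact Hn).
  rewrite E. ring.
Qed.

Lemma polar_1_neq_0 (t : R) : polar 1 t <> 0%C.
Proof. apply Cmod_gt_0. rewrite Cmod_polar; lra. Qed.

Lemma unimodular_phase (z : C) : exists e, Cmod e = 1 /\ (e * z)%C = RtoC (Cmod z).
Proof.
  destruct (polar_form z) as [t [_ E]]. exists (Cconj (polar 1 t)). split.
  - rewrite Cmod_conj, Cmod_polar; lra.
  - rewrite E at 1. rewrite (polar_mult (Cmod z) t), Cconj_polar_1. field. apply polar_1_neq_0.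
Qed.

Lemma limit_at_1 (x A D : R) (n : nat) : 0 <= x -> 0 <= D ->
  (forall r, 0 < r < 1 -> x * r ^ n <= A + D * (1 - r)) -> x <= A.
Proof.
  intros Hx HD H. apply Rnot_lt_le. intros Hlt.
  assert (Hn : 0 <= INR n) by apply pos_INR.
  assert (Hnx : 0 <= INR n * x) by (apply Rmult_le_pos; assumption).
  assert (Hk : exists k, k = INR n * x + D + (x - A) + 1) by (eexists; reflexivity).
  destruct Hk as [k Ek]. assert (Hk : 0 < k) by lra.
  assert (He : exists e, 0 < e /\ e * k = (x - A) / 2).
  { exists ((x - A) / (2 * k)). split; [apply Rdiv_lt_0_compat; lra|field; lra]. }
  destruct He as (e & He0 & Hek).
  assert (He1 : e < 1).
  { apply Rnot_le_lt. intros K. assert (1 * k <= e * k) by (apply Rmult_le_compat_r; lra). lra. }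
  specialize (H (1 - e) ltac:(lra)).
  assert (B : 1 - INR n * e <= (1 - e) ^ n).
  { assert (P : forall m, 1 - INR m * e <= (1 - e) ^ m).
    { induction m as [|m IHm]; [simpl; lra|]. rewrite S_INR. simpl pow.
      pose proof (pos_INR m). assert (Q : (1 - e) * (1 - INR m * e) <= (1 - e) * (1 - e) ^ m) by (apply Rmult_le_compat_l; lra).
      assert (0 <= INR m * e * e) by (repeat apply Rmult_le_pos; lra). lra. }
    apply P. }
  assert (Q : x * (1 - INR n * e) <= x * (1 - e) ^ n) by (apply Rmult_le_compat_l; lra).
  rewrite Ek in Hek. nra.
Qed.

(** Caratheodory's inequality: integrate [F] against the nonnegative kernel
    [1 - cos (n t - t0)]. *)
Lemma caratheodory_circle (F : C -> C) (r : R) (n : nat) : analytic_on_disc F -> 0 < r < 1 ->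
  (forall z, Cmod z = r -> 0 <= Re (F z)) -> (1 <= n)%nat ->
  Cmod (taylor F n) * r ^ n <= 2 * Re (F 0%C).
Proof.
  intros HF Hr Hpos Hn.
  destruct (unimodular_phase (taylor F n)) as [e [He Ee]].
  assert (Hrn : 0 < r ^ n) by (apply pow_lt; lra).
  assert (Dq : forall t, exists l, cderiv F (polar r t) l).
  { intros t. eexists. apply analytic_cderiv; [exact HF|]. unfold disc. rewrite Cmod_polar; lra. }
  assert (Hpol : forall t, polar r t <> 0%C) by (intros t; apply Cmod_gt_0; rewrite Cmod_polar; lra).
  assert (C0 : cont_on_circle F r) by (intros t; destruct (Dq t) as [l Hl]; eapply cderiv_ccont; exact Hl).
  assert (D1 : forall t, exists l, cderiv (fun u => F u / u ^ n)%C (polar r t) l).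
  { intros t. destruct (Dq t) as [l Hl]. eexists. apply cderiv_div; [apply Cpow_nz, Hpol|exact Hl|apply cderiv_pow]. }
  assert (D2 : forall t, exists l, cderiv (fun u => F u * u ^ n)%C (polar r t) l).
  { intros t. destruct (Dq t) as [l Hl]. eexists. apply cderiv_mult; [exact Hl|apply cderiv_pow]. }
  set (k1 := (e * RtoC (r ^ n) / 2)%C). set (k2 := (Cconj e / RtoC (r ^ n) / 2)%C).
  assert (C1 : cont_on_circle (fun u => F u / u ^ n)%C r) by (intros t; destruct (D1 t) as [l Hl]; eapply cderiv_ccont; exact Hl).
  assert (C2 : cont_on_circle (fun u => F u * u ^ n)%C r) by (intros t; destruct (D2 t) as [l Hl]; eapply cderiv_ccont; exact Hl).
  assert (C1' : cont_on_circle (fun u => k1 * (F u / u ^ n))%C r).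
  { intros t; destruct (D1 t) as [l Hl]; eapply cderiv_ccont; apply cderiv_cmult; exact Hl. }
  assert (C2' : cont_on_circle (fun u => k2 * (F u * u ^ n))%C r).
  { intros t; destruct (D2 t) as [l Hl]; eapply cderiv_ccont; apply cderiv_cmult; exact Hl. }
  assert (C3 : cont_on_circle (fun u => F u - k1 * (F u / u ^ n))%C r).
  { intros t; destruct (D1 t) as [l Hl]; destruct (Dq t) as [l' Hl']; eapply cderiv_ccont.
    apply cderiv_minus; [exact Hl'|apply cderiv_cmult; exact Hl]. }
  assert (C4 : cont_on_circle (fun u => F u - k1 * (F u / u ^ n) - k2 * (F u * u ^ n))%C r).
  { intros t; destruct (D1 t) as [l Hl]; destruct (Dq t) as [l' Hl']; destruct (D2 t) as [l2 Hl2]; eapply cderiv_ccont.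
    apply cderiv_minus; [|apply cderiv_cmult; exact Hl2].
    apply cderiv_minus; [exact Hl'|apply cderiv_cmult; exact Hl]. }
  assert (HM : 0 <= Re (cmean (fun u => F u - k1 * (F u / u ^ n) - k2 * (F u * u ^ n))%C r)).
  { apply cmean_Re_nonneg; [exact C4|]. intros t.
    set (p := polar 1 t). assert (Hp : p <> 0%C) by apply polar_1_neq_0.
    assert (Hmp : Cmod p = 1) by (unfold p; apply Cmod_polar; lra).
    assert (Hpn : (p ^ n)%C <> 0%C) by (apply Cpow_nz, Hp).
    set (w := (e * / p ^ n)%C).
    assert (Hw : Cconj w = (Cconj e * p ^ n)%C).
    { unfold w. rewrite Cmult_conj, Cinv_conj, Cpow_conj by exact Hpn. unfold p. rewrite Cconj_polar_1.
      fold p. rewrite Cpow_inv by exact Hp. field. exact Hpn. }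
    assert (Hwm : Cmod w = 1).
    { unfold w. rewrite Cmod_mult, Cmod_inv, Cmod_pow, Hmp, He, pow1, Rinv_1 by exact Hpn. ring. }
    assert (E : (F (polar r t) - k1 * (F (polar r t) / polar r t ^ n) - k2 * (F (polar r t) * polar r t ^ n))%C
       = (F (polar r t) * RtoC (1 - Re w))%C).
    { assert (E1 : (RtoC (1 - Re w) = 1 - (w + Cconj w) / 2)%C).
      { destruct w as [a b]. unfold Cconj, Re, RtoC, Cminus, Cplus, Copp, Cdiv, Cmult, Cinv; simpl. f_equal; field. }
      rewrite E1, Hw. unfold k1, k2, w.
      assert (E2 : (polar r t ^ n = RtoC (r ^ n) * p ^ n)%C).
      { rewrite polar_mult, Cpow_mult_l, <- RtoC_pow. reflexivity. }
      rewrite E2. field. repeat split; try exact Hpn; intros K; injection K; lra. }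
    rewrite E. assert (P := Hpos (polar r t) ltac:(apply Cmod_polar; lra)).
    assert (W := re_le_Cmod w). rewrite Hwm in W. assert (W' := Rle_abs (Re w)).
    destruct (F (polar r t)) as [a b]. unfold Re at 1; unfold Re at 1 in P; unfold Cmult, RtoC; simpl in *. nra. }
  rewrite cmean_minus, cmean_minus, !cmean_cmult in HM by assumption.
  rewrite (cmean_center F r HF Hr), (taylor_mean F n r HF Hr) in HM.
  assert (Z : cmean (fun u => F u * u ^ n)%C r = 0%C).
  { rewrite (cmean_center (fun u => F u * u ^ n)%C r); [|apply analytic_intro|exact Hr].
    - destruct n; [lia|]. rewrite Cpow_S. ring.
    - intros z Hz. eexists. apply cderiv_mult; [apply analytic_cderiv; [exact HF|exact Hz]|apply cderiv_pow]. }
  rewrite Z in HM. unfold k1 in HM.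
  replace (F 0%C - e * RtoC (r ^ n) / 2 * taylor F n - k2 * 0)%C
    with (F 0%C - RtoC (r ^ n) / 2 * (e * taylor F n))%C in HM by (field).
  rewrite Ee in HM. destruct (F 0%C) as [a b]. unfold Re in *; simpl in *. lra.
Qed.

Lemma caratheodory (F : C -> C) (n : nat) : analytic_on_disc F ->
  (forall z, disc z -> 0 <= Re (F z)) -> (1 <= n)%nat -> Cmod (taylor F n) <= 2 * Re (F 0%C).
Proof.
  intros HF Hpos Hn. apply (limit_at_1 _ _ 0 n); [apply Cmod_ge_0|lra|].
  intros r Hr. rewrite Rmult_0_l, Rplus_0_r. apply caratheodory_circle; auto.
  intros z Hz. apply Hpos. unfold disc. lra.
Qed.

Lemma analytic_const (k : C) : analytic_on_disc (fun _ => k).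
Proof. apply analytic_intro. intros z _. eexists. apply cderiv_const. Qed.

Lemma analytic_cmult (k : C) (f : C -> C) : analytic_on_disc f -> analytic_on_disc (fun z => k * f z)%C.
Proof. intros H. apply analytic_mult; [apply analytic_const|exact H]. Qed.

Ltac analytic :=
  repeat first
    [ assumption
    | match goal with
      | |- analytic_on_disc (fun _ => ?k) => exact (analytic_const k)
      | |- analytic_on_disc (fun z => @?f z * @?g z)%C => apply (analytic_mult f g)
      | |- analytic_on_disc (fun z => @?f z + @?g z)%C => apply (analytic_plus f g)
      end ].

Lemma taylor_const_S (k : C) (n : nat) : taylor (fun _ => k) (S n) = 0%C.
Proof.
  assert (HS := RtoC_INR_S_neq_0 n).
  assert (E := taylor_S (fun _ => k) n (analytic_const k)).
  rewrite (taylor_ext (C_derive (fun _ => k)) (fun _ => 0 * 0)%C) in E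
    by (intros z _; rewrite (cderiv_C_derive _ _ _ (cderiv_const k z)); ring).
  rewrite (taylor_cmult 0 (fun _ => RtoC 0) n (analytic_const 0)) in E.
  replace (taylor (fun _ => k) (S n)) with (/ RtoC (INR (S n)) * (RtoC (INR (S n)) * taylor (fun _ => k) (S n)))%C
    by (field; exact HS).
  rewrite E. ring.
Qed.

(** The same for a function bounded by [k] on a circle, applied to [k - e w]. *)
Lemma coef_bound_circle (w : C -> C) (r k : R) (n : nat) : analytic_on_disc w -> 0 < r < 1 ->
  (forall z, Cmod z = r -> Cmod (w z) <= k) ->
  Cmod (taylor w (S n)) * r ^ (S n) <= 2 * (k - Cmod (w 0%C)).
Proof.
  intros Hw Hr Hk. destruct (unimodular_phase (w 0%C)) as [e [He Ee]].
  set (F := fun z => (RtoC k + - e * w z)%C).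
  assert (HF : analytic_on_disc F) by (apply analytic_plus; [apply analytic_const|apply analytic_cmult, Hw]).
  assert (E : Cmod (taylor F (S n)) = Cmod (taylor w (S n))).
  { unfold F. rewrite taylor_plus, taylor_const_S, taylor_cmult by analytic.
    rewrite Cplus_0_l, Cmod_mult, Cmod_opp, He. ring. }
  rewrite <- E. eapply Rle_trans; [apply (caratheodory_circle F r (S n)); auto; [|lia]|].
  - intros z Hz. unfold F.
    assert (A := re_le_Cmod (- e * w z)). rewrite Cmod_mult, Cmod_opp, He, Rmult_1_l in A.
    assert (B := Hk z Hz). apply Rabs_le_between in A. 
    unfold Re in *. simpl in *. lra.
  - unfold F. replace (- e * w 0%C)%C with (- (e * w 0%C))%C by ring. rewrite Ee. unfold Re; simpl. lra.
Qed.

Lemma Series_geom_from_1 (r : R) : 0 <= r < 1 -> is_series (fun n => r ^ S n) (r / (1 - r)).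
Proof.
  intros Hr. apply (is_series_ext (fun n => r * r ^ n)); [intros; reflexivity|].
  replace (r / (1 - r)) with (r * / (1 - r)) by reflexivity.
  apply (is_series_scal (V := R_NormedModule) r). apply is_series_geom. rewrite Rabs_right; lra.
Qed.

(** Bohr's radius: the majorant of a function bounded by [k] stays below [k]
    up to [1/3], because [|w n| <= 2 (k - |w 0|)] for [n >= 1]. *)
Lemma bohr_majorant_aux (c : nat -> C) (k r : R) : 0 <= r <= 1 / 3 ->
  Cmod (c 0%nat) <= k -> (forall n, Cmod (c (S n)) <= 2 * (k - Cmod (c 0%nat))) ->
  majorant c r <= k.
Proof.
  intros Hr H0 H. unfold majorant.
  assert (G := Series_geom_from_1 r ltac:(lra)).
  assert (Ex : ex_series (fun n => Cmod (c (S n)) * r ^ S n)).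
  { apply (ex_series_le (V := R_CompleteNormedModule) _ (fun n => 2 * (k - Cmod (c 0%nat)) * r ^ S n)).
    - intros n. change (Rabs (Cmod (c (S n)) * r ^ S n) <= 2 * (k - Cmod (c 0%nat)) * r ^ S n).
      rewrite Rabs_right by (apply Rle_ge, majorant_terms_nonneg; lra).
      apply Rmult_le_compat_r; [apply pow_le; lra|apply H].
    - eexists. apply (is_series_scal (V := R_NormedModule) (2 * (k - Cmod (c 0%nat)))). exact G. }
  rewrite Series_incr_1 by (apply ex_series_incr_1; exact Ex).
  assert (B : Series (fun n => Cmod (c (S n)) * r ^ S n) <= 2 * (k - Cmod (c 0%nat)) * (r / (1 - r))).
  { assert (U := is_series_unique _ _ (is_series_scal (V := R_NormedModule) (2 * (k - Cmod (c 0%nat))) _ _ G)).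
    change (Series (fun n => 2 * (k - Cmod (c 0%nat)) * r ^ S n) = 2 * (k - Cmod (c 0%nat)) * (r / (1 - r))) in U.
    rewrite <- U.
    apply Series_le.
    - intros n. split; [apply majorant_terms_nonneg; lra|]. apply Rmult_le_compat_r; [apply pow_le; lra|apply H].
    - eexists. apply (is_series_scal (V := R_NormedModule) (2 * (k - Cmod (c 0%nat)))). exact G. }
  assert (R2 : r / (1 - r) <= 1 / 2).
  { apply (Rmult_le_reg_r (1 - r)); [lra|]. unfold Rdiv at 1. rewrite Rmult_assoc, Rinv_l; lra. }
  assert (0 <= r / (1 - r)) by (apply Rmult_le_pos; [lra|left; apply Rinv_0_lt_compat; lra]).
  simpl (r ^ 0). nra.
Qed.

Lemma bohr_majorant (w : C -> C) (k r : R) : analytic_on_disc w ->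
  (forall z, disc z -> Cmod (w z) <= k) -> 0 <= r <= 1 / 3 -> majorant (taylor w) r <= k.
Proof.
  intros Hw Hk Hr. apply bohr_majorant_aux; [exact Hr| |].
  - rewrite taylor_0 by exact Hw. apply Hk, disc_0.
  - intros n. rewrite taylor_0 by exact Hw.
    apply (limit_at_1 _ _ 0 (S n)); [apply Cmod_ge_0|lra|]. intros s Hs. rewrite Rmult_0_l, Rplus_0_r.
    apply coef_bound_circle; auto. intros z Hz. apply Hk. unfold disc; lra.
Qed.

(** [(f z - f 0) / z] extended to the origin: shift the Taylor coefficients. *)
Lemma analytic_div_z (f : C -> C) : analytic_on_disc f ->
  exists q : C -> C, analytic_on_disc q /\ (forall z, disc z -> f z = (f 0%C + z * q z)%C) /\
    forall n, taylor q n = taylor f (S n).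
Proof.
  intros Hf. assert (He := taylor_expansion f Hf). assert (Ha := taylor_abs_conv f Hf).
  assert (Hs : abs_conv (fun n => taylor f (S n))).
  { intros r Hr. set (s := (r + 1) / 2). assert (Hs : r <= s < 1 /\ 0 < s) by (unfold s; lra).
    assert (A := Ha s ltac:(lra)). apply ex_series_incr_1 in A.
    apply (ex_series_scal (V := R_NormedModule) (/ s)) in A.
    apply (ex_series_le (V := R_CompleteNormedModule) _ (fun n => / s * (Cmod (taylor f (S n)) * s ^ S n))); [|exact A].
    intros n. change (Rabs (Cmod (taylor f (S n)) * r ^ n) <= / s * (Cmod (taylor f (S n)) * s ^ S n)).
    rewrite Rabs_right by (apply Rle_ge; apply Rmult_le_pos; [apply Cmod_ge_0|apply pow_le; lra]).
    simpl pow. replace (/ s * (Cmod (taylor f (S n)) * (s * s ^ n))) with (Cmod (taylor f (S n)) * s ^ n) by (field; lra).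
    apply Rmult_le_compat_l; [apply Cmod_ge_0|]. apply pow_incr; lra. }
  destruct (abs_conv_expansion _ Hs) as [q Hq]. exists q. split; [|split].
  - eapply expansion_analytic; exact Hq.
  - intros z Hz. apply (cseries_unique (fun n => taylor f n * z ^ n)%C); [apply expansion_cseries; assumption|].
    rewrite <- taylor_0 by exact Hf. replace (taylor f 0) with (taylor f 0 * z ^ 0)%C by (simpl; ring).
    apply (cseries_unshift (fun n => taylor f n * z ^ n)%C).
    assert (D := cseries_cmult z _ _ (expansion_cseries _ _ z Hq Hz)). revert D. apply cseries_ext.
    intros n. rewrite Cpow_S. ring.
  - intros n. symmetry. exact (expansion_taylor _ _ n Hq).
Qed.

(** By Schwarz's lemma [v z / z] is bounded by 1, and so is its majorant. *)
Lemma schwarz_majorant (v : C -> C) (r : R) : analytic_on_disc v ->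
  (forall z, disc z -> disc (v z)) -> v 0%C = 0%C -> 0 <= r <= 1 / 3 ->
  majorant (taylor v) r <= r.
Proof.
  intros Hv Hd H0 Hr. destruct (analytic_div_z v Hv) as (q & Hq & Eq & Tq).
  assert (B : forall s z, 0 < s < 1 -> Cmod z = s -> Cmod (q z) <= / s).
  { intros s z Hs Hz. assert (Hzd : disc z) by (unfold disc; lra).
    assert (E := Eq z Hzd). rewrite H0, Cplus_0_l in E.
    assert (D := Hd z Hzd). unfold disc in D. rewrite E, Cmod_mult, Hz in D.
    apply (Rmult_le_reg_l s); [lra|]. rewrite Rinv_r; lra. }
  assert (Q0 : Cmod (taylor q 0) <= 1).
  { rewrite taylor_0 by exact Hq. apply (limit_at_1 _ _ 2 1); [apply Cmod_ge_0|lra|].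
    intros s Hs. assert (K := coef_bound_circle q s (/ s) 0 Hq Hs (fun z Hz => B s z Hs Hz)).
    assert (P : 0 <= Cmod (taylor q 1) * s ^ 1) by (apply majorant_terms_nonneg; lra).
    assert (K' : Cmod (q 0%C) <= / s) by lra.
    apply (Rmult_le_compat_r s) in K'; [|lra]. rewrite Rinv_l in K' by lra. simpl. lra. }
  assert (Qn : forall n, Cmod (taylor q (S n)) <= 2 * (1 - Cmod (taylor q 0))).
  { intros n. apply (limit_at_1 _ _ 2 (S (S n))); [apply Cmod_ge_0|lra|].
    intros s Hs. rewrite taylor_0 in * by exact Hq.
    assert (K := coef_bound_circle q s (/ s) n Hq Hs (fun z Hz => B s z Hs Hz)).
    apply (Rmult_le_compat_r s) in K; [|lra].
    replace (2 * (/ s - Cmod (q 0%C)) * s) with (2 * (1 - s * Cmod (q 0%C))) in K by (field; lra).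
    replace (Cmod (taylor q (S n)) * s ^ S (S n)) with (Cmod (taylor q (S n)) * s ^ S n * s) by (simpl; ring).
    pose proof (Cmod_ge_0 (q 0%C)). nra. }
  assert (M := bohr_majorant_aux (taylor q) 1 r Hr Q0 Qn).
  unfold majorant in *. rewrite Series_incr_1 by (apply (taylor_abs_conv v Hv); lra).
  rewrite taylor_0 by exact Hv. rewrite H0, Cmod_0, Rmult_0_l, Rplus_0_l.
  rewrite (Series_ext _ (fun n => r * (Cmod (taylor q n) * r ^ n))).
  - rewrite Series_scal_l. nra.
  - intros n. rewrite Tq. simpl. ring.
Qed.

Lemma analytic_pow (v : C -> C) (n : nat) : analytic_on_disc v -> analytic_on_disc (fun z => v z ^ n)%C.
Proof.
  intros H. induction n as [|n IH]; [apply (analytic_const 1)|].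
  change (analytic_on_disc (fun z => v z * v z ^ n)%C). apply analytic_mult; assumption.
Qed.

Lemma analytic_comp (f v : C -> C) : analytic_on_disc f -> analytic_on_disc v ->
  (forall z, disc z -> disc (v z)) -> analytic_on_disc (fun z => f (v z)).
Proof.
  intros Hf Hv Hd. apply analytic_intro. intros z Hz. eexists.
  apply (cderiv_comp f v); apply analytic_cderiv; auto.
Qed.

Lemma majorant_const_1 (r : R) : 0 <= r < 1 -> majorant (taylor (fun _ => 1%C)) r <= 1.
Proof.
  intros Hr. unfold majorant. apply series_of_bounded.
  - intros n; apply majorant_terms_nonneg; lra.
  - intros n. destruct n as [|n]; [simpl; lra|]. rewrite rsum_shift.
    rewrite (rsum_ext _ (fun k => 0 * 0)) by (intros; rewrite taylor_const_S, Cmod_0; ring).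
    rewrite rsum_mult, taylor_0, Cmod_1 by apply analytic_const. simpl. lra.
Qed.

Lemma majorant_nonneg (a : nat -> C) (r : R) : abs_conv a -> 0 <= r < 1 -> 0 <= majorant a r.
Proof.
  intros Ha Hr. apply (rsum_le_Series (fun n => Cmod (a n) * r ^ n) 0); [|apply Ha, Hr].
  intros; apply majorant_terms_nonneg; lra.
Qed.

Lemma majorant_pow (v : C -> C) (r m : R) (n : nat) : analytic_on_disc v -> 0 <= r < 1 ->
  majorant (taylor v) r <= m -> majorant (taylor (fun z => v z ^ n)%C) r <= m ^ n.
Proof.
  intros Hv Hr Hm. induction n as [|n IH]; [apply majorant_const_1, Hr|].
  assert (A : majorant (taylor (fun z => v z ^ S n)%C) r <=
     majorant (taylor v) r * majorant (taylor (fun z => v z ^ n)%C) r).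
  { replace (taylor (fun z => v z ^ S n)%C) with (conv (taylor v) (taylor (fun z => v z ^ n)%C)).
    - apply majorant_conv; [apply taylor_abs_conv, Hv|apply taylor_abs_conv, analytic_pow, Hv|exact Hr].
    - apply functional_extensionality. intros k. symmetry.
      apply (taylor_mult v (fun z => v z ^ n)%C k Hv (analytic_pow v n Hv)). }
  eapply Rle_trans; [exact A|]. simpl.
  apply Rmult_le_compat; [| |exact Hm|exact IH]; apply majorant_nonneg; auto; apply taylor_abs_conv; auto.
  apply analytic_pow, Hv.
Qed.

Lemma taylor_pow_vanish (v : C -> C) (s : C -> C) (N l : nat) : analytic_on_disc v -> v 0%C = 0%C ->
  analytic_on_disc s -> (l < N)%nat -> taylor (fun z => v z ^ N * s z)%C l = 0%C.
Proof.
  intros Hv H0. revert l s. induction N as [|N IH]; intros l s Hs Hl; [lia|].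
  rewrite (taylor_ext _ (fun z => v z * (v z ^ N * s z))%C) by (intros; rewrite Cpow_S; ring).
  assert (Ha : analytic_on_disc (fun z => v z ^ N * s z)%C) by (apply analytic_mult; [apply analytic_pow|]; assumption).
  rewrite taylor_mult by assumption. unfold conv.
  rewrite csum_shift, taylor_0, H0, Cmult_0_l, Cplus_0_l by exact Hv.
  rewrite (csum_ext _ (fun _ => 0 * 0)%C).
  - rewrite csum_cmult. ring.
  - intros k Hk. rewrite IH; [ring|exact Hs|lia].
Qed.

Lemma taylor_remainder (f : C -> C) (N : nat) : analytic_on_disc f ->
  exists q : C -> C, analytic_on_disc q /\
    forall z, disc z -> f z = (csum (fun k => taylor f k * z ^ k) N + z ^ N * q z)%C.
Proof.
  revert f. induction N as [|N IH]; intros f Hf.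
  - exists f. split; [exact Hf|]. intros z _. simpl. ring.
  - destruct (analytic_div_z f Hf) as (g & Hg & Eg & Tg). destruct (IH g Hg) as (q & Hq & Eq).
    exists q. split; [exact Hq|]. intros z Hz. rewrite csum_shift, (Eg z Hz), (Eq z Hz), taylor_0 by exact Hf.
    rewrite (csum_ext (fun k => taylor f (S k) * z ^ S k)%C (fun k => z * (taylor g k * z ^ k))%C).
    + rewrite csum_cmult. simpl. ring.
    + intros k _. rewrite Tg, Cpow_S. ring.
Qed.

Lemma analytic_csum (u : nat -> C -> C) (N : nat) : (forall k, analytic_on_disc (u k)) ->
  analytic_on_disc (fun z => csum (fun k => u k z) N).
Proof.
  intros H. induction N as [|N IH]; simpl; [apply analytic_const|apply analytic_plus; auto].
Qed.

Lemma taylor_csum (u : nat -> C -> C) (N l : nat) : (forall k, analytic_on_disc (u k)) ->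
  taylor (fun z => csum (fun k => u k z) N) l = csum (fun k => taylor (u k) l) N.
Proof.
  intros H. induction N as [|N IH]; simpl.
  - rewrite (taylor_ext _ (fun _ => 0 * 0)%C) by (intros; ring).
    rewrite taylor_cmult by apply analytic_const. ring.
  - rewrite taylor_plus by (auto; apply analytic_csum; exact H). rewrite IH. reflexivity.
Qed.

Lemma taylor_comp (K v : C -> C) (N l : nat) : analytic_on_disc K -> analytic_on_disc v ->
  (forall z, disc z -> disc (v z)) -> v 0%C = 0%C -> (l < N)%nat ->
  taylor (fun z => K (v z)) l = csum (fun n => taylor K n * taylor (fun z => v z ^ n) l)%C N.
Proof.
  intros HK Hv Hd H0 Hl. destruct (taylor_remainder K N HK) as (q & Hq & Eq).
  assert (Hqv := analytic_comp q v Hq Hv Hd).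
  assert (Hpow : forall k, analytic_on_disc (fun z => taylor K k * v z ^ k)%C) by (intros; apply analytic_cmult, analytic_pow, Hv).
  rewrite (taylor_ext _ (fun z => csum (fun k => taylor K k * v z ^ k) N + v z ^ N * q (v z))%C) by (intros; apply Eq, Hd; assumption).
  rewrite taylor_plus, (taylor_csum (fun k z => taylor K k * v z ^ k)%C), (taylor_pow_vanish v (fun z => q (v z))); auto.
  - rewrite Cplus_0_r. apply csum_ext. intros k _. apply taylor_cmult, analytic_pow, Hv.
  - apply (analytic_csum (fun k z => taylor K k * v z ^ k)%C). exact Hpow.
  - apply analytic_mult; [apply analytic_pow, Hv|exact Hqv].
Qed.

Lemma rsum_exchange (u : nat -> nat -> R) (N M : nat) :
  rsum (fun l => rsum (fun n => u l n) M) N = rsum (fun n => rsum (fun l => u l n) N) M.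
Proof.
  induction N as [|N IH]; simpl.
  - induction M as [|M IHM]; simpl; [reflexivity|]. rewrite <- IHM. ring.
  - rewrite IH, <- rsum_plus. reflexivity.
Qed.

(** Majorants of subordinate functions: [majorant (K o v) <= majorant K] up to
    [1/3], since there [majorant (v ^ n) <= (majorant v) ^ n <= r ^ n]. *)
Lemma majorant_comp (K v : C -> C) (r : R) : analytic_on_disc K -> analytic_on_disc v ->
  (forall z, disc z -> disc (v z)) -> v 0%C = 0%C -> 0 <= r <= 1 / 3 ->
  majorant (taylor (fun z => K (v z))) r <= majorant (taylor K) r.
Proof.
  intros HK Hv Hd H0 Hr. apply series_of_bounded.
  - intros; apply majorant_terms_nonneg; lra.
  - intros N.
    apply Rle_trans with (rsum (fun l => rsum (fun n => Cmod (taylor K n) * (Cmod (taylor (fun z => v z ^ n)%C l) * r ^ l)) N) N).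
    + apply rsum_le. intros l Hl. rewrite (taylor_comp K v N l) by auto.
      eapply Rle_trans; [apply Rmult_le_compat_r; [apply pow_le; lra|apply Cmod_csum]|].
      rewrite Rmult_comm, <- rsum_mult. right. apply rsum_ext. intros n _. rewrite Cmod_mult. ring.
    + rewrite rsum_exchange. apply Rle_trans with (rsum (fun n => Cmod (taylor K n) * r ^ n) N).
      * apply rsum_le. intros n _. rewrite rsum_mult. apply Rmult_le_compat_l; [apply Cmod_ge_0|].
        eapply Rle_trans; [apply rsum_le_Series|].
        -- intros; apply majorant_terms_nonneg; lra.
        -- apply (taylor_abs_conv (fun z => v z ^ n)%C); [apply analytic_pow, Hv|lra].
        -- apply (majorant_pow v r r n Hv); [lra|]. apply schwarz_majorant; auto.
      * apply rsum_le_Series; [intros; apply majorant_terms_nonneg; lra|]. apply (taylor_abs_conv K HK); lra.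
Qed.

(** Since [g' = w h'] with [|w| <= k], the majorant of [g'] is at most
    [majorant w] times that of [h']; passing from [n b n] to [b n] only helps. *)
Lemma dilatation_majorant (h g : C -> C) (k r : R) : analytic_on_disc h -> analytic_on_disc g ->
  (forall z, disc z -> C_derive h z <> 0%C) ->
  (forall z, disc z -> Cmod (C_derive g z / C_derive h z) <= k) -> 0 <= r <= 1 / 3 ->
  Series (fun n => Cmod (taylor g (S n)) * r ^ S n) <= k * Series (fun n => Cmod (taylor h (S n)) * r ^ S n).
Proof.
  intros Hh Hg Hh0 Hk Hr.
  assert (Hh' := analytic_C_derive h Hh). assert (Hg' := analytic_C_derive g Hg).
  set (w := fun z => (C_derive g z / C_derive h z)%C).
  assert (Hw : analytic_on_disc w).
  { apply analytic_intro. intros z Hz. eexists. apply cderiv_div; [apply Hh0, Hz| |]; apply analytic_cderiv; assumption. }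
  assert (Mw := bohr_majorant w k r Hw Hk Hr).
  assert (E : forall n, (RtoC (INR (S n)) * taylor g (S n))%C = csum (fun j => taylor w j * (RtoC (INR (S (n - j))) * taylor h (S (n - j))))%C (S n)).
  { intros n. rewrite taylor_S by exact Hg. rewrite (taylor_ext _ (fun z => w z * C_derive h z)%C).
    - rewrite taylor_mult by assumption. unfold conv. apply csum_ext. intros j _. rewrite taylor_S by exact Hh. reflexivity.
    - intros z Hz. unfold w. field. apply Hh0, Hz. }
  set (x := fun n => Cmod (taylor w n)). set (y := fun n => Cmod (taylor h (S n))). set (c := fun n => Cmod (taylor g (S n))).
  assert (Sh : forall f : C -> C, analytic_on_disc f -> ex_series (fun n => Cmod (taylor f (S n)) * r ^ n)).
  { intros f Hf. destruct (analytic_div_z f Hf) as (q & Hq & _ & Tq).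
    assert (Q := taylor_abs_conv q Hq r ltac:(lra)). revert Q. apply ex_series_ext. intros n. rewrite Tq. reflexivity. }
  assert (P : Series (fun n => c n * r ^ n) <= Series (fun n => x n * r ^ n) * Series (fun n => y n * r ^ n)).
  { apply product_bound; try (intros; apply Cmod_ge_0); [lra| | |].
    - apply (taylor_abs_conv w Hw). lra.
    - apply Sh, Hh.
    - intros n. split; [apply Cmod_ge_0|]. unfold c, x, y.
      assert (HS : 0 < INR (S n)) by (apply lt_0_INR; lia).
      apply (Rmult_le_reg_l (INR (S n))); [exact HS|].
      rewrite <- (Rabs_right (INR (S n))) at 1 by lra. rewrite <- Cmod_R, <- Cmod_mult, E.
      eapply Rle_trans; [apply Cmod_csum|]. rewrite <- rsum_mult. apply rsum_le. intros j Hj.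
      rewrite !Cmod_mult, Cmod_R, Rabs_right by (apply Rle_ge, pos_INR).
      assert (I : INR (S (n - j)) <= INR (S n)) by (apply le_INR; lia).
      assert (0 <= Cmod (taylor w j) * Cmod (taylor h (S (n - j)))) by (apply Rmult_le_pos; apply Cmod_ge_0). nra. }
  rewrite (Series_ext _ (fun n => r * (c n * r ^ n))) by (intros; unfold c; simpl; ring).
  rewrite (Series_ext (fun n => Cmod (taylor h (S n)) * r ^ S n) (fun n => r * (y n * r ^ n))) by (intros; unfold y; simpl; ring).
  rewrite !Series_scal_l.
  assert (Y : 0 <= Series (fun n => y n * r ^ n)).
  { apply (rsum_le_Series (fun n => y n * r ^ n) 0); [|apply Sh, Hh].
    intros. apply Rmult_le_pos; [apply Cmod_ge_0|apply pow_le; lra]. }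
  assert (Mw' : Series (fun n => x n * r ^ n) <= k) by exact Mw.
  assert (Series (fun n => c n * r ^ n) <= k * Series (fun n => y n * r ^ n)).
  { eapply Rle_trans; [exact P|]. apply Rmult_le_compat_r; assumption. }
  nra.
Qed.

Lemma taylor_mul_z (f : C -> C) (n : nat) : analytic_on_disc f ->
  taylor (fun z => z * f z)%C (S n) = taylor f n /\ taylor (fun z => z * f z)%C 0 = 0%C.
Proof.
  intros Hf. set (a := fun n => match n return C with O => 0%C | S k => taylor f k end).
  assert (Ha : has_expansion a (fun z => z * f z)%C).
  { intros z Hz. apply is_pseries_cseries.
    assert (Sh := cseries_cmult z _ _ (expansion_cseries _ _ z (taylor_expansion f Hf) Hz)).
    apply (cseries_ext _ (fun n => a (S n) * z ^ S n)%C) in Sh; [|intros k; rewrite Cpow_S; unfold a; ring].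
    apply (cseries_unshift (fun n => a n * z ^ n)%C) in Sh.
    replace (z * f z)%C with (a 0%nat * z ^ 0 + z * f z)%C by (unfold a; ring). exact Sh. }
  rewrite <- !(expansion_taylor a _ _ Ha). split; reflexivity.
Qed.

(** * The kernel [((1 + e^{ib} v) / (1 - e^{-ib} v)) ^ gamma] *)

Lemma taylor_geom (w : C) (n : nat) : Cmod w = 1 ->
  Cmod (taylor (fun z => / (1 - w * z))%C n) = 1 /\ analytic_on_disc (fun z => / (1 - w * z))%C.
Proof.
  intros Hw.
  assert (Hne : forall z, disc z -> (1 - w * z)%C <> 0%C).
  { intros z Hz. apply Cmod_gt_0. assert (L := Cmod_lower 1 (- (w * z))).
    rewrite Cmod_opp, Cmod_mult, Hw, Cmod_1 in L. unfold disc in Hz. unfold Cminus. lra. }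
  assert (Ha : analytic_on_disc (fun z => / (1 - w * z))%C).
  { apply analytic_intro. intros z Hz. eexists. apply (cderiv_inv (fun z => 1 - w * z)%C); [apply Hne, Hz|].
    apply cderiv_minus; [apply cderiv_const|apply cderiv_cmult, cderiv_id]. }
  split; [|exact Ha].
  set (f := fun z => (/ (1 - w * z))%C) in *.
  assert (Hid : analytic_on_disc (fun z => z)) by (apply analytic_intro; intros; eexists; apply cderiv_id).
  assert (Hzf : analytic_on_disc (fun z => z * f z)%C) by (apply analytic_mult; assumption).
  induction n as [|n IH].
  - rewrite taylor_0 by exact Ha. unfold f. replace (1 - w * 0)%C with (RtoC 1) by ring.
    rewrite Cmod_inv, Cmod_1; [field|]. intros K; injection K; lra.
  - rewrite (taylor_ext _ (fun z => 1 + w * (z * f z))%C).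
    + rewrite (taylor_plus (fun _ => 1%C) (fun z => w * (z * f z))%C), (taylor_const_S 1), (taylor_cmult w (fun z => z * f z)%C)
        by analytic.
      rewrite (proj1 (taylor_mul_z f n Ha)), Cplus_0_l, Cmod_mult, Hw, IH. ring.
    + intros z Hz. unfold f. field. apply Hne, Hz.
Qed.

(** [lam] is the branch at 0 of the logarithm of [(1 + e^{ib} v) / (1 - e^{-ib} v)]. *)
Definition is_half_plane_log (b : R) (lam : C -> C) : Prop :=
  lam 0%C = 0%C /\ forall z, disc z ->
    cderiv lam z (RtoC (2 * cos b) / ((1 + polar 1 b * z) * (1 - polar 1 (- b) * z)))%C.

Lemma half_plane_factor_1 (b : R) (z : C) : disc z -> (1 + polar 1 b * z)%C <> 0%C.
Proof.
  intros Hz. apply Cmod_gt_0. assert (L := Cmod_lower 1 (polar 1 b * z)).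
  rewrite Cmod_mult, Cmod_1, Cmod_polar in L by lra. unfold disc in Hz. lra.
Qed.

Lemma half_plane_factor_2 (b : R) (z : C) : disc z -> (1 - polar 1 b * z)%C <> 0%C.
Proof.
  intros Hz. apply Cmod_gt_0. assert (L := Cmod_lower 1 (- (polar 1 b * z))).
  rewrite Cmod_opp, Cmod_mult, Cmod_1, Cmod_polar in L by lra. unfold disc in Hz. unfold Cminus. lra.
Qed.

Lemma polar_conj_mul (b : R) : (polar 1 b * polar 1 (- b))%C = 1%C.
Proof.
  rewrite <- polar_1_add. replace (b + - b) with 0 by ring. unfold polar, RtoC.
  rewrite cos_0, sin_0. f_equal; ring.
Qed.

Lemma polar_conj_add (b : R) : (polar 1 b + polar 1 (- b))%C = RtoC (2 * cos b).
Proof. unfold polar, RtoC, Cplus; simpl. rewrite cos_neg, sin_neg. f_equal; ring. Qed.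

Lemma polar_conj_sub (b : R) : (polar 1 b - polar 1 (- b))%C = (2 * Ci * RtoC (sin b))%C.
Proof. unfold polar, RtoC, Ci, Cminus, Cplus, Copp, Cmult; simpl. rewrite cos_neg, sin_neg. f_equal; ring. Qed.

Lemma half_plane_log_exists (b : R) : exists lam, is_half_plane_log b lam.
Proof.
  destruct (analytic_primitive (fun z => RtoC (2 * cos b) / ((1 + polar 1 b * z) * (1 - polar 1 (- b) * z)))%C) as [lam H].
  - apply analytic_intro. intros z Hz. eexists.
    apply (cderiv_div (fun _ => RtoC (2 * cos b)) (fun z => (1 + polar 1 b * z) * (1 - polar 1 (- b) * z))%C).
    + apply Cmult_neq_0; [apply half_plane_factor_1, Hz|apply half_plane_factor_2, Hz].
    + apply cderiv_const.
    + apply cderiv_mult; [apply cderiv_plus|apply cderiv_minus]; try apply cderiv_const; apply cderiv_cmult, cderiv_id.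
  - exists lam. exact H.
Qed.

Lemma half_plane_log_exp (b : R) (lam : C -> C) (z : C) : is_half_plane_log b lam -> disc z ->
  cexp (lam z) = ((1 + polar 1 b * z) / (1 - polar 1 (- b) * z))%C.
Proof.
  intros [H0 H] Hz.
  set (f := fun z => (cexp (- lam z) * ((1 + polar 1 b * z) / (1 - polar 1 (- b) * z)))%C).
  assert (D : forall z, disc z -> cderiv f z 0%C).
  { intros u Hu. assert (N1 := half_plane_factor_1 b u Hu). assert (N2 := half_plane_factor_2 (- b) u Hu).
    eapply cderiv_eq.
    - apply cderiv_mult.
      + apply (cderiv_cexp_comp (fun z => - lam z)%C). apply cderiv_opp, H, Hu.
      + apply (cderiv_div (fun z => 1 + polar 1 b * z)%C (fun z => 1 - polar 1 (- b) * z)%C); [exact N2| |];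
          [apply cderiv_plus|apply cderiv_minus]; try apply cderiv_const; apply cderiv_cmult, cderiv_id.
    - cbv beta. rewrite <- (polar_conj_add b).
      revert N1 N2. generalize (polar 1 b) (polar 1 (- b)) (cexp (- lam u)).
      intros p q e N1 N2. field. split; assumption. }
  assert (E := analytic_constant f D z Hz). unfold f in E. rewrite H0 in E.
  replace (- 0)%C with (RtoC 0) in E by ring. rewrite cexp_0 in E.
  replace (1 * ((1 + polar 1 b * 0) / (1 - polar 1 (- b) * 0)))%C with (RtoC 1) in E.
  - rewrite cexp_opp in E. assert (N := cexp_neq_0 (lam z)).
    transitivity (cexp (lam z) * (/ cexp (lam z) * ((1 + polar 1 b * z) / (1 - polar 1 (- b) * z))))%C.
    + rewrite E. ring.
    + generalize dependent ((1 + polar 1 b * z) / (1 - polar 1 (- b) * z))%C.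
      intros y _. field. exact N.
  - rewrite !Cmult_0_r. field.
Qed.

Definition kernel (gam : R) (lam : C -> C) (z : C) : C := cexp (RtoC gam * lam z).

Definition half_plane_log' (b : R) (z : C) : C :=
  (RtoC (2 * cos b) / ((1 + polar 1 b * z) * (1 - polar 1 (- b) * z)))%C.

Section Kernel.

Variables (b gam : R) (lam : C -> C).
Hypothesis Hlam : is_half_plane_log b lam.
Hypothesis Hgam : 0 <= gam <= 1.

Local Notation ker := (kernel gam lam).
Local Notation k := (taylor (kernel gam lam)).
Local Notation lam' := (half_plane_log' b).

Lemma ker_cderiv (z : C) : disc z -> cderiv ker z (RtoC gam * (lam' z * ker z))%C.
Proof.
  intros Hz. eapply cderiv_eq.
  - apply (cderiv_cexp_comp (fun z => RtoC gam * lam z)%C). apply cderiv_cmult. apply Hlam, Hz.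
  - unfold half_plane_log', kernel. ring.
Qed.

Lemma ker_analytic : analytic_on_disc ker.
Proof. apply analytic_intro. intros z Hz. eexists. apply ker_cderiv, Hz. Qed.

Lemma ker_coef_0 : k 0 = 1%C.
Proof.
  rewrite taylor_0 by apply ker_analytic. unfold kernel. rewrite (proj1 Hlam).
  replace (RtoC gam * 0)%C with (RtoC 0) by ring. apply cexp_0.
Qed.

Lemma lam'_coef (n : nat) : analytic_on_disc lam' /\ Cmod (taylor lam' n) <= 2.
Proof.
  set (g1 := fun z => (/ (1 - (- polar 1 b) * z))%C). set (g2 := fun z => (/ (1 - polar 1 (- b) * z))%C).
  assert (M1 : Cmod (- polar 1 b) = 1) by (rewrite Cmod_opp; apply Cmod_polar; lra).
  assert (M2 : Cmod (polar 1 (- b)) = 1) by (apply Cmod_polar; lra).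
  destruct (taylor_geom _ n M1) as [T1 A1]. destruct (taylor_geom _ n M2) as [T2 A2].
  fold g1 in T1, A1. fold g2 in T2, A2.
  assert (E : forall z, disc z -> lam' z = (polar 1 b * g1 z + polar 1 (- b) * g2 z)%C).
  { intros z Hz. assert (N1 := half_plane_factor_1 b z Hz). assert (N2 := half_plane_factor_2 (- b) z Hz).
    unfold half_plane_log', g1, g2. rewrite <- polar_conj_add.
    replace (1 - - polar 1 b * z)%C with (1 + polar 1 b * z)%C by ring.
    revert N1 N2. generalize (polar 1 b) (polar 1 (- b)). intros p q N1 N2. field. split; assumption. }
  split.
  - apply analytic_intro. intros z Hz. eexists. unfold half_plane_log'.
    apply (cderiv_div (fun _ => RtoC (2 * cos b)) (fun z => (1 + polar 1 b * z) * (1 - polar 1 (- b) * z))%C).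
    + apply Cmult_neq_0; [apply half_plane_factor_1, Hz|apply half_plane_factor_2, Hz].
    + apply cderiv_const.
    + apply cderiv_mult; [apply cderiv_plus|apply cderiv_minus]; try apply cderiv_const; apply cderiv_cmult, cderiv_id.
  - rewrite (taylor_ext _ _ n E), taylor_plus, !taylor_cmult by analytic.
    eapply Rle_trans; [apply Cmod_triangle|]. rewrite !Cmod_mult, T1, T2, !Cmod_polar by lra. lra.
Qed.

Lemma ker_coef_1 : k 1 = RtoC (2 * gam * cos b).
Proof.
  assert (E := taylor_S ker 0 ker_analytic). rewrite taylor_0 in E by apply analytic_C_derive, ker_analytic.
  rewrite (cderiv_C_derive _ _ _ (ker_cderiv 0 disc_0)) in E.
  assert (K0 := ker_coef_0). rewrite taylor_0 in K0 by apply ker_analytic.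
  rewrite K0 in E. unfold half_plane_log' in E.
  replace (RtoC (INR 1) * k 1)%C with (k 1) in E by (simpl; ring). rewrite E.
  replace ((1 + polar 1 b * 0) * (1 - polar 1 (- b) * 0))%C with (RtoC 1) by ring.
  rewrite !RtoC_mult. field.
Qed.

(** Recurrence of [((1 + e^{ib} v) / (1 - e^{-ib} v)) ^ gam], from the
    differential equation [(1 + 2 i sin b v - v ^ 2) ker' = 2 gam cos b ker]. *)
Lemma ker_recurrence (n : nat) :
  (RtoC (INR (S (S n))) * k (S (S n)) = 2 * (RtoC (gam * cos b) - RtoC (INR (S n) * sin b) * Ci) * k (S n)
     + RtoC (INR n) * k n)%C.
Proof.
  set (D := C_derive ker).
  assert (HD : analytic_on_disc D) by (apply analytic_C_derive, ker_analytic).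
  assert (Hid : analytic_on_disc (fun z => z)) by (apply analytic_intro; intros; eexists; apply cderiv_id).
  assert (HzD : analytic_on_disc (fun z => z * D z)%C) by (apply analytic_mult; assumption).
  assert (HzzD : analytic_on_disc (fun z => z * (z * D z))%C) by (apply analytic_mult; assumption).
  assert (HT : forall j, taylor D j = (RtoC (INR (S j)) * k (S j))%C) by (intros; symmetry; apply taylor_S, ker_analytic).
  assert (E : forall z, disc z -> (D z + ((2 * Ci * RtoC (sin b)) * (z * D z) + - (1) * (z * (z * D z))))%C
      = (RtoC (2 * gam * cos b) * ker z)%C).
  { intros z Hz. unfold D. rewrite (cderiv_C_derive _ _ _ (ker_cderiv z Hz)).
    assert (N1 := half_plane_factor_1 b z Hz). assert (N2 := half_plane_factor_2 (- b) z Hz).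
    rewrite <- polar_conj_sub.
    assert (P := polar_conj_mul b). set (p := polar 1 b) in *. set (q := polar 1 (- b)) in *.
    transitivity ((1 + p * z) * (1 - q * z) * (RtoC gam * (lam' z * ker z)))%C.
    - replace ((1 + p * z) * (1 - q * z))%C with (1 + ((p - q) * z + - (1) * (z * z)))%C.
      + ring.
      + transitivity (1 + ((p - q) * z + - (p * q) * (z * z)))%C; [rewrite P; ring|ring].
    - unfold half_plane_log'. fold p q. rewrite !RtoC_mult. field. split; assumption. }
  assert (F : taylor (fun z => D z + ((2 * Ci * RtoC (sin b)) * (z * D z) + - (1) * (z * (z * D z))))%C (S n)
     = taylor (fun z => RtoC (2 * gam * cos b) * ker z)%C (S n)) by (apply taylor_ext; exact E).
  rewrite taylor_plus, taylor_plus, !taylor_cmult in F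
    by (pose proof ker_analytic; analytic).
  rewrite (proj1 (taylor_mul_z D n HD)) in F.
  rewrite (proj1 (taylor_mul_z (fun z => z * D z)%C n HzD)) in F.
  rewrite !HT in F.
  assert (Z : taylor (fun z => z * D z)%C n = (RtoC (INR n) * k n)%C).
  { destruct n as [|n]; [rewrite (proj2 (taylor_mul_z D 0 HD)); simpl; ring|].
    rewrite (proj1 (taylor_mul_z D n HD)). apply HT. }
  rewrite Z in F.
  transitivity (RtoC (INR (S (S n))) * k (S (S n)) + (2 * Ci * RtoC (sin b) * (RtoC (INR (S n)) * k (S n)) + - (1) * (RtoC (INR n) * k n))
    - (2 * Ci * RtoC (sin b) * (RtoC (INR (S n)) * k (S n)) + - (1) * (RtoC (INR n) * k n)))%C; [ring|].
  rewrite F. rewrite !RtoC_mult. ring.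
Qed.

Lemma ker_coef_sum (n : nat) : INR (S n) * Cmod (k (S n)) <= 2 * gam * rsum (fun j => Cmod (k j)) (S n).
Proof.
  assert (HL := proj1 (lam'_coef 0)).
  assert (E : (RtoC (INR (S n)) * k (S n))%C = (RtoC gam * conv (taylor ker) (taylor lam') n)%C).
  { rewrite taylor_S by apply ker_analytic.
    rewrite (taylor_ext _ (fun z => RtoC gam * (ker z * lam' z))%C).
    - rewrite taylor_cmult, taylor_mult by (pose proof ker_analytic; analytic). reflexivity.
    - intros z Hz. rewrite (cderiv_C_derive _ _ _ (ker_cderiv z Hz)). ring. }
  assert (E' : INR (S n) * Cmod (k (S n)) = gam * Cmod (conv (taylor ker) (taylor lam') n)).
  { rewrite <- (Rabs_right (INR (S n))) by (apply Rle_ge, pos_INR). rewrite <- Cmod_R, <- Cmod_mult, E, Cmod_mult, Cmod_R.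
    rewrite (Rabs_right gam) by lra. reflexivity. }
  rewrite E'. rewrite (Rmult_comm 2), Rmult_assoc. apply Rmult_le_compat_l; [lra|].
  unfold conv. eapply Rle_trans; [apply Cmod_csum|]. rewrite <- rsum_mult. apply rsum_le. intros j Hj.
  rewrite Cmod_mult. rewrite Rmult_comm. apply Rmult_le_compat_r; [apply Cmod_ge_0|]. apply lam'_coef.
Qed.

End Kernel.

(** Coefficients of [(1 - z) ^ (- 2 gam)], which dominate those of the kernel. *)
Fixpoint tdom (gam : R) (n : nat) : R :=
  match n with O => 1 | S m => (INR m + 2 * gam) / INR (S m) * tdom gam m end.

(** [n tdom n] is the convolution of [tdom] with the coefficients [2 gam] of the
    logarithmic derivative; the kernel obeys the same relation as an inequality,
    by [ker_coef_sum]. *)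
Lemma tdom_sum (gam : R) (n : nat) : INR (S n) * tdom gam (S n) = 2 * gam * rsum (tdom gam) (S n).
Proof.
  induction n as [|n IH].
  - simpl. field.
  - change (rsum (tdom gam) (S (S n))) with (rsum (tdom gam) (S n) + tdom gam (S n)).
    rewrite Rmult_plus_distr_l, <- IH.
    change (tdom gam (S (S n))) with ((INR (S n) + 2 * gam) / INR (S (S n)) * tdom gam (S n)).
    field. apply not_0_INR; lia.
Qed.

Lemma tdom_bound (gam : R) (n : nat) : 0 <= gam <= 1 -> (2 <= n)%nat -> tdom gam n <= gam * (1 + gam * INR n).
Proof.
  intros Hg Hn. induction Hn as [|n Hn IH].
  - simpl. right. field.
  - change (tdom gam (S n)) with ((INR n + 2 * gam) / INR (S n) * tdom gam n).
    assert (HS : 0 < INR (S n)) by (apply lt_0_INR; lia).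
    apply (Rmult_le_reg_l (INR (S n))); [exact HS|].
    replace (INR (S n) * ((INR n + 2 * gam) / INR (S n) * tdom gam n)) with ((INR n + 2 * gam) * tdom gam n) by (field; lra).
    assert (H2 : 2 <= INR n) by (apply (le_INR 2); exact Hn).
    apply Rle_trans with ((INR n + 2 * gam) * (gam * (1 + gam * INR n))); [apply Rmult_le_compat_l; lra|].
    rewrite S_INR. set (x := INR n) in *.
    assert (P : 0 <= gam * (1 - gam + 2 * gam * x * (1 - gam))).
    { apply Rmult_le_pos; [lra|]. assert (0 <= 2 * gam * x * (1 - gam)) by (repeat apply Rmult_le_pos; lra). lra. }
    nra.
Qed.

Lemma kernel_coef_bound (b gam : R) (lam : C -> C) (n : nat) : is_half_plane_log b lam -> 0 <= gam <= 1 ->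
  (2 <= n)%nat -> Cmod (taylor (kernel gam lam) n) <= gam * (1 + gam * INR n).
Proof.
  intros Hl Hg Hn. eapply Rle_trans; [|apply tdom_bound; assumption].
  clear Hn. assert (A : forall m j, (j < m)%nat -> Cmod (taylor (kernel gam lam) j) <= tdom gam j).
  { induction m as [|m IH]; intros j Hj; [lia|].
    destruct j as [|j].
    - rewrite (ker_coef_0 b gam lam Hl), Cmod_1. simpl. lra.
    - assert (HS : 0 < INR (S j)) by (apply lt_0_INR; lia).
      apply (Rmult_le_reg_l (INR (S j))); [exact HS|]. rewrite tdom_sum.
      eapply Rle_trans; [apply (ker_coef_sum b gam lam Hl Hg)|].
      apply Rmult_le_compat_l; [lra|]. apply rsum_le. intros i Hi. apply IH. lia. }
  apply (A (S n)). lia.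
Qed.

(** Two consecutive coefficients of [((1 + z) / (1 - z)) ^ gam], which satisfy a
    two-step recurrence. *)
Fixpoint scoef2 (gam : R) (n : nat) : R * R :=
  match n with
  | O => (1, 2 * gam)
  | S m => let (x, y) := scoef2 gam m in (y, (2 * gam * y + INR m * x) / INR (S (S m)))
  end.

Definition scoef (gam : R) (n : nat) : R := fst (scoef2 gam n).

Lemma scoef_S (gam : R) (n : nat) : scoef gam (S n) = snd (scoef2 gam n).
Proof. unfold scoef. simpl. destruct (scoef2 gam n). reflexivity. Qed.

Lemma scoef_rec (gam : R) (n : nat) :
  INR (S (S n)) * scoef gam (S (S n)) = 2 * gam * scoef gam (S n) + INR n * scoef gam n.
Proof.
  rewrite !scoef_S. unfold scoef.
  change (scoef2 gam (S n)) with (let (x, y) := scoef2 gam n in (y, (2 * gam * y + INR n * x) / INR (S (S n)))).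
  destruct (scoef2 gam n) as [x y]. cbn [fst snd].
  field. apply not_0_INR; lia.
Qed.

Lemma scoef_nonneg (gam : R) (n : nat) : 0 <= gam -> 0 <= scoef gam n.
Proof.
  intros Hg. assert (A : 0 <= scoef gam n /\ 0 <= scoef gam (S n)); [|apply A].
  induction n as [|n [I1 I2]].
  - unfold scoef; simpl. lra.
  - split; [exact I2|]. assert (HS : 0 < INR (S (S n))) by (apply lt_0_INR; lia).
    apply (Rmult_le_reg_l (INR (S (S n)))); [exact HS|]. rewrite scoef_rec, Rmult_0_r.
    pose proof (pos_INR n). assert (0 <= 2 * gam * scoef gam (S n)) by (apply Rmult_le_pos; lra).
    assert (0 <= INR n * scoef gam n) by (apply Rmult_le_pos; lra). lra.
Qed.

Lemma kernel_coef_symmetric (gam : R) (lam : C -> C) (n : nat) : is_half_plane_log 0 lam -> 0 <= gam <= 1 ->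
  taylor (kernel gam lam) n = RtoC (scoef gam n).
Proof.
  intros Hl Hg. assert (A : taylor (kernel gam lam) n = RtoC (scoef gam n) /\
    taylor (kernel gam lam) (S n) = RtoC (scoef gam (S n))); [|apply A].
  induction n as [|n [I1 I2]].
  - rewrite (ker_coef_0 0 gam lam Hl), (ker_coef_1 0 gam lam Hl), cos_0.
    unfold scoef; simpl. split; [reflexivity|]. f_equal. ring.
  - split; [exact I2|]. assert (HS := RtoC_INR_S_neq_0 (S n)).
    assert (E := ker_recurrence 0 gam lam Hl n). rewrite I1, I2, cos_0, sin_0 in E.
    replace (taylor (kernel gam lam) (S (S n))) with
      (/ RtoC (INR (S (S n))) * (RtoC (INR (S (S n))) * taylor (kernel gam lam) (S (S n))))%C by (field; exact HS).
    rewrite E.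
    replace (scoef gam (S (S n))) with (/ INR (S (S n)) * (2 * gam * scoef gam (S n) + INR n * scoef gam n)).
    + rewrite !RtoC_mult, RtoC_plus, !RtoC_mult, RtoC_inv by (apply not_0_INR; lia). ring.
    + rewrite <- scoef_rec. field. apply not_0_INR; lia.
Qed.

Lemma csum_RtoC (u : nat -> R) (n : nat) : csum (fun k => RtoC (u k)) n = RtoC (rsum u n).
Proof. induction n as [|n IH]; simpl; [reflexivity|]. rewrite IH, RtoC_plus. reflexivity. Qed.

Lemma scoef_sum_le (gam r : R) (N : nat) : 0 <= gam <= 1 -> 0 <= r < 1 ->
  rsum (fun n => scoef gam n * r ^ n) N <= Rpower ((1 + r) / (1 - r)) gam.
Proof.
  intros Hg Hr. destruct (half_plane_log_exists 0) as [lam Hl].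
  assert (Hd : disc (RtoC r)) by (unfold disc; rewrite Cmod_R, Rabs_right; lra).
  assert (Hq : 0 < (1 + r) / (1 - r)) by (apply Rdiv_lt_0_compat; lra).
  assert (Ek : Cmod (kernel gam lam (RtoC r)) = Rpower ((1 + r) / (1 - r)) gam).
  { unfold kernel. rewrite Cmod_cexp. unfold Rpower. f_equal.
    replace (Re (RtoC gam * lam (RtoC r))) with (gam * Re (lam (RtoC r))) by (unfold Re, Cmult, RtoC; simpl; ring).
    f_equal. assert (E := half_plane_log_exp 0 lam (RtoC r) Hl Hd). apply (f_equal Cmod) in E.
    rewrite Cmod_cexp in E. rewrite <- (ln_exp (Re (lam (RtoC r)))), E. f_equal.
    assert (P : polar 1 0 = 1%C) by (unfold polar, RtoC; rewrite cos_0, sin_0; f_equal; ring).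
    rewrite Ropp_0, P, !Cmult_1_l, <- RtoC_plus, <- RtoC_minus, <- RtoC_div by lra.
    rewrite Cmod_R. apply Rabs_right; lra. }
  rewrite <- Ek.
  assert (Hs := expansion_cseries _ _ _ (taylor_expansion _ (ker_analytic 0 gam lam Hl)) Hd).
  apply Rnot_lt_le. intros Hlt. set (M := Cmod (kernel gam lam (RtoC r))) in *.
  set (T := fun n => rsum (fun n => scoef gam n * r ^ n) n) in *.
  change (M < T N) in Hlt.
  destruct (Hs (T N - M)) as [N1 HN1]; [lra|].
  specialize (HN1 (max N N1) ltac:(lia)).
  rewrite (csum_ext _ (fun n => RtoC (scoef gam n * r ^ n))) in HN1.
  - rewrite csum_RtoC in HN1.
    assert (A := Cmod_lower (RtoC (T (max N N1))) (- kernel gam lam (RtoC r))).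
    rewrite Cmod_opp in A. fold M in A.
    assert (B : T N <= T (max N N1)).
    { apply rsum_incr; [|lia]. intros; apply Rmult_le_pos; [apply scoef_nonneg; lra|apply pow_le; lra]. }
    rewrite Cmod_R in A. assert (L := Rle_abs (T (max N N1))). unfold Cminus in HN1. fold (T (max N N1)) in HN1. lra.
  - intros j _. rewrite kernel_coef_symmetric, RtoC_mult, RtoC_pow by assumption. reflexivity.
Qed.

(** ** Comparing the kernel with the symmetric one *)

(** Excess of the kernel coefficients over [scoef], per unit of [sin b ^ 2]. *)
Definition defect (gam : R) (n : nat) : R :=
  (INR n ^ 2 + 2) / 6 + gam * (2 * INR n ^ 3 + INR n ^ 2) / 12.

Section Compare.

Variables (b gam : R) (lam : C -> C).
Hypothesis Hlam : is_half_plane_log b lam.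
Hypothesis Hgam : 0 < gam <= 1.
Hypothesis Hb : 0 < cos b.

Let y (n : nat) : R := Cmod (taylor (kernel gam lam) n).
Let s := sin b.
Let c := cos b.

Lemma sin2_cos2_compare : s * s + c * c = 1.
Proof. assert (H := sin2_cos2 b). unfold Rsqr in H. exact H. Qed.

(** The modulus [sqrt (gam^2 c^2 + n^2 s^2)] exceeds [gam] only to second
    order in [s]; a triangle inequality on [gam c] and [n s] would lose the
    first order. *)
Lemma compare_step (n : nat) :
  INR (S (S n)) * y (S (S n)) <=
  2 * gam * y (S n) + s * s * (INR (S n) ^ 2 - gam ^ 2) * (y (S n) / gam) + INR n * y n.
Proof.
  assert (E := ker_recurrence b gam lam Hlam n). apply (f_equal Cmod) in E.
  rewrite Cmod_mult, Cmod_R, Rabs_right in E by (apply Rle_ge, pos_INR). fold (y (S (S n))) in E. rewrite E.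
  eapply Rle_trans; [apply Cmod_triangle|].
  rewrite !Cmod_mult, !Cmod_R, (Rabs_right (INR n)), (Rabs_right 2) by (try apply Rle_ge; try apply pos_INR; lra).
  fold (y n) (y (S n)). apply Rplus_le_compat_r.
  set (x := INR (S n)). assert (Hx : 1 <= x) by (unfold x; rewrite S_INR; pose proof (pos_INR n); lra).
  assert (Hy : 0 <= y (S n)) by apply Cmod_ge_0.
  assert (SC := sin2_cos2_compare).
  assert (M : Cmod (RtoC (gam * cos b) - RtoC (x * sin b) * Ci) <= gam + s * s * (x ^ 2 - gam ^ 2) / (2 * gam)).
  { set (m := Cmod _). assert (Hm : 0 <= m) by apply Cmod_ge_0.
    assert (Em : m ^ 2 = (gam * c) ^ 2 + (x * s) ^ 2).
    { unfold m. rewrite Cmod2_alt. unfold RtoC, Ci, Cminus, Cplus, Copp, Cmult, Re, Im, c, s; simpl. ring. }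
    (* AM-GM: m <= (m^2 / gam + gam) / 2 *)
    assert (A : 2 * gam * m <= m ^ 2 + gam ^ 2) by (assert (0 <= (m - gam) ^ 2) by apply pow2_ge_0; lra).
    apply (Rmult_le_reg_l (2 * gam)); [lra|].
    replace (2 * gam * (gam + s * s * (x ^ 2 - gam ^ 2) / (2 * gam))) with (2 * gam * gam + s * s * (x ^ 2 - gam ^ 2)) by (field; lra).
    rewrite Em in A. eapply Rle_trans; [exact A|]. right.
    replace ((gam * c) ^ 2 + (x * s) ^ 2 + gam ^ 2) with (gam ^ 2 * (c * c) + x ^ 2 * (s * s) + gam ^ 2) by ring.
    replace (c * c) with (1 - s * s) by lra. ring. }
  apply Rle_trans with (2 * (gam + s * s * (x ^ 2 - gam ^ 2) / (2 * gam)) * y (S n)).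
  - apply Rmult_le_compat_r; [exact Hy|]. lra.
  - right. field. lra.
Qed.

Lemma compare_bound (n : nat) :
  y (S (S n)) <= scoef gam (S (S n)) + s * s * defect gam (S (S n)) /\
  (n = 0%nat -> y (S (S n)) <= scoef gam (S (S n)) + s * s).
Proof.
  assert (SC := sin2_cos2_compare).
  assert (Hs : 0 <= s * s) by nra.
  assert (Hc1 : c <= 1) by (apply COS_bound).
  assert (Y1 : y 1 = 2 * gam * c).
  { unfold y. rewrite (ker_coef_1 b gam lam Hlam), Cmod_R. fold c. apply Rabs_right, Rle_ge.
    apply Rmult_le_pos; [lra|unfold c; lra]. }
  assert (Y1' : y 1 <= 2 * gam) by (rewrite Y1; nra).
  assert (B1 : scoef gam 1 = 2 * gam) by reflexivity.
  assert (B2 : scoef gam 2 = 2 * gam * gam).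
  { unfold scoef; simpl. field. }
  assert (Y2 : y 2 <= scoef gam 2 + s * s).
  { assert (T := compare_step 0). simpl INR in T. rewrite B2.
    assert (Q : y 1 / gam <= 2).
    { apply (Rmult_le_reg_r gam); [lra|]. unfold Rdiv. rewrite Rmult_assoc, Rinv_l; lra. }
    assert (Q0 : 0 <= s * s * (1 - gam ^ 2)) by (apply Rmult_le_pos; [exact Hs|nra]).
    assert (Q1 : s * s * (1 ^ 2 - gam ^ 2) * (y 1 / gam) <= s * s * (1 - gam ^ 2) * 2).
    { rewrite pow1. apply Rmult_le_compat_l; assumption. }
    assert (0 <= s * s * gam ^ 2) by (apply Rmult_le_pos; [exact Hs|apply pow2_ge_0]).
    nra. }
  assert (Hyg : forall m, (2 <= m)%nat -> y m / gam <= 1 + gam * INR m).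
  { intros m Hm. assert (K := kernel_coef_bound b gam lam m Hlam ltac:(lra) Hm). fold (y m) in K.
    apply (Rmult_le_reg_r gam); [lra|]. unfold Rdiv. rewrite Rmult_assoc, Rinv_l by lra. lra. }
  assert (D1 : forall m, (2 <= m)%nat -> s * s * (INR m ^ 2 - gam ^ 2) * (y m / gam) <= s * s * (INR m ^ 2 * (1 + gam * INR m))).
  { intros m Hm. rewrite Rmult_assoc. apply Rmult_le_compat_l; [exact Hs|].
    assert (2 <= INR m) by (apply (le_INR 2); exact Hm).
    assert (0 <= y m / gam) by (apply Rmult_le_pos; [apply Cmod_ge_0|left; apply Rinv_0_lt_compat; lra]).
    apply Rmult_le_compat; [nra|assumption|nra|apply Hyg, Hm]. }
  assert (A : (y (S (S n)) <= scoef gam (S (S n)) + s * s * defect gam (S (S n))) /\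
     (y (S (S (S n))) <= scoef gam (S (S (S n))) + s * s * defect gam (S (S (S n))))).
  { induction n as [|n [I1 I2]].
    - assert (X2 : y 2 <= scoef gam 2 + s * s * defect gam 2).
      { eapply Rle_trans; [exact Y2|]. apply Rplus_le_compat_l. rewrite <- (Rmult_1_r (s * s)) at 1.
        apply Rmult_le_compat_l; [exact Hs|]. unfold defect. simpl INR. nra. }
      split; [exact X2|].
      assert (T := compare_step 1). assert (D := D1 2%nat (le_n 2)). assert (R3 := scoef_rec gam 1).
      assert (P : 0 <= gam * (s * s)) by (apply Rmult_le_pos; lra).
      assert (P2 : gam * y 2 <= gam * (scoef gam 2 + s * s)) by (apply Rmult_le_compat_l; lra).
      unfold defect. simpl INR in *. lra.
    - split; [exact I2|].
      assert (T := compare_step (S (S n))). assert (D := D1 (S (S (S n))) ltac:(lia)).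
      assert (R3 := scoef_rec gam (S (S n))).
      assert (P2 : gam * y (S (S (S n))) <= gam * (scoef gam (S (S (S n))) + s * s * defect gam (S (S (S n)))))
        by (apply Rmult_le_compat_l; [lra|exact I2]).
      assert (HS : 0 <= INR (S (S n))) by apply pos_INR.
      assert (P3 : INR (S (S n)) * y (S (S n)) <= INR (S (S n)) * (scoef gam (S (S n)) + s * s * defect gam (S (S n))))
        by (apply Rmult_le_compat_l; [exact HS|exact I1]).
      set (y4 := y (S (S (S (S n))))) in *. set (B4 := scoef gam (S (S (S (S n))))) in *.
      apply (Rmult_le_reg_l (INR (S (S (S (S n)))))); [apply lt_0_INR; lia|].
      set (x := INR (S (S (S n)))) in *.
      assert (Ex : INR (S (S (S (S n)))) = x + 1) by (unfold x; rewrite (S_INR (S (S (S n)))); reflexivity).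
      assert (Ex' : INR (S (S n)) = x - 1) by (unfold x; rewrite (S_INR (S (S n))); ring).
      assert (Hx : 3 <= x) by (unfold x; rewrite !S_INR; pose proof (pos_INR n); lra).
      unfold defect in *. fold x in P2. rewrite Ex, Ex' in *.
      (* [defect] is a supersolution of the recurrence of [compare_step] *)
      assert (K : 2 * gam * ((x ^ 2 + 2) / 6 + gam * (2 * x ^ 3 + x ^ 2) / 12) + x ^ 2 * (1 + gam * x)
        + (x - 1) * (((x - 1) ^ 2 + 2) / 6 + gam * (2 * (x - 1) ^ 3 + (x - 1) ^ 2) / 12)
        <= (x + 1) * (((x + 1) ^ 2 + 2) / 6 + gam * (2 * (x + 1) ^ 3 + (x + 1) ^ 2) / 12)).
      { assert (K0 : 0 <= gam * (1 - gam) * (x ^ 3 / 3 + x ^ 2 / 6)).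
        { apply Rmult_le_pos; [nra|]. assert (0 <= x ^ 3) by (apply pow_le; lra). assert (0 <= x ^ 2) by (apply pow_le; lra). lra. }
        assert (K1 : 0 <= gam * (4 * x / 3 - 1 / 2)) by (apply Rmult_le_pos; lra). lra. }
      apply (Rmult_le_compat_l (s * s)) in K; [|exact Hs]. lra. }
  split; [apply A|]. intros ->. exact Y2.
Qed.

(** Partial sums of [defect gam n * 3 ^ (1 - n)] from [n = 3] on telescope. *)
Lemma defect_sum (N : nat) : rsum (fun k => defect gam (k + 3) * (1 / 3) ^ (k + 2)) N <= 5 / 12 + 235 / 144 * gam.
Proof.
  set (p := fun x : R => (x ^ 2 + x + 3) / 4 + gam * (x ^ 3 / 4 + x ^ 2 / 2 + 7 / 8 * x + 13 / 16)).
  assert (E : rsum (fun k => defect gam (k + 3) * (1 / 3) ^ (k + 2)) N + p (INR N + 3) * (1 / 3) ^ (N + 2)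
     = 5 / 12 + 235 / 144 * gam).
  { induction N as [|N IH].
    - unfold p. simpl. field.
    - rewrite <- IH. simpl rsum. replace (S N + 2)%nat with (S (N + 2)) by lia. simpl pow.
      rewrite S_INR. unfold defect, p. rewrite plus_INR. simpl (INR 3). field. }
  assert (0 <= p (INR N + 3) * (1 / 3) ^ (N + 2)); [|lra].
  pose proof (pos_INR N). apply Rmult_le_pos; [|apply pow_le; lra]. unfold p.
  set (x := INR N + 3). assert (Hx : 0 <= x) by (unfold x; lra).
  assert (0 <= x ^ 2) by (apply pow_le; lra). assert (0 <= x ^ 3) by (apply pow_le; lra).
  assert (0 <= gam * (x ^ 3 / 4 + x ^ 2 / 2 + 7 / 8 * x + 13 / 16)) by (apply Rmult_le_pos; lra). lra.
Qed.

Lemma compare_majorant_pos (r : R) : 0 <= r <= 1 / 3 ->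
  cos b * majorant (taylor (kernel gam lam)) r <= Rpower ((1 + r) / (1 - r)) gam - (1 - cos b) * (1 - r) ^ 2.
Proof.
  fold c. intros Hr. assert (SC := sin2_cos2_compare).
  assert (Hs : 0 <= s * s) by nra.
  assert (Hc1 : c <= 1) by (apply COS_bound). assert (Hc0 : 0 < c) by exact Hb.
  set (P := Rpower ((1 + r) / (1 - r)) gam).
  assert (M : majorant (taylor (kernel gam lam)) r <= (P - (1 - c) * (1 - r) ^ 2) / c).
  { apply series_of_bounded; [intros; apply majorant_terms_nonneg; lra|]. intros N.
    apply Rle_trans with (rsum (fun n => y n * r ^ n) (S (S (S N)))).
    { apply rsum_incr; [intros; apply majorant_terms_nonneg; lra|lia]. }
    apply (Rmult_le_reg_l c); [exact Hc0|]. replace (c * ((P - (1 - c) * (1 - r) ^ 2) / c)) with (P - (1 - c) * (1 - r) ^ 2) by (field; lra).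
    assert (Q := scoef_sum_le gam r (S (S (S N))) ltac:(lra) ltac:(lra)). fold P in Q.
    do 3 rewrite rsum_shift. do 3 rewrite rsum_shift in Q.
    assert (Y0 : y 0 = 1) by (unfold y; rewrite (ker_coef_0 b gam lam Hlam); apply Cmod_1).
    assert (Y1 : y 1 = 2 * gam * c).
    { unfold y. rewrite (ker_coef_1 b gam lam Hlam), Cmod_R. fold c. apply Rabs_right, Rle_ge.
      apply Rmult_le_pos; [lra|unfold c; lra]. }
    assert (B0 : scoef gam 0 = 1) by reflexivity. assert (B1 : scoef gam 1 = 2 * gam) by reflexivity.
    rewrite Y0, Y1. rewrite B0, B1 in Q.
    assert (Y2 := proj2 (compare_bound 0) eq_refl).
    set (RY := rsum (fun k => y (S (S (S k))) * r ^ S (S (S k))) N).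
    set (RB := rsum (fun k => scoef gam (S (S (S k))) * r ^ S (S (S k))) N) in Q.
    assert (HR : RY <= RB + s * s * (r * (5 / 12 + 235 / 144 * gam))).
    { apply Rle_trans with (rsum (fun k => scoef gam (S (S (S k))) * r ^ S (S (S k)) + s * s * (r * (defect gam (k + 3) * (1 / 3) ^ (k + 2)))) N).
      - apply rsum_le. intros k _. assert (K := proj1 (compare_bound (S k))).
        assert (Hp : 0 <= r ^ S (S (S k))) by (apply pow_le; lra).
        apply (Rmult_le_compat_r _ _ _ Hp) in K. eapply Rle_trans; [exact K|].
        rewrite Rmult_plus_distr_r. apply Rplus_le_compat_l. rewrite Rmult_assoc. apply Rmult_le_compat_l; [exact Hs|].
        replace (k + 3)%nat with (S (S (S k))) by lia. replace (k + 2)%nat with (S (S k)) by lia.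
        change (r ^ S (S (S k))) with (r * r ^ S (S k)).
        assert (r ^ S (S k) <= (1 / 3) ^ S (S k)) by (apply pow_incr; lra).
        assert (0 <= defect gam (S (S (S k)))).
        { unfold defect. assert (0 <= INR (S (S (S k))) ^ 2) by (apply pow_le, pos_INR).
          assert (0 <= INR (S (S (S k))) ^ 3) by (apply pow_le, pos_INR).
          assert (0 <= gam * (2 * INR (S (S (S k))) ^ 3 + INR (S (S (S k))) ^ 2)) by (apply Rmult_le_pos; lra). lra. }
        rewrite (Rmult_comm (defect _ _)), Rmult_assoc. apply Rmult_le_compat_l; [lra|].
        rewrite Rmult_comm. apply Rmult_le_compat_l; assumption.
      - rewrite rsum_plus, rsum_mult, rsum_mult. fold RB. apply Rplus_le_compat_l.
        apply Rmult_le_compat_l; [exact Hs|]. apply Rmult_le_compat_l; [lra|]. apply defect_sum. }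
    assert (Hr2 : 0 <= r ^ 2) by (apply pow_le; lra).
    assert (Y2' : y 2 * r ^ 2 <= (scoef gam 2 + s * s) * r ^ 2) by (apply Rmult_le_compat_r; assumption).
    assert (HRY0 : 0 <= RY) by (apply rsum_nonneg; intros; apply majorant_terms_nonneg; lra).
    assert (Hy2 : 0 <= y 2 * r ^ 2) by (apply majorant_terms_nonneg; lra).
    assert (CY : c * (y 2 * r ^ 2 + RY) <= y 2 * r ^ 2 + RY) by nra.
    assert (T : s * s * (r ^ 2 + r * (5 / 12 + 235 / 144 * gam)) <= s * s * (r * (1 - r / 2 + 2 * gam))).
    { apply Rmult_le_compat_l; [exact Hs|]. replace (r ^ 2) with (r * r) by ring. rewrite <- Rmult_plus_distr_l.
      apply Rmult_le_compat_l; lra. }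
    assert (U : s * s * (r - r * r / 2) <= (1 - c) * (2 * r - r * r)).
    { replace (s * s) with ((1 - c) * (1 + c)) by lra. assert (0 <= (1 - c) * (2 * r - r * r)) by (apply Rmult_le_pos; nra). nra. }
    change (S 1) with 2%nat. simpl (r ^ 0). simpl (r ^ 1) in *. simpl (r ^ 0) in Q.
    fold RY.
    assert (V : c * (2 * gam * c * (r * 1)) = 2 * gam * r - 2 * gam * r * (s * s)) by (replace (s * s) with (1 - c * c) by lra; ring).
    lra. }
  apply (Rmult_le_compat_l c) in M; [|lra].
  replace (c * ((P - (1 - c) * (1 - r) ^ 2) / c)) with (P - (1 - c) * (1 - r) ^ 2) in M by (field; lra). exact M.
Qed.

End Compare.

(** Tilting the half plane by [b] multiplies the coefficients of [Q] by [cos b] and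
    enlarges those of the kernel only by order [sin b ^ 2]. The product is smaller
    than in the symmetric case [b = 0], with a margin [(1 - cos b) (1 - r) ^ 2]
    that has to pay for the loss in the linear coefficient. *)
Lemma compare_majorant (b gam : R) (lam : C -> C) (r : R) : is_half_plane_log b lam -> 0 <= gam <= 1 ->
  0 < cos b -> 0 <= r <= 1 / 3 ->
  cos b * majorant (taylor (kernel gam lam)) r <= Rpower ((1 + r) / (1 - r)) gam - (1 - cos b) * (1 - r) ^ 2.
Proof.
  intros Hl Hg Hb Hr. destruct (Req_dec gam 0) as [->|Hg0].
  - assert (M : majorant (taylor (kernel 0 lam)) r <= 1).
    { replace (kernel 0 lam) with (fun _ : C => RtoC 1); [apply majorant_const_1; lra|].
      apply functional_extensionality. intros z. unfold kernel. rewrite Cmult_0_l, cexp_0. reflexivity. }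
    rewrite Rpower_O by (apply Rdiv_lt_0_compat; lra). assert (B := COS_bound b).
    assert ((1 - cos b) * (1 - r) ^ 2 <= (1 - cos b) * 1) by (apply Rmult_le_compat_l; [lra|nra]). nra.
  - apply compare_majorant_pos; auto; lra.
Qed.

(** * Functions with values in a sector *)

Lemma segment_disc (z : C) (t : R) : disc z -> 0 <= t <= 1 -> disc (RtoC t * z)%C.
Proof.
  unfold disc. intros Hz Ht. rewrite Cmod_mult, Cmod_R, Rabs_right by lra. pose proof (Cmod_ge_0 z). nra.
Qed.

Lemma rderiv_ray (f : C -> C) (z : C) (t : R) : analytic_on_disc f -> disc z -> 0 <= t <= 1 ->
  rderiv (fun x => f (RtoC x * z)%C) t (C_derive f (RtoC t * z) * z)%C.
Proof.
  intros Hf Hz Ht. apply (rderiv_comp f (fun x => RtoC x * z)%C).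
  - apply analytic_cderiv; [exact Hf|apply segment_disc; assumption].
  - assert (H := rderiv_affine 0 z t).
    replace (fun x => RtoC x * z)%C with (fun x => 0 + RtoC x * z)%C; [exact H|].
    apply functional_extensionality. intros x. ring.
Qed.

(** The disc is connected: the real part cannot cross a value it omits. *)
Lemma re_lt_of_avoid (f : C -> C) (a : R) : analytic_on_disc f -> Re (f 0%C) < a ->
  (forall z, disc z -> Re (f z) <> a) -> forall z, disc z -> Re (f z) < a.
Proof.
  intros Hf H0 Ha z Hz. apply Rnot_le_lt. intros Hle.
  assert (Hlt : a < Re (f z)) by (destruct Hle as [H|H]; [exact H|exfalso; apply (Ha z Hz); lra]).
  destruct (Ranalysis5.IVT_interv (fun t => Re (f (RtoC t * z)%C) - a) 0 1) as [t [Ht Et]].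
  - intros t Ht. apply continuity_pt_minus; [|apply continuity_pt_const; intros x y; reflexivity].
    apply continuity_pt_filterlim. apply (pcont_Re (fun t => f (RtoC t * z)%C)).
    eapply rderiv_pcont. apply rderiv_ray; assumption.
  - lra.
  - rewrite Cmult_0_l. lra.
  - rewrite Cmult_1_l. lra.
  - apply (Ha (RtoC t * z)%C); [apply segment_disc; assumption|]. lra.
Qed.

(** For a primitive [L] of [F' / F] the product [cexp (- L) * F] is constant. *)
Lemma analytic_log (F : C -> C) : analytic_on_disc F -> (forall z, disc z -> F z <> 0%C) -> F 0%C = 1%C ->
  exists L : C -> C, L 0%C = 0%C /\
    forall z, disc z -> cderiv L z (C_derive F z / F z)%C /\ cexp (L z) = F z.
Proof.
  intros HF Hn H1.
  destruct (analytic_primitive (fun z => C_derive F z / F z)%C) as (L & L0 & HL).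
  { apply analytic_intro. intros z Hz. eexists. apply cderiv_div; [apply Hn, Hz| |];
      apply analytic_cderiv; auto. apply analytic_C_derive, HF. }
  exists L. split; [exact L0|]. intros z Hz. split; [apply HL, Hz|].
  assert (D : forall z, disc z -> cderiv (fun z => cexp (- L z) * F z)%C z 0%C).
  { intros u Hu. eapply cderiv_eq.
    - apply cderiv_mult; [|apply analytic_cderiv; [exact HF|exact Hu]].
      apply (cderiv_cexp_comp (fun z => - L z)%C). apply cderiv_opp, HL, Hu.
    - cbv beta. field. apply Hn, Hu. }
  assert (E := analytic_constant _ D z Hz). cbv beta in E. rewrite L0, H1, Copp_0, cexp_0, Cmult_1_l, cexp_opp in E.
  assert (N := cexp_neq_0 (L z)).
  transitivity (cexp (L z) * (/ cexp (L z) * F z))%C; [rewrite E; ring|field; exact N].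
Qed.

Lemma cexp_coords (z : C) : cexp z = (RtoC (exp (Re z)) * polar 1 (Im z))%C.
Proof. unfold cexp, polar, RtoC, Cmult; simpl. f_equal; ring. Qed.

(** By connectedness: where [Im L] took the value [lo] or [hi], [F] would lie on
    one of the two rays. *)
Lemma log_strip (F L : C -> C) (lo hi : R) : lo < 0 < hi ->
  L 0%C = 0%C -> analytic_on_disc L -> (forall z, disc z -> cexp (L z) = F z) ->
  (forall z s, disc z -> 0 <= s -> F z <> polar s lo /\ F z <> polar s hi) ->
  forall z, disc z -> lo < Im (L z) < hi.
Proof.
  intros Hlh L0 HL HE HF z Hz.
  assert (Av : forall z, disc z -> Im (L z) <> lo /\ Im (L z) <> hi).
  { intros u Hu. destruct (HF u (exp (Re (L u))) Hu) as [N1 N2]; [left; apply exp_pos|].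
    rewrite <- HE, cexp_coords, <- polar_mult in N1, N2 by exact Hu.
    split; intros K; [apply N1|apply N2]; rewrite K; reflexivity. }
  assert (Re1 : forall u, Re (- Ci * L u) = Im (L u)) by (intros u; unfold Re, Im, Ci, Copp, Cmult; simpl; ring).
  assert (Re2 : forall u, Re (Ci * L u) = - Im (L u)) by (intros u; unfold Re, Im, Ci, Cmult; simpl; ring).
  assert (I0 : Im (L 0%C) = 0) by (rewrite L0; reflexivity).
  split.
  - assert (K : Re (Ci * L z) < - lo); [|rewrite Re2 in K; lra].
    apply (re_lt_of_avoid (fun u => Ci * L u)%C); [apply analytic_cmult, HL| | |exact Hz].
    + rewrite Re2. lra.
    + intros u Hu K. rewrite Re2 in K. apply (proj1 (Av u Hu)). lra.
  - rewrite <- Re1. apply (re_lt_of_avoid (fun u => - Ci * L u)%C); [apply analytic_cmult, HL| | |exact Hz].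
    + rewrite Re1. lra.
    + intros u Hu K. rewrite Re1 in K. apply (proj2 (Av u Hu)). exact K.
Qed.

(** ** The comparison function [((1 + x) / (1 - x)) ^ p] on [[0, 1)] *)

Definition sector_pow (p x : R) : R := Rpower ((1 + x) / (1 - x)) p.

Lemma sector_pow_0 (p : R) : sector_pow p 0 = 1.
Proof.
  unfold sector_pow. replace ((1 + 0) / (1 - 0)) with 1 by field. unfold Rpower. rewrite ln_1, Rmult_0_r. apply exp_0.
Qed.

Lemma sector_base_pos (x : R) : 0 <= x < 1 -> 0 < (1 + x) / (1 - x).
Proof. intros Hx. apply Rdiv_lt_0_compat; lra. Qed.

Lemma sector_pow_derive (p x : R) : 0 <= x < 1 ->
  is_derive (sector_pow p) x (2 * p * (sector_pow (p - 1) x / (1 - x) ^ 2)).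
Proof.
  intros Hx. assert (Hq := sector_base_pos x Hx).
  unfold sector_pow, Rpower. auto_derive.
  - split; [lra|]. split; [|exact I]. exact Hq.
  - replace ((1 + x) * / (1 + - x)) with ((1 + x) / (1 - x)) by reflexivity.
    replace ((p - 1) * ln ((1 + x) / (1 - x))) with (p * ln ((1 + x) / (1 - x)) + - ln ((1 + x) / (1 - x))) by ring.
    rewrite exp_plus, exp_Ropp, exp_ln by exact Hq. field. repeat split; lra.
Qed.

Lemma sector_pow_pos (p x : R) : 0 < sector_pow p x.
Proof. apply exp_pos. Qed.

Lemma sector_pow_ge_1 (p x : R) : 0 <= p -> 0 <= x < 1 -> 1 <= sector_pow p x.
Proof.
  intros Hp Hx. unfold sector_pow, Rpower. rewrite <- exp_0 at 1.
  assert (H : 0 <= p * ln ((1 + x) / (1 - x))).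
  { apply Rmult_le_pos; [exact Hp|]. rewrite <- ln_1. apply ln_le; [lra|].
    apply (Rmult_le_reg_r (1 - x)); [lra|]. unfold Rdiv. rewrite Rmult_assoc, Rinv_l; lra. }
  destruct H as [H|H]; [left; apply exp_increasing; exact H|right; rewrite <- H; reflexivity].
Qed.

Lemma increasing_of_derive (w w' : R -> R) (a b : R) : a <= b ->
  (forall x, a <= x <= b -> is_derive w x (w' x)) -> (forall x, a <= x <= b -> 0 <= w' x) -> w a <= w b.
Proof.
  intros Hab Hd Hp. destruct (MVT_gen w a b w') as [x [Hx E]].
  - intros x Hx. rewrite Rmin_left, Rmax_right in Hx by exact Hab. apply Hd; lra.
  - intros x Hx. rewrite Rmin_left, Rmax_right in Hx by exact Hab.
    apply continuity_pt_filterlim. apply (ex_derive_continuous (V := R_NormedModule)). eexists. apply Hd, Hx.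
  - rewrite Rmin_left, Rmax_right in Hx by exact Hab. specialize (Hp x Hx). nra.
Qed.

Lemma weighted_geometric (r : R) : 0 <= r < 1 ->
  ex_series (fun n => INR (S n) * r ^ n) /\ Series (fun n => INR (S n) * r ^ n) <= / (1 - r) ^ 2.
Proof.
  intros Hr. assert (G : is_series (fun n => 1 * r ^ n) (/ (1 - r))).
  { apply (is_series_ext (fun n => r ^ n)); [intros n; symmetry; apply Rmult_1_l|]. apply is_series_geom. rewrite Rabs_right; lra. }
  destruct (product_bound (fun _ => 1) (fun _ => 1) (fun n => INR (S n)) r) as [E B]; try (intros; lra).
  - eexists; exact G.
  - eexists; exact G.
  - intros n. split; [apply pos_INR|]. right. rewrite Rmult_1_l. generalize (S n). induction n0 as [|m IH]; [reflexivity|].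
    rewrite S_INR, IH. reflexivity.
  - split; [exact E|]. eapply Rle_trans; [exact B|]. rewrite !(is_series_unique _ _ G). right. field. lra.
Qed.

(** What a function with values in a sector of opening [alpha * PI] inherits
    from the symmetric sector map [((1 + z) / (1 - z)) ^ alpha]. *)
Record sector_estimates (alpha : R) (F : C -> C) : Prop := {
  se_derive : forall z, disc z ->
    Cmod (C_derive F z) <= 2 * alpha * (sector_pow (alpha - 1) (Cmod z) / (1 - Cmod z) ^ 2);
  se_growth : forall z, disc z -> Cmod (F z - 1) <= sector_pow alpha (Cmod z) - 1;
  se_tail : forall r, 0 <= r <= 1 / 3 ->
    Series (fun n => Cmod (taylor F (n + 2)) * r ^ (n + 2)) <= sector_pow alpha r - 1 - 2 * alpha * r
}.

Lemma growth_of_derive (alpha : R) (F : C -> C) (z : C) : 1 <= alpha -> analytic_on_disc F -> F 0%C = 1%C ->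
  (forall z, disc z -> Cmod (C_derive F z) <= 2 * alpha * (sector_pow (alpha - 1) (Cmod z) / (1 - Cmod z) ^ 2)) ->
  disc z -> Cmod (F z - 1) <= sector_pow alpha (Cmod z) - 1.
Proof.
  intros Ha HF H1 HD Hz. set (rho := Cmod z). assert (Hrho : 0 <= rho < 1) by (split; [apply Cmod_ge_0|exact Hz]).
  destruct (unimodular_phase (F z - 1)) as [e [He Ee]].
  set (u := fun t => Re (e * (F (RtoC t * z)%C - 1))).
  set (du := fun t => Re (e * (C_derive F (RtoC t * z) * z))).
  assert (W : sector_pow alpha (0 * rho) - u 0 <= sector_pow alpha (1 * rho) - u 1).
  { apply (increasing_of_derive (fun t => sector_pow alpha (t * rho) - u t)
       (fun t => rho * (2 * alpha * (sector_pow (alpha - 1) (t * rho) / (1 - t * rho) ^ 2)) - du t)); [lra| |].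
    - intros t Ht. apply (is_derive_minus (V := R_NormedModule)).
      + apply (is_derive_comp (K := R_AbsRing) (V := R_NormedModule) (sector_pow alpha) (fun t => t * rho)).
        * apply sector_pow_derive. nra.
        * auto_derive; [exact I|ring].
      + assert (R1 : rderiv (fun t => e * (F (RtoC t * z)%C - 1))%C t (e * (C_derive F (RtoC t * z) * z))%C).
        { replace (e * (C_derive F (RtoC t * z) * z))%C with ((e * C_derive F (RtoC t * z)) * z)%C by ring.
          apply (rderiv_comp (fun w => e * (F w - 1))%C (fun t => RtoC t * z)%C).
          - eapply cderiv_eq; [apply cderiv_cmult, cderiv_minus; [apply analytic_cderiv; [exact HF|apply segment_disc; assumption]|apply cderiv_const]|]. ring.
          - assert (H := rderiv_affine 0 z t).
            replace (fun x => RtoC x * z)%C with (fun x => 0 + RtoC x * z)%C; [exact H|].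
            apply functional_extensionality. intros x. ring. }
        apply (rderiv_Re _ _ _ R1).
    - intros t Ht. assert (Hzt := segment_disc z t Hz Ht). specialize (HD _ Hzt).
      rewrite (Cmod_mult (RtoC t)), Cmod_R, (Rabs_right t) in HD by lra. fold rho in HD.
      assert (A : du t <= Cmod (C_derive F (RtoC t * z)) * rho).
      { unfold du. eapply Rle_trans; [apply Rle_abs|]. eapply Rle_trans; [apply re_le_Cmod|].
        rewrite !Cmod_mult, He. fold rho. lra. }
      assert (B : Cmod (C_derive F (RtoC t * z)) * rho <= 2 * alpha * (sector_pow (alpha - 1) (t * rho) / (1 - t * rho) ^ 2) * rho)
        by (apply Rmult_le_compat_r; lra).
      lra. }
  unfold u in W. rewrite Rmult_0_l, Rmult_1_l, sector_pow_0, Cmult_0_l, Cmult_1_l, H1, Ee in W.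
  replace (e * (1 - 1))%C with (RtoC 0) in W by ring. change (1 - 0 <= sector_pow alpha rho - Cmod (F z - 1)) in W. lra.
Qed.

(** [F = Q ^ alpha = Q * Q ^ (alpha - 1)] with [Q] in a half plane whose
    inner normal has argument [b]. *)
Section Sector.

Variables (alpha b : R) (Lam : C -> C).
Hypothesis Halpha : 1 <= alpha <= 2.
Hypothesis HLam : analytic_on_disc Lam.
Hypothesis HLam0 : Lam 0%C = 0%C.
Hypothesis Hb : - PI / 2 < b < PI / 2.
Hypothesis Hstrip : forall z, disc z -> b - PI / 2 < Im (Lam z) < b + PI / 2.

Local Notation Q := (fun z => cexp (Lam z)).
Local Notation G := (fun z => cexp (RtoC (alpha - 1) * Lam z)).
Local Notation F := (fun z => cexp (RtoC alpha * Lam z)).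

Lemma cos_b_pos : 0 < cos b.
Proof. apply cos_gt_0; lra. Qed.

Lemma cexp_Lam_cderiv (x : R) (z : C) : disc z ->
  cderiv (fun z => cexp (RtoC x * Lam z)) z (RtoC x * C_derive Lam z * cexp (RtoC x * Lam z))%C.
Proof.
  intros Hz. apply (cderiv_cexp_comp (fun z => RtoC x * Lam z)%C). apply cderiv_cmult, analytic_cderiv; assumption.
Qed.

Lemma Q_cderiv (z : C) : disc z -> cderiv Q z (C_derive Lam z * cexp (Lam z))%C.
Proof. intros Hz. apply (cderiv_cexp_comp Lam). apply analytic_cderiv; assumption. Qed.

Lemma Q_analytic : analytic_on_disc Q.
Proof. apply analytic_intro. intros z Hz. eexists. apply Q_cderiv, Hz. Qed.

Lemma G_analytic : analytic_on_disc G.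
Proof. apply analytic_intro. intros z Hz. eexists. apply cexp_Lam_cderiv, Hz. Qed.

Lemma F_analytic : analytic_on_disc F.
Proof. apply analytic_intro. intros z Hz. eexists. apply cexp_Lam_cderiv, Hz. Qed.

Lemma Q_0 : cexp (Lam 0%C) = 1%C.
Proof. rewrite HLam0. apply cexp_0. Qed.

Lemma F_derive (z : C) : disc z -> C_derive F z = (RtoC alpha * (C_derive Q z * G z))%C.
Proof.
  intros Hz. rewrite (cderiv_C_derive _ _ _ (cexp_Lam_cderiv alpha z Hz)), (cderiv_C_derive _ _ _ (Q_cderiv z Hz)).
  replace (RtoC alpha * Lam z)%C with (Lam z + RtoC (alpha - 1) * Lam z)%C by (rewrite RtoC_minus; ring).
  rewrite cexp_plus. ring.
Qed.

Lemma rotated_Q_pos (z : C) : disc z -> 0 < Re (polar 1 (- b) * cexp (Lam z)).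
Proof.
  intros Hz. assert (S := Hstrip z Hz).
  replace (Re (polar 1 (- b) * cexp (Lam z))) with (exp (Re (Lam z)) * cos (Im (Lam z) - b)).
  - apply Rmult_lt_0_compat; [apply exp_pos|]. apply cos_gt_0; lra.
  - unfold cexp, polar, Cmult, Re, Im; simpl. rewrite cos_minus, cos_neg, sin_neg. ring.
Qed.

Lemma Q_coef (n : nat) : (1 <= n)%nat -> Cmod (taylor Q n) <= 2 * cos b.
Proof.
  intros Hn. assert (HQ := Q_analytic).
  assert (K := caratheodory (fun z => polar 1 (- b) * cexp (Lam z))%C n (analytic_cmult _ _ HQ)
     (fun z Hz => Rlt_le _ _ (rotated_Q_pos z Hz)) Hn).
  rewrite (taylor_cmult (polar 1 (- b)) Q n HQ), Cmod_mult, Cmod_polar, Q_0, Rmult_1_l in K by lra.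
  eapply Rle_trans; [exact K|]. right. unfold polar, Re; simpl. rewrite cos_neg. ring.
Qed.

Lemma dQ_coef (n : nat) : Cmod (taylor (C_derive Q) n) <= INR (S n) * (2 * cos b).
Proof.
  rewrite <- (taylor_S Q n Q_analytic), Cmod_mult, Cmod_R, Rabs_right by (apply Rle_ge, pos_INR).
  apply Rmult_le_compat_l; [apply pos_INR|apply Q_coef; lia].
Qed.

Lemma Q_bound (z : C) : disc z -> Cmod (cexp (Lam z)) <= (1 + Cmod z) / (1 - Cmod z).
Proof.
  intros Hz. set (rho := Cmod z). assert (Hrho : 0 <= rho < 1) by (split; [apply Cmod_ge_0|exact Hz]).
  assert (HQ := Q_analytic).
  assert (Sh := cseries_shift _ _ (expansion_cseries _ _ z (taylor_expansion Q HQ) Hz)).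
  assert (T0 : (taylor Q 0 * z ^ 0)%C = 1%C) by (rewrite (taylor_0 Q HQ), Q_0; simpl; ring).
  cbv beta in Sh. rewrite T0 in Sh.
  assert (Gm := Series_geom_from_1 rho Hrho).
  assert (G2 := is_series_scal (V := R_NormedModule) 2 _ _ Gm).
  assert (B : Cmod (cexp (Lam z) - 1) <= 2 * (rho / (1 - rho))).
  { assert (U := is_series_unique _ _ G2). change (Series (fun n => 2 * rho ^ S n) = 2 * (rho / (1 - rho))) in U. rewrite <- U.
    apply (cseries_bound _ _ _ Sh); [|eexists; exact G2].
    intros n. rewrite Cmod_mult, Cmod_pow. fold rho. apply Rmult_le_compat_r; [apply pow_le; lra|].
    assert (K := Q_coef (S n) ltac:(lia)). assert (COS := COS_bound b). lra. }
  assert (T := Cmod_triangle (cexp (Lam z) - 1) 1). replace (cexp (Lam z) - 1 + 1)%C with (cexp (Lam z)) in T by ring.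
  rewrite Cmod_1 in T. replace ((1 + rho) / (1 - rho)) with (2 * (rho / (1 - rho)) + 1) by (field; lra). lra.
Qed.

Lemma dQ_bound (z : C) : disc z -> Cmod (C_derive Q z) <= 2 / (1 - Cmod z) ^ 2.
Proof.
  intros Hz. set (rho := Cmod z). assert (Hrho : 0 <= rho < 1) by (split; [apply Cmod_ge_0|exact Hz]).
  destruct (weighted_geometric rho Hrho) as [E B].
  assert (S0 := expansion_cseries _ _ z (taylor_expansion _ (analytic_C_derive _ Q_analytic)) Hz).
  apply Rle_trans with (Series (fun n => 2 * (INR (S n) * rho ^ n))).
  - apply (cseries_bound _ _ _ S0).
    + intros n. rewrite Cmod_mult, Cmod_pow. fold rho. rewrite <- Rmult_assoc.
      apply Rmult_le_compat_r; [apply pow_le; lra|]. eapply Rle_trans; [apply dQ_coef|].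
      assert (COS := COS_bound b). pose proof (pos_INR (S n)). nra.
    + apply (ex_series_scal (V := R_NormedModule) 2). exact E.
  - rewrite Series_scal_l. unfold Rdiv. lra.
Qed.

(** By Caratheodory's inequality the coefficients of [Q] from the first
    on are at most [2 cos b <= 2], those of [(1 + z) / (1 - z)]; this bounds [Q] and [Q']
    by their values for the symmetric sector. *)
Lemma F_derive_bound (z : C) : disc z ->
  Cmod (C_derive F z) <= 2 * alpha * (sector_pow (alpha - 1) (Cmod z) / (1 - Cmod z) ^ 2).
Proof.
  intros Hz. rewrite (F_derive z Hz), !Cmod_mult, Cmod_R, Rabs_right by lra.
  set (rho := Cmod z). assert (Hrho : 0 <= rho < 1) by (split; [apply Cmod_ge_0|exact Hz]).
  assert (BG : Cmod (cexp (RtoC (alpha - 1) * Lam z)) <= sector_pow (alpha - 1) rho).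
  { rewrite Cmod_cexp. assert (QB := Q_bound z Hz). rewrite Cmod_cexp in QB. fold rho in QB.
    replace (Re (RtoC (alpha - 1) * Lam z)) with ((alpha - 1) * Re (Lam z)) by (unfold Re, Cmult, RtoC; simpl; ring).
    rewrite <- (ln_exp (Re (Lam z))). unfold sector_pow. apply (Rle_Rpower_l _ _ (alpha - 1)); [lra|].
    split; [apply exp_pos|exact QB]. }
  assert (BQ := dQ_bound z Hz). fold rho in BQ.
  replace (2 * alpha * (sector_pow (alpha - 1) rho / (1 - rho) ^ 2))
    with (alpha * (2 / (1 - rho) ^ 2 * sector_pow (alpha - 1) rho)) by (field; lra).
  apply Rmult_le_compat_l; [lra|]. apply Rmult_le_compat; auto; apply Cmod_ge_0.
Qed.

(** [Q] is subordinate to the half-plane map, so [G] is subordinate to the kernel. *)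
Lemma G_subordinate : exists lam v, is_half_plane_log b lam /\ analytic_on_disc v /\
  (forall z, disc z -> disc (v z)) /\ v 0%C = 0%C /\
  forall z, disc z -> G z = kernel (alpha - 1) lam (v z).
Proof.
  destruct (half_plane_log_exists b) as [lam Hl].
  set (p := polar 1 b). set (q := polar 1 (- b)).
  assert (Hpq : (p * q)%C = 1%C) by apply polar_conj_mul.
  assert (Hc := cos_b_pos).
  assert (Hden : forall z, disc z -> (q * cexp (Lam z) + p)%C <> 0%C).
  { intros z Hz K. assert (P := rotated_Q_pos z Hz). fold q in P.
    apply (f_equal Re) in K. unfold Re, Cplus in K, P. simpl fst in K. unfold p, polar in K. simpl in K, P. lra. }
  set (v := fun z => ((cexp (Lam z) - 1) / (q * cexp (Lam z) + p))%C).
  assert (Hv : analytic_on_disc v).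
  { apply analytic_intro. intros z Hz. assert (D := Q_cderiv z Hz). eexists. unfold v.
    apply (cderiv_div (fun z => cexp (Lam z) - 1)%C (fun z => q * cexp (Lam z) + p)%C); [apply Hden, Hz| |].
    - apply cderiv_minus; [exact D|apply cderiv_const].
    - apply cderiv_plus; [apply cderiv_cmult; exact D|apply cderiv_const]. }
  assert (Hvd : forall z, disc z -> disc (v z)).
  { intros z Hz. unfold disc, v. rewrite Cmod_div by apply Hden, Hz.
    assert (P := rotated_Q_pos z Hz). fold q in P. set (W := (q * cexp (Lam z))%C) in *.
    assert (Dp : 0 < Cmod (W + p)) by (apply Cmod_gt_0, Hden, Hz).
    assert (EQ : (cexp (Lam z) - 1)%C = (p * (W - q))%C).
    { unfold W. transitivity ((p * q) * cexp (Lam z) - p * q)%C; [rewrite Hpq; ring|ring]. }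
    rewrite EQ, Cmod_mult. unfold p at 1. rewrite Cmod_polar, Rmult_1_l by lra.
    apply (Rmult_lt_reg_r (Cmod (W + p))); [exact Dp|]. unfold Rdiv. rewrite Rmult_assoc, Rinv_l, Rmult_1_r, Rmult_1_l by lra.
    assert (E2 : Cmod (W - q) ^ 2 < Cmod (W + p) ^ 2).
    { rewrite !Cmod2_alt. clearbody W. destruct W as [x y]. unfold p, q, polar, Re, Im, Cminus, Cplus, Copp in *; simpl in *.
      rewrite cos_neg, sin_neg. nra. }
    assert (0 <= Cmod (W - q)) by apply Cmod_ge_0. nra. }
  assert (Hv0 : v 0%C = 0%C).
  { unfold v. rewrite Q_0. replace (1 - 1)%C with (RtoC 0) by ring. unfold Cdiv. ring. }
  exists lam, v. repeat split; try assumption; try apply Hl.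
  assert (EQ : forall z, disc z -> cexp (lam (v z)) = cexp (Lam z)).
  { intros z Hz. rewrite (half_plane_log_exp b lam (v z) Hl (Hvd z Hz)). fold p q.
    assert (N := Hden z Hz). assert (N2 := half_plane_factor_2 (- b) (v z) (Hvd z Hz)). fold q in N2.
    assert (E1 : (1 + p * v z)%C = (cexp (Lam z) * (1 - q * v z))%C).
    { unfold v.
      transitivity ((q * cexp (Lam z) + p + p * (cexp (Lam z) - 1)) / (q * cexp (Lam z) + p))%C; [field; exact N|].
      transitivity (cexp (Lam z) * (q * cexp (Lam z) + p - q * (cexp (Lam z) - 1)) / (q * cexp (Lam z) + p))%C; [|field; exact N].
      f_equal. ring. }
    rewrite E1. field. exact N2. }
  assert (Hlv : forall z, disc z -> exists l, cderiv (fun z => lam (v z) - Lam z)%C z l).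
  { intros z Hz. eexists. apply cderiv_minus; [|apply analytic_cderiv; assumption].
    apply (cderiv_comp lam v); [apply Hl, Hvd, Hz|apply analytic_cderiv; assumption]. }
  assert (E1 : forall z, disc z -> cexp (lam (v z) - Lam z) = 1%C).
  { intros z Hz. unfold Cminus. rewrite cexp_plus, cexp_opp, (EQ z Hz). field. apply cexp_neq_0. }
  assert (Z : forall z, disc z -> cderiv (fun z => lam (v z) - Lam z)%C z 0%C).
  { intros z Hz. destruct (Hlv z Hz) as [l D].
    assert (D1 := cderiv_cexp_comp _ _ _ D). cbv beta in D1. rewrite (E1 z Hz) in D1.
    assert (D2 : cderiv (fun z => cexp (lam (v z) - Lam z)) z 0%C).
    { apply (cderiv_ext_loc (fun _ => RtoC 1) _ z 0 (1 - Cmod z)); [unfold disc in Hz; lra| |apply cderiv_const].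
      intros u Hu. symmetry. apply E1. unfold disc.
      assert (T := Cmod_triangle (u - z) z). replace (u - z + z)%C with u in T by ring. lra. }
    assert (El := cderiv_unique _ _ _ _ D1 D2). rewrite Cmult_1_r in El. rewrite El in D. exact D. }
  intros z Hz. unfold kernel. do 2 f_equal.
  assert (K := analytic_constant _ Z z Hz). cbv beta in K. rewrite Hv0, (proj1 Hl), HLam0 in K.
  replace (Lam z) with (lam (v z) - (lam (v z) - Lam z))%C by ring. rewrite K. ring.
Qed.

Lemma G_majorant (r : R) : 0 <= r <= 1 / 3 ->
  cos b * majorant (taylor G) r <= sector_pow (alpha - 1) r - (1 - cos b) * (1 - r) ^ 2.
Proof.
  intros Hr. destruct G_subordinate as (lam & v & Hl & Hv & Hvd & Hv0 & HG).
  assert (Hc := cos_b_pos).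
  eapply Rle_trans; [|apply (compare_majorant b (alpha - 1) lam r Hl); auto; lra].
  apply Rmult_le_compat_l; [lra|].
  replace (taylor G) with (taylor (fun z => kernel (alpha - 1) lam (v z))).
  - apply majorant_comp; auto. apply (ker_analytic b (alpha - 1) lam Hl).
  - apply functional_extensionality. intros n. apply taylor_ext. intros z Hz. symmetry. apply HG, Hz.
Qed.

(** [(n + 1) F_(n+1)] is a Cauchy product of the coefficients of [Q'] and [G];
    integrating the resulting bound on the derivative of the majorant brings
    back the coefficients themselves. The linear coefficient is replaced by its
    upper bound [2 alpha cos b]; what it falls short of [2 alpha] is the margin of
    [compare_majorant]. *)
Lemma F_tail (r : R) : 0 <= r <= 1 / 3 ->
  Series (fun n => Cmod (taylor F (n + 2)) * r ^ (n + 2)) <= sector_pow alpha r - 1 - 2 * alpha * r.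
Proof.
  intros Hr. assert (Hc := cos_b_pos). assert (COS := COS_bound b).
  set (c := fun n => match n with O => 2 * alpha * cos b | S _ => INR (S n) * Cmod (taylor F (S n)) end).
  assert (Hc0 : forall n, 0 <= c n).
  { intros [|n]; unfold c; [nra|]. apply Rmult_le_pos; [apply pos_INR|apply Cmod_ge_0]. }
  assert (Bc : forall x, 0 <= x <= 1 / 3 -> ex_series (fun n => c n * x ^ n) /\
     Series (fun n => c n * x ^ n) <= 2 * alpha * (sector_pow (alpha - 1) x / (1 - x) ^ 2) - 2 * alpha * (1 - cos b)).
  { intros x Hx. destruct (weighted_geometric x ltac:(lra)) as [E B].
    destruct (product_bound (fun k => 2 * alpha * cos b * INR (S k)) (fun k => Cmod (taylor G k)) c x) as [Ec Bc].
    - lra.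
    - intros k. apply Rmult_le_pos; [nra|apply pos_INR].
    - intros; apply Cmod_ge_0.
    - apply (ex_series_ext (fun n => 2 * alpha * cos b * (INR (S n) * x ^ n))); [intros n; change (2 * alpha * cos b * (INR (S n) * x ^ n) = 2 * alpha * cos b * INR (S n) * x ^ n); ring|].
      apply (ex_series_scal (V := R_NormedModule)). exact E.
    - apply (taylor_abs_conv G G_analytic). lra.
    - intros n. split; [apply Hc0|]. destruct n as [|n].
      + unfold c. cbn [rsum Nat.sub]. rewrite (taylor_0 G G_analytic), HLam0, Cmult_0_r, cexp_0, Cmod_1. simpl (INR 1). lra.
      + unfold c. set (m := S n). rewrite <- (Rabs_right (INR (S m))) by (apply Rle_ge, pos_INR).
        rewrite <- Cmod_R, <- Cmod_mult, (taylor_S F m F_analytic).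
        rewrite (taylor_ext _ (fun z => RtoC alpha * (C_derive Q z * G z))%C m F_derive).
        assert (HdQ := analytic_C_derive _ Q_analytic). assert (HG := G_analytic).
        rewrite (taylor_cmult (RtoC alpha) (fun z => C_derive Q z * G z)%C) by (apply analytic_mult; assumption).
        rewrite (taylor_mult (C_derive Q) G m HdQ HG), Cmod_mult, Cmod_R, Rabs_right by lra.
        unfold conv. eapply Rle_trans; [apply Rmult_le_compat_l; [lra|apply Cmod_csum]|].
        rewrite <- rsum_mult. apply rsum_le. intros k Hk. rewrite Cmod_mult, <- Rmult_assoc.
        apply Rmult_le_compat_r; [apply Cmod_ge_0|].
        assert (D := dQ_coef k). apply (Rmult_le_compat_l alpha) in D; lra.
    - split; [exact Ec|]. eapply Rle_trans; [exact Bc|].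
      rewrite (Series_ext _ (fun n => 2 * alpha * cos b * (INR (S n) * x ^ n))) by (intros; ring).
      rewrite Series_scal_l.
      assert (M := G_majorant x Hx). unfold majorant in M.
      set (MG := Series (fun n => Cmod (taylor G n) * x ^ n)) in *.
      assert (MG0 : 0 <= MG) by (apply majorant_nonneg; [apply taylor_abs_conv, G_analytic|lra]).
      assert (Hi : 0 < / (1 - x) ^ 2) by (apply Rinv_0_lt_compat, pow_lt; lra).
      apply Rle_trans with (2 * alpha * (/ (1 - x) ^ 2 * (cos b * MG))).
      + replace (2 * alpha * (/ (1 - x) ^ 2 * (cos b * MG))) with (2 * alpha * cos b * / (1 - x) ^ 2 * MG) by ring.
        apply Rmult_le_compat_r; [exact MG0|]. apply Rmult_le_compat_l; [nra|exact B].
      + apply Rle_trans with (2 * alpha * (/ (1 - x) ^ 2 * (sector_pow (alpha - 1) x - (1 - cos b) * (1 - x) ^ 2))).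
        * apply Rmult_le_compat_l; [lra|]. apply Rmult_le_compat_l; lra.
        * right. field. lra. }
  apply series_of_bounded; [intros; apply majorant_terms_nonneg; lra|]. intros N.
  set (A := fun x => rsum (fun n => Cmod (taylor F (n + 2)) * x ^ (n + 2)) N).
  set (A' := fun x => rsum (fun n => c (S n) * x ^ S n) N).
  assert (DA : forall x, is_derive A x (A' x)).
  { intros x. unfold A, A'. clear -alpha. induction N as [|N IH].
    - simpl. apply (is_derive_const (V := R_NormedModule)).
    - simpl rsum. apply (is_derive_plus (V := R_NormedModule)); [exact IH|].
      replace (N + 2)%nat with (S (S N)) by lia. auto_derive; [exact I|]. unfold c. simpl pred. ring. }
  assert (W : sector_pow alpha 0 - 2 * alpha * 0 - A 0 <= sector_pow alpha r - 2 * alpha * r - A r).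
  { apply (increasing_of_derive (fun x => sector_pow alpha x - 2 * alpha * x - A x)
       (fun x => 2 * alpha * (sector_pow (alpha - 1) x / (1 - x) ^ 2) - 2 * alpha - A' x)); [lra| |].
    - intros x Hx. apply (is_derive_minus (V := R_NormedModule)); [|apply DA].
      apply (is_derive_minus (V := R_NormedModule)); [apply sector_pow_derive; lra|]. auto_derive; [exact I|ring].
    - intros x Hx. destruct (Bc x ltac:(lra)) as [E B].
      assert (T : rsum (fun n => c n * x ^ n) (S N) <= Series (fun n => c n * x ^ n)).
      { apply rsum_le_Series; [|exact E]. intros; apply Rmult_le_pos; [apply Hc0|apply pow_le; lra]. }
      rewrite rsum_shift in T. fold (A' x) in T. unfold c at 1 in T. simpl (x ^ 0) in T. lra. }
  rewrite sector_pow_0 in W.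
  assert (A0 : A 0 = 0).
  { unfold A. rewrite (rsum_ext _ (fun _ => 0 * 0)); [rewrite rsum_mult; ring|].
    intros k _. replace (k + 2)%nat with (S (S k)) by lia. simpl. ring. }
  unfold A in *. lra.
Qed.

Lemma sector_estimates_exp : sector_estimates alpha F.
Proof.
  split.
  - exact F_derive_bound.
  - intros z Hz. apply (growth_of_derive alpha F z); auto using F_analytic, F_derive_bound; [lra|].
    rewrite HLam0, Cmult_0_r. apply cexp_0.
  - exact F_tail.
Qed.

End Sector.

Lemma sector_estimates_ext (alpha : R) (F H : C -> C) : (forall z, disc z -> F z = H z) -> analytic_on_disc F ->
  sector_estimates alpha F -> sector_estimates alpha H.
Proof.
  intros E HF [S1 S2 S3].
  assert (ED : forall z, disc z -> C_derive H z = C_derive F z).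
  { intros z Hz. apply cderiv_C_derive.
    apply (cderiv_ext_loc F H z _ (1 - Cmod z)); [unfold disc in Hz; lra| |apply analytic_cderiv; assumption].
    intros u Hu. apply E. unfold disc.
    assert (T := Cmod_triangle (u - z) z). replace (u - z + z)%C with u in T by ring. lra. }
  split.
  - intros z Hz. rewrite ED by exact Hz. apply S1, Hz.
  - intros z Hz. rewrite <- E by exact Hz. apply S2, Hz.
  - intros r Hr. rewrite (Series_ext _ (fun n => Cmod (taylor F (n + 2)) * r ^ (n + 2))); [apply S3, Hr|].
    intros n. do 2 f_equal. symmetry. apply taylor_ext. exact E.
Qed.

(** [Q = F ^ (1 / alpha)] has its argument in an interval of length at most [PI],
    hence in a half plane. *)
Lemma sector_estimates_of_rays (alpha lo hi : R) (F : C -> C) : 1 <= alpha <= 2 ->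
  analytic_on_disc F -> F 0%C = 1%C -> lo < 0 < hi -> hi - lo <= alpha * PI ->
  (forall z s, disc z -> 0 <= s -> F z <> polar s lo /\ F z <> polar s hi) ->
  sector_estimates alpha F.
Proof.
  intros Ha HF H1 Hlh Hw Hr. pose proof PI_RGT_0 as Hpi.
  assert (Hn : forall z, disc z -> F z <> 0%C).
  { intros z Hz K. apply (proj1 (Hr z 0 Hz (Rle_refl 0))). rewrite K. unfold polar, RtoC. f_equal; ring. }
  destruct (analytic_log F HF Hn H1) as (L & L0 & HL).
  assert (LA : analytic_on_disc L) by (apply analytic_intro; intros z Hz; eexists; apply (HL z Hz)).
  assert (St := log_strip F L lo hi Hlh L0 LA (fun z Hz => proj2 (HL z Hz)) Hr).
  set (Lam := fun z => (RtoC (/ alpha) * L z)%C).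
  assert (Hai : 0 < / alpha) by (apply Rinv_0_lt_compat; lra).
  set (b := hi * / alpha - PI / 2).
  assert (Hx : lo * / alpha >= b - PI / 2).
  { unfold b. apply Rle_ge. apply (Rmult_le_reg_r alpha); [lra|]. rewrite Rmult_minus_distr_r, Rmult_minus_distr_r, !Rmult_assoc, Rinv_l by lra. lra. }
  assert (Hlo : lo * / alpha < 0) by nra. assert (Hhi : 0 < hi * / alpha) by nra.
  apply (sector_estimates_ext alpha (fun z => cexp (RtoC alpha * Lam z))).
  - intros z Hz. unfold Lam. rewrite Cmult_assoc, <- RtoC_mult, Rinv_r, Cmult_1_l by lra. apply HL, Hz.
  - apply (F_analytic alpha Lam). apply analytic_cmult, LA.
  - apply (sector_estimates_exp alpha b Lam Ha).
    + apply analytic_cmult, LA.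
    + unfold Lam. rewrite L0. ring.
    + unfold b in *. lra.
    + intros z Hz. assert (S := St z Hz). unfold Lam.
      replace (Im (RtoC (/ alpha) * L z)) with (/ alpha * Im (L z)) by (unfold Im, Cmult, RtoC; simpl; ring).
      unfold b in *. nra.
Qed.

(** * Geometry of concave univalent maps *)

Lemma center_bound (F : C -> C) (r M : R) : analytic_on_disc F -> 0 < r < 1 ->
  (forall t, 0 <= t <= 2 * PI -> Cmod (F (polar r t)) <= M) -> Cmod (F 0%C) <= 2 * M.
Proof.
  intros HF Hr HM. rewrite <- (cmean_center F r HF Hr). apply cmean_bound_weak; [|exact HM].
  apply disc_cont_on_circle; [exact Hr|]. intros u Hu. eexists. apply analytic_cderiv; [exact HF|apply Hu].
Qed.

(** Open mapping: if [phi - w] had no zero near [z0], then [1 / (phi - w)]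
    would be larger at [z0] than the mean value property allows. *)
Lemma open_mapping (phi : C -> C) (z0 : C) (eps : R) : analytic_on_disc phi -> univalent_on_disc phi ->
  disc z0 -> 0 < eps ->
  exists d, 0 < d /\ forall w, Cmod (w - phi z0) < d -> exists z, disc z /\ Cmod (z - z0) < eps /\ phi z = w.
Proof.
  intros Ha Hu Hz0 Heps. unfold disc in Hz0. pose proof PI_RGT_0 as Hpi.
  set (e := Rmin eps (1 - Cmod z0)).
  assert (He : 0 < e) by (unfold e; apply Rmin_glb_lt; lra).
  assert (He1 : e <= eps) by apply Rmin_l. assert (He2 : e <= 1 - Cmod z0) by apply Rmin_r. clearbody e.
  set (T := fun u : C => (z0 + RtoC e * u)%C).
  assert (HT : forall u, disc u -> disc (T u) /\ Cmod (T u - z0) < eps).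
  { intros u Hd. unfold disc in *. assert (B : Cmod (RtoC e * u) < e).
    { rewrite Cmod_mult, Cmod_R, Rabs_right by lra. rewrite <- (Rmult_1_r e) at 2. apply Rmult_lt_compat_l; assumption. }
    split.
    - unfold T. eapply Rle_lt_trans; [apply Cmod_triangle|]. lra.
    - replace (T u - z0)%C with (RtoC e * u)%C by (unfold T; ring). lra. }
  assert (DT : forall u, cderiv T u (RtoC e)).
  { intros u. eapply cderiv_eq; [apply cderiv_plus; [apply cderiv_const|apply cderiv_cmult, cderiv_id]|]. ring. }
  assert (Hp2 : forall t, disc (polar (1 / 2) t)) by (intros; unfold disc; rewrite Cmod_polar; lra).
  set (m := fun t => Cmod (phi (T (polar (1 / 2) t)) - phi z0)).
  destruct (continuity_ab_min m 0 (2 * PI)) as [t0 [Ht0 _]]; [lra| |].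
  { intros t _. apply (pcont_Cmod (fun t => phi (T (polar (1 / 2) t)) - phi z0)%C).
    apply (pcont_comp (fun u => phi (T u) - phi z0)%C); [|apply pcont_polar].
    eapply cderiv_ccont. apply cderiv_minus; [|apply cderiv_const].
    apply (cderiv_comp phi T); [apply analytic_cderiv; [exact Ha|apply HT, Hp2]|apply DT]. }
  assert (Hm : 0 < m t0).
  { apply Cmod_gt_0. intros E. assert (E' : phi (T (polar (1 / 2) t0)) = phi z0).
    { replace (phi (T (polar (1 / 2) t0))) with (phi (T (polar (1 / 2) t0)) - phi z0 + phi z0)%C by ring. rewrite E. ring. }
    apply Hu in E'; [|apply HT, Hp2|exact Hz0].
    assert (K : Cmod (T (polar (1 / 2) t0) - z0) = 0) by (rewrite E'; replace (z0 - z0)%C with (RtoC 0) by ring; apply Cmod_0).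
    replace (T (polar (1 / 2) t0) - z0)%C with (RtoC e * polar (1 / 2) t0)%C in K by (unfold T; ring).
    rewrite Cmod_mult, Cmod_R, Rabs_right, Cmod_polar in K by lra. lra. }
  exists (m t0 / 4). split; [lra|]. intros w Hw. apply NNPP. intros Hno.
  assert (Hne : forall u, disc u -> (phi (T u) - w)%C <> 0%C).
  { intros u Hd K. apply Hno. exists (T u). destruct (HT u Hd) as [A B]. repeat split; auto.
    replace (phi (T u)) with (phi (T u) - w + w)%C by ring. rewrite K. ring. }
  set (F := fun u => (/ (phi (T u) - w))%C).
  assert (HF : analytic_on_disc F).
  { apply analytic_intro. intros u Hd. eexists. apply (cderiv_inv (fun u => phi (T u) - w)%C); [apply Hne, Hd|].
    apply cderiv_minus; [|apply cderiv_const]. apply (cderiv_comp phi T); [apply analytic_cderiv; [exact Ha|apply HT, Hd]|apply DT]. }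
  assert (B := center_bound F (1 / 2) (/ (3 * m t0 / 4)) HF ltac:(lra)).
  assert (T0 : T 0%C = z0) by (unfold T; ring).
  assert (N0 := Hne 0%C disc_0). rewrite T0 in N0.
  assert (P0 : 0 < Cmod (phi z0 - w)) by (apply Cmod_gt_0, N0).
  assert (B' : Cmod (F 0%C) <= 2 * / (3 * m t0 / 4)).
  { apply B. intros t Ht. unfold F. rewrite Cmod_inv by (apply Hne, Hp2).
    apply Rinv_le_contravar; [lra|]. specialize (Ht0 t Ht).
    assert (L := Cmod_lower (phi (T (polar (1 / 2) t)) - phi z0) (phi z0 - w)). fold (m t) in L.
    replace (phi (T (polar (1 / 2) t)) - phi z0 + (phi z0 - w))%C with (phi (T (polar (1 / 2) t)) - w)%C in L by ring.
    rewrite (Cmod_sub_sym (phi z0)) in L. lra. }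
  unfold F in B'. rewrite T0, Cmod_inv in B' by exact N0. rewrite Cmod_sub_sym in Hw.
  assert (C1 : / (m t0 / 4) < / Cmod (phi z0 - w)) by (apply Rinv_lt_contravar; [apply Rmult_lt_0_compat; lra|exact Hw]).
  assert (C2 : 2 * / (3 * m t0 / 4) < / (m t0 / 4)).
  { replace (/ (m t0 / 4)) with (4 * / m t0) by (field; lra). replace (2 * / (3 * m t0 / 4)) with (8 / 3 * / m t0) by (field; lra).
    assert (0 < / m t0) by (apply Rinv_0_lt_compat; lra). lra. }
  lra.
Qed.

Section Concave.

Variables (alpha : R) (phi : C -> C).
Hypothesis Halpha : 1 <= alpha <= 2.
Hypothesis Hphi : concave_univalent alpha phi.
Hypothesis Hd0 : C_derive phi 0%C <> 0%C.

Local Notation Omega := (image_of_disc phi).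

Lemma image_open (w : C) : Omega w -> exists d, 0 < d /\ forall w', Cmod (w' - w) < d -> Omega w'.
Proof.
  intros [z [Hz Ez]]. destruct (open_mapping phi z 1 (cu_analytic _ _ Hphi) (cu_univalent _ _ Hphi) Hz Rlt_0_1) as [d [Hd H]].
  exists d. split; [exact Hd|]. intros w' Hw'. rewrite <- Ez in Hw'. destruct (H w' Hw') as [z' [A [_ B]]]. exists z'. auto.
Qed.

(** The annulus is compact, and every point of it has a neighbourhood covered by
    the image of a compact part of the disc. *)
Lemma proper_on_annulus (R1 M : R) : (forall w, R1 <= Cmod w -> Omega w) ->
  exists d, 0 < d /\ forall z, disc z -> R1 <= Cmod (phi z) <= M -> Cmod z <= 1 - d.
Proof.
  intros HR.
  assert (Loc : forall u v : R, exists d : posreal, forall z, disc z -> R1 <= Cmod (phi z) ->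
     Rabs (Re (phi z) - u) < d -> Rabs (Im (phi z) - v) < d -> Cmod z <= 1 - d).
  { intros u v. set (w := (u, v) : C).
    assert (Hdist : forall z d, Rabs (Re (phi z) - u) < d -> Rabs (Im (phi z) - v) < d -> Cmod (phi z - w) < 2 * d).
    { intros z d H1 H2. eapply Rle_lt_trans; [apply Cmod_le_abs|]. unfold w.
      destruct (phi z) as [a b]. unfold Re, Im, Cminus, Cplus, Copp in *; simpl in *. unfold Rminus in *. lra. }
    destruct (Rle_dec R1 (Cmod w)) as [Hw|Hw].
    - destruct (HR w Hw) as [z0 [Hz0 Ez0]]. unfold disc in Hz0. set (e := (1 - Cmod z0) / 2).
      destruct (open_mapping phi z0 e (cu_analytic _ _ Hphi) (cu_univalent _ _ Hphi) Hz0 ltac:(unfold e; lra)) as [d [Hd H]].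
      assert (Hm : 0 < Rmin (d / 2) e) by (apply Rmin_glb_lt; unfold e; lra).
      exists (mkposreal _ Hm). simpl. intros z Hz _ H1 H2.
      assert (D := Hdist z _ H1 H2). assert (A1 := Rmin_l (d / 2) e). assert (A2 := Rmin_r (d / 2) e).
      destruct (H (phi z)) as [z' [Hz' [Dz' Ez']]]; [rewrite Ez0; lra|].
      apply (cu_univalent _ _ Hphi) in Ez'; [|exact Hz'|exact Hz]. subst z'.
      assert (T := Cmod_triangle (z - z0) z0). replace (z - z0 + z0)%C with z in T by ring. unfold e in *. lra.
    - assert (Hp : 0 < (R1 - Cmod w) / 2) by lra. exists (mkposreal _ Hp). simpl. intros z _ H0 H1 H2.
      assert (D := Hdist z _ H1 H2). assert (T := Cmod_triangle (phi z - w) w).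
      replace (phi z - w + w)%C with (phi z) in T by ring. lra. }
  set (del := fun u v => proj1_sig (constructive_indefinite_description _ (Loc u v))).
  destruct (compactness_value_2d (- M) M (- M) M del) as [d Hd].
  exists d. split; [apply cond_pos|]. intros z Hz HM.
  apply Rnot_lt_le. intros Hlt.
  assert (A1 := re_le_Cmod (phi z)). assert (A2 := im_le_Cmod (phi z)).
  assert (B1 : - M <= Re (phi z) <= M) by (apply Rabs_le_between; lra).
  assert (B2 : - M <= Im (phi z) <= M) by (apply Rabs_le_between; lra).
  apply (Hd _ _ B1 B2). intros (u & v & _ & _ & D1 & D2 & D3).
  unfold del in *. destruct (constructive_indefinite_description _ (Loc u v)) as [e He]. simpl in *.
  assert (K := He z Hz ltac:(lra) D1 D2). lra.
Qed.

(** The omitted set is unbounded. Otherwise [phi] would tend to infinity at the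
    whole unit circle (by connectedness of circles, since it does so at 1), and
    [z / (phi z - phi 0)] would be holomorphic with boundary values 0. *)
Lemma omitted_unbounded (R0 : R) : exists w, ~ Omega w /\ R0 < Cmod w.
Proof.
  apply NNPP. intros Hno.
  assert (HR : forall w, R0 + 1 <= Cmod w -> Omega w).
  { intros w Hw. apply NNPP. intros K. apply Hno. exists w. split; [exact K|lra]. }
  set (R1 := R0 + 1) in *.
  destruct (analytic_div_z phi (cu_analytic _ _ Hphi)) as (q & Hq & Eq & Tq).
  assert (Hq0 : forall z, disc z -> q z <> 0%C).
  { intros z Hz K. destruct (classic (z = 0%C)) as [->|Hz0].
    - assert (E := Tq 0%nat). rewrite taylor_0, K in E by exact Hq.
      assert (E1 := taylor_S phi 0 (cu_analytic _ _ Hphi)). rewrite <- E, taylor_0 in E1 by apply analytic_C_derive, (cu_analytic _ _ Hphi).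
      apply Hd0. rewrite <- E1. ring.
    - apply Hz0. apply (cu_univalent _ _ Hphi); [exact Hz|apply disc_0|]. rewrite (Eq z Hz), K. ring. }
  set (m := Cmod (q 0%C)). assert (Hm : 0 < m) by (apply Cmod_gt_0, Hq0, disc_0).
  set (M := Rmax R1 0 + Cmod (phi 0%C) + 2 * m + 1).
  assert (M1 := Rmax_l R1 0). assert (M2 := Rmax_r R1 0). assert (M3 := Cmod_ge_0 (phi 0%C)).
  assert (HM1 : R1 <= M) by (unfold M; lra).
  destruct (proper_on_annulus R1 M HR) as [d [Hd Hprop]].
  assert (Hpole := cu_pole _ _ Hphi (fun x => M < x)).
  destruct Hpole as [e He]. { exists M. auto. }
  assert (He' : exists e, 0 < e /\ forall z, Cmod (z - 1) < e -> disc z -> M < Cmod (phi z)).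
  { exists e. split; [apply cond_pos|]. intros z Hz1 Hz. apply He; [|exact Hz]. apply C_NormedModule_mixin_compat1. exact Hz1. }
  clear e He. destruct He' as [e [He HeM]].
  set (r := 1 - Rmin (Rmin (d / 2) (e / 2)) (1 / 2)).
  assert (Hr : 0 < Rmin (Rmin (d / 2) (e / 2)) (1 / 2)) by (repeat apply Rmin_glb_lt; lra).
  assert (Hr1 := Rmin_l (Rmin (d / 2) (e / 2)) (1 / 2)). assert (Hr2 := Rmin_r (Rmin (d / 2) (e / 2)) (1 / 2)).
  assert (Hr3 := Rmin_l (d / 2) (e / 2)). assert (Hr4 := Rmin_r (d / 2) (e / 2)).
  assert (Hrr : 1 / 2 <= r < 1 /\ 1 - d < r /\ 1 - e < r) by (unfold r; lra). clearbody r.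
  assert (Hpol : forall t, disc (polar r t)) by (intros; unfold disc; rewrite Cmod_polar; lra).
  assert (Hcirc : forall t, 0 <= t -> M < Cmod (phi (polar r t))).
  { intros t Ht. apply Rnot_le_lt. intros Hle.
    assert (Hstart : M < Cmod (phi (polar r 0))).
    { apply HeM; [|apply Hpol]. unfold polar. rewrite cos_0, sin_0.
      replace (((r * 1)%R, (r * 0)%R) - 1)%C with (RtoC (r - 1)) by (unfold RtoC, Cminus, Cplus, Copp; simpl; f_equal; ring).
      rewrite Cmod_R, Rabs_left; lra. }
    assert (Hs : 0 < t) by (destruct Ht as [K|K]; [exact K|subst t; lra]).
    destruct (Ranalysis5.IVT_interv (fun t => M - Cmod (phi (polar r t))) 0 t) as [x [Hx Ex]].
    - intros x _. apply continuity_pt_minus; [apply continuity_pt_const; intros a b; reflexivity|].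
      apply (pcont_Cmod (fun t => phi (polar r t))). apply (pcont_comp phi (polar r)); [|apply pcont_polar].
      eapply cderiv_ccont. apply analytic_cderiv; [apply (cu_analytic _ _ Hphi)|apply Hpol].
    - exact Hs.
    - lra.
    - destruct Hle as [K|K]; [lra|]. exfalso. assert (P := Hprop (polar r t) (Hpol t) ltac:(lra)). rewrite Cmod_polar in P; lra.
    - assert (P := Hprop (polar r x) (Hpol x) ltac:(lra)). rewrite Cmod_polar in P; lra. }
  assert (HG : analytic_on_disc (fun z => / q z)%C).
  { apply analytic_intro. intros z Hz. eexists. apply cderiv_inv; [apply Hq0, Hz|apply analytic_cderiv; assumption]. }
  assert (B := center_bound _ r (/ (2 * m + 1)) HG ltac:(lra)). cbv beta in B.
  rewrite Cmod_inv in B by (apply Hq0, disc_0). fold m in B.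
  assert (B' : / m <= 2 * / (2 * m + 1)).
  { apply B. intros t Ht. rewrite Cmod_inv by (apply Hq0, Hpol). apply Rinv_le_contravar; [lra|].
    specialize (Hcirc t ltac:(lra)). rewrite (Eq _ (Hpol t)) in Hcirc.
    assert (T := Cmod_triangle (phi 0) (polar r t * q (polar r t))). rewrite Cmod_mult, Cmod_polar in T by lra.
    assert (0 <= Cmod (q (polar r t))) by apply Cmod_ge_0. unfold M in Hcirc. nra. }
  apply (Rmult_le_compat_l (m * (2 * m + 1))) in B'; [|nra].
  replace (m * (2 * m + 1) * / m) with (2 * m + 1) in B' by (field; lra).
  replace (m * (2 * m + 1) * (2 * / (2 * m + 1))) with (2 * m) in B' by (field; lra). lra.
Qed.

Lemma omitted_closed (w : C) : (forall e, 0 < e -> exists w', ~ Omega w' /\ Cmod (w' - w) < e) -> ~ Omega w.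
Proof.
  intros H Hw. destruct (image_open w Hw) as [d [Hd HO]]. destruct (H d Hd) as [w' [A B]]. apply A, HO, B.
Qed.

(** ** Distance to the boundary *)

Lemma boundary_nonempty : exists w, boundary Omega w.
Proof.
  destruct (omitted_unbounded 0) as [p [Hp _]].
  set (x := fun t : R => (phi 0%C + RtoC t * (p - phi 0%C))%C).
  assert (Hx : forall s t, Cmod (x s - x t) = Rabs (s - t) * Cmod (p - phi 0%C)).
  { intros s t. replace (x s - x t)%C with (RtoC (s - t) * (p - phi 0%C))%C by (unfold x; rewrite RtoC_minus; ring).
    rewrite Cmod_mult, Cmod_R. reflexivity. }
  assert (X0 : Omega (x 0)) by (exists 0%C; split; [apply disc_0|unfold x; ring]).
  assert (X1 : ~ Omega (x 1)) by (replace (x 1) with p by (unfold x; ring); exact Hp).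
  destruct (completeness (fun t => 0 <= t <= 1 /\ Omega (x t))) as [s [S1 S2]].
  - exists 1. intros t [Ht _]. lra.
  - exists 0. split; [lra|exact X0].
  - assert (Hs : 0 <= s <= 1).
    { split; [apply S1; split; [lra|exact X0]|apply S2; intros t [Ht _]; lra]. }
    set (k := Cmod (p - phi 0%C)). assert (Hk : 0 <= k) by apply Cmod_ge_0.
    exists (x s). intros e He. set (h := e / (k + 1)). assert (Hh : 0 < h) by (apply Rdiv_lt_0_compat; lra).
    assert (Near : forall t, Rabs (t - s) < h -> Cmod (x t - x s) < e).
    { intros t Ht. rewrite Hx. fold k. pose proof (Rabs_pos (t - s)).
      assert (h * (k + 1) = e) by (unfold h; field; lra). nra. }
    split.
    + apply NNPP. intros K. assert (s <= s - h); [|lra]. apply S2. intros t [Ht Ot].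
      apply Rnot_lt_le. intros Hlt. apply K. exists (x t). split; [|exact Ot]. apply Near.
      assert (t <= s) by (apply S1; auto). apply Rabs_def1; lra.
    + destruct (Rle_dec 1 s) as [L|L].
      * exists (x 1). split; [|exact X1]. apply Near. replace (1 - s) with 0 by lra. rewrite Rabs_R0. exact Hh.
      * set (t := s + Rmin (h / 2) (1 - s)). assert (A1 := Rmin_l (h / 2) (1 - s)). assert (A2 := Rmin_r (h / 2) (1 - s)).
        assert (A3 : 0 < Rmin (h / 2) (1 - s)) by (apply Rmin_glb_lt; lra).
        exists (x t). split; [apply Near; unfold t; rewrite Rabs_right; lra|].
        intros K. assert (t <= s); [apply S1; split; [unfold t; lra|exact K]|unfold t in *; lra].
Qed.

(** A boundary point nearly realizing the distance has omitted points beside it. *)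
Lemma near_omitted_point (eps : R) : 0 < eps -> exists p, ~ Omega p /\
  Cmod (phi 0%C - p) < dist_to_set (phi 0%C) (boundary Omega) + eps.
Proof.
  intros Heps. set (S := fun x : R => exists w : C, boundary Omega w /\ x = Cmod (phi 0%C - w)).
  destruct (Glb_Rbar_correct S) as [G1 G2]. unfold dist_to_set. fold S.
  assert (L0 : Rbar_le 0 (Glb_Rbar S)). { apply G2. intros x [w [_ ->]]. simpl. apply Cmod_ge_0. }
  destruct boundary_nonempty as [w0 Hw0].
  assert (L1 : Rbar_le (Glb_Rbar S) (Cmod (phi 0%C - w0))) by (apply G1; exists w0; auto).
  destruct (Glb_Rbar S) as [d| |] eqn:E; simpl in L0, L1; try contradiction. simpl.
  assert (K : exists x, S x /\ x < d + eps / 2).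
  { apply NNPP. intros N. assert (B : Rbar_le (d + eps / 2) d).
    { apply G2. intros x Sx. simpl. apply Rnot_lt_le. intros Hlt. apply N. exists x. auto. }
    simpl in B. lra. }
  destruct K as [x [[w [Bw ->]] Hx]]. destruct (Bw (eps / 2) ltac:(lra)) as [_ [p [Hp Np]]].
  exists p. split; [exact Np|].
  replace (phi 0 - p)%C with ((phi 0 - w) + - (p - w))%C by ring.
  eapply Rle_lt_trans; [apply Cmod_triangle|]. rewrite Cmod_opp. lra.
Qed.

(** ** The recession cone of the omitted set *)

Section Cone.

Variable p : C.
Hypothesis Hp : ~ Omega p.

Definition omitted_ray (t : R) : Prop := forall s, 0 <= s -> ~ Omega (p + polar s t)%C.

Lemma omitted_ray_ext (t u : R) : polar 1 t = polar 1 u -> omitted_ray t -> omitted_ray u.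
Proof. intros E H s Hs. rewrite polar_mult, <- E, <- polar_mult. apply H, Hs. Qed.

Lemma convex_point (w : C) (x : R) : ~ Omega w -> 0 <= x <= 1 -> ~ Omega (p + RtoC x * (w - p))%C.
Proof.
  intros Hw Hx. assert (K := cu_convex _ _ Hphi p w x Hp Hw Hx). cbv beta in K.
  replace (p + RtoC x * (w - p))%C with (RtoC (1 - x) * p + RtoC x * w)%C by (rewrite RtoC_minus; ring). exact K.
Qed.

Lemma polar_close (s t eps : R) : 0 < eps -> exists d, 0 < d /\ forall t', Rabs (t' - t) < d -> Cmod (polar s t' - polar s t) < eps.
Proof. intros He. exact (pcont_polar s t eps He). Qed.

Lemma not_omitted_ray_open (t : R) : ~ omitted_ray t ->
  exists s d, 0 <= s /\ 0 < d /\ forall t', Rabs (t' - t) < d -> Omega (p + polar s t')%C.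
Proof.
  intros H. apply not_all_ex_not in H. destruct H as [s H]. apply imply_to_and in H. destruct H as [Hs H].
  apply NNPP in H. destruct (image_open _ H) as [e [He HO]]. destruct (polar_close s t e He) as [d [Hd HH]].
  exists s, d. repeat split; auto. intros t' Ht'. apply HO.
  replace (p + polar s t' - (p + polar s t))%C with (polar s t' - polar s t)%C by ring. apply HH, Ht'.
Qed.

Lemma omitted_ray_exists : exists t, omitted_ray t.
Proof.
  apply NNPP. intros Hno.
  assert (Loc : forall t, exists d : posreal, forall t', Rabs (t' - t) < d -> exists s, 0 <= s <= / d /\ Omega (p + polar s t')%C).
  { intros t. assert (N : ~ omitted_ray t) by (intros K; apply Hno; exists t; exact K).
    destruct (not_omitted_ray_open t N) as (s & d & Hs & Hd & H).
    assert (Hm : 0 < Rmin d (/ (s + 1))) by (apply Rmin_glb_lt; [exact Hd|apply Rinv_0_lt_compat; lra]).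
    exists (mkposreal _ Hm). simpl. intros t' Ht'. exists s. split.
    - split; [exact Hs|]. apply Rle_trans with (/ / (s + 1)).
      + rewrite Rinv_inv. lra.
      + apply Rinv_le_contravar; [exact Hm|apply Rmin_r].
    - apply H. eapply Rlt_le_trans; [exact Ht'|apply Rmin_l]. }
  set (del := fun t => proj1_sig (constructive_indefinite_description _ (Loc t))).
  destruct (compactness_value_1d (- PI) PI del) as [d Hd]. assert (Hdp := cond_pos d).
  assert (Hid : 0 < / d) by (apply Rinv_0_lt_compat, Hdp).
  destruct (omitted_unbounded (Cmod p + / d)) as [w [Hw Bw]].
  destruct (polar_form (w - p)) as [t [Ht Et]].
  assert (Bwp : / d < Cmod (w - p)).
  { assert (T := Cmod_triangle (w - p) p). replace (w - p + p)%C with w in T by ring. lra. }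
  apply (Hd t ltac:(lra)). intros (u & _ & D1 & D2).
  unfold del in *. destruct (constructive_indefinite_description _ (Loc u)) as [e He]. simpl in *.
  destruct (He t D1) as [s [Hs Os]].
  assert (Hse : s <= / d) by (eapply Rle_trans; [apply Hs|apply Rinv_le_contravar; [exact Hdp|exact D2]]).
  apply (convex_point w (s / Cmod (w - p)) Hw).
  - split; [apply Rmult_le_pos; [lra|left; apply Rinv_0_lt_compat; lra]|].
    apply (Rmult_le_reg_r (Cmod (w - p))); [lra|]. unfold Rdiv. rewrite Rmult_assoc, Rinv_l; lra.
  - rewrite Et at 2. rewrite (polar_mult (Cmod (w - p))), Cmult_assoc, <- RtoC_mult.
    replace (s / Cmod (w - p) * Cmod (w - p)) with s by (field; lra). rewrite <- polar_mult. exact Os.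
Qed.

(** If omitted points of argument [t] existed arbitrarily far away, the segments
    joining them to [p] would fill up the half-line from [p]. *)
Lemma direction_of_not_omitted (t : R) : ~ omitted_ray t -> direction_to_infinity Omega t.
Proof.
  intros H. apply NNPP. intros N. apply H. intros s Hs. apply omitted_closed. intros e He.
  set (M := s * (Cmod p + 1) / e + s + 1).
  assert (K : exists x, M < x /\ ~ Omega (polar x t)).
  { apply NNPP. intros N'. apply N. exists M. intros x Hx. apply NNPP. intros O. apply N'. exists x. split; [exact Hx|exact O]. }
  destruct K as [x [Hx Ox]]. pose proof (Cmod_ge_0 p) as Hp0.
  assert (Hse : 0 <= s * (Cmod p + 1) / e).
  { apply Rmult_le_pos; [apply Rmult_le_pos; lra|left; apply Rinv_0_lt_compat, He]. }
  assert (Hxp : 0 < x) by (unfold M in Hx; lra).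
  exists (p + RtoC (s / x) * (polar x t - p))%C. split.
  - apply convex_point; [exact Ox|]. split; [apply Rmult_le_pos; [exact Hs|left; apply Rinv_0_lt_compat, Hxp]|].
    apply (Rmult_le_reg_r x); [exact Hxp|]. unfold Rdiv. rewrite Rmult_assoc, Rinv_l by lra. unfold M in Hx. lra.
  - replace (p + RtoC (s / x) * (polar x t - p) - (p + polar s t))%C with (- (RtoC (s / x) * p))%C.
    + rewrite Cmod_opp, Cmod_mult, Cmod_R, Rabs_right
        by (apply Rle_ge, Rmult_le_pos; [exact Hs|left; apply Rinv_0_lt_compat, Hxp]).
      apply (Rmult_lt_reg_r x); [exact Hxp|]. replace (s / x * Cmod p * x) with (s * Cmod p) by (field; lra).
      assert (A : s * (Cmod p + 1) <= e * (s * (Cmod p + 1) / e)) by (right; field; lra).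
      assert (B : e * (s * (Cmod p + 1) / e) < e * x) by (apply Rmult_lt_compat_l; [exact He|unfold M in Hx; lra]). lra.
    + rewrite (polar_mult x), (polar_mult s). rewrite RtoC_div by lra. field. intros K; injection K; lra.
Qed.

Lemma omitted_ray_convex (t1 t t2 : R) : omitted_ray t1 -> omitted_ray t2 -> t1 <= t <= t2 -> t2 - t1 < PI -> omitted_ray t.
Proof.
  intros H1 H2 Ht Hpi s Hs. pose proof PI_RGT_0.
  destruct (Req_dec t1 t2) as [E|E]. { replace t with t1 by lra. apply H1, Hs. }
  assert (Sp : 0 < sin (t2 - t1)) by (apply sin_gt_0; lra).
  assert (S1 : 0 <= sin (t2 - t)) by (apply sin_ge_0; lra).
  assert (S2 : 0 <= sin (t - t1)) by (apply sin_ge_0; lra).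
  assert (Hi : 0 < / sin (t2 - t1)) by (apply Rinv_0_lt_compat, Sp).
  set (x := 2 * s * sin (t2 - t) / sin (t2 - t1)). set (y := 2 * s * sin (t - t1) / sin (t2 - t1)).
  assert (Hx : 0 <= x) by (unfold x, Rdiv; repeat apply Rmult_le_pos; lra).
  assert (Hy : 0 <= y) by (unfold y, Rdiv; repeat apply Rmult_le_pos; lra).
  assert (K := cu_convex _ _ Hphi _ _ (1 / 2) (H1 x Hx) (H2 y Hy) ltac:(lra)). cbv beta in K.
  replace (p + polar s t)%C with (RtoC (1 - 1 / 2) * (p + polar x t1) + RtoC (1 / 2) * (p + polar y t2))%C; [exact K|].
  assert (SC1 := sin2_cos2 t1). assert (SC2 := sin2_cos2 t2). unfold Rsqr in *.
  assert (Ec : sin (t2 - t) * cos t1 + sin (t - t1) * cos t2 = cos t * sin (t2 - t1)).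
  { rewrite !sin_minus. ring. }
  assert (Es : sin (t2 - t) * sin t1 + sin (t - t1) * sin t2 = sin t * sin (t2 - t1)).
  { rewrite !sin_minus. ring. }
  assert (E1 : x * cos t1 + y * cos t2 = 2 * s * cos t).
  { unfold x, y. replace (2 * s * cos t) with (2 * s * (cos t * sin (t2 - t1)) / sin (t2 - t1)) by (field; lra).
    rewrite <- Ec. field. lra. }
  assert (E2 : x * sin t1 + y * sin t2 = 2 * s * sin t).
  { unfold x, y. replace (2 * s * sin t) with (2 * s * (sin t * sin (t2 - t1)) / sin (t2 - t1)) by (field; lra).
    rewrite <- Es. field. lra. }
  destruct p as [a b]. unfold polar, RtoC, Cplus, Cmult; simpl. f_equal; lra.
Qed.

(** [e] is the sense of rotation away from [t0]. *)
Lemma last_omitted (t0 e : R) : e = 1 \/ e = -1 -> omitted_ray t0 ->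
  exists b, 0 <= b <= PI /\ omitted_ray (t0 + e * b) /\ forall x, b < x <= PI -> ~ omitted_ray (t0 + e * x).
Proof.
  intros He H0. pose proof PI_RGT_0.
  destruct (completeness (fun b => 0 <= b <= PI /\ omitted_ray (t0 + e * b))) as [b [B1 B2]].
  - exists PI. intros b [Hb _]. lra.
  - exists 0. split; [lra|]. rewrite Rmult_0_r, Rplus_0_r. exact H0.
  - assert (Hb : 0 <= b <= PI).
    { split; [apply B1; split; [lra|rewrite Rmult_0_r, Rplus_0_r; exact H0]|apply B2; intros x [Hx _]; lra]. }
    exists b. split; [exact Hb|]. split.
    + apply NNPP. intros N. destruct (not_omitted_ray_open _ N) as (s & d & Hs & Hd & H1).
      assert (b <= b - d); [|lra]. apply B2. intros x [Hx Ox]. apply Rnot_lt_le. intros Hlt.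
      assert (x <= b) by (apply B1; auto). apply (Ox s Hs). apply H1.
      apply Rabs_def1; destruct He; subst e; lra.
    + intros x Hx Ox. assert (x <= b) by (apply B1; split; [lra|exact Ox]). lra.
Qed.

Lemma polar_opp (t : R) : polar 1 (t + PI) = (- polar 1 t)%C.
Proof. unfold polar, Copp; simpl. rewrite neg_cos, neg_sin. f_equal; ring. Qed.

(** A line in the complement confines the connected image to one of its sides. *)
Lemma omitted_half_plane (t0 : R) : omitted_ray t0 -> omitted_ray (t0 + PI) ->
  exists tau, forall t, tau <= t <= tau + PI -> omitted_ray t.
Proof.
  intros H1 H2. pose proof PI_RGT_0.
  set (k := (- Ci * polar 1 (- t0))%C).
  set (f := fun z => (k * (phi z - p))%C).
  assert (Hf : analytic_on_disc f).
  { apply analytic_intro. intros z Hz. eexists. apply cderiv_cmult, cderiv_minus; [|apply cderiv_const].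
    apply analytic_cderiv; [apply (cu_analytic _ _ Hphi)|exact Hz]. }
  assert (Hk : forall s t, Re (k * polar s t) = s * sin (t - t0)).
  { intros s t. unfold k, polar, Ci, Copp, Cmult, Re; simpl. rewrite cos_neg, sin_neg, sin_minus. ring. }
  assert (Side : forall z s t, disc z -> (phi z - p)%C = polar s t -> Re (f z) = s * sin (t - t0)).
  { intros z s t _ E. unfold f. rewrite E. apply Hk. }
  assert (Av : forall z, disc z -> Re (f z) <> 0).
  { intros z Hz K. set (u := (polar 1 (- t0) * (phi z - p))%C).
    assert (Iu : Im u = 0).
    { rewrite <- K. unfold f, k. fold u. replace (- Ci * polar 1 (- t0) * (phi z - p))%C with (- Ci * u)%C by (unfold u; ring).
      destruct u as [x y]. unfold Re, Im, Ci, Copp, Cmult; simpl. ring. }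
    assert (Eu : (phi z - p)%C = (RtoC (Re u) * polar 1 t0)%C).
    { replace (RtoC (Re u)) with u by (destruct u as [x y]; unfold Im in Iu; simpl in Iu; subst y; reflexivity).
      unfold u. transitivity ((polar 1 t0 * polar 1 (- t0)) * (phi z - p))%C; [rewrite polar_conj_mul; ring|ring]. }
    assert (Oz : Omega (phi z)) by (exists z; auto).
    replace (phi z) with (p + (phi z - p))%C in Oz by ring. rewrite Eu in Oz.
    destruct (Rle_dec 0 (Re u)) as [Hs|Hs].
    - apply (H1 (Re u) Hs). rewrite polar_mult. exact Oz.
    - apply (H2 (- Re u) ltac:(lra)). rewrite polar_mult, polar_opp. 
      replace (RtoC (- Re u) * - polar 1 t0)%C with (RtoC (Re u) * polar 1 t0)%C by (rewrite RtoC_opp; ring). exact Oz. }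
  assert (Out : forall s t, Omega (p + polar s t)%C -> exists z, disc z /\ Re (f z) = s * sin (t - t0)).
  { intros s t [z [Hz E]]. exists z. split; [exact Hz|]. apply Side; [exact Hz|]. rewrite E. ring. }
  destruct (Rlt_dec (Re (f 0%C)) 0) as [L|L].
  - assert (All := re_lt_of_avoid f 0 Hf L Av). exists t0. intros t Ht s Hs O.
    destruct (Out s t O) as [z [Hz E]]. specialize (All z Hz). assert (0 <= sin (t - t0)) by (apply sin_ge_0; lra). nra.
  - assert (N0 := Av 0%C disc_0).
    assert (R1 : forall z, Re (- (1) * f z) = - Re (f z)) by (intros z; unfold Re, Cmult, Copp, RtoC; simpl; ring).
    assert (All : forall z, disc z -> Re (- (1) * f z) < 0).
    { apply (re_lt_of_avoid (fun z => - (1) * f z)%C 0).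
      - apply analytic_cmult, Hf.
      - rewrite R1. lra.
      - intros z Hz. rewrite R1. specialize (Av z Hz). lra. }
    exists (t0 - PI). intros t Ht s Hs O. destruct (Out s t O) as [z [Hz E]]. specialize (All z Hz). rewrite R1 in All.
    assert (0 <= sin (t0 - t)) by (apply sin_ge_0; lra).
    replace (t - t0) with (- (t0 - t)) in E by ring. rewrite sin_neg in E. nra.
Qed.

(** Between the last omitted directions on the two sides of [t0] the rays are
    omitted by convexity; the remaining arc consists of directions to infinity, so
    its width is at most [alpha PI]. If a side reaches a half turn, the complement
    contains a line and hence a half plane, and [alpha >= 1]. *)
Lemma omitted_cone : exists tau, forall t, tau <= t <= tau + (2 - alpha) * PI -> omitted_ray t.
Proof.
  pose proof PI_RGT_0 as Hpi. destruct omitted_ray_exists as [t0 H0].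
  destruct (last_omitted t0 1 ltac:(left; reflexivity) H0) as (b & Hb & Ob & Nb).
  destruct (last_omitted t0 (-1) ltac:(right; reflexivity) H0) as (a & Ha & Oa & Na).
  rewrite Rmult_1_l in Ob.
  assert (Line : omitted_ray (t0 + PI) -> exists tau, forall t, tau <= t <= tau + (2 - alpha) * PI -> omitted_ray t).
  { intros H1. destruct (omitted_half_plane t0 H0 H1) as [tau Ht]. exists tau. intros t Htt. apply Ht. nra. }
  destruct (Req_dec b PI) as [Eb|Eb]; [apply Line; rewrite <- Eb; exact Ob|].
  destruct (Req_dec a PI) as [Ea|Ea].
  { apply Line. apply (omitted_ray_ext (t0 + -1 * a)); [|exact Oa]. subst a.
    rewrite <- (polar_periodic 1 (t0 + -1 * PI)). f_equal. ring. }
  assert (Angle := cu_angle _ _ Hphi). unfold opening_angle_at_infinity in Angle.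
  set (S := fun x : R => _) in Angle. destruct (Lub_Rbar_correct S) as [U _].
  assert (Sx : S (2 * PI - a - b)).
  { exists (t0 + b), (t0 + 2 * PI - a). split; [lra|]. split; [ring|]. intros t Ht. apply direction_of_not_omitted.
    destruct (Rle_dec t (t0 + PI)) as [K|K].
    - replace t with (t0 + 1 * (t - t0)) by ring. apply Nb. lra.
    - intros O. apply (Na (t0 + 2 * PI - t)); [lra|]. apply (omitted_ray_ext t); [|exact O].
      rewrite <- (polar_periodic 1 (t0 + -1 * _)). f_equal. ring. }
  assert (B := Rbar_le_trans _ _ _ (U _ Sx) Angle). simpl in B.
  exists (t0 - a). intros t Ht. replace (t0 + -1 * a) with (t0 - a) in Oa by ring.
  destruct (Rle_dec t t0) as [K|K].
  - apply (omitted_ray_convex (t0 - a) t t0); auto; lra.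
  - apply (omitted_ray_convex t0 t (t0 + b)); auto; lra.
Qed.

(** Seen from [p] relative to [phi 0], the image lies between two rays. *)
Lemma omitted_rays : exists lo hi, lo < 0 < hi /\ hi - lo <= alpha * PI /\
  forall w s, Omega w -> 0 <= s -> ((w - p) / (phi 0 - p))%C <> polar s lo /\ ((w - p) / (phi 0 - p))%C <> polar s hi.
Proof.
  pose proof PI_RGT_0 as Hpi. destruct omitted_cone as [tau Hc].
  assert (O0 : Omega (phi 0%C)) by (exists 0%C; split; [apply disc_0|reflexivity]).
  destruct (polar_form (phi 0 - p)) as [th [_ Eth]]. set (del := Cmod (phi 0 - p)) in *.
  assert (Hne : (phi 0 - p)%C <> 0%C).
  { intros K. apply Hp. replace p with (phi 0 - (phi 0 - p))%C by ring. rewrite K. replace (phi 0 - 0)%C with (phi 0%C) by ring. exact O0. }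
  assert (Hdel : 0 < del) by (apply Cmod_gt_0, Hne).
  assert (Nth : ~ omitted_ray th).
  { intros K. apply (K del ltac:(lra)). rewrite <- Eth. replace (p + (phi 0 - p))%C with (phi 0%C) by ring. exact O0. }
  assert (Hmod : exists hi, 0 < hi <= 2 * PI /\ polar 1 hi = polar 1 (tau - th)).
  { destruct (polar_form (polar 1 (tau - th))) as [x [Hx Ex]]. rewrite Cmod_polar in Ex by lra.
    destruct (Rlt_dec 0 x) as [K|K].
    - exists x. split; [lra|]. symmetry; exact Ex.
    - exists (x + 2 * PI). split; [lra|]. rewrite polar_periodic. symmetry; exact Ex. }
  destruct Hmod as (hi & Hhi & Ehi).
  assert (Hray : forall x, 0 <= x <= (2 - alpha) * PI -> omitted_ray (th + hi + x)).
  { intros x Hx. apply (omitted_ray_ext (tau + x)); [|apply Hc; lra].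
    rewrite !polar_1_add, Ehi, <- polar_1_add. rewrite <- !polar_1_add. f_equal. ring. }
  assert (Nper : ~ omitted_ray (th + 2 * PI)).
  { intros K. apply Nth. apply (omitted_ray_ext (th + 2 * PI)); [apply polar_periodic|exact K]. }
  set (om := (2 - alpha) * PI) in *. assert (Hom : 0 <= om) by (unfold om; nra).
  assert (Hlo : hi + om < 2 * PI).
  { apply Rnot_le_lt. intros K. apply Nper. replace (th + 2 * PI) with (th + hi + (2 * PI - hi)) by ring. apply Hray. lra. }
  exists (hi + om - 2 * PI), hi. split; [lra|]. split; [unfold om; lra|].
  assert (Hw : forall w s t, Omega w -> 0 <= s -> omitted_ray (th + t) -> ((w - p) / (phi 0 - p))%C <> polar s t).
  { intros w s t Ow Hs Ht K. apply (Ht (del * s)); [apply Rmult_le_pos; lra|].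
    replace (p + polar (del * s) (th + t))%C with w; [exact Ow|].
    rewrite polar_mult, polar_1_add, RtoC_mult.
    replace (RtoC del * RtoC s * (polar 1 th * polar 1 t))%C with ((RtoC del * polar 1 th) * (RtoC s * polar 1 t))%C by ring.
    rewrite <- !polar_mult, <- Eth, <- K. field. exact Hne. }
  intros w s Ow Hs. split; apply Hw; auto.
  - apply (omitted_ray_ext (th + hi + om)); [|apply Hray; lra].
    rewrite <- (polar_periodic 1 (th + (hi + om - 2 * PI))). f_equal. ring.
  - replace (th + hi) with (th + hi + 0) by ring. apply Hray. lra.
Qed.

End Cone.

End Concave.

(** * The radius *)

Lemma Rpower_quotient (p x : R) : 0 <= x < 1 ->
  Rpower (1 + x) (p - 1) / Rpower (1 - x) (p + 1) = sector_pow (p - 1) x / (1 - x) ^ 2.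
Proof.
  intros Hx. unfold sector_pow, Rpower. rewrite ln_div by lra.
  replace ((p + 1) * ln (1 - x)) with ((p - 1) * ln (1 - x) + 2 * ln (1 - x)) by ring.
  replace ((p - 1) * (ln (1 + x) - ln (1 - x))) with ((p - 1) * ln (1 + x) + - ((p - 1) * ln (1 - x))) by ring.
  rewrite !exp_plus, exp_Ropp. replace (exp (2 * ln (1 - x))) with ((1 - x) ^ 2).
  - assert (0 < exp ((p - 1) * ln (1 - x))) by apply exp_pos. field. split; lra.
  - replace (2 * ln (1 - x)) with (ln (1 - x) + ln (1 - x)) by ring. rewrite exp_plus, exp_ln by lra. ring.
Qed.

Lemma f_alpha_sector (alpha x : R) : f_alpha alpha x = / (2 * alpha) * (sector_pow alpha x - 1).
Proof. reflexivity. Qed.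

(** The left side of the equation in terms of [sector_pow]; unlike the
    original it is continuous across [r = 0]. *)
Definition radius_fun (K : R) (m : nat) (alpha lambda r : R) : R :=
  / (2 * alpha) * (sector_pow alpha (r ^ m) - 1)
  + r * (sector_pow (alpha - 1) (r ^ m) / (1 - r ^ m) ^ 2)
  + lambda * (2 * K / (K + 1) * (/ (2 * alpha) * (sector_pow alpha r - 1)) - r)
  - / (2 * alpha).

Lemma pow_unit (r : R) (m : nat) : (1 <= m)%nat -> 0 <= r < 1 -> 0 <= r ^ m < 1.
Proof.
  intros Hm Hr. split; [apply pow_le; lra|]. destruct m as [|m]; [lia|]. simpl.
  assert (r ^ m <= 1) by (rewrite <- (pow1 m); apply pow_incr; lra).
  assert (0 <= r ^ m) by (apply pow_le; lra). nra.
Qed.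

Lemma radius_fun_eq (K : R) (m : nat) (alpha lambda r : R) : (1 <= m)%nat -> 0 <= r < 1 ->
  radius_equation_lhs K m alpha lambda r = radius_fun K m alpha lambda r.
Proof.
  intros Hm Hr. unfold radius_equation_lhs, radius_fun. rewrite Rpower_quotient by (apply pow_unit; assumption).
  rewrite !f_alpha_sector. reflexivity.
Qed.

Lemma sector_pow_le (p x y : R) : 0 <= p -> 0 <= x <= y -> y < 1 -> sector_pow p x <= sector_pow p y.
Proof.
  intros Hp Hxy Hy. apply Rle_Rpower_l; [exact Hp|]. split; [apply sector_base_pos; lra|].
  apply (Rmult_le_reg_r ((1 - x) * (1 - y))); [apply Rmult_lt_0_compat; lra|].
  replace ((1 + x) / (1 - x) * ((1 - x) * (1 - y))) with ((1 + x) * (1 - y)) by (field; lra).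
  replace ((1 + y) / (1 - y) * ((1 - x) * (1 - y))) with ((1 + y) * (1 - x)) by (field; lra). lra.
Qed.

Lemma qc_factor_ge_1 (K : R) : 1 <= K -> 1 <= 2 * K / (K + 1).
Proof.
  intros HK. apply (Rmult_le_reg_r (K + 1)); [lra|]. unfold Rdiv. rewrite Rmult_assoc, Rinv_l; lra.
Qed.

Lemma radius_fun_increasing (K : R) (m : nat) (alpha lambda x y : R) : 1 <= K -> 1 <= alpha -> 0 < lambda -> (1 <= m)%nat ->
  0 <= x < y -> y < 1 -> radius_fun K m alpha lambda x < radius_fun K m alpha lambda y.
Proof.
  intros HK Ha Hl Hm Hxy Hy. unfold radius_fun.
  assert (Px := pow_unit x m Hm ltac:(lra)). assert (Py := pow_unit y m Hm ltac:(lra)).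
  assert (Pxy : x ^ m <= y ^ m) by (apply pow_incr; lra).
  set (X := x ^ m) in *. set (Y := y ^ m) in *.
  assert (Hi : 0 < / (2 * alpha)) by (apply Rinv_0_lt_compat; lra).
  assert (A1 : / (2 * alpha) * (sector_pow alpha X - 1) <= / (2 * alpha) * (sector_pow alpha Y - 1)).
  { apply Rmult_le_compat_l; [lra|]. assert (M := sector_pow_le alpha X Y ltac:(lra) ltac:(lra) ltac:(lra)). lra. }
  assert (A2 : x * (sector_pow (alpha - 1) X / (1 - X) ^ 2) < y * (sector_pow (alpha - 1) Y / (1 - Y) ^ 2)).
  { assert (PX := sector_pow_pos (alpha - 1) X). assert (PY := sector_pow_pos (alpha - 1) Y).
    assert (IX : 0 < / (1 - X) ^ 2) by (apply Rinv_0_lt_compat, pow_lt; lra).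
    assert (IY : / (1 - X) ^ 2 <= / (1 - Y) ^ 2).
    { apply Rinv_le_contravar; [apply pow_lt; lra|]. apply pow_incr. lra. }
    apply Rle_lt_trans with (x * (sector_pow (alpha - 1) Y / (1 - Y) ^ 2)).
    - apply Rmult_le_compat_l; [lra|]. apply Rmult_le_compat; [lra|lra| |exact IY]. apply sector_pow_le; lra.
    - apply Rmult_lt_compat_r; [|lra]. apply Rmult_lt_0_compat; lra. }
  assert (A3 : 2 * K / (K + 1) * (/ (2 * alpha) * (sector_pow alpha x - 1)) - x
     <= 2 * K / (K + 1) * (/ (2 * alpha) * (sector_pow alpha y - 1)) - y).
  { assert (Hk := qc_factor_ge_1 K HK). set (k := 2 * K / (K + 1)) in *.
    apply (increasing_of_derive (fun t => k * (/ (2 * alpha) * (sector_pow alpha t - 1)) - t)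
       (fun t => k * (sector_pow (alpha - 1) t / (1 - t) ^ 2) - 1)); [lra| |].
    - intros t Ht. assert (D := sector_pow_derive alpha t ltac:(lra)).
      replace (k * (sector_pow (alpha - 1) t / (1 - t) ^ 2) - 1)
        with (k * (/ (2 * alpha) * (2 * alpha * (sector_pow (alpha - 1) t / (1 - t) ^ 2) - 0)) - 1) by (field; lra).
      apply (is_derive_minus (V := R_NormedModule)); [|apply (is_derive_id (K := R_AbsRing))].
      apply (is_derive_scal (fun t => / (2 * alpha) * (sector_pow alpha t - 1))).
      apply (is_derive_scal (fun t => sector_pow alpha t - 1)).
      apply (is_derive_minus (V := R_NormedModule)); [exact D|apply (is_derive_const (V := R_NormedModule))].
    - intros t Ht. assert (S := sector_pow_ge_1 (alpha - 1) t ltac:(lra) ltac:(lra)).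
      assert (I1 : 1 <= / (1 - t) ^ 2).
      { rewrite <- Rinv_1 at 1. apply Rinv_le_contravar; [apply pow_lt; lra|]. simpl. nra. }
      assert (1 <= sector_pow (alpha - 1) t / (1 - t) ^ 2) by (unfold Rdiv; nra). nra. }
  assert (A4 := Rmult_le_compat_l lambda _ _ (Rlt_le _ _ Hl) A3). lra.
Qed.

Lemma sector_pow_continuity (p x : R) : 0 <= x < 1 -> continuity_pt (sector_pow p) x.
Proof.
  intros Hx. apply continuity_pt_filterlim. apply (ex_derive_continuous (V := R_NormedModule)).
  eexists. apply sector_pow_derive, Hx.
Qed.

Lemma radius_fun_continuity (K : R) (m : nat) (alpha lambda r : R) : (1 <= m)%nat -> 0 <= r < 1 ->
  continuity_pt (radius_fun K m alpha lambda) r.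
Proof.
  intros Hm Hr. assert (P := pow_unit r m Hm Hr).
  assert (Cc : forall k : R, continuity_pt (fun _ => k) r) by (intros; apply continuity_pt_const; intros u v; reflexivity).
  assert (Cid : continuity_pt (fun x => x) r) by apply derivable_continuous_pt, derivable_pt_id.
  assert (Cp : continuity_pt (fun x => x ^ m) r) by apply derivable_continuous_pt, derivable_pt_pow.
  assert (Cs : forall p, continuity_pt (fun x => sector_pow p (x ^ m)) r).
  { intros p. apply (continuity_pt_comp (fun x => x ^ m) (sector_pow p)); [exact Cp|apply sector_pow_continuity, P]. }
  assert (C1 := Cc 1).
  unfold radius_fun. apply continuity_pt_minus; [|apply Cc]. apply continuity_pt_plus; [apply continuity_pt_plus|].
  - apply continuity_pt_mult; [apply Cc|]. apply continuity_pt_minus; [apply Cs|apply Cc].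
  - apply continuity_pt_mult; [exact Cid|]. apply continuity_pt_div; [apply Cs| |].
    + simpl. apply continuity_pt_mult; [|apply continuity_pt_mult; [|apply Cc]];
        (apply continuity_pt_minus; [apply Cc|exact Cp]).
    + apply pow_nonzero. lra.
  - apply continuity_pt_mult; [apply Cc|]. apply continuity_pt_minus; [|exact Cid].
    apply continuity_pt_mult; [apply Cc|]. apply continuity_pt_mult; [apply Cc|].
    apply continuity_pt_minus; [apply sector_pow_continuity, Hr|apply Cc].
Qed.

Lemma radius_fun_0 (K : R) (m : nat) (alpha lambda : R) : 1 <= alpha -> (1 <= m)%nat -> radius_fun K m alpha lambda 0 < 0.
Proof.
  intros Ha Hm. unfold radius_fun. rewrite pow_i by lia. rewrite !sector_pow_0.
  assert (0 < / (2 * alpha)) by (apply Rinv_0_lt_compat; lra). lra.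
Qed.

(** At [r = 1 - 1 / (2 m)] Bernoulli's inequality gives [r ^ m >= 1 / 2], where
    [((1 + x) / (1 - x)) ^ alpha >= 3] already. *)
Lemma radius_exists (K : R) (m : nat) (alpha lambda : R) : 1 <= K -> 1 <= alpha -> 0 < lambda -> (1 <= m)%nat ->
  exists r, is_radius K m alpha lambda r.
Proof.
  intros HK Ha Hl Hm. assert (Hm1 : 1 <= INR m) by (apply (le_INR 1); exact Hm).
  set (e := / (2 * INR m)). assert (He : 0 < e) by (apply Rinv_0_lt_compat; lra).
  assert (He2 : INR m * e = 1 / 2) by (unfold e; field; lra).
  assert (He1 : e <= 1 / 2) by nra.
  assert (B : forall n, 1 - INR n * e <= (1 - e) ^ n).
  { induction n as [|n IH]; [simpl; lra|]. rewrite S_INR. simpl pow. pose proof (pos_INR n).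
    assert (Q : (1 - e) * (1 - INR n * e) <= (1 - e) * (1 - e) ^ n) by (apply Rmult_le_compat_l; lra).
    assert (0 <= INR n * e * e) by (repeat apply Rmult_le_pos; lra). lra. }
  specialize (B m). set (r1 := 1 - e) in *.
  assert (Hr1 : 0 < r1 < 1) by (unfold r1; lra).
  assert (P := pow_unit r1 m Hm ltac:(lra)).
  assert (Hi : 0 < / (2 * alpha)) by (apply Rinv_0_lt_compat; lra).
  assert (H3 : 3 <= sector_pow alpha (r1 ^ m)).
  { apply Rle_trans with (sector_pow 1 (r1 ^ m)).
    - apply Rle_trans with (sector_pow 1 (1 / 2)).
      + unfold sector_pow. rewrite Rpower_1; lra.
      + apply sector_pow_le; lra.
    - unfold sector_pow. apply Rle_Rpower; [|exact Ha].
      apply (Rmult_le_reg_r (1 - r1 ^ m)); [lra|]. unfold Rdiv. rewrite Rmult_assoc, Rinv_l; lra. }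
  assert (Pos : 0 < radius_fun K m alpha lambda r1).
  { unfold radius_fun.
    assert (A2 : 0 <= r1 * (sector_pow (alpha - 1) (r1 ^ m) / (1 - r1 ^ m) ^ 2)).
    { apply Rmult_le_pos; [lra|]. apply Rmult_le_pos; [left; apply sector_pow_pos|]. left. apply Rinv_0_lt_compat, pow_lt. lra. }
    assert (A3 : 0 <= 2 * K / (K + 1) * (/ (2 * alpha) * (sector_pow alpha r1 - 1)) - r1).
    { assert (Hk := qc_factor_ge_1 K HK).
      (* Bernoulli's inequality for real exponents *)
      assert (T : r1 <= / (2 * alpha) * (sector_pow alpha r1 - 1)).
      { assert (W := increasing_of_derive (fun t => sector_pow alpha t - 2 * alpha * t)
          (fun t => 2 * alpha * (sector_pow (alpha - 1) t / (1 - t) ^ 2) - 2 * alpha) 0 r1 ltac:(lra)).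
        cbv beta in W. rewrite sector_pow_0 in W.
        apply (Rmult_le_reg_l (2 * alpha)); [lra|]. rewrite <- Rmult_assoc, Rinv_r, Rmult_1_l by lra.
        assert (1 - 2 * alpha * 0 <= sector_pow alpha r1 - 2 * alpha * r1); [|lra]. apply W.
        - intros t Ht. apply (is_derive_minus (V := R_NormedModule)); [apply sector_pow_derive; lra|]. auto_derive; [exact I|ring].
        - intros t Ht. assert (S := sector_pow_ge_1 (alpha - 1) t ltac:(lra) ltac:(lra)).
          assert (I1 : 1 <= / (1 - t) ^ 2).
          { rewrite <- Rinv_1 at 1. apply Rinv_le_contravar; [apply pow_lt; lra|]. simpl. nra. }
          assert (1 <= sector_pow (alpha - 1) t / (1 - t) ^ 2) by (unfold Rdiv; nra). nra. }
      nra. }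
    assert (0 <= lambda * (2 * K / (K + 1) * (/ (2 * alpha) * (sector_pow alpha r1 - 1)) - r1)) by (apply Rmult_le_pos; lra).
    nra. }
  assert (Neg := radius_fun_0 K m alpha lambda Ha Hm).
  destruct (Ranalysis5.IVT_interv (radius_fun K m alpha lambda) 0 r1) as [r [Hr Er]]; [|lra|exact Neg|exact Pos|].
  - intros x Hx. apply radius_fun_continuity; [exact Hm|lra].
  - assert (Hr0 : r <> 0) by (intros ->; lra).
    exists r. split; [lra|]. rewrite radius_fun_eq by (auto; lra). exact Er.
Qed.

Lemma radius_unique (K : R) (m : nat) (alpha lambda r r' : R) : 1 <= K -> 1 <= alpha -> 0 < lambda -> (1 <= m)%nat ->
  is_radius K m alpha lambda r -> is_radius K m alpha lambda r' -> r = r'.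
Proof.
  intros HK Ha Hl Hm [Hr E] [Hr' E']. rewrite radius_fun_eq in E, E' by (auto; lra).
  destruct (Rtotal_order r r') as [L|[L|L]]; [|exact L|]; exfalso.
  - assert (M := radius_fun_increasing K m alpha lambda r r' HK Ha Hl Hm ltac:(lra) ltac:(lra)). lra.
  - assert (M := radius_fun_increasing K m alpha lambda r' r HK Ha Hl Hm ltac:(lra) ltac:(lra)). lra.
Qed.

Lemma radius_fun_nonpos (K : R) (m : nat) (alpha lambda r x : R) : 1 <= K -> 1 <= alpha -> 0 < lambda -> (1 <= m)%nat ->
  is_radius K m alpha lambda r -> 0 <= x <= r -> radius_fun K m alpha lambda x <= 0.
Proof.
  intros HK Ha Hl Hm [Hr E] Hx. rewrite radius_fun_eq in E by (auto; lra).
  destruct (Req_dec x r) as [->|Hne]; [lra|].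
  assert (M := radius_fun_increasing K m alpha lambda x r HK Ha Hl Hm ltac:(lra) ltac:(lra)). lra.
Qed.

(** * The inequality *)

Lemma Series_split_first (u : nat -> R) : ex_series (fun n => u (S n)) ->
  Series (fun n => u (S n)) = u 1%nat + Series (fun n => u (n + 2)%nat).
Proof.
  intros H. rewrite Series_incr_1 by exact H. f_equal. apply Series_ext. intros n. f_equal. lia.
Qed.

(** Chain rule at the origin. *)
Lemma subordinate_derive_0 (h phi : C -> C) : analytic_on_disc phi -> subordinate h phi ->
  C_derive h 0%C <> 0%C -> C_derive phi 0%C <> 0%C.
Proof.
  intros Hphi (w & Hw & _ & Hw0 & Hhw) Hh0 K0. apply Hh0.
  assert (D : cderiv (fun z => phi (w z)) 0 (C_derive w 0 * C_derive phi (w 0))%C).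
  { apply (cderiv_comp phi w); apply analytic_cderiv; auto using disc_0. rewrite Hw0. apply disc_0. }
  rewrite Hw0, K0, Cmult_0_r in D.
  apply cderiv_C_derive. apply (cderiv_ext_loc _ h 0 _ 1 Rlt_0_1) with (2 := D).
  intros u Hu. symmetry. apply Hhw. unfold disc. replace u with (u - 0)%C by ring. exact Hu.
Qed.

(** [F = (h - p) / (phi 0 - p)] takes values in a sector and [F 0 = 1], so that
    [sector_estimates] bounds each of the four terms by [|phi 0 - p|] times its
    value for the extremal sector; these add up to [radius_fun]. *)
Lemma bohr_sum_omitted (K alpha lambda : R) (m : nat) (h g phi : C -> C) (a b : nat -> C) (p z : C) :
  1 <= K -> 1 <= alpha <= 2 -> 0 < lambda -> (1 <= m)%nat ->
  analytic_on_disc h -> analytic_on_disc g ->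
  (forall z, disc z -> C_derive h z <> 0%C) ->
  (forall z, disc z -> Cmod (dilatation h g z) <= (K - 1) / (K + 1)) ->
  has_expansion a h -> has_expansion b g -> concave_univalent alpha phi -> subordinate h phi ->
  ~ image_of_disc phi p -> Cmod z <= 1 / 3 -> radius_fun K m alpha lambda (Cmod z) <= 0 ->
  bohr_sum m lambda h a b z <= Cmod (phi 0%C) + Cmod (phi 0%C - p).
Proof.
  intros HK Ha Hl Hm Hh Hg Hh0 Hdil Exa Exb Hphi (w & Hw & Hwd & Hw0 & Hhw) Hp Hz13 Hrad.
  assert (Ea : forall n, a n = taylor h n) by (intros; apply expansion_taylor; exact Exa).
  assert (Eb : forall n, b n = taylor g n) by (intros; apply expansion_taylor; exact Exb).
  assert (Eh0 : h 0%C = phi 0%C) by (rewrite (Hhw 0%C disc_0), Hw0; reflexivity).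
  assert (Hd0 : C_derive phi 0%C <> 0%C).
  { apply (subordinate_derive_0 h phi); [apply (cu_analytic _ _ Hphi)|exists w; auto|apply Hh0, disc_0]. }
  destruct (omitted_rays alpha phi Ha Hphi Hd0 p Hp) as (lo & hi & Hlh & Hwid & Hrays).
  set (c := (phi 0 - p)%C). set (del := Cmod c).
  assert (Hc : c <> 0%C).
  { intros K0. apply Hp. exists 0%C. split; [apply disc_0|]. replace p with (phi 0 - c)%C by (unfold c; ring). rewrite K0. ring. }
  assert (Hdel : 0 < del) by (apply Cmod_gt_0, Hc).
  set (F := fun z => ((h z - p) / c)%C).
  assert (Hhp : forall z, disc z -> image_of_disc phi (h z)) by (intros u Hu; exists (w u); split; [auto|symmetry; apply Hhw, Hu]).
  assert (DF : forall z, disc z -> cderiv F z (/ c * C_derive h z)%C).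
  { intros u Hu. apply (cderiv_ext (fun z => / c * (h z - p))%C); [intros; unfold F, Cdiv; ring|].
    eapply cderiv_eq; [apply cderiv_cmult, cderiv_minus; [apply analytic_cderiv; assumption|apply cderiv_const]|]. ring. }
  assert (HF : analytic_on_disc F) by (apply analytic_intro; intros u Hu; eexists; apply DF, Hu).
  assert (F1 : F 0%C = 1%C) by (unfold F; rewrite Eh0; fold c; field; exact Hc).
  assert (SE : sector_estimates alpha F).
  { apply (sector_estimates_of_rays alpha lo hi F Ha HF F1 Hlh); [lra|]. intros u s Hu Hs. apply Hrays; auto. }
  destruct SE as [S1 S2 S3].
  assert (Edh : forall u, disc u -> Cmod (C_derive h u) = del * Cmod (C_derive F u)).
  { intros u Hu. rewrite (cderiv_C_derive _ _ _ (DF u Hu)), Cmod_mult, Cmod_inv by exact Hc. fold del. field. lra. }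
  assert (Eth : forall n, Cmod (taylor h (S n)) = del * Cmod (taylor F (S n))).
  { intros n. rewrite (taylor_ext h (fun z => p + c * F z)%C) by (intros; unfold F; field; exact Hc).
    rewrite (taylor_plus (fun _ => p) (fun z => c * F z)%C), (taylor_const_S p), (taylor_cmult c F) by analytic.
    rewrite Cplus_0_l, Cmod_mult. reflexivity. }
  set (r := Cmod z) in *. assert (Hr0 : 0 <= r) by apply Cmod_ge_0.
  assert (Hrm := pow_unit r m Hm ltac:(lra)).
  assert (Hzm : disc (z ^ m)%C) by (unfold disc; rewrite Cmod_pow; apply Hrm).
  assert (Ezm : Cmod (z ^ m) = r ^ m) by (rewrite Cmod_pow; reflexivity).
  assert (T1 : Cmod (h (z ^ m)%C) <= Cmod (phi 0%C) + del * (sector_pow alpha (r ^ m) - 1)).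
  { replace (h (z ^ m)%C) with (phi 0 + c * (F (z ^ m)%C - 1))%C by (unfold F; field_simplify; [|exact Hc]; unfold c; ring).
    eapply Rle_trans; [apply Cmod_triangle|]. apply Rplus_le_compat_l. rewrite Cmod_mult. fold del.
    apply Rmult_le_compat_l; [lra|]. rewrite <- Ezm. apply S2, Hzm. }
  assert (T2 : Cmod (C_derive h (z ^ m)%C) * r <= del * (2 * alpha * (r * (sector_pow (alpha - 1) (r ^ m) / (1 - r ^ m) ^ 2)))).
  { rewrite (Edh _ Hzm), Rmult_assoc. apply Rmult_le_compat_l; [lra|].
    assert (S := S1 _ Hzm). rewrite Ezm in S. apply (Rmult_le_compat_r r) in S; [|exact Hr0]. lra. }
  assert (T3 : Series (fun n => Cmod (a (n + 2)%nat) * r ^ (n + 2)) <= del * (sector_pow alpha r - 1 - 2 * alpha * r)).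
  { rewrite (Series_ext _ (fun n => del * (Cmod (taylor F (n + 2)) * r ^ (n + 2)))).
    - rewrite Series_scal_l. apply Rmult_le_compat_l; [lra|]. apply S3. lra.
    - intros n. rewrite Ea. replace (n + 2)%nat with (S (n + 1)) by lia. rewrite Eth. ring. }
  assert (A1 : Cmod (taylor h 1) <= del * (2 * alpha)).
  { rewrite Eth. apply Rmult_le_compat_l; [lra|].
    assert (S := S1 0%C disc_0). rewrite Cmod_0, sector_pow_0 in S.
    assert (T := taylor_S F 0 HF). rewrite taylor_0 in T by apply analytic_C_derive, HF. rewrite <- T in S.
    replace (RtoC (INR 1) * taylor F 1)%C with (taylor F 1) in S by (simpl; ring). lra. }
  assert (Hk : 0 <= (K - 1) / (K + 1)) by (apply Rmult_le_pos; [lra|left; apply Rinv_0_lt_compat; lra]).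
  assert (T4 : Series (fun n => Cmod (b (n + 1)%nat) * r ^ (n + 1)) <= (K - 1) / (K + 1) * (del * (sector_pow alpha r - 1))).
  { rewrite (Series_ext _ (fun n => Cmod (taylor g (S n)) * r ^ S n)) by (intros n; rewrite Eb; replace (n + 1)%nat with (S n) by lia; reflexivity).
    eapply Rle_trans; [apply (dilatation_majorant h g ((K - 1) / (K + 1)) r Hh Hg Hh0 Hdil); lra|].
    apply Rmult_le_compat_l; [exact Hk|].
    assert (E := taylor_abs_conv h Hh r ltac:(lra)). apply ex_series_incr_1 in E.
    rewrite (Series_split_first (fun n => Cmod (taylor h n) * r ^ n) E).
    rewrite (Series_ext (fun n => Cmod (taylor h (n + 2)) * r ^ (n + 2)) (fun n => Cmod (a (n + 2)%nat) * r ^ (n + 2)))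
      by (intros n; rewrite Ea; reflexivity).
    assert (Cmod (taylor h 1) * r ^ 1 <= del * (2 * alpha) * r) by (simpl; rewrite Rmult_1_r; apply Rmult_le_compat_r; assumption).
    lra. }
  unfold bohr_sum. fold r.
  assert (T34 := Rmult_le_compat_l lambda _ _ (Rlt_le _ _ Hl) (Rplus_le_compat _ _ _ _ T3 T4)).
  eapply Rle_trans; [apply Rplus_le_compat; [apply Rplus_le_compat; [exact T1|exact T2]|exact T34]|].
  fold c. fold del.
  assert (E : Cmod (phi 0%C) + del * (sector_pow alpha (r ^ m) - 1)
     + del * (2 * alpha * (r * (sector_pow (alpha - 1) (r ^ m) / (1 - r ^ m) ^ 2)))
     + lambda * (del * (sector_pow alpha r - 1 - 2 * alpha * r) + (K - 1) / (K + 1) * (del * (sector_pow alpha r - 1)))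
     = Cmod (phi 0%C) + del + del * (2 * alpha) * radius_fun K m alpha lambda r).
  { unfold radius_fun. field. repeat split; lra. }
  rewrite E. assert (0 <= del * (2 * alpha)) by (apply Rmult_le_pos; lra). nra.
Qed.

Lemma bohr_inequality_holds (K alpha lambda r : R) (m : nat) :
  1 <= K -> 1 <= alpha <= 2 -> 0 < lambda -> (1 <= m)%nat -> is_radius K m alpha lambda r ->
  bohr_inequality_up_to K m alpha lambda (Rmin (1 / 3) r).
Proof.
  intros HK Ha Hl Hm Hr f h g phi a b [[Hh Hg _] Hh0 _ Hdil] Exa Exb _ Hphi Hsub z Hz Hzr.
  assert (B1 := Rmin_l (1 / 3) r). assert (B2 := Rmin_r (1 / 3) r).
  assert (Hrad : radius_fun K m alpha lambda (Cmod z) <= 0).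
  { apply (radius_fun_nonpos K m alpha lambda r); auto; [lra|]. split; [apply Cmod_ge_0|lra]. }
  assert (Hd0 : C_derive phi 0%C <> 0%C).
  { apply (subordinate_derive_0 h phi); [apply (cu_analytic _ _ Hphi)|exact Hsub|apply Hh0, disc_0]. }
  apply Rnot_lt_le. intros Hlt.
  set (X := Cmod (phi 0%C) + dist_to_set (phi 0%C) (boundary (image_of_disc phi))) in *.
  destruct (near_omitted_point alpha phi Hphi Hd0 (bohr_sum m lambda h a b z - X) ltac:(lra)) as [p [Hp Dp]].
  assert (B := bohr_sum_omitted K alpha lambda m h g phi a b p z HK Ha Hl Hm Hh Hg Hh0 Hdil Exa Exb Hphi Hsub Hp ltac:(lra) Hrad).
  unfold X in Dp. lra.
Qed.

(** * The sector map *)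

Lemma Cmod_sqr (z : C) : Cmod z ^ 2 = Re z ^ 2 + Im z ^ 2.
Proof. unfold Cmod. rewrite pow2_sqrt; [reflexivity|]. pose proof (pow2_ge_0 (Re z)). pose proof (pow2_ge_0 (Im z)). unfold Re, Im in *. lra. Qed.

Lemma polar_inj (a b : R) : polar 1 a = polar 1 b -> Rabs (a - b) < 2 * PI -> a = b.
Proof.
  intros E H. assert (Ec : cos a = cos b) by (apply (f_equal Re) in E; unfold polar, Re in E; simpl in E; lra).
  assert (Es : sin a = sin b) by (apply (f_equal Im) in E; unfold polar, Im in E; simpl in E; lra).
  assert (C1 : cos (a - b) = 1).
  { rewrite cos_minus, Ec, Es. assert (S := sin2_cos2 b). unfold Rsqr in S. lra. }
  assert (Z : forall d, 0 < d < 2 * PI -> cos d <> 1).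
  { intros d Hd K. replace d with (2 * (d / 2)) in K by field. rewrite cos_2a_sin in K.
    assert (0 < sin (d / 2)) by (apply sin_gt_0; lra). nra. }
  apply Rabs_def2 in H.
  destruct (Rtotal_order a b) as [L|[L|L]]; [|exact L|]; exfalso.
  - apply (Z (b - a)); [lra|]. rewrite <- C1, <- cos_neg. f_equal. ring.
  - apply (Z (a - b)); lra.
Qed.

Lemma cexp_inj (u v : C) : cexp u = cexp v -> Rabs (Im u - Im v) < 2 * PI -> u = v.
Proof.
  intros E H. assert (Er : exp (Re u) = exp (Re v)) by (rewrite <- !Cmod_cexp, E; reflexivity).
  assert (Ei : Im u = Im v).
  { apply polar_inj; [|exact H]. rewrite !cexp_coords, <- Er in E.
    assert (N : RtoC (exp (Re u)) <> 0%C) by (intros K; injection K; pose proof (exp_pos (Re u)); lra).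
    transitivity (/ RtoC (exp (Re u)) * (RtoC (exp (Re u)) * polar 1 (Im u)))%C; [field; exact N|].
    rewrite E. field. exact N. }
  apply exp_inv in Er. destruct u as [u1 u2], v as [v1 v2]. unfold Re, Im in *; simpl in *. congruence.
Qed.

Lemma dist_to_set_le (p w : C) (S : C -> Prop) : S w -> dist_to_set p S <= Cmod (p - w).
Proof.
  intros Hw. unfold dist_to_set.
  match goal with |- real (Glb_Rbar ?T) <= _ => destruct (Glb_Rbar_correct T) as [G1 G2]; set (d := Glb_Rbar T) in * end.
  assert (L0 : Rbar_le 0 d) by (apply G2; intros x [v [_ ->]]; apply Cmod_ge_0).
  assert (L1 : Rbar_le d (Cmod (p - w))) by (apply G1; exists w; auto).
  destruct d; simpl in *; try contradiction. exact L1.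
Qed.

Section SectorMap.

Variables (alpha : R) (lam : C -> C).
Hypothesis Halpha : 1 <= alpha <= 2.
Hypothesis Hlam : is_half_plane_log 0 lam.

Local Notation eta := (alpha * (PI / 2)).

Definition sector_map (z : C) : C := (RtoC (/ (2 * alpha)) * (kernel alpha lam z - 1))%C.

Lemma lam_exp (z : C) : disc z -> cexp (lam z) = ((1 + z) / (1 - z))%C.
Proof.
  intros Hz. rewrite (half_plane_log_exp 0 lam z Hlam Hz), Ropp_0.
  replace (polar 1 0) with (RtoC 1) by (unfold polar, RtoC; rewrite cos_0, sin_0; f_equal; ring).
  rewrite !Cmult_1_l. reflexivity.
Qed.

Lemma one_minus_neq_0 (z : C) : disc z -> (1 - z)%C <> 0%C.
Proof.
  intros Hz K. unfold disc in Hz. replace z with (1 - (1 - z))%C in Hz by ring. rewrite K in Hz.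
  replace (1 - 0)%C with (RtoC 1) in Hz by ring. rewrite Cmod_1 in Hz. lra.
Qed.

Lemma one_plus_neq_0 (z : C) : disc z -> (1 + z)%C <> 0%C.
Proof.
  intros Hz. replace (1 + z)%C with (1 - - z)%C by ring. apply one_minus_neq_0. unfold disc. rewrite Cmod_opp. exact Hz.
Qed.

Lemma cayley_right_half_plane (z : C) : disc z -> 0 < Re ((1 + z) / (1 - z))%C.
Proof.
  intros Hz. assert (N := one_minus_neq_0 z Hz).
  set (w := ((1 + z) / (1 - z))%C).
  assert (E : (w * (1 - z))%C = (1 + z)%C) by (unfold w; field; exact N).
  clearbody w. assert (Q := Cmod_sqr z). unfold disc in Hz. assert (H0 := Cmod_ge_0 z).
  assert (H1 : Re z ^ 2 + Im z ^ 2 < 1) by nra. clear Q H0 Hz.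
  destruct z as [x y], w as [u v]. unfold Cmult, Cplus, Cminus, Copp, RtoC, Re, Im in *; simpl in *.
  assert (E1 := f_equal fst E). assert (E2 := f_equal snd E). simpl in E1, E2.
  assert (E3 : u * ((1 - x) * (1 - x) + y * y) = 1 - x * x - y * y).
  { replace (1 - x * x - y * y) with ((1 + x) * (1 - x) - y * (0 + y)) by ring. rewrite <- E1, <- E2. ring. }
  assert (D0 := Rle_0_sqr (1 - x)). assert (D1 := Rle_0_sqr y). unfold Rsqr in D0, D1.
  apply Rnot_le_lt. intros Hu. assert (0 < 1 - x * x - y * y) by lra.
  assert (u * ((1 - x) * (1 - x) + y * y) <= 0 * ((1 - x) * (1 - x) + y * y)) by (apply Rmult_le_compat_r; lra). lra.
Qed.

Lemma cayley_surjective (w : C) : 0 < Re w -> exists z, disc z /\ ((1 + z) / (1 - z))%C = w.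
Proof.
  intros Hw. assert (N : (w + 1)%C <> 0%C).
  { intros K. apply (f_equal Re) in K. unfold Re, Cplus, RtoC in *; simpl in K. lra. }
  assert (P : 0 < Cmod (w + 1)) by (apply Cmod_gt_0, N).
  assert (L : Cmod (w - 1) < Cmod (w + 1)).
  { assert (Q1 := Cmod_sqr (w - 1)). assert (Q2 := Cmod_sqr (w + 1)).
    assert (Re (w - 1) ^ 2 + Im (w - 1) ^ 2 < Re (w + 1) ^ 2 + Im (w + 1) ^ 2).
    { destruct w as [u v]. unfold Re, Im, Cminus, Cplus, Copp, RtoC in *; simpl in *. nra. }
    assert (0 <= Cmod (w - 1)) by apply Cmod_ge_0. nra. }
  exists ((w - 1) / (w + 1))%C. split.
  - unfold disc. rewrite Cmod_div by exact N. apply (Rmult_lt_reg_r (Cmod (w + 1))); [exact P|].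
    unfold Rdiv. rewrite Rmult_assoc, Rinv_l; lra.
  - assert (N2 : RtoC 2 <> 0%C) by (intros K; injection K; lra).
    field. split; [exact N|]. replace (w + 1 - (w - 1))%C with (RtoC 2) by (rewrite RtoC_plus || ring; ring). exact N2.
Qed.

Lemma lam_analytic : analytic_on_disc lam.
Proof. apply analytic_intro. intros z Hz. eexists. apply Hlam, Hz. Qed.

Lemma lam_strip (z : C) : disc z -> Rabs (Im (lam z)) < PI / 2.
Proof.
  intros Hz. pose proof PI_RGT_0. apply Rabs_def1; apply (log_strip (fun z => (1 + z) / (1 - z))%C lam (- (PI / 2)) (PI / 2));
    try exact Hz; try lra; try apply Hlam; try apply lam_analytic; try apply lam_exp.
  - intros u s Hu Hs. assert (P := cayley_right_half_plane u Hu).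
    split; intros K; rewrite K in P; unfold polar, Re in P; simpl in P; rewrite ?cos_neg, cos_PI2 in P; lra.
  - intros u s Hu Hs. assert (P := cayley_right_half_plane u Hu).
    split; intros K; rewrite K in P; unfold polar, Re in P; simpl in P; rewrite ?cos_neg, cos_PI2 in P; lra.
Qed.

Lemma cayley_injective (z1 z2 : C) : disc z1 -> disc z2 -> ((1 + z1) / (1 - z1))%C = ((1 + z2) / (1 - z2))%C -> z1 = z2.
Proof.
  intros H1 H2 E. assert (N1 := one_minus_neq_0 z1 H1). assert (N2 := one_minus_neq_0 z2 H2).
  assert (E1 : ((1 + z1) * (1 - z2))%C = ((1 + z2) * (1 - z1))%C).
  { transitivity ((1 + z1) / (1 - z1) * ((1 - z1) * (1 - z2)))%C; [field; exact N1|]. rewrite E. field. exact N2. }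
  assert (E2 : (RtoC 2 * (z1 - z2))%C = 0%C).
  { replace (RtoC 2 * (z1 - z2))%C with ((1 + z1) * (1 - z2) - (1 + z2) * (1 - z1))%C by ring. rewrite E1. ring. }
  assert (N3 : RtoC 2 <> 0%C) by (intros K; injection K; lra).
  replace z1 with (/ RtoC 2 * (RtoC 2 * (z1 - z2)) + z2)%C by (field; exact N3). rewrite E2. ring.
Qed.

Lemma kernel_arg (z : C) : disc z -> Im (RtoC alpha * lam z) = alpha * Im (lam z) /\ Rabs (alpha * Im (lam z)) < eta.
Proof.
  intros Hz. split.
  - destruct (lam z) as [x y]. unfold Im, RtoC, Cmult; simpl. ring.
  - rewrite Rabs_mult, Rabs_right by lra. apply Rmult_lt_compat_l; [lra|]. apply lam_strip, Hz.
Qed.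

Lemma kernel_injective (z1 z2 : C) : disc z1 -> disc z2 -> kernel alpha lam z1 = kernel alpha lam z2 -> z1 = z2.
Proof.
  intros H1 H2 E. pose proof PI_RGT_0.
  destruct (kernel_arg z1 H1) as [A1 B1]. destruct (kernel_arg z2 H2) as [A2 B2].
  apply cexp_inj in E.
  - assert (Na : RtoC alpha <> 0%C) by (intros K; injection K; lra).
    apply cayley_injective; try assumption. rewrite <- !lam_exp by assumption. f_equal.
    transitivity (/ RtoC alpha * (RtoC alpha * lam z1))%C; [field; exact Na|]. rewrite E. field. exact Na.
  - rewrite A1, A2. apply Rabs_def2 in B1. apply Rabs_def2 in B2. apply Rabs_def1; nra.
Qed.

(** The image is a sector: [(1 + z) / (1 - z)] maps onto the right half plane and
    the power multiplies arguments by [alpha]. *)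
Lemma kernel_image (W : C) :
  (exists z, disc z /\ kernel alpha lam z = W) <-> (exists rho t, 0 < rho /\ Rabs t < eta /\ W = polar rho t).
Proof.
  pose proof PI_RGT_0. split.
  - intros [z [Hz E]]. destruct (kernel_arg z Hz) as [A B].
    exists (exp (Re (RtoC alpha * lam z))), (alpha * Im (lam z)). repeat split; [apply exp_pos|exact B|].
    rewrite <- E, <- A. reflexivity.
  - intros (rho & t & Hr & Ht & ->).
    assert (Ht' : Rabs (t / alpha) < PI / 2).
    { unfold Rdiv at 1. rewrite Rabs_mult, (Rabs_right (/ alpha)) by (apply Rle_ge; left; apply Rinv_0_lt_compat; lra).
      apply (Rmult_lt_reg_r alpha); [lra|]. rewrite Rmult_assoc, Rinv_l; lra. }
    assert (Ht2 := Rabs_def2 _ _ Ht').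
    set (l := (ln rho / alpha, t / alpha) : C).
    destruct (cayley_surjective (cexp l)) as [z [Hz Ez]].
    { unfold cexp, l, Re, Im; simpl. apply Rmult_lt_0_compat; [apply exp_pos|]. apply cos_gt_0; lra. }
    exists z. split; [exact Hz|]. rewrite <- lam_exp in Ez by exact Hz. apply cexp_inj in Ez.
    + unfold kernel. rewrite Ez. unfold l, cexp, polar, Re, Im, RtoC, Cmult; simpl.
      replace (alpha * (ln rho / alpha) - 0 * (t / alpha)) with (ln rho) by (field; lra).
      replace (alpha * (t / alpha) + 0 * (ln rho / alpha)) with t by (field; lra).
      rewrite exp_ln by exact Hr. reflexivity.
    + assert (S := lam_strip z Hz). apply Rabs_def2 in S. unfold l. simpl. apply Rabs_def1; lra.
Qed.

(** The complement of the sector [|arg| < eta]. As [- cos eta >= 0], it is the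
    sublevel set of two convex functions. *)
Definition outside_sector (W : C) : Prop := Re W <= 0 /\ Re W * sin eta - Rabs (Im W) * cos eta <= 0.

Lemma eta_bounds : PI / 2 <= eta <= PI.
Proof. pose proof PI_RGT_0. nra. Qed.

Lemma sin_Rabs (t : R) : - PI <= t <= PI -> Rabs (sin t) = sin (Rabs t).
Proof.
  intros Ht. destruct (Rle_dec 0 t) as [L|L].
  - rewrite (Rabs_right t) by lra. apply Rabs_right, Rle_ge, sin_ge_0; lra.
  - assert (S : 0 <= sin (- t)) by (apply sin_ge_0; lra). rewrite (Rabs_left t) by lra.
    rewrite sin_neg in *. rewrite Rabs_left1; lra.
Qed.

Lemma cos_Rabs (t : R) : cos (Rabs t) = cos t.
Proof. unfold Rabs. destruct (Rcase_abs t); [apply cos_neg|reflexivity]. Qed.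

Lemma sector_form_polar (rho t : R) : 0 <= rho -> - PI <= t <= PI ->
  Re (polar rho t) * sin eta - Rabs (Im (polar rho t)) * cos eta = rho * sin (eta - Rabs t).
Proof.
  intros Hr Ht. unfold polar, Re, Im; simpl. rewrite Rabs_mult, (Rabs_right rho), sin_Rabs by (try apply Rle_ge; assumption).
  rewrite sin_minus, cos_Rabs. ring.
Qed.

Lemma kernel_omitted (W : C) : ~ (exists z, disc z /\ kernel alpha lam z = W) <-> outside_sector W.
Proof.
  assert (Hpi := PI_RGT_0). assert (He := eta_bounds). rewrite kernel_image. unfold outside_sector. split.
  - intros H. destruct (polar_form W) as [t [Ht E]]. assert (H0 := Cmod_ge_0 W).
    rewrite E. rewrite sector_form_polar by lra. set (rho := Cmod W) in *.
    destruct (Req_dec rho 0) as [Z|Z].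
    { rewrite Z, Rmult_0_l. unfold polar, Re; simpl. rewrite Rmult_0_l. lra. }
    assert (Hn : eta <= Rabs t).
    { apply Rnot_lt_le. intros L. apply H. exists rho, t. repeat split; [lra|exact L|exact E]. }
    assert (Hp : Rabs t <= PI) by (apply Rabs_le; lra).
    split.
    + unfold polar, Re; simpl. rewrite <- cos_Rabs. assert (cos (Rabs t) <= 0) by (apply cos_le_0; lra). nra.
    + assert (0 <= sin (Rabs t - eta)) by (apply sin_ge_0; lra).
      replace (eta - Rabs t) with (- (Rabs t - eta)) by ring. rewrite sin_neg. nra.
  - intros [H1 H2] (rho & t & Hr & Ht & ->).
    assert (Ht' : - PI <= t <= PI) by (apply Rabs_def2 in Ht; lra).
    rewrite sector_form_polar in H2 by lra. unfold polar, Re in H1; simpl in H1.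
    assert (P := Rabs_pos t).
    destruct (Req_dec (eta - Rabs t) PI) as [Z|Z].
    + assert (Z2 : Rabs t = 0) by lra. rewrite <- cos_Rabs, Z2, cos_0 in H1. lra.
    + assert (0 < sin (eta - Rabs t)) by (apply sin_gt_0; lra). nra.
Qed.

Lemma sector_map_eq (z w : C) : sector_map z = w <-> kernel alpha lam z = (RtoC (2 * alpha) * w + 1)%C.
Proof.
  assert (N : RtoC (2 * alpha) <> 0%C) by (intros K; injection K; lra).
  unfold sector_map. rewrite RtoC_inv by lra. split; intros H.
  - rewrite <- H. field. exact N.
  - rewrite H. field. exact N.
Qed.

Lemma sector_map_omitted (w : C) :
  ~ image_of_disc sector_map w <-> outside_sector (RtoC (2 * alpha) * w + 1)%C.
Proof.
  rewrite <- kernel_omitted. unfold image_of_disc. split; intros H [z [Hz E]]; apply H; exists z; split; auto; apply sector_map_eq; exact E.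
Qed.

Lemma sector_map_convex : convex_set (fun w => ~ image_of_disc sector_map w).
Proof.
  intros x y t Hx Hy Ht. rewrite sector_map_omitted in *.
  replace (RtoC (2 * alpha) * (RtoC (1 - t) * x + RtoC t * y) + 1)%C
    with (RtoC (1 - t) * (RtoC (2 * alpha) * x + 1) + RtoC t * (RtoC (2 * alpha) * y + 1))%C by (rewrite RtoC_minus; ring).
  generalize dependent (RtoC (2 * alpha) * x + 1)%C. generalize dependent (RtoC (2 * alpha) * y + 1)%C.
  intros [y1 y2] [Hy1 Hy2] [x1 x2] [Hx1 Hx2]. unfold outside_sector, Re, Im, Cplus, Cmult, RtoC in *; simpl in *.
  assert (He := eta_bounds). pose proof PI_RGT_0.
  assert (Hc : cos eta <= 0) by (apply cos_le_0; lra).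
  split; [nra|].
  assert (T : Rabs ((1 - t) * x2 + 0 * x1 + (t * y2 + 0 * y1)) <= (1 - t) * Rabs x2 + t * Rabs y2).
  { replace ((1 - t) * x2 + 0 * x1 + (t * y2 + 0 * y1)) with ((1 - t) * x2 + t * y2) by ring.
    eapply Rle_trans; [apply Rabs_triang|]. rewrite !Rabs_mult, (Rabs_right t), (Rabs_right (1 - t)) by lra. lra. }
  assert (T2 := Rmult_le_compat_neg_l (cos eta) _ _ Hc T).
  assert (0 <= (1 - t) * - (x1 * sin eta - Rabs x2 * cos eta)) by (apply Rmult_le_pos; lra).
  assert (0 <= t * - (y1 * sin eta - Rabs y2 * cos eta)) by (apply Rmult_le_pos; lra). lra.
Qed.

Lemma sector_map_cderiv (z : C) : disc z -> cderiv sector_map z (kernel alpha lam z / ((1 + z) * (1 - z)))%C.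
Proof.
  intros Hz. eapply cderiv_eq.
  - apply cderiv_cmult, cderiv_minus; [apply (ker_cderiv 0 alpha lam Hlam z Hz)|apply cderiv_const].
  - assert (N1 := one_minus_neq_0 z Hz). assert (N2 := one_plus_neq_0 z Hz). unfold half_plane_log'.
    rewrite Ropp_0, cos_0. replace (polar 1 0) with (RtoC 1) by (unfold polar, RtoC; rewrite cos_0, sin_0; f_equal; ring).
    rewrite !Cmult_1_l, Rmult_1_r, RtoC_inv, RtoC_mult by lra.
    assert (Na : RtoC alpha <> 0%C) by (intros K; injection K; lra).
    assert (N3 : RtoC 2 <> 0%C) by (intros K; injection K; lra). field. repeat split; assumption.
Qed.

Lemma sector_map_analytic : analytic_on_disc sector_map.
Proof. apply analytic_intro. intros z Hz. eexists. apply sector_map_cderiv, Hz. Qed.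

Lemma sector_map_univalent : univalent_on_disc sector_map.
Proof.
  intros z1 z2 H1 H2 E. apply kernel_injective; auto. apply sector_map_eq in E. rewrite E. symmetry. apply sector_map_eq. reflexivity.
Qed.

Lemma sector_map_pole : filterlim (fun z : C => Cmod (sector_map z))
  (within disc (locally (RtoC 1))) (Rbar_locally p_infty).
Proof.
  intros P [M HM]. unfold filtermap, within.
  set (T := Rmax 1 (2 * alpha * M + 2)). assert (T1 : 1 <= T) by apply Rmax_l. assert (T2 : 2 * alpha * M + 2 <= T) by apply Rmax_r.
  clearbody T. apply locally_Cmod. exists (/ T). split; [apply Rinv_0_lt_compat; lra|].
  intros z Hz1 Hz. apply HM.
  assert (N := one_minus_neq_0 z Hz). rewrite Cmod_sub_sym in Hz1.
  assert (P0 : 0 < Cmod (1 - z)) by (apply Cmod_gt_0, N).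
  assert (Hi : / T <= 1) by (rewrite <- Rinv_1; apply Rinv_le_contravar; lra).
  assert (L : 1 <= Cmod (1 + z)).
  { assert (L := Cmod_lower 2 (- (1 - z))). rewrite Cmod_opp in L. replace (2 + - (1 - z))%C with (1 + z)%C in L by ring.
    rewrite Cmod_R, Rabs_right in L by lra. lra. }
  assert (E : exp (Re (lam z)) = Cmod (1 + z) / Cmod (1 - z)) by (rewrite <- Cmod_cexp, lam_exp, Cmod_div by assumption; reflexivity).
  assert (B : T <= exp (Re (lam z))).
  { rewrite E. apply (Rmult_le_reg_r (Cmod (1 - z))); [exact P0|]. unfold Rdiv. rewrite Rmult_assoc, Rinv_l, Rmult_1_r by lra.
    assert (T * Cmod (1 - z) <= T * / T) by (apply Rmult_le_compat_l; lra). rewrite Rinv_r in H by lra. lra. }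
  assert (B0 : 0 <= Re (lam z)).
  { apply Rnot_lt_le. intros K. apply exp_increasing in K. rewrite exp_0 in K. lra. }
  assert (B1 : T <= Cmod (kernel alpha lam z)).
  { unfold kernel. rewrite Cmod_cexp. replace (Re (RtoC alpha * lam z)) with (alpha * Re (lam z))
      by (destruct (lam z); unfold Re, RtoC, Cmult; simpl; ring).
    eapply Rle_trans; [exact B|]. destruct (Req_dec (alpha * Re (lam z)) (Re (lam z))) as [->|Hne]; [lra|].
    left. apply exp_increasing. nra. }
  unfold sector_map. assert (Hi2 : 0 < / (2 * alpha)) by (apply Rinv_0_lt_compat; lra).
  rewrite Cmod_mult, Cmod_R, Rabs_right by lra.
  assert (L2 := Cmod_lower (kernel alpha lam z) (- (1))). rewrite Cmod_opp, Cmod_1 in L2. fold (kernel alpha lam z - 1)%C in L2.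
  apply (Rmult_lt_reg_l (2 * alpha)); [lra|]. rewrite <- Rmult_assoc, Rinv_r, Rmult_1_l by lra. lra.
Qed.

Lemma sector_map_direction (t u : R) : polar 1 t = polar 1 u -> - PI <= u <= PI ->
  direction_to_infinity (image_of_disc sector_map) t -> Rabs u <= eta.
Proof.
  intros E Hu [M HM]. pose proof PI_RGT_0. assert (He := eta_bounds).
  apply Rnot_lt_le. intros L. assert (Hp : Rabs u <= PI) by (apply Rabs_le; lra).
  assert (C0 : cos u < 0) by (rewrite <- cos_Rabs; apply cos_lt_0; lra).
  assert (S0 : 0 < sin (Rabs u - eta)) by (apply sin_gt_0; lra).
  set (q := Rmax (/ - cos u) (/ sin (Rabs u - eta))).
  assert (Q1 : / - cos u <= q) by apply Rmax_l. assert (Q2 : / sin (Rabs u - eta) <= q) by apply Rmax_r.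
  assert (I1 : 0 < / - cos u) by (apply Rinv_0_lt_compat; lra).
  set (s := Rmax M q + 1). assert (s1 := Rmax_l M q). assert (s2 := Rmax_r M q).
  assert (Hs : 0 < s) by (unfold s; lra).
  assert (O := HM s ltac:(unfold s; lra)). cbv beta in O.
  apply (proj2 (sector_map_omitted _)) in O; [exact O|].
  change (s * cos t, s * sin t) with (polar s t). rewrite polar_mult, E, <- polar_mult.
  assert (K1 : 1 <= s * - cos u).
  { rewrite <- (Rinv_l (- cos u)) by lra. apply Rmult_le_compat_r; [lra|]. unfold s. lra. }
  assert (K2 : 1 <= s * sin (Rabs u - eta)).
  { rewrite <- (Rinv_l (sin (Rabs u - eta))) by lra. apply Rmult_le_compat_r; [lra|]. unfold s. lra. }
  assert (F := sector_form_polar s u ltac:(lra) Hu).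
  replace (eta - Rabs u) with (- (Rabs u - eta)) in F by ring. rewrite sin_neg in F.
  unfold outside_sector. 
  assert (R1 : Re (RtoC (2 * alpha) * polar s u + 1)%C = 2 * alpha * (s * cos u) + 1) by (unfold polar, Re, Cplus, Cmult, RtoC; simpl; ring).
  assert (R2 : Im (RtoC (2 * alpha) * polar s u + 1)%C = 2 * alpha * Im (polar s u)) by (unfold polar, Im, Cplus, Cmult, RtoC; simpl; ring).
  rewrite R1, R2, Rabs_mult, (Rabs_right (2 * alpha)) by lra.
  replace (Re (polar s u)) with (s * cos u) in F by reflexivity.
  assert (Se : 0 <= sin eta <= 1) by (split; [apply sin_ge_0; lra|apply SIN_bound]).
  split; [nra|].
  replace ((2 * alpha * (s * cos u) + 1) * sin eta - 2 * alpha * Rabs (Im (polar s u)) * cos eta)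
    with (2 * alpha * (s * cos u * sin eta - Rabs (Im (polar s u)) * cos eta) + sin eta) by ring.
  rewrite F. nra.
Qed.

(** An arc longer than [2 eta] contains, on the side of its midpoint away from
    the positive axis, a direction of argument beyond [eta]. *)
Lemma sector_map_angle : Rbar_le (opening_angle_at_infinity (image_of_disc sector_map)) (Finite (PI * alpha)).
Proof.
  pose proof PI_RGT_0. assert (He := eta_bounds).
  unfold opening_angle_at_infinity.
  match goal with |- Rbar_le (Lub_Rbar ?S) _ => destruct (Lub_Rbar_correct S) as [_ H2] end.
  apply H2. intros x (a & b & Hab & -> & Hd). simpl. apply Rnot_lt_le. intros L.
  set (c := (a + b) / 2). set (h := (b - a) / 2).
  assert (Hh : eta < h) by (unfold h; lra). assert (Hpi : eta < PI) by lra.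
  destruct (polar_form (polar 1 c)) as [u [Hu E]]. rewrite Cmod_polar in E by lra.
  assert (Dir : forall x, - h < x < h -> - PI <= u + x <= PI -> Rabs (u + x) <= eta).
  { intros x Hx Hux. apply (sector_map_direction (c + x)); [rewrite !polar_1_add, E; reflexivity|exact Hux|].
    apply Hd. unfold c, h in *. lra. }
  assert (U0 : Rabs u <= eta).
  { replace u with (u + 0) by ring. apply Dir; lra. }
  apply Rabs_le_between in U0.
  destruct (Rle_dec 0 u) as [Hu0|Hu0].
  - set (m := Rmin h (PI - u)). assert (m1 : m <= h) by apply Rmin_l. assert (m2 : m <= PI - u) by apply Rmin_r.
    assert (m3 : eta - u < m) by (apply Rmin_glb_lt; lra). clearbody m.
    assert (B := Dir ((eta - u + m) / 2) ltac:(lra) ltac:(lra)). apply Rabs_le_between in B. lra.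
  - set (m := Rmin h (PI + u)). assert (m1 : m <= h) by apply Rmin_l. assert (m2 : m <= PI + u) by apply Rmin_r.
    assert (m3 : eta + u < m) by (apply Rmin_glb_lt; lra). clearbody m.
    assert (B := Dir (- ((eta + u + m) / 2)) ltac:(lra) ltac:(lra)). apply Rabs_le_between in B. lra.
Qed.

Lemma sector_map_concave : concave_univalent alpha sector_map.
Proof.
  constructor; [apply sector_map_analytic|apply sector_map_univalent|apply sector_map_pole|apply sector_map_convex|apply sector_map_angle].
Qed.

Lemma sector_map_0 : sector_map 0%C = 0%C.
Proof.
  unfold sector_map, kernel. rewrite (proj1 Hlam), Cmult_0_r, cexp_0. ring.
Qed.

(** The vertex [- 1 / (2 alpha)] of the sector is a boundary point. *)
Lemma sector_map_dist : dist_to_set (sector_map 0%C) (boundary (image_of_disc sector_map)) <= / (2 * alpha).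
Proof.
  pose proof PI_RGT_0. assert (He := eta_bounds).
  assert (Hi : 0 < / (2 * alpha)) by (apply Rinv_0_lt_compat; lra).
  set (v := RtoC (- / (2 * alpha))).
  assert (Vert : forall x, (RtoC (2 * alpha) * (v + RtoC x) + 1)%C = RtoC (2 * alpha * x)).
  { intros x. unfold v. rewrite <- RtoC_plus, <- RtoC_mult, <- RtoC_plus. f_equal. field. lra. }
  apply Rle_trans with (Cmod (sector_map 0 - v)).
  - apply dist_to_set_le. intros e Hpos. split.
    + exists (v + RtoC (e / 2))%C. split.
      * replace (v + RtoC (e / 2) - v)%C with (RtoC (e / 2)) by ring. rewrite Cmod_R, Rabs_right; lra.
      * destruct (proj2 (kernel_image (RtoC (2 * alpha * (e / 2))))) as [z [Hz E]].
        -- exists (2 * alpha * (e / 2)), 0. repeat split; [nra|rewrite Rabs_R0; lra|].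
           unfold polar, RtoC. rewrite cos_0, sin_0. f_equal; ring.
        -- exists z. split; [exact Hz|]. apply sector_map_eq. rewrite Vert. exact E.
    + exists v. split; [replace (v - v)%C with (RtoC 0) by ring; rewrite Cmod_0; exact Hpos|].
      apply sector_map_omitted. replace v with (v + RtoC 0)%C by ring. rewrite Vert, Rmult_0_r.
      unfold outside_sector, Re, Im, RtoC; simpl. rewrite Rabs_R0. lra.
  - right. rewrite sector_map_0. unfold v. rewrite <- RtoC_minus, Cmod_R, Rabs_right; lra.
Qed.

Lemma kernel_real (x : R) : 0 <= x < 1 -> kernel alpha lam (RtoC x) = RtoC (sector_pow alpha x).
Proof.
  intros Hx. assert (Hq := sector_base_pos x Hx). assert (Hpi := PI_RGT_0).
  assert (Hd : disc (RtoC x)) by (unfold disc; rewrite Cmod_R, Rabs_right; lra).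
  assert (ER : forall y, cexp (RtoC y) = RtoC (exp y)).
  { intros y. unfold cexp, RtoC; simpl. rewrite cos_0, sin_0. f_equal; ring. }
  assert (E : lam (RtoC x) = RtoC (ln ((1 + x) / (1 - x)))).
  { apply cexp_inj.
    - rewrite ER, exp_ln, lam_exp by assumption. rewrite RtoC_div, RtoC_plus, RtoC_minus by lra. reflexivity.
    - assert (S := lam_strip (RtoC x) Hd). change (Im (RtoC (ln ((1 + x) / (1 - x))))) with 0. rewrite Rminus_0_r. lra. }
  unfold kernel. rewrite E, <- RtoC_mult, ER. reflexivity.
Qed.

Lemma sector_map_real (x : R) : 0 <= x < 1 -> sector_map (RtoC x) = RtoC (/ (2 * alpha) * (sector_pow alpha x - 1)).
Proof. intros Hx. unfold sector_map. rewrite kernel_real by exact Hx. rewrite <- RtoC_minus, <- RtoC_mult. reflexivity. Qed.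

Lemma sector_map_derive_neq_0 (z : C) : disc z -> C_derive sector_map z <> 0%C.
Proof.
  intros Hz. rewrite (cderiv_C_derive _ _ _ (sector_map_cderiv z Hz)).
  assert (N1 := one_minus_neq_0 z Hz). assert (N2 := one_plus_neq_0 z Hz).
  apply Cmult_neq_0; [apply cexp_neq_0|]. apply Cmod_gt_0. rewrite Cmod_inv by (apply Cmult_neq_0; assumption).
  apply Rinv_0_lt_compat, Cmod_gt_0, Cmult_neq_0; assumption.
Qed.

Lemma sector_map_derive_real (x : R) : 0 <= x < 1 ->
  C_derive sector_map (RtoC x) = RtoC (sector_pow (alpha - 1) x / (1 - x) ^ 2).
Proof.
  intros Hx. assert (Hq := sector_base_pos x Hx).
  assert (Hd : disc (RtoC x)) by (unfold disc; rewrite Cmod_R, Rabs_right; lra).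
  rewrite (cderiv_C_derive _ _ _ (sector_map_cderiv _ Hd)), kernel_real by exact Hx.
  rewrite <- RtoC_plus, <- RtoC_minus, <- RtoC_mult, <- RtoC_div by nra. f_equal.
  assert (E : sector_pow alpha x = sector_pow (alpha - 1) x * ((1 + x) / (1 - x))).
  { unfold sector_pow. rewrite <- (Rpower_1 ((1 + x) / (1 - x))) at 3 by exact Hq. rewrite <- Rpower_plus. f_equal. ring. }
  rewrite E. field. lra.
Qed.

(** At a positive point the modulus of a sum is at most the sum of the moduli. *)
Lemma sector_map_taylor_sums (x : R) : 0 <= x < 1 ->
  / (2 * alpha) * (sector_pow alpha x - 1) - x <= Series (fun n => Cmod (taylor sector_map (n + 2)) * x ^ (n + 2)) /\
  / (2 * alpha) * (sector_pow alpha x - 1) <= Series (fun n => Cmod (taylor sector_map (n + 1)) * x ^ (n + 1)).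
Proof.
  intros Hx. assert (HS := sector_map_analytic).
  assert (Hd : disc (RtoC x)) by (unfold disc; rewrite Cmod_R, Rabs_right; lra).
  assert (A := expansion_cseries _ _ _ (taylor_expansion sector_map HS) Hd).
  assert (E0 : taylor sector_map 0 = 0%C) by (rewrite taylor_0 by exact HS; apply sector_map_0).
  assert (E1 : taylor sector_map 1 = 1%C).
  { assert (T := taylor_S sector_map 0 HS). rewrite taylor_0 in T by apply analytic_C_derive, HS.
    rewrite (sector_map_derive_real 0) in T by lra. rewrite sector_pow_0 in T.
    replace (1 / (1 - 0) ^ 2) with 1 in T by field.
    rewrite <- T. simpl. ring. }
  assert (C := taylor_abs_conv sector_map HS x Hx). apply ex_series_incr_1 in C. assert (C2 := C). apply ex_series_incr_1 in C2.
  assert (Hpow : forall n, Cmod (RtoC x ^ n) = x ^ n) by (intros n; rewrite Cmod_pow, Cmod_R, Rabs_right by lra; reflexivity).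
  assert (A1 := cseries_shift _ _ A). assert (A2 := cseries_shift _ _ A1). cbv beta in A1, A2.
  rewrite sector_map_real, E0 in A1, A2 by exact Hx. rewrite E1 in A2. simpl Cpow in A2. rewrite Cmult_0_l in A1, A2.
  set (f := / (2 * alpha) * (sector_pow alpha x - 1)) in *.
  split.
  - rewrite (Series_ext _ (fun n => Cmod (taylor sector_map (S (S n))) * x ^ S (S n))) by (intros n; rewrite Nat.add_comm; reflexivity).
    eapply Rle_trans; [|apply (cseries_bound _ _ _ A2); [|exact C2]].
    + replace (RtoC f - 0 - 1 * (RtoC x * 1))%C with (RtoC (f - x)) by (rewrite RtoC_minus; ring). rewrite Cmod_R. apply Rle_abs.
    + intros n. rewrite Cmod_mult. right. f_equal. apply (Hpow (S (S n))).
  - rewrite (Series_ext _ (fun n => Cmod (taylor sector_map (S n)) * x ^ S n)) by (intros n; rewrite Nat.add_comm; reflexivity).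
    eapply Rle_trans; [|apply (cseries_bound _ _ _ A1); [|exact C]].
    + replace (RtoC f - 0 * 1)%C with (RtoC f) by ring. replace (RtoC f - 0)%C with (RtoC f) by ring. rewrite Cmod_R. apply Rle_abs.
    + intros n. rewrite Cmod_mult, Hpow. lra.
Qed.

(** For [h = phi = sector_map] and [g = k phi] each term of the sum is, on the
    positive axis, at least the corresponding term of [radius_fun]. *)
Lemma sector_map_extremal (K lambda rho x : R) (m : nat) : 1 <= K -> 0 < lambda -> (1 <= m)%nat ->
  0 <= x < 1 -> x <= rho -> bohr_inequality_up_to K m alpha lambda rho -> radius_fun K m alpha lambda x <= 0.
Proof.
  intros HK Hl Hm Hx Hrho HB. assert (HS := sector_map_analytic).
  set (k := (K - 1) / (K + 1)). assert (Hk : 0 <= k < 1).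
  { unfold k. split; [apply Rmult_le_pos; [lra|left; apply Rinv_0_lt_compat; lra]|].
    apply (Rmult_lt_reg_r (K + 1)); [lra|]. unfold Rdiv. rewrite Rmult_assoc, Rinv_l; lra. }
  set (g := fun z => (RtoC k * sector_map z)%C).
  assert (Hg : analytic_on_disc g) by (apply analytic_cmult, HS).
  assert (Dil : forall z, disc z -> Cmod (dilatation sector_map g z) = k).
  { intros z Hz. unfold dilatation. assert (N := sector_map_derive_neq_0 z Hz).
    assert (D : C_derive g z = (RtoC k * C_derive sector_map z)%C) by (apply cderiv_C_derive, cderiv_cmult, analytic_cderiv; assumption).
    rewrite D. replace (RtoC k * C_derive sector_map z / C_derive sector_map z)%C with (RtoC k) by (field; exact N).
    rewrite Cmod_R. apply Rabs_right. lra. }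
  assert (Hd : disc (RtoC x)) by (unfold disc; rewrite Cmod_R, Rabs_right; lra).
  assert (B := HB (fun z => (sector_map z + Cconj (g z))%C) sector_map g sector_map (taylor sector_map) (taylor g)).
  assert (B' : bohr_sum m lambda sector_map (taylor sector_map) (taylor g) (RtoC x)
     <= Cmod (sector_map 0%C) + dist_to_set (sector_map 0%C) (boundary (image_of_disc sector_map))).
  { apply B.
    - constructor.
      + constructor; [exact HS|exact Hg|reflexivity].
      + exact sector_map_derive_neq_0.
      + intros z Hz. rewrite Dil by exact Hz. lra.
      + intros z Hz. rewrite Dil by exact Hz. unfold k. lra.
    - apply taylor_expansion, HS.
    - apply taylor_expansion, Hg.
    - rewrite taylor_0 by exact Hg. unfold g. rewrite sector_map_0. ring.
    - apply sector_map_concave.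
    - exists (fun z => z). repeat split; auto. apply analytic_intro. intros z _. eexists. apply cderiv_id.
    - exact Hd.
    - rewrite Cmod_R, Rabs_right; lra. }
  clear B HB. assert (D := sector_map_dist). rewrite sector_map_0, Cmod_0 in B'. rewrite sector_map_0 in D.
  assert (P := pow_unit x m Hm Hx). destruct (sector_map_taylor_sums x Hx) as [S1 S2].
  unfold bohr_sum in B'. rewrite <- RtoC_pow in B'.
  rewrite (sector_map_real _ P), (sector_map_derive_real _ P), !Cmod_R, (Rabs_right x) in B' by lra.
  rewrite (Series_ext (fun n => Cmod (taylor g (n + 1)) * x ^ (n + 1)) (fun n => k * (Cmod (taylor sector_map (n + 1)) * x ^ (n + 1)))) in B'.
  2:{ intros n. unfold g. rewrite (taylor_cmult (RtoC k) sector_map), Cmod_mult, Cmod_R, Rabs_right by (assumption || lra). ring. }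
  rewrite Series_scal_l in B'.
  set (u := / (2 * alpha) * (sector_pow alpha (x ^ m) - 1)) in *.
  set (v := sector_pow (alpha - 1) (x ^ m) / (1 - x ^ m) ^ 2) in *.
  assert (L1 := Rle_abs u). assert (L2 := Rle_abs v).
  unfold radius_fun. fold u. fold v. replace (2 * K / (K + 1)) with (1 + k) by (unfold k; field; lra).
  set (w := / (2 * alpha) * (sector_pow alpha x - 1)) in *.
  assert (L3 : Rabs v * x >= x * v) by nra.
  assert (L4 := Rmult_le_compat_l k _ _ (proj1 Hk) S2).
  assert (L5 := Rmult_le_compat_l lambda _ _ (Rlt_le _ _ Hl) (Rplus_le_compat _ _ _ _ S1 L4)). nra.
Qed.

End SectorMap.

Theorem theorem4p3 (K alpha lambda : R) (m : nat)
    (hK : 1 <= K) (halpha : 1 <= alpha <= 2) (hlambda : 0 < lambda)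
    (hm : (1 <= m)%nat) :
  (exists! r : R, is_radius K m alpha lambda r) /\
  (forall r : R, is_radius K m alpha lambda r ->
     bohr_inequality_up_to K m alpha lambda (Rmin (1 / 3) r) /\
     (r <= 1 / 3 ->
        forall rho : R, r < rho ->
          ~ bohr_inequality_up_to K m alpha lambda rho)).
Proof.
  split.
  - destruct (radius_exists K m alpha lambda hK (proj1 halpha) hlambda hm) as [r Hr]. exists r. split; [exact Hr|].
    intros r' Hr'. apply (radius_unique K m alpha lambda); tauto.
  - intros r Hr. split; [apply bohr_inequality_holds; assumption|]. intros _ rho Hrho HB.
    destruct (half_plane_log_exists 0) as [lam Hlam]. destruct Hr as [Hr E].
    rewrite radius_fun_eq in E by (auto; lra).
    set (x := (r + Rmin rho 1) / 2). assert (x1 := Rmin_l rho 1). assert (x2 := Rmin_r rho 1).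
    assert (x3 : r < Rmin rho 1) by (apply Rmin_glb_lt; lra).
    assert (N := sector_map_extremal alpha lam halpha Hlam K lambda rho x m hK hlambda hm ltac:(unfold x; lra) ltac:(unfold x; lra) HB).
    assert (M := radius_fun_increasing K m alpha lambda r x hK (proj1 halpha) hlambda hm ltac:(unfold x; lra) ltac:(unfold x; lra)). lra.
Qed.
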